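(* The following two statements are equivalent: (i) The Riemann hypothesis is true (all nontrivial zeros of the Riemann zeta function $\zeta$ have real part $1/2$). (ii) The Ingham function $\Phi(x)=x\lfloor 1/x\rfloor$, $x\in(0,1]$, is a function of good variation with regularity index $\alpha(\Phi)=\tfrac12$.
   Context: Let $G:\mathbb{N}^*\times\mathbb{N}^*\to\mathbb{R}$. For a real parameter $\beta$, the associated sequence $(a_n)_{n\ge1}$ is the sequence with $a_1=1$ uniquely determined by $\sum_{k=1}^{n}a_kG(n,k)=n^{-\beta}$ for all $n\ge2$. Arithmetic Mellin transform: $G$ has an arithmetic Mellin transform if for $\Re z<0$ the limit $G^{\star}(z):=\lim_{n\to\infty}\left(-\frac{z}{n}\right)\sum_{k=1}^{n}G(n,k)\left(\frac{k}{n}\right)^{-z-1}$ exists; $G^{\star}$ denotes its analytic continuation to $\mathbb{C}$ (possibly excluding a countable set of poles or singularities), and $G^\star$ must have a removable singularity at $0$. Regular arithmetic function (RAF): $G$ is a RAF with regularity index $\alpha(G)\in\mathbb{R}$ if it has an arithmetic Mellin transform and, for the associated sequence $(a_n)$: for every $\beta<\alpha(G)$, $\sum_{n\le x}a_n\sim \frac{1}{G^{\star}(\beta)}x^{-\beta}$ as $x\to\infty$; and for every $\beta\ge\alpha(G)$ and every $\varepsilon>0$, $\sum_{n\le x}a_n=O(x^{-\alpha(G)+\varepsilon})$ as $x\to\infty$. Function of good variation (FGV): a function $g$ on $(0,1]$ is an FGV with regularity index $\alpha(g)$ if $G(n,k)=g(k/n)$ is a RAF with $\alpha(G)=\alpha(g)$.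 *)

(* Defs.v *)
From Stdlib Require Import Reals Zfloor.
From Coquelicot Require Import Coquelicot.
Open Scope R_scope.

Definition Cexp (z : C) : C := (exp (Re z) * cos (Im z), exp (Re z) * sin (Im z)).

(* x^s = exp (s log x); only meaningful for x > 0 *)
Definition Rcpower (x : R) (s : C) : C := Cexp (s * RtoC (ln x))%C.

(* Complex differentiability on a neighbourhood of z. *)
Definition holomorphic_at (f : C -> C) (z : C) : Prop :=
  locally (T := C_UniformSpace) z
    (fun w => ex_derive (K := C_AbsRing) (V := C_NormedModule) f w).

Definition countable_set (S : C -> Prop) : Prop :=
  exists e : nat -> C, forall z, S z -> exists n, e n = z.

(* In the sequences and kernels below indices range over n >= 1 (and
   1 <= k <= n); values at index 0 are never used. *)

Definition associated_sequence (G : nat -> nat -> R) (beta : R) (a : nat -> R) : Prop :=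
  a 1%nat = 1 /\
  forall n : nat, (2 <= n)%nat ->
    sum_n_m (fun k => a k * G n k) 1 n = Rpower (INR n) (- beta).

Definition mellin_mean (G : nat -> nat -> R) (z : C) (n : nat) : C :=
  (- z / RtoC (INR n) *
   sum_n_m (G := C_AbelianMonoid)
     (fun k => RtoC (G n k) * Rcpower (INR k / INR n) (- z - 1)) 1 n)%C.

(* Gs is the continued transform.  It is a total function whose set of
   singularities is the set where it is not holomorphic (its values there are
   irrelevant); this set is closed and countable, so its complement is
   connected and the continuation is unique.  Holomorphy at 0 says that the
   singularity at 0 is removable and has been removed. *)
Definition arithmetic_mellin_transform (G : nat -> nat -> R) (Gs : C -> C) : Prop :=
  (forall z : C, Re z < 0 ->
     filterlim (mellin_mean G z) eventually (locally (T := C_UniformSpace) (Gs z))) /\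
  (forall z : C, Re z < 0 -> holomorphic_at Gs z) /\
  countable_set (fun z => ~ holomorphic_at Gs z) /\
  holomorphic_at Gs 0%C.

(* sum of a_n over 1 <= n <= x *)
Definition summatory (a : nat -> R) (x : R) : R :=
  sum_n_m a 1 (Z.to_nat (Zfloor x)).

(* The asymptotic equivalence is taken in C because Gs is complex valued; it
   presupposes that 1 / Gs beta makes sense. *)
Definition RAF (G : nat -> nat -> R) (alpha : R) : Prop :=
  exists Gs : C -> C, arithmetic_mellin_transform G Gs /\
  forall beta : R, exists a : nat -> R,
    associated_sequence G beta a /\
    (forall b : nat -> R, associated_sequence G beta b ->
       forall n : nat, (1 <= n)%nat -> b n = a n) /\
    (beta < alpha ->
       holomorphic_at Gs (RtoC beta) /\ Gs (RtoC beta) <> 0%C /\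
       is_equiv (K := C_AbsRing) (V := C_NormedModule) (Rbar_locally p_infty)
         (fun x : R => RtoC (summatory a x))
         (fun x : R => (/ Gs (RtoC beta) * RtoC (Rpower x (- beta)))%C)) /\
    (alpha <= beta -> forall eps : R, 0 < eps ->
       exists M : R, Rbar_locally p_infty
         (fun x : R => Rabs (summatory a x) <= M * Rpower x (- alpha + eps))).

(* g stands for a function on (0,1]; only its values there matter. *)
Definition FGV (g : R -> R) (alpha : R) : Prop :=
  RAF (fun n k => g (INR k / INR n)) alpha.

Definition Ingham (x : R) : R := x * IZR (Zfloor (/ x)).

(* These conditions determine zeta on C \ {1}, which is connected; its value
   at 1 is arbitrary. *)
Definition is_Riemann_zeta (zeta : C -> C) : Prop :=
  (forall s : C, 1 < Re s ->
     is_series (K := C_AbsRing) (V := C_NormedModule)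
       (fun n => Rcpower (INR (S n)) (- s)%C) (zeta s)) /\
  (forall s : C, s <> 1%C -> holomorphic_at zeta s).

(* The trivial zeros are the negative even integers. *)
Definition Riemann_hypothesis : Prop :=
  exists zeta : C -> C, is_Riemann_zeta zeta /\
  forall s : C, s <> 1%C -> zeta s = 0%C ->
    (forall m : nat, s <> RtoC (- (2 * INR (S m)))) -> Re s = 1 / 2.

(* Main.v *)
(* For the Ingham function the associated sequence is the Dirichlet convolution of mu with
   n^(1-beta) - (n-1)^(1-beta), divided by n; for beta = 1 it is mu(n)/n. Good variation with
   index 1/2 therefore bounds sum_{n <= x} mu(n)/n by x^(-1/2+eps), so that 1/zeta is holomorphic
   on Re s > 1/2, and the functional equation takes care of the left half plane. The functional
   equation is obtained on (0,1) by applying Muentz's formula to exp(-x) and 1/(1+x^2), whose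
   summations are exchanged by x -> 2 pi / x through the partial fractions of coth.
   Conversely, under the Riemann hypothesis the Borel-Caratheodory inequality gives
   1/zeta = O(|t|^eps) to the right of Re s = 1/2, a smoothed Perron formula turns this into the
   bound on sum mu(n)/n, and Dirichlet's hyperbola method yields the asymptotics of the associated
   sequences for all beta, with transform z zeta(1-z) / (z-1). *)

Require Import Defs.
From Stdlib Require Import Reals.
From Stdlib Require Import ZArith Lra Lia Wf_nat Zfloor ssreflect.
From Coquelicot Require Import Coquelicot.
Open Scope R_scope.

(** * Sums, limits and derivatives of complex functions *)

(** The Riemann hypothesis asserts the existence of zeta, and good variation supplies none: the
    reverse implication has to construct the continuation to the whole plane before it can locate
    zeros, and this is where the functional equation enters. The direct implication works with the
    zeta it is given. The pole at 1 is avoided by using (s - 1) zeta(s), given by a convergent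
    series on Re s > 0, and Gamma enters through the entire function 1 / Gamma. Primes never occur:
    for [mu] only |mu(n)| <= n^2 is proved, which confines absolute convergence of its Dirichlet
    series to Re s >= 5 and explains the abscissas 4, 5 and 6. The smoothed Perron kernel is taken
    in difference form between N and N + 1; as max(x / k - 1, 0) is linear in x between these
    integers, the sharp sum over n <= N comes out without an unsmoothing error. Contours are
    rectangles, and the identity theorem is proved on convex open sets, so other regions are covered
    by overlapping convex pieces. *)

Fixpoint csum (f : nat -> C) (n : nat) : C :=
  match n with O => 0%C | S m => (csum f m + f m)%C end.

Fixpoint rsum (f : nat -> R) (n : nat) : R :=
  match n with O => 0 | S m => rsum f m + f m end.

Definition clim (u : nat -> C) (l : C) : Prop :=
  forall eps, 0 < eps -> exists N, forall n, (N <= n)%nat -> Cmod (u n - l)%C < eps.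

Definition ccont (f : C -> C) (z : C) : Prop :=
  forall eps, 0 < eps -> exists d, 0 < d /\
    forall w, Cmod (w - z)%C < d -> Cmod (f w - f z)%C < eps.

(** The error is bounded by [eps * Cmod (w - z)] instead of dividing by w - z, so that [w = z] is
    allowed; [cderiv_is_derive] links this notion to the derivative used in [holomorphic_at]. *)
Definition cderiv (f : C -> C) (z l : C) : Prop :=
  forall eps, 0 < eps -> exists d, 0 < d /\
    forall w, Cmod (w - z)%C < d ->
      Cmod (f w - f z - l * (w - z))%C <= eps * Cmod (w - z)%C.

Definition cdiff (f : C -> C) (z : C) : Prop := exists l, cderiv f z l.

Lemma Cmod_sub_sym (a b : C) : Cmod (a - b)%C = Cmod (b - a)%C.
Proof. rewrite -Cmod_opp; f_equal; ring. Qed.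

Lemma Cmod_triangle_sub (a b : C) : Cmod (a - b)%C <= Cmod a + Cmod b.
Proof. rewrite -(Cmod_opp b); apply Cmod_triangle. Qed.

Lemma Cmod_triangle3 (a b c : C) : Cmod (a - c)%C <= Cmod (a - b)%C + Cmod (b - c)%C.
Proof. replace (a - c)%C with ((a - b) + (b - c))%C by ring; apply Cmod_triangle. Qed.

Lemma Cmod_triangle_rev (a b : C) : Cmod a - Cmod b <= Cmod (a - b)%C.
Proof.
have H := Cmod_triangle (a - b)%C b.
replace (a - b + b)%C with a in H by ring. lra.
Qed.

Lemma Cmod_le_1 (a : C) : Cmod a <= Rabs (fst a) + Rabs (snd a).
Proof.
replace a with (RtoC (fst a) + Ci * RtoC (snd a))%C at 1
  by (destruct a; unfold RtoC, Ci, Cplus, Cmult; simpl; f_equal; ring).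
eapply Rle_trans. apply Cmod_triangle.
rewrite Cmod_mult Cmod_Ci !Cmod_R. lra.
Qed.

Lemma Rabs_fst_le (a : C) : Rabs (fst a) <= Cmod a.
Proof. apply re_le_Cmod. Qed.

Lemma Rabs_snd_le (a : C) : Rabs (snd a) <= Cmod a.
Proof. eapply Rle_trans; [|apply Rmax_Cmod]. apply Rmax_r. Qed.

Lemma Cmod_sqr (a : C) : Cmod a * Cmod a = fst a * fst a + snd a * snd a.
Proof. have H := Cmod2_alt a. unfold Re, Im in H. simpl in H. lra. Qed.

(** The Cauchy-Schwarz inequality in the plane: the difference of the squares is the square of the
    determinant of [a] and [b]. *)
Lemma Cdot_le (a b : C) : fst a * fst b + snd a * snd b <= Cmod a * Cmod b.
Proof.
have Ha := Cmod_ge_0 a. have Hb := Cmod_ge_0 b.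
have H1 := Cmod_sqr a. have H2 := Cmod_sqr b.
apply Rsqr_incr_0_var; [|nra]. unfold Rsqr.
replace (Cmod a * Cmod b * (Cmod a * Cmod b)) with
 ((Cmod a * Cmod a) * (Cmod b * Cmod b)) by ring.
rewrite H1 H2.
have := Rle_0_sqr (fst a * snd b - snd a * fst b). unfold Rsqr. nra.
Qed.

Lemma Cinv_neq_0 (z : C) : z <> 0%C -> (/ z)%C <> 0%C.
Proof.
move=> H H0. have := Cinv_r z H. rewrite H0 Cmult_0_r => E.
injection E; lra.
Qed.

Lemma csum_ext f g n : (forall k, (k < n)%nat -> f k = g k) -> csum f n = csum g n.
Proof. elim: n => [//|n IH] H /=. rewrite IH ?H //; intros; apply H; lia. Qed.

Lemma rsum_ext f g n : (forall k, (k < n)%nat -> f k = g k) -> rsum f n = rsum g n.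
Proof. elim: n => [//|n IH] H /=. rewrite IH ?H //; intros; apply H; lia. Qed.

Lemma csum_plus f g n : csum (fun k => f k + g k)%C n = (csum f n + csum g n)%C.
Proof. elim: n => [|n IH] /=; [ring|rewrite IH; ring]. Qed.

Lemma csum_minus f g n : csum (fun k => f k - g k)%C n = (csum f n - csum g n)%C.
Proof. elim: n => [|n IH] /=; [ring|rewrite IH; ring]. Qed.

Lemma csum_scal c f n : csum (fun k => c * f k)%C n = (c * csum f n)%C.
Proof. elim: n => [|n IH] /=; [ring|rewrite IH; ring]. Qed.

Lemma rsum_plus f g n : rsum (fun k => f k + g k) n = rsum f n + rsum g n.
Proof. elim: n => [|n IH] /=; [ring|rewrite IH; ring]. Qed.

Lemma rsum_minus f g n : rsum (fun k => f k - g k) n = rsum f n - rsum g n.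
Proof. elim: n => [|n IH] /=; [ring|rewrite IH; ring]. Qed.

Lemma rsum_scal c f n : rsum (fun k => c * f k) n = c * rsum f n.
Proof. elim: n => [|n IH] /=; [ring|rewrite IH; ring]. Qed.

Lemma rsum_le f g n : (forall k, (k < n)%nat -> f k <= g k) -> rsum f n <= rsum g n.
Proof.
elim: n => [|n IH] H /=; [lra|].
have := IH (fun k Hk => H k (Nat.lt_lt_succ_r _ _ Hk)). have := H n (Nat.lt_succ_diag_r n). lra.
Qed.

Lemma rsum_ge0 f n : (forall k, (k < n)%nat -> 0 <= f k) -> 0 <= rsum f n.
Proof.
move=> H. have := rsum_le (fun _ => 0) f n H.
replace (rsum (fun _ => 0) n) with 0; [lra|]. clear. elim: n => [|n IH] //=. lra.
Qed.

Lemma rsum_const c n : rsum (fun _ => c) n = INR n * c.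
Proof. elim: n => [|n IH]; [simpl; ring|]. rewrite S_INR /= IH. ring. Qed.

Lemma csum_const c n : csum (fun _ => c) n = (RtoC (INR n) * c)%C.
Proof. elim: n => [|n IH]; [simpl; ring|]. rewrite S_INR RtoC_plus /= IH. ring. Qed.

Lemma Rabs_rsum_le f n : Rabs (rsum f n) <= rsum (fun k => Rabs (f k)) n.
Proof.
elim: n => [|n IH] /=; [rewrite Rabs_R0; lra|].
eapply Rle_trans; [apply Rabs_triang|]. lra.
Qed.

Lemma Cmod_csum_le f n : Cmod (csum f n) <= rsum (fun k => Cmod (f k)) n.
Proof.
elim: n => [|n IH] /=; [rewrite Cmod_0; lra|].
eapply Rle_trans; [apply Cmod_triangle|]. lra.
Qed.

Lemma csum_RtoC f n : csum (fun k => RtoC (f k)) n = RtoC (rsum f n).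
Proof. elim: n => [//|n IH] /=. by rewrite IH RtoC_plus. Qed.

Lemma csum_add f m n : csum f (m + n) = (csum f m + csum (fun k => f (m + k)%nat) n)%C.
Proof.
elim: n => [|n IH]; [rewrite Nat.add_0_r /=; ring|].
rewrite Nat.add_succ_r /= IH. ring.
Qed.

Lemma rsum_add f m n : rsum f (m + n) = rsum f m + rsum (fun k => f (m + k)%nat) n.
Proof.
elim: n => [|n IH]; [rewrite Nat.add_0_r /=; ring|].
rewrite Nat.add_succ_r /= IH. ring.
Qed.

Lemma csum_split f m n : (m <= n)%nat ->
  csum f n = (csum f m + csum (fun k => f (m + k)%nat) (n - m))%C.
Proof. move=> H. rewrite -csum_add. f_equal. lia. Qed.

Lemma rsum_split f m n : (m <= n)%nat ->
  rsum f n = rsum f m + rsum (fun k => f (m + k)%nat) (n - m).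
Proof. move=> H. rewrite -rsum_add. f_equal. lia. Qed.

Lemma csum_diff_le f b m n : (m <= n)%nat -> (forall k, Cmod (f k) <= b k) ->
  Cmod (csum f n - csum f m)%C <= rsum b n - rsum b m.
Proof.
move=> Hmn H. rewrite (csum_split f m n) // (rsum_split b m n) //.
replace (_ + _ - _)%C with (csum (fun k => f (m + k)%nat) (n - m)) by ring.
eapply Rle_trans; [apply Cmod_csum_le|].
have := rsum_le (fun k => Cmod (f (m + k)%nat)) (fun k => b (m + k)%nat) (n - m) (fun k _ => H _).
lra.
Qed.

Lemma clim_unique u l1 l2 : clim u l1 -> clim u l2 -> l1 = l2.
Proof.
move=> H1 H2.
have E : Cmod (l1 - l2)%C = 0.
{ apply Rle_antisym; [|apply Cmod_ge_0].
  apply le_epsilon => eps He.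
  destruct (H1 (eps/2) ltac:(lra)) as [N1 K1].
  destruct (H2 (eps/2) ltac:(lra)) as [N2 K2].
  have A := K1 (max N1 N2) ltac:(lia). have B := K2 (max N1 N2) ltac:(lia).
  have T := Cmod_triangle3 l1 (u (max N1 N2)) l2.
  rewrite (Cmod_sub_sym l1 (u _)) in T. lra. }
apply Cmod_eq_0 in E. replace l1 with ((l1 - l2) + l2)%C by ring. rewrite E. ring.
Qed.

Lemma clim_ext u v l : (forall n, u n = v n) -> clim u l -> clim v l.
Proof. move=> E H eps He. destruct (H eps He) as [N K]. exists N => n Hn. rewrite -E. auto. Qed.

Lemma clim_const c : clim (fun _ => c) c.
Proof. move=> eps He. exists O => n _. replace (c - c)%C with (RtoC 0) by ring. rewrite Cmod_0. lra. Qed.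

Lemma clim_plus u v a b : clim u a -> clim v b -> clim (fun n => u n + v n)%C (a + b)%C.
Proof.
move=> Hu Hv eps He.
destruct (Hu (eps/2) ltac:(lra)) as [N1 K1]. destruct (Hv (eps/2) ltac:(lra)) as [N2 K2].
exists (max N1 N2) => n Hn.
have A := K1 n ltac:(lia). have B := K2 n ltac:(lia).
replace (u n + v n - (a + b))%C with ((u n - a) + (v n - b))%C by ring.
have := Cmod_triangle (u n - a)%C (v n - b)%C. lra.
Qed.

Lemma clim_scal u a c : clim u a -> clim (fun n => c * u n)%C (c * a)%C.
Proof.
move=> Hu eps He. have Hc := Cmod_ge_0 c.
destruct (Hu (eps / (Cmod c + 1))) as [N K]; [apply Rdiv_lt_0_compat; lra|].
exists N => n Hn. replace (c * u n - c * a)%C with (c * (u n - a))%C by ring.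
rewrite Cmod_mult. have A := K n Hn. have B := Cmod_ge_0 (u n - a)%C.
apply Rle_lt_trans with ((Cmod c + 1) * Cmod (u n - a)%C); [nra|].
replace eps with ((Cmod c + 1) * (eps / (Cmod c + 1))) by (field; lra).
apply Rmult_lt_compat_l; lra.
Qed.

Lemma clim_minus u v a b : clim u a -> clim v b -> clim (fun n => u n - v n)%C (a - b)%C.
Proof.
move=> Hu Hv. have H := clim_plus _ _ _ _ Hu (clim_scal _ _ (-(1))%C Hv).
replace (a - b)%C with (a + - (1) * b)%C by ring.
apply: clim_ext H => n /=. ring.
Qed.

Lemma clim_bound u l M : clim u l -> (exists N, forall n, (N <= n)%nat -> Cmod (u n) <= M) -> Cmod l <= M.
Proof.
move=> H [N0 HM]. apply le_epsilon => eps He.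
destruct (H eps He) as [N K].
have A := K (max N N0) ltac:(lia). have B := HM (max N N0) ltac:(lia).
have T := Cmod_triangle_rev l (u (max N N0)). rewrite Cmod_sub_sym in T. lra.
Qed.

Lemma clim_shift u l k : clim (fun n => u (n + k)%nat) l <-> clim u l.
Proof.
split=> H eps He; destruct (H eps He) as [N K].
- exists (N + k)%nat => n Hn. have := K (n - k)%nat ltac:(lia).
  by replace (n - k + k)%nat with n by lia.
- exists N => n Hn. apply K. lia.
Qed.

Lemma is_lim_seq_eps (u : nat -> R) (l : R) :
  is_lim_seq u l <-> forall eps, 0 < eps -> exists N, forall n, (N <= n)%nat -> Rabs (u n - l) < eps.
Proof.
split.
- move=> H eps He. apply is_lim_seq_spec in H. destruct (H (mkposreal eps He)) as [N K]. by exists N.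
- move=> H. apply is_lim_seq_spec => eps. destruct (H eps (cond_pos eps)) as [N K]. by exists N.
Qed.

Lemma clim_fst u l : clim u l -> is_lim_seq (fun n => fst (u n)) (fst l).
Proof.
move=> H. apply is_lim_seq_eps => eps He. destruct (H eps He) as [N K]. exists N => n Hn.
eapply Rle_lt_trans; [apply (Rabs_fst_le (u n - l)%C)|auto].
Qed.

Lemma clim_snd u l : clim u l -> is_lim_seq (fun n => snd (u n)) (snd l).
Proof.
move=> H. apply is_lim_seq_eps => eps He. destruct (H eps He) as [N K]. exists N => n Hn.
eapply Rle_lt_trans; [apply (Rabs_snd_le (u n - l)%C)|auto].
Qed.

Lemma clim_pair u a b : is_lim_seq (fun n => fst (u n)) (Finite a) ->
  is_lim_seq (fun n => snd (u n)) (Finite b) -> clim u (a, b).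
Proof.
move=> /is_lim_seq_eps Ha /is_lim_seq_eps Hb eps He.
destruct (Ha (eps/2) ltac:(lra)) as [N1 K1]. destruct (Hb (eps/2) ltac:(lra)) as [N2 K2].
exists (max N1 N2) => n Hn. have A := K1 n ltac:(lia). have B := K2 n ltac:(lia).
eapply Rle_lt_trans; [apply Cmod_le_1|]. destruct (u n) as [x y]. simpl in *.
unfold Rminus in *. lra.
Qed.

Lemma clim_RtoC (u : nat -> R) (l : R) : is_lim_seq u l -> clim (fun n => RtoC (u n)) (RtoC l).
Proof. move=> H. apply clim_pair => //=. apply is_lim_seq_const. Qed.

(** Componentwise real limits, hence total; the value is meaningful only together with a proof of
    convergence, from which [clim_Clim] identifies it. *)
Definition Clim (u : nat -> C) : C :=
  (real (Lim_seq (fun n => fst (u n))), real (Lim_seq (fun n => snd (u n)))).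

Lemma clim_Clim u l : clim u l -> Clim u = l.
Proof.
move=> H. unfold Clim.
rewrite (is_lim_seq_unique _ _ (clim_fst _ _ H)) (is_lim_seq_unique _ _ (clim_snd _ _ H)).
by destruct l.
Qed.

Lemma rsum_lim_bounded b B : (forall k, 0 <= b k) -> (forall n, rsum b n <= B) ->
  exists T : R, is_lim_seq (rsum b) T /\ forall n, rsum b n <= T.
Proof.
move=> Hb HB.
have [T HT] := ex_finite_lim_seq_incr (rsum b) B (fun n => ltac:(simpl; have := Hb n; lra)) HB.
exists T. split=> // n. apply: is_lim_seq_incr_compare HT _ n => k /=. have := Hb k. lra.
Qed.

(* The error of the Weierstrass M-test only depends on the majorant. *)
Lemma csum_majorant (f : nat -> C) (b : nat -> R) (T : R) :
  (forall k, Cmod (f k) <= b k) -> is_lim_seq (rsum b) T ->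
  clim (csum f) (Clim (csum f)) /\
  forall n, Cmod (Clim (csum f) - csum f n)%C <= T - rsum b n.
Proof.
move=> Hf HT.
have Hb : forall k, 0 <= b k by move=> k; have := Hf k; have := Cmod_ge_0 (f k); lra.
have Hle : forall n, rsum b n <= T.
{ move=> n. apply: is_lim_seq_incr_compare HT _ n => k /=. have := Hb k. lra. }
have HC : forall eps : posreal, exists N, forall n m, (N <= n)%nat -> (N <= m)%nat ->
   Cmod (csum f n - csum f m)%C < eps.
{ move=> eps. move/is_lim_seq_eps: HT => /(_ eps (cond_pos eps)) [N K].
  exists N.
  have G : forall n m, (N <= n)%nat -> (n <= m)%nat -> Cmod (csum f m - csum f n)%C < eps.
  { move=> n m Hn Hm. have A := csum_diff_le f b n m Hm Hf. have := K n Hn.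
    have := Hle m. have := Hle n. move=> h1 h2. rewrite Rabs_left1; lra. }
  move=> n m Hn Hm. destruct (Nat.le_ge_cases n m).
  rewrite Cmod_sub_sym. by apply G. by apply G. }
have [a Ha] : ex_finite_lim_seq (fun n => fst (csum f n)).
{ apply ex_lim_seq_cauchy_corr => eps. have [N K] := HC eps. exists N => n m Hn Hm.
  eapply Rle_lt_trans; [apply (Rabs_fst_le (csum f n - csum f m)%C)|auto]. }
have [b' Hb'] : ex_finite_lim_seq (fun n => snd (csum f n)).
{ apply ex_lim_seq_cauchy_corr => eps. have [N K] := HC eps. exists N => n m Hn Hm.
  eapply Rle_lt_trans; [apply (Rabs_snd_le (csum f n - csum f m)%C)|auto]. }
have HL : clim (csum f) (a, b') by apply clim_pair.
rewrite (clim_Clim _ _ HL). split=> // n.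
apply (clim_bound (fun m => csum f m - csum f n)%C).
- apply clim_minus => //. apply clim_const.
- exists n => m Hm. have A := csum_diff_le f b n m Hm Hf. have := Hle m. lra.
Qed.

Lemma ccont_cderiv f z l : cderiv f z l -> ccont f z.
Proof.
move=> H eps He. destruct (H 1 ltac:(lra)) as [d [Hd K]].
have Hl := Cmod_ge_0 l.
exists (Rmin d (eps / (Cmod l + 2))). split.
- apply Rmin_glb_lt => //. apply Rdiv_lt_0_compat; lra.
- move=> w Hw. have A := K w (Rlt_le_trans _ _ _ Hw (Rmin_l _ _)).
  have B := Rlt_le_trans _ _ _ Hw (Rmin_r _ _).
  replace (f w - f z)%C with ((f w - f z - l * (w - z)) + l * (w - z))%C by ring.
  eapply Rle_lt_trans; [apply Cmod_triangle|]. rewrite Cmod_mult.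
  have P := Cmod_ge_0 (w - z)%C.
  apply Rle_lt_trans with ((Cmod l + 2) * Cmod (w - z)%C); [nra|].
  replace eps with ((Cmod l + 2) * (eps / (Cmod l + 2))) by (field; lra).
  apply Rmult_lt_compat_l; lra.
Qed.

Lemma ccont_cdiff f z : cdiff f z -> ccont f z.
Proof. case=> l; apply ccont_cderiv. Qed.

Lemma ccont_const c z : ccont (fun _ => c) z.
Proof. move=> eps He. exists 1. split; [lra|]. move=> w _. replace (c - c)%C with (RtoC 0) by ring. rewrite Cmod_0. lra. Qed.

Lemma ccont_plus f g z : ccont f z -> ccont g z -> ccont (fun w => f w + g w)%C z.
Proof.
move=> Hf Hg eps He. destruct (Hf (eps/2) ltac:(lra)) as [d1 [P1 K1]].
destruct (Hg (eps/2) ltac:(lra)) as [d2 [P2 K2]].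
exists (Rmin d1 d2). split; [by apply Rmin_glb_lt|]. move=> w Hw.
have A := K1 w (Rlt_le_trans _ _ _ Hw (Rmin_l _ _)).
have B := K2 w (Rlt_le_trans _ _ _ Hw (Rmin_r _ _)).
replace (f w + g w - (f z + g z))%C with ((f w - f z) + (g w - g z))%C by ring.
have := Cmod_triangle (f w - f z)%C (g w - g z)%C. lra.
Qed.

Lemma ccont_mult f g z : ccont f z -> ccont g z -> ccont (fun w => f w * g w)%C z.
Proof.
move=> Hf Hg eps He. have Pf := Cmod_ge_0 (f z). have Pg := Cmod_ge_0 (g z).
set M := Cmod (f z) + Cmod (g z) + 1.
have HM : 0 < eps / (2 * M) by apply Rdiv_lt_0_compat; unfold M; lra.
destruct (Hf (Rmin 1 (eps/(2*M)))) as [d1 [P1 K1]]; [apply Rmin_glb_lt; lra|].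
destruct (Hg (eps/(2*M)) HM) as [d2 [P2 K2]].
exists (Rmin d1 d2). split; [by apply Rmin_glb_lt|]. move=> w Hw.
have A := K1 w (Rlt_le_trans _ _ _ Hw (Rmin_l _ _)).
have B := K2 w (Rlt_le_trans _ _ _ Hw (Rmin_r _ _)).
have A1 := Rlt_le_trans _ _ _ A (Rmin_l _ _). have A2 := Rlt_le_trans _ _ _ A (Rmin_r _ _).
replace (f w * g w - f z * g z)%C with ((f w - f z) * g z + f w * (g w - g z))%C by ring.
eapply Rle_lt_trans; [apply Cmod_triangle|]. rewrite !Cmod_mult.
have T := Cmod_triangle_rev (f w) (f z). have Q := Cmod_ge_0 (f w).
have Q1 := Cmod_ge_0 (f w - f z)%C. have Q2 := Cmod_ge_0 (g w - g z)%C.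
replace eps with (eps/(2*M) * M + M * (eps/(2*M))) by (field; unfold M; lra).
set e := (eps/(2*M)) in A2 B HM *.
apply Rle_lt_trans with (e * Cmod (g z) + (Cmod (f z) + 1) * e).
- apply Rplus_le_compat; apply Rmult_le_compat; lra.
- unfold M. nra.
Qed.

Lemma ccont_near0 f z : ccont f z -> f z <> 0%C -> exists d, 0 < d /\
  forall w, Cmod (w - z)%C < d -> Cmod (f z) / 2 < Cmod (f w).
Proof.
move=> Hf Hz. have P : 0 < Cmod (f z) by apply Cmod_gt_0.
destruct (Hf (Cmod (f z) / 2) ltac:(lra)) as [d [Hd K]]. exists d; split=> // w Hw.
have A := K w Hw. have B := Cmod_triangle_rev (f z) (f w). rewrite (Cmod_sub_sym (f z)) in B. lra.
Qed.

Lemma ccont_inv f z : ccont f z -> f z <> 0%C -> ccont (fun w => / f w)%C z.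
Proof.
move=> Hf Hz eps He. have P : 0 < Cmod (f z) by apply Cmod_gt_0.
destruct (ccont_near0 f z Hf Hz) as [d1 [P1 K1]].
destruct (Hf (eps * (Cmod (f z) / 2 * Cmod (f z)))) as [d2 [P2 K2]]; [apply Rmult_lt_0_compat; [lra|apply Rmult_lt_0_compat; lra]|].
exists (Rmin d1 d2). split; [by apply Rmin_glb_lt|]. move=> w Hw.
have A := K1 w (Rlt_le_trans _ _ _ Hw (Rmin_l _ _)).
have B := K2 w (Rlt_le_trans _ _ _ Hw (Rmin_r _ _)).
have Hw0 : f w <> 0%C by apply Cmod_gt_0; lra.
replace (/ f w - / f z)%C with (- (f w - f z) / (f w * f z))%C by (field; auto).
rewrite Cmod_div; [|by apply Cmult_neq_0]. rewrite Cmod_opp Cmod_mult.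
apply Rmult_lt_reg_r with (Cmod (f w) * Cmod (f z)); [nra|].
unfold Rdiv. rewrite Rmult_assoc Rinv_l; [|nra]. rewrite Rmult_1_r.
eapply Rlt_trans; [apply B|]. apply Rmult_lt_compat_l => //. nra.
Qed.

Lemma cderiv_ext f g z l : (forall w, f w = g w) -> cderiv f z l -> cderiv g z l.
Proof. move=> E H eps He. destruct (H eps He) as [d [Hd K]]. exists d. split=> // w Hw. rewrite -!E. auto. Qed.

Lemma cderiv_ext_loc f g z l : (exists r, 0 < r /\ forall w, Cmod (w - z)%C < r -> f w = g w) ->
  cderiv f z l -> cderiv g z l.
Proof.
move=> [r [Hr E]] H eps He. destruct (H eps He) as [d [Hd K]].
exists (Rmin r d). split; [by apply Rmin_glb_lt|]. move=> w Hw.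
rewrite -!E; first last.
- exact (Rlt_le_trans _ _ _ Hw (Rmin_l _ _)).
- replace (z - z)%C with (RtoC 0) by ring. by rewrite Cmod_0.
- apply K. exact (Rlt_le_trans _ _ _ Hw (Rmin_r _ _)).
Qed.

Lemma cdiff_ext_loc f g z : (exists r, 0 < r /\ forall w, Cmod (w - z)%C < r -> f w = g w) ->
  cdiff f z -> cdiff g z.
Proof. move=> E [l H]. exists l. by apply: cderiv_ext_loc H. Qed.

Lemma cderiv_const c z : cderiv (fun _ => c) z 0%C.
Proof.
move=> eps He. exists 1. split; [lra|]. move=> w _.
replace (c - c - 0 * (w - z))%C with (RtoC 0) by ring. rewrite Cmod_0.
have := Cmod_ge_0 (w - z)%C. nra.
Qed.

Lemma cderiv_id z : cderiv (fun w => w) z 1%C.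
Proof.
move=> eps He. exists 1. split; [lra|]. move=> w _.
replace (w - z - 1 * (w - z))%C with (RtoC 0) by ring. rewrite Cmod_0.
have := Cmod_ge_0 (w - z)%C. nra.
Qed.

Lemma cderiv_plus f g z a b : cderiv f z a -> cderiv g z b -> cderiv (fun w => f w + g w)%C z (a + b)%C.
Proof.
move=> Hf Hg eps He. destruct (Hf (eps/2) ltac:(lra)) as [d1 [P1 K1]].
destruct (Hg (eps/2) ltac:(lra)) as [d2 [P2 K2]].
exists (Rmin d1 d2). split; [by apply Rmin_glb_lt|]. move=> w Hw.
have A := K1 w (Rlt_le_trans _ _ _ Hw (Rmin_l _ _)).
have B := K2 w (Rlt_le_trans _ _ _ Hw (Rmin_r _ _)).
replace (f w + g w - (f z + g z) - (a + b) * (w - z))%C with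
  ((f w - f z - a * (w - z)) + (g w - g z - b * (w - z)))%C by ring.
eapply Rle_trans; [apply Cmod_triangle|]. lra.
Qed.

Lemma cderiv_comp f g z a b : cderiv g z a -> cderiv f (g z) b -> cderiv (fun w => f (g w)) z (b * a)%C.
Proof.
move=> Hg Hf eps He. have Pa := Cmod_ge_0 a. have Pb := Cmod_ge_0 b.
set e1 := Rmin 1 (eps / (2 * (Cmod b + 1))). set e2 := eps / (2 * (Cmod a + 1)).
have He1 : 0 < e1 by apply Rmin_glb_lt; [lra|apply Rdiv_lt_0_compat; lra].
have He2 : 0 < e2 by apply Rdiv_lt_0_compat; lra.
destruct (Hf e2 He2) as [d1 [P1 K1]]. destruct (Hg e1 He1) as [d2 [P2 K2]].
destruct (ccont_cderiv g z a Hg d1 P1) as [d3 [P3 K3]].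
exists (Rmin d2 d3). split; [by apply Rmin_glb_lt|]. move=> w Hw.
have A := K2 w (Rlt_le_trans _ _ _ Hw (Rmin_l _ _)).
have B := K1 (g w) (K3 w (Rlt_le_trans _ _ _ Hw (Rmin_r _ _))).
replace (f (g w) - f (g z) - b * a * (w - z))%C with
  ((f (g w) - f (g z) - b * (g w - g z)) + b * (g w - g z - a * (w - z)))%C by ring.
eapply Rle_trans; [apply Cmod_triangle|]. rewrite Cmod_mult.
have Pw := Cmod_ge_0 (w - z)%C.
have G : Cmod (g w - g z)%C <= (Cmod a + 1) * Cmod (w - z)%C.
{ replace (g w - g z)%C with ((g w - g z - a * (w - z)) + a * (w - z))%C by ring.
  eapply Rle_trans; [apply Cmod_triangle|]. rewrite Cmod_mult.
  have : e1 <= 1 by apply Rmin_l. nra. }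
have E1 : e1 * (Cmod b + 1) <= eps / 2.
{ apply Rle_trans with (eps / (2 * (Cmod b + 1)) * (Cmod b + 1)).
  apply Rmult_le_compat_r; [lra|apply Rmin_r]. right; field; lra. }
have E2 : e2 * (Cmod a + 1) = eps / 2 by unfold e2; field; lra.
apply Rle_trans with (e2 * ((Cmod a + 1) * Cmod (w - z)%C) + Cmod b * (e1 * Cmod (w - z)%C)).
- apply Rplus_le_compat.
  + eapply Rle_trans; [apply B|]. apply Rmult_le_compat_l; lra.
  + apply Rmult_le_compat_l; lra.
- have : Cmod b * e1 <= eps / 2 by nra. move=> E3. nra.
Qed.

Lemma cderiv_sqr z : cderiv (fun w => w * w)%C z (2 * z)%C.
Proof.
move=> eps He. exists eps. split=> // w Hw.
replace (w * w - z * z - 2 * z * (w - z))%C with ((w - z) * (w - z))%C by ring.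
rewrite Cmod_mult. apply Rmult_le_compat_r; [apply Cmod_ge_0|lra].
Qed.

Lemma cderiv_scal c f z a : cderiv f z a -> cderiv (fun w => c * f w)%C z (c * a)%C.
Proof.
move=> H. apply: (cderiv_comp (fun w => c * w)%C f) H _.
move=> eps He. exists 1. split; [lra|]. move=> w _.
replace (c * w - c * f z - c * (w - f z))%C with (RtoC 0) by ring. rewrite Cmod_0.
have := Cmod_ge_0 (w - f z)%C. nra.
Qed.

Lemma cderiv_opp f z a : cderiv f z a -> cderiv (fun w => - f w)%C z (- a)%C.
Proof.
move=> H. replace (- a)%C with (- (1) * a)%C by ring.
apply: cderiv_ext (cderiv_scal (-(1))%C f z a H) => w. ring.
Qed.

Lemma cderiv_minus f g z a b : cderiv f z a -> cderiv g z b -> cderiv (fun w => f w - g w)%C z (a - b)%C.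
Proof. move=> Hf Hg. apply: cderiv_plus Hf _. by apply cderiv_opp. Qed.

(* Polarization reduces products to squares. *)
Lemma cderiv_mult f g z a b : cderiv f z a -> cderiv g z b ->
  cderiv (fun w => f w * g w)%C z (a * g z + f z * b)%C.
Proof.
move=> Hf Hg.
have Hp := cderiv_comp (fun w => w * w)%C _ z _ _ (cderiv_plus f g z a b Hf Hg) (cderiv_sqr _).
have Hm := cderiv_comp (fun w => w * w)%C _ z _ _ (cderiv_minus f g z a b Hf Hg) (cderiv_sqr _).
have H := cderiv_scal (/4)%C _ _ _ (cderiv_minus _ _ _ _ _ Hp Hm). simpl in H.
have H4 : RtoC 4 <> 0%C by move=> E; injection E; lra.
replace (a * g z + f z * b)%C with
  (/ 4 * (2 * (f z + g z) * (a + b) - 2 * (f z - g z) * (a - b)))%C by (field; auto).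
apply: cderiv_ext H => w. field; auto.
Qed.

Lemma cderiv_Cinv (z : C) : z <> 0%C -> cderiv Cinv z (- / (z * z))%C.
Proof.
move=> Hz eps He. have P : 0 < Cmod z by apply Cmod_gt_0.
set M := Cmod z * Cmod z * Cmod z.
have HM : 0 < M by unfold M; apply Rmult_lt_0_compat; nra.
exists (Rmin (Cmod z / 2) (eps * (M / 2))). split.
{ apply Rmin_glb_lt; [lra|]. apply Rmult_lt_0_compat; lra. }
move=> w Hw.
have A := Rlt_le_trans _ _ _ Hw (Rmin_l _ _). have B := Rlt_le_trans _ _ _ Hw (Rmin_r _ _).
have T := Cmod_triangle_rev z w. rewrite Cmod_sub_sym in T.
have Pw : Cmod z / 2 < Cmod w by lra.
have Hw0 : w <> 0%C by apply Cmod_gt_0; lra.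
replace (/ w - / z - - / (z * z) * (w - z))%C with ((w - z) * ((w - z) * / (z * z * w)))%C by (field; auto).
rewrite 2!Cmod_mult Rmult_comm. apply Rmult_le_compat_r; [apply Cmod_ge_0|].
rewrite Cmod_inv; [|by repeat apply Cmult_neq_0]. rewrite !Cmod_mult.
apply Rmult_le_reg_r with (Cmod z * Cmod z * Cmod w); [apply Rmult_lt_0_compat; nra|].
rewrite Rmult_assoc Rinv_l; [|apply Rgt_not_eq; apply Rmult_lt_0_compat; nra].
rewrite Rmult_1_r. apply Rlt_le, (Rlt_le_trans _ _ _ B).
apply Rmult_le_compat_l; [lra|]. unfold M.
replace (Cmod z * Cmod z * Cmod z / 2) with (Cmod z * Cmod z * (Cmod z / 2)) by field.
apply Rmult_le_compat_l; nra.
Qed.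

Lemma cdiff_const c z : cdiff (fun _ => c) z. Proof. eexists; apply cderiv_const. Qed.
Lemma cdiff_id z : cdiff (fun w => w) z. Proof. eexists; apply cderiv_id. Qed.
Lemma cdiff_plus f g z : cdiff f z -> cdiff g z -> cdiff (fun w => f w + g w)%C z.
Proof. move=> [a Ha] [b Hb]. eexists; apply (cderiv_plus _ _ _ _ _ Ha Hb). Qed.
Lemma cdiff_minus f g z : cdiff f z -> cdiff g z -> cdiff (fun w => f w - g w)%C z.
Proof. move=> [a Ha] [b Hb]. eexists; apply (cderiv_minus _ _ _ _ _ Ha Hb). Qed.
Lemma cdiff_mult f g z : cdiff f z -> cdiff g z -> cdiff (fun w => f w * g w)%C z.
Proof. move=> [a Ha] [b Hb]. eexists; apply (cderiv_mult _ _ _ _ _ Ha Hb). Qed.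
Lemma cdiff_opp f z : cdiff f z -> cdiff (fun w => - f w)%C z.
Proof. move=> [a Ha]. eexists; apply (cderiv_opp _ _ _ Ha). Qed.
Lemma cdiff_comp f g z : cdiff g z -> cdiff f (g z) -> cdiff (fun w => f (g w)) z.
Proof. move=> [a Ha] [b Hb]. eexists; apply (cderiv_comp _ _ _ _ _ Ha Hb). Qed.
Lemma cdiff_inv f z : cdiff f z -> f z <> 0%C -> cdiff (fun w => / f w)%C z.
Proof. move=> Hf Hz. apply: (cdiff_comp Cinv) => //. eexists; by apply cderiv_Cinv. Qed.
Lemma cdiff_div f g z : cdiff f z -> cdiff g z -> g z <> 0%C -> cdiff (fun w => f w / g w)%C z.
Proof. move=> Hf Hg Hz. apply: cdiff_mult => //. by apply cdiff_inv. Qed.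

Lemma cderiv_is_derive f z l : cderiv f z l <-> is_derive (K := C_AbsRing) (V := C_NormedModule) f z l.
Proof.
split.
- move=> H. split; [apply is_linear_scal_l|].
  move=> x Hx eps. have E : z = x by apply (is_filter_lim_locally_unique (V := AbsRing_NormedModule C_AbsRing)).
  subst x.
  destruct (H eps (cond_pos eps)) as [d [Hd K]].
  exists (mkposreal d Hd) => w Hw.
  change (Cmod (f w + - f z + - ((w + - z) * l))%C <= eps * Cmod (w + - z)%C).
  replace (f w + - f z + - ((w + - z) * l))%C with (f w - f z - l * (w - z))%C by ring.
  apply K, Hw.
- move=> [_ H] eps He.
  have := H z (fun P p => p) (mkposreal eps He) => {}H.
  destruct H as [d K].
  exists d. split; [apply cond_pos|]. move=> w Hw.
  have G : Cmod (f w + - f z + - ((w + - z) * l))%C <= eps * Cmod (w + - z)%C by apply (K w Hw).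
  replace (f w - f z - l * (w - z))%C with (f w + - f z + - ((w + - z) * l))%C by ring.
  exact G.
Qed.

Lemma locally_C_Cmod (z : C) (P : C -> Prop) : locally (T := C_UniformSpace) z P <->
  exists r, 0 < r /\ forall w, Cmod (w - z)%C < r -> P w.
Proof.
split.
- move=> H. apply (locally_norm_le_locally (V := C_NormedModule)) in H. destruct H as [d K].
  exists d. split; [apply cond_pos|]. exact K.
- move=> [r [Hr K]]. apply (locally_le_locally_norm (V := C_NormedModule)).
  by exists (mkposreal r Hr).
Qed.

Lemma holomorphic_at_iff f z : holomorphic_at f z <->
  exists r, 0 < r /\ forall w, Cmod (w - z)%C < r -> cdiff f w.
Proof.
unfold holomorphic_at. rewrite locally_C_Cmod.
by split; move=> [r [Hr K]]; exists r; split=> // w Hw; have [l Hl] := K w Hw; exists l;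
  apply cderiv_is_derive.
Qed.

(** * Complex functions of a real variable *)

Definition rderiv (g : R -> C) (t : R) (l : C) : Prop :=
  is_derive (fun u => fst (g u)) t (fst l) /\ is_derive (fun u => snd (g u)) t (snd l).

Definition rcont (g : R -> C) (t : R) : Prop :=
  continuous (fun u => fst (g u)) t /\ continuous (fun u => snd (g u)) t.

Lemma is_derive_eps (f : R -> R) (t l : R) :
  is_derive f t l <-> forall eps, 0 < eps -> exists d, 0 < d /\
    forall u, Rabs (u - t) < d -> Rabs (f u - f t - l * (u - t)) <= eps * Rabs (u - t).
Proof.
rewrite is_derive_Reals. split.
- move=> H eps He. destruct (H eps He) as [d K]. exists d. split; [apply cond_pos|]. move=> u Hu.
  destruct (Req_dec u t) as [->|Hn].
  { replace (f t - f t - l * (t - t)) with 0 by ring. rewrite Rminus_diag Rabs_R0. lra. }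
  have A := K (u - t) ltac:(lra) Hu. replace (t + (u - t)) with u in A by ring.
  replace (f u - f t - l * (u - t)) with (((f u - f t) / (u - t) - l) * (u - t)) by (field; lra).
  rewrite Rabs_mult. apply Rmult_le_compat_r; [apply Rabs_pos|lra].
- move=> H eps He. destruct (H (eps / 2) ltac:(lra)) as [d [Hd K]]. exists (mkposreal d Hd) => h Hh Hd' /=.
  have A := K (t + h). replace (t + h - t) with h in A by ring. have {}A := A Hd'.
  replace ((f (t + h) - f t) / h - l) with ((f (t + h) - f t - l * h) / h) by (field; lra).
  have P : 0 < Rabs h by apply Rabs_pos_lt.
  unfold Rdiv. rewrite Rabs_mult Rabs_inv.
  apply Rmult_lt_reg_r with (Rabs h) => //. rewrite Rmult_assoc Rinv_l; [|lra]. nra.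
Qed.

Lemma rderiv_eps (g : R -> C) t l : rderiv g t l <-> forall eps, 0 < eps -> exists d, 0 < d /\
    forall u, Rabs (u - t) < d -> Cmod (g u - g t - l * RtoC (u - t))%C <= eps * Rabs (u - t).
Proof.
have E1 : forall u, fst (g u - g t - l * RtoC (u - t))%C = fst (g u) - fst (g t) - fst l * (u - t).
{ move=> u. destruct (g u), (g t), l. simpl. ring. }
have E2 : forall u, snd (g u - g t - l * RtoC (u - t))%C = snd (g u) - snd (g t) - snd l * (u - t).
{ move=> u. destruct (g u), (g t), l. simpl. ring. }
unfold rderiv. rewrite !is_derive_eps. split.
- move=> [H1 H2] eps He. destruct (H1 (eps/2) ltac:(lra)) as [d1 [P1 K1]].
  destruct (H2 (eps/2) ltac:(lra)) as [d2 [P2 K2]].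
  exists (Rmin d1 d2). split; [by apply Rmin_glb_lt|]. move=> u Hu.
  have A := K1 u (Rlt_le_trans _ _ _ Hu (Rmin_l _ _)).
  have B := K2 u (Rlt_le_trans _ _ _ Hu (Rmin_r _ _)).
  eapply Rle_trans; [apply Cmod_le_1|]. rewrite E1 E2. lra.
- move=> H. split=> eps He; destruct (H eps He) as [d [Hd K]]; exists d; split=> // u Hu;
  (eapply Rle_trans; [|apply (K u Hu)]); [rewrite -E1; apply Rabs_fst_le|rewrite -E2; apply Rabs_snd_le].
Qed.

Lemma rcont_eps (g : R -> C) t : rcont g t <-> forall eps, 0 < eps -> exists d, 0 < d /\
    forall u, Rabs (u - t) < d -> Cmod (g u - g t)%C < eps.
Proof.
split.
- move=> [/filterlim_locally H1 /filterlim_locally H2] eps He.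
  destruct (H1 (mkposreal (eps/2) ltac:(lra))) as [d1 K1].
  destruct (H2 (mkposreal (eps/2) ltac:(lra))) as [d2 K2].
  exists (Rmin d1 d2). split; [apply Rmin_glb_lt; apply cond_pos|]. move=> u Hu.
  have A := K1 u (Rlt_le_trans _ _ _ Hu (Rmin_l _ _)).
  have B := K2 u (Rlt_le_trans _ _ _ Hu (Rmin_r _ _)).
  change (Rabs (fst (g u) - fst (g t)) < eps / 2) in A.
  change (Rabs (snd (g u) - snd (g t)) < eps / 2) in B.
  eapply Rle_lt_trans; [apply Cmod_le_1|]. destruct (g u), (g t). simpl in *. unfold Rminus in *. lra.
- move=> H. split; apply filterlim_locally => eps; destruct (H eps (cond_pos eps)) as [d [Hd K]];
  exists (mkposreal d Hd) => u Hu.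
  + eapply Rle_lt_trans; [|apply (K u Hu)]. apply (Rabs_fst_le (g u - g t)%C).
  + eapply Rle_lt_trans; [|apply (K u Hu)]. apply (Rabs_snd_le (g u - g t)%C).
Qed.

Lemma rderiv_rcont g t l : rderiv g t l -> rcont g t.
Proof. move=> [H1 H2]. split; apply: ex_derive_continuous; eexists; eassumption. Qed.

Lemma rcont_ccont (f : C -> C) g t : rcont g t -> ccont f (g t) -> rcont (fun u => f (g u)) t.
Proof.
move=> /rcont_eps Hg Hf. apply rcont_eps => eps He. destruct (Hf eps He) as [d [Hd K]].
destruct (Hg d Hd) as [d2 [P2 K2]]. exists d2. split=> // u Hu. apply K, K2, Hu.
Qed.

Lemma rderiv_cderiv (f : C -> C) g t l m : rderiv g t m -> cderiv f (g t) l ->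
  rderiv (fun u => f (g u)) t (l * m)%C.
Proof.
move=> /rderiv_eps Hg Hf.
apply rderiv_eps => eps He. have Pm := Cmod_ge_0 m. have Pl := Cmod_ge_0 l.
set e2 := eps / (2 * (Cmod m + 1)). set e1 := Rmin 1 (eps / (2 * (Cmod l + 1))).
have He2 : 0 < e2 by apply Rdiv_lt_0_compat; lra.
have He1 : 0 < e1 by apply Rmin_glb_lt; [lra|apply Rdiv_lt_0_compat; lra].
destruct (Hf e2 He2) as [d1 [P1 K1]]. destruct (Hg e1 He1) as [d2 [P2 K2]].
have P3 : 0 < d1 / (Cmod m + 1) by apply Rdiv_lt_0_compat; lra.
exists (Rmin d2 (d1 / (Cmod m + 1))). split; [by apply Rmin_glb_lt|]. move=> u Hu.
have A := K2 u (Rlt_le_trans _ _ _ Hu (Rmin_l _ _)).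
have B := Rlt_le_trans _ _ _ Hu (Rmin_r _ _).
have Pu := Rabs_pos (u - t).
have G : Cmod (g u - g t)%C <= (Cmod m + 1) * Rabs (u - t).
{ replace (g u - g t)%C with ((g u - g t - m * RtoC (u - t)) + m * RtoC (u - t))%C by ring.
  eapply Rle_trans; [apply Cmod_triangle|]. rewrite Cmod_mult Cmod_R.
  have : e1 <= 1 by apply Rmin_l. nra. }
have G2 : Cmod (g u - g t)%C < d1.
{ eapply Rle_lt_trans; [apply G|]. replace d1 with ((Cmod m + 1) * (d1 / (Cmod m + 1))) by (field; lra).
  apply Rmult_lt_compat_l; lra. }
have D := K1 (g u) G2.
replace (f (g u) - f (g t) - l * m * RtoC (u - t))%C with
  ((f (g u) - f (g t) - l * (g u - g t)) + l * (g u - g t - m * RtoC (u - t)))%C by ring.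
eapply Rle_trans; [apply Cmod_triangle|]. rewrite Cmod_mult.
have E1 : e1 * (Cmod l + 1) <= eps / 2.
{ apply Rle_trans with (eps / (2 * (Cmod l + 1)) * (Cmod l + 1)).
  apply Rmult_le_compat_r; [lra|apply Rmin_r]. right; field; lra. }
have E2 : e2 * (Cmod m + 1) = eps / 2 by unfold e2; field; lra.
apply Rle_trans with (e2 * ((Cmod m + 1) * Rabs (u - t)) + Cmod l * (e1 * Rabs (u - t))).
- apply Rplus_le_compat.
  + eapply Rle_trans; [apply D|]. apply Rmult_le_compat_l; lra.
  + apply Rmult_le_compat_l; lra.
- have : Cmod l * e1 <= eps / 2 by nra. move=> E3. nra.
Qed.

Lemma rderiv_RtoC (f : R -> R) t l : is_derive f t l -> rderiv (fun u => RtoC (f u)) t (RtoC l).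
Proof. move=> H. split=> //=. apply: is_derive_const. Qed.

Lemma rderiv_line (z w : C) t : rderiv (fun u => z + RtoC u * w)%C t w.
Proof.
apply rderiv_eps => eps He. exists 1. split; [lra|]. move=> u _.
replace (z + RtoC u * w - (z + RtoC t * w) - w * RtoC (u - t))%C with (RtoC 0).
- rewrite Cmod_0. have := Rabs_pos (u - t). nra.
- rewrite RtoC_minus. ring.
Qed.

Lemma rderiv_const c t : rderiv (fun _ => c) t 0%C.
Proof. split; apply: is_derive_const. Qed.

Lemma rderiv_ext g h t l : (forall u, g u = h u) -> rderiv g t l -> rderiv h t l.
Proof.
move=> E [H1 H2]. split.
- apply: is_derive_ext H1 => u. by rewrite E.
- apply: is_derive_ext H2 => u. by rewrite E.
Qed.

Lemma rderiv_horizontal (y t : R) : rderiv (fun u => (u, y)) t 1%C.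
Proof. split=> /=. apply: is_derive_id. apply: is_derive_const. Qed.

Lemma rderiv_vertical (x t : R) : rderiv (fun u => (x, u)) t Ci.
Proof. split=> /=. apply: is_derive_const. apply: is_derive_id. Qed.

Lemma rderiv_plus g h t a b : rderiv g t a -> rderiv h t b -> rderiv (fun u => g u + h u)%C t (a + b)%C.
Proof. move=> [H1 H2] [K1 K2]. split=> /=; [apply: is_derive_plus H1 K1|apply: is_derive_plus H2 K2]. Qed.

Lemma rderiv_scal g t a c : rderiv g t a -> rderiv (fun u => c * g u)%C t (c * a)%C.
Proof.
move=> H. apply: (rderiv_cderiv (fun w => c * w)%C) H _.
have := cderiv_scal c (fun w => w) (g t) _ (cderiv_id _).
by replace (c * 1)%C with c by ring.
Qed.

Lemma rderiv_minus g h t a b : rderiv g t a -> rderiv h t b -> rderiv (fun u => g u - h u)%C t (a - b)%C.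
Proof.
move=> H K. have := rderiv_plus _ _ _ _ _ H (rderiv_scal _ _ _ (-(1))%C K).
replace (a + - (1) * b)%C with (a - b)%C by ring. apply: rderiv_ext => u. ring.
Qed.

(** The real mean value theorem is applied to the component of [g] in the direction of the total
    increment [D]: its increment is |D|^2, and Cauchy-Schwarz bounds its derivative by |D| M. *)
Lemma MVT_C (g g' : R -> C) a b M : a <= b ->
  (forall t, a <= t <= b -> rderiv g t (g' t)) ->
  (forall t, a <= t <= b -> Cmod (g' t) <= M) ->
  Cmod (g b - g a)%C <= M * (b - a).
Proof.
move=> Hab Hd HM. set D := (g b - g a)%C.
have HM0 : 0 <= M by have := HM a ltac:(lra); have := Cmod_ge_0 (g' a); lra.
destruct (MVT_gen (fun t => fst D * fst (g t) + snd D * snd (g t)) a b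
  (fun t => fst D * fst (g' t) + snd D * snd (g' t))) as [c [Hc E]].
- move=> x; rewrite /= Rmin_left // Rmax_right // => Hx.
  destruct (Hd x ltac:(lra)) as [K1 K2].
  apply: is_derive_plus; apply: is_derive_scal; assumption.
- move=> x; rewrite /= Rmin_left // Rmax_right // => Hx.
  destruct (Hd x Hx) as [K1 K2]. apply continuity_pt_filterlim.
  apply: ex_derive_continuous. eexists.
  apply: is_derive_plus; apply: is_derive_scal; eassumption.
rewrite Rmin_left // Rmax_right // in Hc.
have E2 : Cmod D * Cmod D = fst D * fst (g' c) * (b - a) + snd D * snd (g' c) * (b - a).
{ rewrite Cmod_sqr. transitivity (fst D * fst (g b) + snd D * snd (g b) - (fst D * fst (g a) + snd D * snd (g a))).
  - unfold D. destruct (g b), (g a). simpl. ring.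
  - rewrite E. ring. }
have K := Cdot_le D (g' c). have L := HM c Hc. have P := Cmod_ge_0 D.
destruct (Req_dec (Cmod D) 0) as [->|Hn]; [nra|].
apply Rmult_le_reg_l with (Cmod D); [lra|]. rewrite E2.
apply Rle_trans with (Cmod D * Cmod (g' c) * (b - a)); [nra|].
replace (Cmod D * (M * (b - a))) with (Cmod D * M * (b - a)) by ring.
apply Rmult_le_compat_r; [lra|]. apply Rmult_le_compat_l; lra.
Qed.

Definition exCI (f : R -> C) a b : Prop :=
  ex_RInt (fun t => fst (f t)) a b /\ ex_RInt (fun t => snd (f t)) a b.

Definition CI (f : R -> C) a b : C :=
  (RInt (fun t => fst (f t)) a b, RInt (fun t => snd (f t)) a b).

Lemma RInt_scal_R (f : R -> R) a b l : ex_RInt f a b -> RInt (fun t => l * f t) a b = l * RInt f a b.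
Proof. move=> H. exact: (RInt_scal f a b l H). Qed.

Lemma RInt_plus_R (f g : R -> R) a b : ex_RInt f a b -> ex_RInt g a b ->
  RInt (fun t => f t + g t) a b = RInt f a b + RInt g a b.
Proof. move=> H K. exact: (RInt_plus f g a b H K). Qed.

Lemma RInt_minus_R (f g : R -> R) a b : ex_RInt f a b -> ex_RInt g a b ->
  RInt (fun t => f t - g t) a b = RInt f a b - RInt g a b.
Proof. move=> H K. exact: (RInt_minus f g a b H K). Qed.

Lemma ex_RInt_scal_R (f : R -> R) a b l : ex_RInt f a b -> ex_RInt (fun t => l * f t) a b.
Proof. move=> H. exact: (ex_RInt_scal f a b l H). Qed.

Lemma exCI_cont f a b : a <= b -> (forall t, a <= t <= b -> rcont f t) -> exCI f a b.
Proof.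
move=> Hab H. split; apply: ex_RInt_continuous => z; rewrite Rmin_left // Rmax_right // => Hz;
by destruct (H z Hz).
Qed.

Lemma C_eq_pair (z : C) a b : fst z = a -> snd z = b -> z = (a, b).
Proof. destruct z. simpl. by move=> -> ->. Qed.

Lemma CI_ext f g a b : a <= b -> (forall t, a < t < b -> f t = g t) -> CI f a b = CI g a b.
Proof.
move=> Hab H. unfold CI. f_equal; apply RInt_ext => x; rewrite Rmin_left // Rmax_right // => Hx; by rewrite H.
Qed.

Lemma CI_plus f g a b : exCI f a b -> exCI g a b -> CI (fun t => f t + g t)%C a b = (CI f a b + CI g a b)%C.
Proof.
move=> [f1 f2] [g1 g2]. unfold CI, Cplus. simpl. f_equal.
- by apply: RInt_plus.
- by apply: RInt_plus.
Qed.

Lemma exCI_plus f g a b : exCI f a b -> exCI g a b -> exCI (fun t => f t + g t)%C a b.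
Proof. move=> [f1 f2] [g1 g2]. split; simpl; by apply: ex_RInt_plus. Qed.

Lemma exCI_scal c f a b : exCI f a b -> exCI (fun t => c * f t)%C a b.
Proof.
move=> [f1 f2]. split; simpl.
- apply: ex_RInt_minus; by apply: ex_RInt_scal.
- apply: ex_RInt_plus; by apply: ex_RInt_scal.
Qed.

Lemma CI_scal c f a b : exCI f a b -> CI (fun t => c * f t)%C a b = (c * CI f a b)%C.
Proof.
move=> [f1 f2]. unfold CI, Cmult. simpl. f_equal.
- rewrite RInt_minus_R; try by apply: ex_RInt_scal_R. by rewrite !RInt_scal_R.
- rewrite RInt_plus_R; try by apply: ex_RInt_scal_R. by rewrite !RInt_scal_R.
Qed.

Lemma CI_minus f g a b : exCI f a b -> exCI g a b -> CI (fun t => f t - g t)%C a b = (CI f a b - CI g a b)%C.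
Proof.
move=> [f1 f2] [g1 g2]. unfold CI, Cminus, Cplus, Copp. simpl. f_equal.
- by apply: RInt_minus.
- by apply: RInt_minus.
Qed.

Lemma exCI_minus f g a b : exCI f a b -> exCI g a b -> exCI (fun t => f t - g t)%C a b.
Proof. move=> [f1 f2] [g1 g2]. split; simpl; by apply: ex_RInt_minus. Qed.

Lemma CI_Chasles f a b c : exCI f a b -> exCI f b c -> (CI f a b + CI f b c)%C = CI f a c.
Proof.
move=> [f1 f2] [g1 g2]. unfold CI, Cplus. simpl. f_equal; by apply: RInt_Chasles.
Qed.

Lemma CI_const c a b : CI (fun _ => c) a b = (RtoC (b - a) * c)%C.
Proof.
unfold CI. rewrite !RInt_const /scal /= /mult /=. destruct c. unfold Cmult, RtoC. simpl. f_equal; ring.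
Qed.

(** Projecting the integrand on the value [I] of the integral gives |I|^2 as the integral of the
    scalar product of [I] and [f], which is at most |I| times the integral of [g]. *)
Lemma CI_bound_fun f g a b : a <= b -> exCI f a b -> ex_RInt g a b ->
  (forall t, a < t < b -> Cmod (f t) <= g t) -> Cmod (CI f a b) <= RInt g a b.
Proof.
move=> Hab [f1 f2] Hg H. set I := CI f a b.
have E : RInt (fun t => fst I * fst (f t) + snd I * snd (f t)) a b = Cmod I * Cmod I.
{ rewrite Cmod_sqr.
  rewrite RInt_plus_R; try by apply: ex_RInt_scal_R. by rewrite !RInt_scal_R. }
have L : RInt (fun t => fst I * fst (f t) + snd I * snd (f t)) a b <= RInt (fun t => Cmod I * g t) a b.
{ apply RInt_le => //.
  - apply: ex_RInt_plus; by apply: ex_RInt_scal.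
  - by apply: ex_RInt_scal.
  - move=> t Ht. eapply Rle_trans; [apply Cdot_le|]. apply Rmult_le_compat_l; [apply Cmod_ge_0|auto]. }
have S : RInt (fun t => Cmod I * g t) a b = Cmod I * RInt g a b by apply: RInt_scal.
rewrite E S in L.
destruct (Req_dec (Cmod I) 0) as [->|Hn].
- apply RInt_ge_0 => // t Ht. have := H t Ht. have := Cmod_ge_0 (f t). lra.
- have P := Cmod_ge_0 I. apply Rmult_le_reg_l with (Cmod I); lra.
Qed.

Lemma CI_bound f a b M : a <= b -> exCI f a b ->
  (forall t, a < t < b -> Cmod (f t) <= M) -> Cmod (CI f a b) <= M * (b - a).
Proof.
move=> Hab Hf H.
have := CI_bound_fun f (fun _ => M) a b Hab Hf (ex_RInt_const _ _ _) H.
rewrite RInt_const /scal /= /mult /=. lra.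
Qed.

Lemma CI_derive g g' a b : a <= b -> (forall t, a <= t <= b -> rderiv g t (g' t)) ->
  (forall t, a <= t <= b -> rcont g' t) -> CI g' a b = (g b - g a)%C.
Proof.
move=> Hab Hd Hc. symmetry. apply C_eq_pair.
- symmetry. apply: is_RInt_unique. apply: (is_RInt_derive (fun t => fst (g t)));
  rewrite Rmin_left // Rmax_right // => x Hx; [by destruct (Hd x Hx)|by destruct (Hc x Hx)].
- symmetry. apply: is_RInt_unique. apply: (is_RInt_derive (fun t => snd (g t)));
  rewrite Rmin_left // Rmax_right // => x Hx; [by destruct (Hd x Hx)|by destruct (Hc x Hx)].
Qed.

(** * Cauchy's theorem and power series expansions *)

(** The contour integral taken counterclockwise, with dz = i dy on the vertical sides. *)
Definition RectI (f : C -> C) (a b c d : R) : C :=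
  (CI (fun x => f (x, c)) a b + Ci * CI (fun y => f (b, y)) c d
   - CI (fun x => f (x, d)) a b - Ci * CI (fun y => f (a, y)) c d)%C.

Definition on_rect (P : C -> Prop) (a b c d : R) : Prop :=
  forall x y, a <= x <= b -> c <= y <= d -> P (x, y).

Lemma on_rect_sub P a b c d a' b' c' d' : a <= a' -> b' <= b -> c <= c' -> d' <= d ->
  on_rect P a b c d -> on_rect P a' b' c' d'.
Proof. move=> h1 h2 h3 h4 H x y Hx Hy. apply H; lra. Qed.

Lemma on_rect_impl (P Q : C -> Prop) a b c d : (forall z, P z -> Q z) ->
  on_rect P a b c d -> on_rect Q a b c d.
Proof. move=> h H x y Hx Hy. by apply h, H. Qed.

Lemma rcont_hor f x y : ccont f (x, y) -> rcont (fun u => f (u, y)) x.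
Proof. move=> H. apply: (rcont_ccont f (fun u => (u, y))) => //. apply: rderiv_rcont. apply rderiv_horizontal. Qed.

Lemma rcont_ver f x y : ccont f (x, y) -> rcont (fun u => f (x, u)) y.
Proof. move=> H. apply: (rcont_ccont f (fun u => (x, u))) => //. apply: rderiv_rcont. apply rderiv_vertical. Qed.

Definition on_frame (P : C -> Prop) (a b c d : R) : Prop :=
  (forall x, a <= x <= b -> P (x, c) /\ P (x, d)) /\
  (forall y, c <= y <= d -> P (a, y) /\ P (b, y)).

Lemma on_rect_frame P a b c d : a <= b -> c <= d -> on_rect P a b c d -> on_frame P a b c d.
Proof. move=> H1 H2 H. split=> t Ht; split; apply H; lra. Qed.

Lemma exCI_frame f a b c d : a <= b -> c <= d -> on_frame (ccont f) a b c d ->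
  (exCI (fun x => f (x, c)) a b /\ exCI (fun x => f (x, d)) a b) /\
  (exCI (fun y => f (a, y)) c d /\ exCI (fun y => f (b, y)) c d).
Proof.
move=> Hab Hcd [H1 H2]. split; split; apply exCI_cont => // t Ht.
- apply (rcont_hor f). by apply H1.
- apply (rcont_hor f). by apply H1.
- apply (rcont_ver f). by apply H2.
- apply (rcont_ver f). by apply H2.
Qed.

Lemma RectI_split_v f a m b c d : a <= m <= b -> c <= d -> on_frame (ccont f) a b c d ->
  RectI f a b c d = (RectI f a m c d + RectI f m b c d)%C.
Proof.
move=> Hm Hcd [H _]. unfold RectI.
rewrite -(CI_Chasles (fun x => f (x, c)) a m b); try (apply exCI_cont; [lra|move=> t Ht; apply (rcont_hor f), H; lra]).
rewrite -(CI_Chasles (fun x => f (x, d)) a m b); try (apply exCI_cont; [lra|move=> t Ht; apply (rcont_hor f), H; lra]).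
ring.
Qed.

Lemma RectI_split_h f a b c m d : a <= b -> c <= m <= d -> on_frame (ccont f) a b c d ->
  RectI f a b c d = (RectI f a b c m + RectI f a b m d)%C.
Proof.
move=> Hab Hm [_ H]. unfold RectI.
rewrite -(CI_Chasles (fun y => f (b, y)) c m d); try (apply exCI_cont; [lra|move=> t Ht; apply (rcont_ver f), H; lra]).
rewrite -(CI_Chasles (fun y => f (a, y)) c m d); try (apply exCI_cont; [lra|move=> t Ht; apply (rcont_ver f), H; lra]).
ring.
Qed.

Lemma RectI_plus f g a b c d : a <= b -> c <= d -> on_frame (ccont f) a b c d -> on_frame (ccont g) a b c d ->
  RectI (fun z => f z + g z)%C a b c d = (RectI f a b c d + RectI g a b c d)%C.
Proof.
move=> Hab Hcd Hf Hg. unfold RectI.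
have [[f1 f2] [f3 f4]] := exCI_frame f _ _ _ _ Hab Hcd Hf.
have [[g1 g2] [g3 g4]] := exCI_frame g _ _ _ _ Hab Hcd Hg.
rewrite (CI_plus (fun x => f (x, c)) (fun x => g (x, c))) // (CI_plus (fun x => f (x, d)) (fun x => g (x, d))) //
  (CI_plus (fun y => f (a, y)) (fun y => g (a, y))) // (CI_plus (fun y => f (b, y)) (fun y => g (b, y))) //.
ring.
Qed.

Lemma RectI_scal k f a b c d : a <= b -> c <= d -> on_frame (ccont f) a b c d ->
  RectI (fun z => k * f z)%C a b c d = (k * RectI f a b c d)%C.
Proof.
move=> Hab Hcd Hf. unfold RectI.
have [[f1 f2] [f3 f4]] := exCI_frame f _ _ _ _ Hab Hcd Hf.
rewrite (CI_scal k (fun x => f (x, c))) // (CI_scal k (fun x => f (x, d))) //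
  (CI_scal k (fun y => f (a, y))) // (CI_scal k (fun y => f (b, y))) //.
ring.
Qed.

Lemma RectI_ext f g a b c d : a <= b -> c <= d -> on_frame (fun z => f z = g z) a b c d ->
  RectI f a b c d = RectI g a b c d.
Proof.
move=> Hab Hcd [H1 H2]. unfold RectI.
have E1 := CI_ext (fun x => f (x, c)) (fun x => g (x, c)) a b Hab.
have E2 := CI_ext (fun x => f (x, d)) (fun x => g (x, d)) a b Hab.
have E3 := CI_ext (fun y => f (a, y)) (fun y => g (a, y)) c d Hcd.
have E4 := CI_ext (fun y => f (b, y)) (fun y => g (b, y)) c d Hcd.
rewrite E1 ?E2 ?E3 ?E4 // => t Ht; [apply H2|apply H2|apply H1|apply H1]; lra.
Qed.

Lemma on_frame_all (P : C -> Prop) a b c d : (forall z, P z) -> on_frame P a b c d.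
Proof. move=> H. split=> t _; split; apply H. Qed.

Lemma on_frame_impl (P Q : C -> Prop) a b c d : (forall z, P z -> Q z) -> on_frame P a b c d -> on_frame Q a b c d.
Proof. move=> h [H1 H2]. split=> t Ht; split; apply h; [apply H1|apply H1|apply H2|apply H2]; done. Qed.

Lemma on_frame_and (P Q : C -> Prop) a b c d : on_frame P a b c d -> on_frame Q a b c d ->
  on_frame (fun z => P z /\ Q z) a b c d.
Proof. move=> [H1 H2] [K1 K2]. split=> t Ht; split; split; try apply H1; try apply H2; try apply K1; try apply K2; done. Qed.

Lemma RectI_minus f g a b c d : a <= b -> c <= d -> on_frame (ccont f) a b c d -> on_frame (ccont g) a b c d ->
  RectI (fun z => f z - g z)%C a b c d = (RectI f a b c d - RectI g a b c d)%C.
Proof.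
move=> Hab Hcd Hf Hg.
rewrite (RectI_ext _ (fun z => f z + (-(1)) * g z)%C) //; [|apply on_frame_all => z; ring].
rewrite RectI_plus // ?RectI_scal //; [ring|].
apply: on_frame_impl Hg => z Hz. by apply ccont_mult; [apply ccont_const|].
Qed.

Lemma RectI_bound f a b c d M : a <= b -> c <= d -> on_frame (ccont f) a b c d ->
  on_frame (fun z => Cmod (f z) <= M) a b c d ->
  Cmod (RectI f a b c d) <= M * (2 * (b - a) + 2 * (d - c)).
Proof.
move=> Hab Hcd [H1 H2] [M1 M2]. unfold RectI.
have K1 : Cmod (CI (fun x => f (x, c)) a b) <= M * (b - a).
{ apply CI_bound => //. apply exCI_cont => // t Ht. apply rcont_hor, H1 => //. move=> t Ht. apply M1. lra. }
have K2 : Cmod (CI (fun x => f (x, d)) a b) <= M * (b - a).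
{ apply CI_bound => //. apply exCI_cont => // t Ht. apply rcont_hor, H1 => //. move=> t Ht. apply M1. lra. }
have K3 : Cmod (CI (fun y => f (a, y)) c d) <= M * (d - c).
{ apply CI_bound => //. apply exCI_cont => // t Ht. apply rcont_ver, H2 => //. move=> t Ht. apply M2. lra. }
have K4 : Cmod (CI (fun y => f (b, y)) c d) <= M * (d - c).
{ apply CI_bound => //. apply exCI_cont => // t Ht. apply rcont_ver, H2 => //. move=> t Ht. apply M2. lra. }
eapply Rle_trans; [apply Cmod_triangle_sub|]. rewrite Cmod_mult Cmod_Ci.
have T := Cmod_triangle_sub (CI (fun x => f (x, c)) a b + Ci * CI (fun y => f (b, y)) c d)%C (CI (fun x => f (x, d)) a b).
have T2 := Cmod_triangle (CI (fun x => f (x, c)) a b) (Ci * CI (fun y => f (b, y)) c d)%C.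
rewrite Cmod_mult Cmod_Ci in T2. nra.
Qed.

Lemma RectI_primitive F f a b c d : a <= b -> c <= d ->
  on_frame (fun z => cderiv F z (f z)) a b c d -> on_frame (ccont f) a b c d -> RectI f a b c d = 0%C.
Proof.
move=> Hab Hcd [HF1 HF2] [Hf1 Hf2]. unfold RectI.
have E1 : CI (fun x => f (x, c)) a b = (F (b, c) - F (a, c))%C.
{ apply (CI_derive (fun x => F (x, c))) => // t Ht.
  - replace (f (t, c)) with (f (t, c) * 1)%C by ring.
    apply (rderiv_cderiv F (fun x => (x, c))). apply rderiv_horizontal. by apply HF1.
  - by apply rcont_hor, Hf1. }
have E2 : CI (fun x => f (x, d)) a b = (F (b, d) - F (a, d))%C.
{ apply (CI_derive (fun x => F (x, d))) => // t Ht.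
  - replace (f (t, d)) with (f (t, d) * 1)%C by ring.
    apply (rderiv_cderiv F (fun x => (x, d))). apply rderiv_horizontal. by apply HF1.
  - by apply rcont_hor, Hf1. }
have V : forall x, (forall y, c <= y <= d -> cderiv F (x, y) (f (x, y)) /\ ccont f (x, y)) ->
   (Ci * CI (fun y => f (x, y)) c d)%C = (F (x, d) - F (x, c))%C.
{ move=> x H. rewrite -CI_scal; last first.
  { apply exCI_cont => // t Ht. by apply rcont_ver, H. }
  apply (CI_derive (fun y => F (x, y))) => // t Ht.
  - replace (Ci * f (x, t))%C with (f (x, t) * Ci)%C by ring.
    apply (rderiv_cderiv F (fun y => (x, y))). apply rderiv_vertical. by apply H.
  - apply rcont_eps => eps He. have : rcont (fun y => f (x, y)) t by apply rcont_ver, H.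
    move/rcont_eps => /(_ eps He) [dd [Hd K]]. exists dd. split=> // u Hu.
    replace (Ci * f (x, u) - Ci * f (x, t))%C with (Ci * (f (x, u) - f (x, t)))%C by ring.
    rewrite Cmod_mult Cmod_Ci Rmult_1_l. auto. }
rewrite E1 E2 (V a) ?(V b); [ring|..]; move=> y Hy; split; try apply HF2; try apply Hf2; lra.
Qed.

Definition rect := (R * R * R * R)%type.
Definition rectI f (r : rect) : C := let '(a, b, c, d) := r in RectI f a b c d.

(* Selects a quarter whose contour integral is at least a quarter of the whole. *)
Definition quarter (f : C -> C) (r : rect) : rect :=
  let '(a, b, c, d) := r in
  let m := (a + b) / 2 in let n := (c + d) / 2 in
  match Rle_dec (Cmod (rectI f r)) (4 * Cmod (RectI f a m c n)) with left _ => (a, m, c, n) | right _ =>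
  match Rle_dec (Cmod (rectI f r)) (4 * Cmod (RectI f m b c n)) with left _ => (m, b, c, n) | right _ =>
  match Rle_dec (Cmod (rectI f r)) (4 * Cmod (RectI f a m n d)) with left _ => (a, m, n, d) | right _ =>
  (m, b, n, d) end end end.

Lemma quarter_le f a b c d : a <= b -> c <= d -> on_rect (ccont f) a b c d ->
  Cmod (rectI f (a, b, c, d)) <= 4 * Cmod (rectI f (quarter f (a, b, c, d))).
Proof.
move=> Hab Hcd H. simpl. set m := (a + b) / 2. set n := (c + d) / 2.
have Hm : a <= m <= b by unfold m; lra. have Hn : c <= n <= d by unfold n; lra.
case: Rle_dec => [//|h1]. case: Rle_dec => [//|h2]. case: Rle_dec => [//|h3]. simpl.
have E : RectI f a b c d = (RectI f a m c n + RectI f a m n d + (RectI f m b c n + RectI f m b n d))%C.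
{ rewrite (RectI_split_v f a m) //; [|by apply on_rect_frame].
  have H1 : on_rect (ccont f) a m c d by apply: on_rect_sub H; lra.
  have H2 : on_rect (ccont f) m b c d by apply: on_rect_sub H; lra.
  rewrite (RectI_split_h f a m c n); try lra; [|apply on_rect_frame; by try lra].
  rewrite (RectI_split_h f m b c n); try lra; [done|apply on_rect_frame; by try lra]. }
have T := Cmod_triangle (RectI f a m c n + RectI f a m n d)%C (RectI f m b c n + RectI f m b n d)%C.
rewrite -E in T.
have T1 := Cmod_triangle (RectI f a m c n) (RectI f a m n d).
have T2 := Cmod_triangle (RectI f m b c n) (RectI f m b n d). lra.
Qed.

Lemma nested_point (u v : nat -> R) : (forall n, u n <= u (S n)) -> (forall n, v (S n) <= v n) ->
  (forall n, u n <= v n) -> exists x, forall n, u n <= x <= v n.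
Proof.
move=> Hu Hv Huv.
have U : forall k n, u n <= u (n + k)%nat.
{ elim=> [|k IH] n; [rewrite Nat.add_0_r; lra|]. rewrite Nat.add_succ_r. have := IH n. have := Hu (n + k)%nat. lra. }
have V : forall k n, v (n + k)%nat <= v n.
{ elim=> [|k IH] n; [rewrite Nat.add_0_r; lra|]. rewrite Nat.add_succ_r. have := IH n. have := Hv (n + k)%nat. lra. }
have UV : forall n m, u n <= v m.
{ move=> n m. have A := U m n. have B := V n m. have D := Huv (n + m)%nat.
  rewrite (Nat.add_comm m n) in B. lra. }
have [x Hx] := ex_finite_lim_seq_incr u (v O) Hu (fun n => UV n O).
exists x => n. split.
- apply: is_lim_seq_incr_compare Hx Hu n.
- apply (is_lim_seq_le u (fun _ => v n) x (v n)) => //. apply is_lim_seq_const.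
Qed.

(** The selected quarters shrink to a point where [f] has a derivative. There [f] is affine up to an
    error small relative to the diameter; affine functions have primitives and integrate to 0, and
    the factor 4^n lost in the selection is regained from perimeter times diameter. *)
Lemma Goursat f a b c d : a <= b -> c <= d -> on_rect (cdiff f) a b c d -> RectI f a b c d = 0%C.
Proof.
move=> Hab Hcd Hf.
have Hc : on_rect (ccont f) a b c d by apply: on_rect_impl Hf; apply ccont_cdiff.
set r := fun n => Nat.iter n (quarter f) (a, b, c, d).
set pa := fun n => fst (fst (fst (r n))). set pb := fun n => snd (fst (fst (r n))).
set pc := fun n => snd (fst (r n)). set pd := fun n => snd (r n).
have Er : forall n, r n = (pa n, pb n, pc n, pd n).
{ move=> n. unfold pa, pb, pc, pd. by destruct (r n) as [[[? ?] ?] ?]. }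
have Step : forall n, (pa (S n) = pa n /\ pb (S n) = (pa n + pb n) / 2 \/ pa (S n) = (pa n + pb n) / 2 /\ pb (S n) = pb n) /\
   (pc (S n) = pc n /\ pd (S n) = (pc n + pd n) / 2 \/ pc (S n) = (pc n + pd n) / 2 /\ pd (S n) = pd n).
{ move=> n. have : r (S n) = quarter f (pa n, pb n, pc n, pd n) by rewrite -Er.
  rewrite Er /=. case: Rle_dec => _ /=; [move=> [-> -> -> ->]; tauto|].
  case: Rle_dec => _ /=; [move=> [-> -> -> ->]; tauto|].
  case: Rle_dec => _ /=; move=> [-> -> -> ->]; tauto. }
have Inv : forall n, a <= pa n <= pb n /\ pb n <= b /\ c <= pc n <= pd n /\ pd n <= d /\
   pb n - pa n = (b - a) / 2 ^ n /\ pd n - pc n = (d - c) / 2 ^ n.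
{ elim=> [|n IH].
  - unfold pa, pb, pc, pd, r. simpl. repeat split; try lra; field.
  - clear Hf Hc. have P : 0 < 2 ^ n by apply pow_lt; lra.
    have E1 : (b - a) / 2 ^ S n = ((b - a) / 2 ^ n) / 2 by simpl; field; lra.
    have E2 : (d - c) / 2 ^ S n = ((d - c) / 2 ^ n) / 2 by simpl; field; lra.
    rewrite E1 E2. destruct IH as [I1 [I2 [I3 [I4 [I5 I6]]]]].
    case: (Step n) => [[[h1 h2]|[h1 h2]] [[h3 h4]|[h3 h4]]]; rewrite h1 h2 h3 h4; repeat split; lra. }
have Mono : forall n, pa n <= pa (S n) /\ pb (S n) <= pb n /\ pc n <= pc (S n) /\ pd (S n) <= pd n.
{ move=> n. have [I1 [I2 [I3 [I4 _]]]] := Inv n.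
  case: (Step n) => [[[h1 h2]|[h1 h2]] [[h3 h4]|[h3 h4]]]; rewrite h1 h2 h3 h4; repeat split; lra. }
have Big : forall n, Cmod (RectI f a b c d) <= 4 ^ n * Cmod (RectI f (pa n) (pb n) (pc n) (pd n)).
{ elim=> [|n IH].
  - rewrite /pa /pb /pc /pd /r /=. lra.
  - have I := Inv n.
    have Q := quarter_le f (pa n) (pb n) (pc n) (pd n) ltac:(lra) ltac:(lra) ltac:(apply: on_rect_sub Hc; lra).
    have E : quarter f (pa n, pb n, pc n, pd n) = (pa (S n), pb (S n), pc (S n), pd (S n)) by rewrite -!Er.
    rewrite E in Q. simpl in Q. simpl.
    have P : 0 < 4 ^ n by apply pow_lt; lra. nra. }
have [x Hx] := nested_point pa pb ltac:(move=> n; have := Mono n; lra)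
  ltac:(move=> n; have := Mono n; lra) ltac:(move=> n; have := Inv n; lra).
have [y Hy] := nested_point pc pd ltac:(move=> n; have := Mono n; lra)
  ltac:(move=> n; have := Mono n; lra) ltac:(move=> n; have := Inv n; lra).
have [l Hl] : cdiff f (x, y).
{ apply Hf. have := Hx O. have := Inv O. lra. have := Hy O. have := Inv O. lra. }
apply Cmod_eq_0. apply Rle_antisym; [|apply Cmod_ge_0]. apply le_epsilon => eps He.
rewrite Rplus_0_l. set L := (b - a) + (d - c).
have HL : 0 <= L by unfold L; lra.
(* After n bisections perimeter times diameter is at most 2 (L / 2^n)^2, whence 2 L L; the + 1
   covers L = 0. *)
have He1 : 0 < eps / (2 * (L * L + 1)) by apply Rdiv_lt_0_compat; nra.
destruct (Hl _ He1) as [dl [Hdl K]].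
have [n Hn] : exists n, L / 2 ^ n < dl.
{ have [n Hn] := pow_lt_1_zero (1/2) ltac:(rewrite Rabs_right; lra) (dl / (L + 1)) ltac:(apply Rdiv_lt_0_compat; lra).
  exists n. have := Hn n (Nat.le_refl _). rewrite Rabs_right; [|apply Rle_ge, pow_le; lra].
  move=> A. have P : 0 < 2 ^ n by apply pow_lt; lra.
  have E : (1 / 2) ^ n = / 2 ^ n by rewrite /Rdiv Rmult_1_l pow_inv.
  rewrite E in A. unfold Rdiv in *.
  have A2 : (L + 1) * / 2 ^ n < dl.
  { apply Rlt_le_trans with ((L + 1) * (dl * / (L + 1))). apply Rmult_lt_compat_l; lra. right; field; lra. }
  have := Rinv_0_lt_compat _ P. nra. }
have I := Inv n. have P2 : 0 < 2 ^ n by apply pow_lt; lra.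
have EL : (pb n - pa n) + (pd n - pc n) = L / 2 ^ n.
{ destruct I as [_ [_ [_ [_ [-> ->]]]]]. unfold L. field. lra. }
set z0 := (x, y) : C.
(* The first order Taylor remainder at the limit point; it differs from [f] by an affine function,
   whose contour integral is 0. *)
set g := fun z => (f z - (f z0 - l * z0) - l * z)%C.
have Hcn : on_rect (ccont f) (pa n) (pb n) (pc n) (pd n) by apply: on_rect_sub Hc; lra.
have Haff : forall z, ccont (fun z => (f z0 - l * z0) + l * z)%C z.
{ move=> z. apply ccont_plus; [apply ccont_const|]. apply ccont_mult; [apply ccont_const|]. apply ccont_cdiff, cdiff_id. }
have Eg : RectI f (pa n) (pb n) (pc n) (pd n) = RectI g (pa n) (pb n) (pc n) (pd n).
{ rewrite (RectI_ext g (fun z => f z - ((f z0 - l * z0) + l * z))%C); try lra; [|apply on_frame_all => z; unfold g; ring].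
  rewrite RectI_minus; try lra; [|apply on_rect_frame; by try lra|by apply on_frame_all].
  rewrite (RectI_primitive (fun z => (f z0 - l * z0) * z + (l / 2) * (z * z))%C (fun z => (f z0 - l * z0) + l * z)%C); try lra; [ring|..].
  - apply on_rect_frame; try lra. move=> u v _ _.
    replace (f z0 - l * z0 + l * (u, v))%C with ((f z0 - l * z0) * 1 + (l / 2) * (2 * (u, v)))%C; last first.
    { field. }
    apply cderiv_plus; apply cderiv_scal; [apply cderiv_id|apply cderiv_sqr].
  - apply on_rect_frame; try lra. move=> u v _ _. apply Haff. }
have Bg : on_rect (fun z => Cmod (g z) <= eps / (2 * (L * L + 1)) * (L / 2 ^ n)) (pa n) (pb n) (pc n) (pd n).
{ move=> u v Hu Hv.
  have D : Cmod ((u, v) - z0)%C <= L / 2 ^ n.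
  { eapply Rle_trans; [apply Cmod_le_1|]. simpl. have := Hx n. have := Hy n. rewrite -EL. move=> h1 h2.
    apply Rplus_le_compat; apply Rabs_le; lra. }
  have G := K (u, v) ltac:(eapply Rle_lt_trans; [apply D|done]).
  replace (g (u, v)) with (f (u, v) - f (x, y) - l * ((u, v) - (x, y)))%C by (unfold g, z0; ring).
  eapply Rle_trans; [apply G|]. apply Rmult_le_compat_l; [lra|done]. }
have Cg : on_rect (ccont g) (pa n) (pb n) (pc n) (pd n).
{ move=> u v Hu Hv. unfold g. have A := Hcn u v Hu Hv.
  have : ccont (fun z => f z + (-(f z0 - l * z0) + (- l) * z))%C (u, v).
  { apply ccont_plus => //. apply ccont_plus; [apply ccont_const|]. apply ccont_mult; [apply ccont_const|]. apply ccont_cdiff, cdiff_id. }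
  move=> B e E. destruct (B e E) as [dd [H1 H2]]. exists dd. split=> // w Hw. have := H2 w Hw.
  by replace (f w - (f z0 - l * z0) - l * w - (f (u, v) - (f z0 - l * z0) - l * (u, v)))%C with
   (f w + (- (f z0 - l * z0) + - l * w) - (f (u, v) + (- (f z0 - l * z0) + - l * (u, v))))%C by ring. }
have Iab : pa n <= pb n by lra. have Icd : pc n <= pd n by lra.
have B := RectI_bound g _ _ _ _ _ Iab Icd (on_rect_frame _ _ _ _ _ Iab Icd Cg) (on_rect_frame _ _ _ _ _ Iab Icd Bg).
have Bn := Big n. rewrite Eg in Bn.
eapply Rle_trans; [apply Bn|].
replace (2 * (pb n - pa n) + 2 * (pd n - pc n)) with (2 * (L / 2 ^ n)) in B by lra.
apply Rle_trans with (4 ^ n * (eps / (2 * (L * L + 1)) * (L / 2 ^ n) * (2 * (L / 2 ^ n)))).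
{ apply Rmult_le_compat_l; [apply pow_le; lra|done]. }
replace (4 ^ n) with (2 ^ n * 2 ^ n) by (rewrite -Rpow_mult_distr; f_equal; lra).
replace (2 ^ n * 2 ^ n * (eps / (2 * (L * L + 1)) * (L / 2 ^ n) * (2 * (L / 2 ^ n)))) with
  (eps * (L * L / (L * L + 1))) by (field; nra).
rewrite -{2}(Rmult_1_r eps). apply Rmult_le_compat_l; [lra|].
apply Rmult_le_reg_r with (L * L + 1); [nra|]. unfold Rdiv. rewrite Rmult_assoc Rinv_l; nra.
Qed.

(** * Cauchy's integral formula on squares *)

Definition SqI (f : C -> C) (p : C) (h : R) : C :=
  RectI f (fst p - h) (fst p + h) (snd p - h) (snd p + h).

Definition on_sq (P : C -> Prop) (p : C) (h : R) : Prop :=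
  forall z, Rabs (fst z - fst p) <= h -> Rabs (snd z - snd p) <= h -> P z.

Definition on_sqframe (P : C -> Prop) (p : C) (h : R) : Prop :=
  on_frame P (fst p - h) (fst p + h) (snd p - h) (snd p + h).

Definition twopii : C := (0, 2 * PI).

Lemma C_surj (z : C) : (fst z, snd z) = z. Proof. by destruct z. Qed.

Lemma sqframe_intro (P : C -> Prop) p h : 0 <= h ->
  (forall z, Rabs (fst z - fst p) <= h -> Rabs (snd z - snd p) <= h ->
     (Rabs (fst z - fst p) = h \/ Rabs (snd z - snd p) = h) -> P z) ->
  on_sqframe P p h.
Proof.
move=> Hh H. split=> t Ht; split; apply H; simpl;
 try (apply Rabs_le; lra); try (left; rewrite Rabs_left1; lra); try (left; rewrite Rabs_right; lra);
 try (right; rewrite Rabs_left1; lra); (right; rewrite Rabs_right; lra).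
Qed.

Lemma sq_sqframe (P : C -> Prop) p h : 0 <= h -> on_sq P p h -> on_sqframe P p h.
Proof. move=> Hh H. apply sqframe_intro => // z H1 H2 _. by apply H. Qed.

Lemma sqr_plus_pos (u k : R) : k <> 0 -> 0 < u * u + k * k.
Proof. move=> Hk. have := Rle_0_sqr u. have := Rsqr_pos_lt k Hk. unfold Rsqr. lra. Qed.

Lemma is_derive_half_log (x0 k : R) (x : R) : k <> 0 ->
  is_derive (fun x => / 2 * ln ((x - x0) * (x - x0) + k * k)) x ((x - x0) / ((x - x0) * (x - x0) + k * k)).
Proof. move=> Hk. have P := sqr_plus_pos (x - x0) k Hk. auto_derive; [exact P|field; lra]. Qed.

Lemma is_derive_atan_div (x0 k : R) (x : R) : k <> 0 ->
  is_derive (fun x => atan ((x - x0) / k)) x (k / ((x - x0) * (x - x0) + k * k)).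
Proof.
move=> Hk. have P := sqr_plus_pos (x - x0) k Hk.
have H : is_derive (fun x => (x - x0) / k) x (/ k) by auto_derive; [done|field; done].
have G := is_derive_comp atan _ x _ _ (proj2 (is_derive_Reals _ _ _) (derivable_pt_lim_atan _)) H.
eapply eq_ind; [exact G|]. rewrite /scal /= /mult /=. unfold Rsqr. field.
split; [lra|done].
Qed.

Lemma is_derive_shift (x0 t : R) : is_derive (fun x : R => x - x0) t 1.
Proof. auto_derive; [exact I|reflexivity]. Qed.

(** The primitive is the logarithm in the form ln |w| + i arg w; as the line at height [k] avoids
    the pole, [atan] gives the argument up to a constant along all of it. *)
Lemma CI_inv_line x0 k a b : k <> 0 -> a <= b ->
  CI (fun x => / (RtoC (x - x0) - Ci * RtoC k))%C a b =
  (/ 2 * ln ((b - x0) * (b - x0) + k * k) - / 2 * ln ((a - x0) * (a - x0) + k * k),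
   atan ((b - x0) / k) - atan ((a - x0) / k)).
Proof.
move=> Hk Hab.
set g := fun x => (/ 2 * ln ((x - x0) * (x - x0) + k * k), atan ((x - x0) / k)) : C.
have E : forall x, (/ (RtoC (x - x0) - Ci * RtoC k))%C =
  ((x - x0) / ((x - x0) * (x - x0) + k * k), k / ((x - x0) * (x - x0) + k * k)).
{ move=> x. have P := sqr_plus_pos (x - x0) k Hk.
  unfold Cinv, Cminus, Cplus, Copp, Cmult, Ci, RtoC. simpl. f_equal; field; nra. }
rewrite (CI_derive g) // => t Ht.
- rewrite E. split; simpl; [by apply is_derive_half_log|by apply is_derive_atan_div].
- apply (rcont_ccont Cinv (fun x => (RtoC (x - x0) - Ci * RtoC k)%C)).
  + apply: rderiv_rcont. apply: rderiv_minus.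
    * apply rderiv_RtoC, is_derive_shift.
    * apply (rderiv_const (Ci * RtoC k)).
  + apply: ccont_inv; [apply ccont_cdiff, cdiff_id|]. move=> E0. injection E0. lra.
Qed.

(** The half side equals the distance to the pole, so the logarithms at the two ends agree and the
    arguments are PI / 4 and - PI / 4. The sign [s] distinguishes two opposite sides. *)
Lemma CI_inv_side x0 h s : 0 < h -> s = 1 \/ s = -1 ->
  CI (fun x => / (RtoC (x - x0) - Ci * RtoC (s * h)))%C (x0 - h) (x0 + h) = (0, s * (PI / 2)).
Proof.
move=> Hh Hs. rewrite CI_inv_line; [|by case: Hs => ->; lra|lra].
replace ((x0 + h - x0) / (s * h)) with s by (case: Hs => ->; field; lra).
replace ((x0 - h - x0) / (s * h)) with (- s) by (case: Hs => ->; field; lra).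
rewrite atan_opp. replace (x0 + h - x0) with h by ring. replace (x0 - h - x0) with (- h) by ring.
replace (- h * - h) with (h * h) by ring. f_equal; [ring|].
case: Hs => ->. rewrite atan_1. lra. rewrite atan_opp atan_1. lra.
Qed.

(** Each side contributes i PI / 2; the vertical sides become horizontal ones when a factor [Ci] is
    taken out of the difference to [p]. *)
Lemma SqI_inv (p : C) h : 0 < h -> SqI (fun z => / (z - p))%C p h = twopii.
Proof.
move=> Hh. destruct p as [x0 y0]. unfold SqI, RectI. simpl.
have E1 : CI (fun x => / ((x, (y0 - h)%R) - (x0, y0)))%C (x0 - h) (x0 + h) = (0, 1 * (PI / 2)).
{ rewrite -(CI_inv_side x0 h 1); [|done|by left]. apply CI_ext; [lra|]. move=> t Ht. f_equal.
  unfold Cminus, Cplus, Copp, Cmult, Ci, RtoC. simpl. f_equal; ring. }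
have E2 : CI (fun x => / ((x, (y0 + h)%R) - (x0, y0)))%C (x0 - h) (x0 + h) = (0, -1 * (PI / 2)).
{ rewrite -(CI_inv_side x0 h (-1)); [|done|by right]. apply CI_ext; [lra|]. move=> t Ht. f_equal.
  unfold Cminus, Cplus, Copp, Cmult, Ci, RtoC. simpl. f_equal; ring. }
have V : forall s, s = 1 \/ s = -1 ->
  (Ci * CI (fun y => / (((x0 + s * h)%R, y) - (x0, y0))) (y0 - h) (y0 + h))%C = (0, s * (PI / 2)).
{ move=> s Hs. rewrite -(CI_inv_side y0 h s) //.
  have Nz : forall t, (((x0 + s * h)%R, t) - (x0, y0))%C <> 0%C.
  { move=> t E. injection E => _. case: Hs => ->; lra. }
  have Nz2 : forall t, (RtoC (t - y0) - Ci * RtoC (s * h))%C <> 0%C.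
  { move=> t E. injection E. case: Hs => ->; lra. }
  rewrite -CI_scal; last first.
  { apply exCI_cont; [lra|]. move=> t Ht.
    apply (rcont_ccont (fun z => / (z - (x0, y0)))%C (fun y => (x0 + s * h, y))).
    apply: rderiv_rcont. apply rderiv_vertical.
    apply: ccont_inv => //. apply ccont_cdiff, cdiff_minus; [apply cdiff_id|apply cdiff_const]. }
  apply CI_ext; [lra|]. move=> t Ht.
  have Nt := Nz t. have Nt2 := Nz2 t.
  have E : (((x0 + s * h)%R, t) - (x0, y0))%C = (Ci * (RtoC (t - y0) - Ci * RtoC (s * h)))%C.
  { unfold Cminus, Cplus, Copp, Cmult, Ci, RtoC. simpl. f_equal; ring. }
  rewrite E. have HCi : Ci <> 0%C by move=> E0; injection E0; lra. field. auto. }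
have V1 := V 1 (or_introl eq_refl). have V2 := V (-1) (or_intror eq_refl).
replace (x0 + 1 * h) with (x0 + h) in V1 by ring. replace (x0 + -1 * h) with (x0 - h) in V2 by ring.
rewrite E1 E2 V1 V2. unfold twopii, Cminus, Cplus, Copp. simpl. f_equal; lra.
Qed.

(* Cutting off the four strips around the small square, on which Goursat applies. *)
Lemma RectI_shrink f (z : C) a b c d e : 0 < e ->
  a <= fst z - e -> fst z + e <= b -> c <= snd z - e -> snd z + e <= d ->
  (forall w, a <= fst w <= b -> c <= snd w <= d -> w <> z -> cdiff f w) ->
  RectI f a b c d = SqI f z e.
Proof.
move=> He Ha Hb Hc Hd H.
have Hx : forall x y, a <= x <= b -> c <= y <= d -> (x <> fst z \/ y <> snd z) -> cdiff f (x, y).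
{ move=> x y h1 h2 h3. apply H => //. move=> E. subst z. simpl in h3. lra. }
have Hy : forall x y, a <= x <= b -> c <= y <= d -> (x <> fst z \/ y <> snd z) -> ccont f (x, y).
{ move=> x y h1 h2 h3. by apply ccont_cdiff, Hx. }
set x0 := fst z in Ha Hb Hx Hy *. set y0 := snd z in Hc Hd Hx Hy *.
rewrite (RectI_split_v f a (x0 - e)); [..|split=> t Ht; split; apply Hy]; try lra.
rewrite (RectI_split_v f (x0 - e) (x0 + e) b); [..|split=> t Ht; split; apply Hy]; try lra.
rewrite (RectI_split_h f (x0 - e) (x0 + e) c (y0 - e) d); [..|split=> t Ht; split; apply Hy]; try lra.
rewrite (RectI_split_h f (x0 - e) (x0 + e) (y0 - e) (y0 + e) d); [..|split=> t Ht; split; apply Hy]; try lra.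
rewrite (Goursat f a (x0 - e) c d); [..|move=> x y h1 h2; apply Hx]; try lra.
rewrite (Goursat f (x0 + e) b c d); [..|move=> x y h1 h2; apply Hx]; try lra.
rewrite (Goursat f (x0 - e) (x0 + e) c (y0 - e)); [..|move=> x y h1 h2; apply Hx]; try lra.
rewrite (Goursat f (x0 - e) (x0 + e) (y0 + e) d); [..|move=> x y h1 h2; apply Hx]; try lra.
unfold SqI. fold x0 y0. ring.
Qed.

(** The formula is separated from differentiability because it passes to uniform limits and already
    implies a power series expansion; [cdiff_unif_lim] rests on this. *)
Definition Cauchy_formula (f : C -> C) (p : C) (h : R) : Prop :=
  on_sqframe (ccont f) p h /\
  forall z, Rabs (fst z - fst p) < h -> Rabs (snd z - snd p) < h ->
    SqI (fun w => f w / (w - z))%C p h = (twopii * f z)%C.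

Lemma Rabs_lt_both (x y h : R) : Rabs (x - y) < h -> y - h < x < y + h.
Proof. move=> H. apply Rabs_def2 in H. lra. Qed.

Lemma Csub_neq_0 (z w : C) : z <> w -> (z - w)%C <> 0%C.
Proof. move=> H E. apply H. replace z with ((z - w) + w)%C by ring. rewrite E. ring. Qed.

(** Goursat's theorem replaces the square by one of half side [e] about [z], where the difference
    quotient is at most |l| + 1 while the perimeter 8 e tends to 0. *)
Lemma Cauchy_formula_cdiff f p h : 0 < h -> on_sq (cdiff f) p h -> Cauchy_formula f p h.
Proof.
move=> Hh Hf. split.
{ apply sq_sqframe; [lra|]. move=> z H1 H2. by apply ccont_cdiff, Hf. }
move=> z Hz1 Hz2.
have Z1 := Rabs_lt_both _ _ _ Hz1. have Z2 := Rabs_lt_both _ _ _ Hz2.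
have [l Hl] : cdiff f z by apply Hf; lra.
destruct (Hl 1 ltac:(lra)) as [d [Hd K]].
set m := Rmin (Rmin (fst z - (fst p - h)) (fst p + h - fst z)) (Rmin (Rmin (snd z - (snd p - h)) (snd p + h - snd z)) (d / 3)).
have Hm : 0 < m by unfold m; repeat apply Rmin_glb_lt; lra.
have Pl := Cmod_ge_0 l.
have Main : forall e, 0 < e <= m ->
  Cmod (SqI (fun w => f w / (w - z)) p h - twopii * f z)%C <= (Cmod l + 1) * (8 * e).
{ move=> e [He Hem].
  have M1 : e <= fst z - (fst p - h). { eapply Rle_trans; [apply Hem|]. unfold m. eapply Rle_trans; [apply Rmin_l|apply Rmin_l]. }
  have M2 : e <= fst p + h - fst z. { eapply Rle_trans; [apply Hem|]. unfold m. eapply Rle_trans; [apply Rmin_l|apply Rmin_r]. }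
  have M3 : e <= snd z - (snd p - h). { eapply Rle_trans; [apply Hem|]. unfold m. eapply Rle_trans; [apply Rmin_r|]. eapply Rle_trans; [apply Rmin_l|apply Rmin_l]. }
  have M4 : e <= snd p + h - snd z. { eapply Rle_trans; [apply Hem|]. unfold m. eapply Rle_trans; [apply Rmin_r|]. eapply Rle_trans; [apply Rmin_l|apply Rmin_r]. }
  have M5 : e <= d / 3. { eapply Rle_trans; [apply Hem|]. unfold m. eapply Rle_trans; [apply Rmin_r|apply Rmin_r]. }
  have Dw : forall w, w <> z -> cdiff (fun w => w - z)%C w /\ (w - z)%C <> 0%C.
  { move=> w Hw. split; [apply cdiff_minus; [apply cdiff_id|apply cdiff_const]|by apply Csub_neq_0]. }
  unfold SqI at 1. rewrite (RectI_shrink _ z _ _ _ _ e); try lra; last first.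
  { move=> w H1 H2 Hw. have [D1 D2] := Dw w Hw. apply cdiff_div => //. apply Hf; apply Rabs_le; lra. }
  rewrite -(SqI_inv z e He).
  have Hin : on_sqframe (fun w => w <> z /\ Cmod (w - z)%C < d /\ ccont f w) z e.
  { apply sqframe_intro; [lra|]. move=> w H1 H2 H3. repeat split.
    - move=> E. subst w. rewrite !Rminus_diag Rabs_R0 in H3. lra.
    - eapply Rle_lt_trans; [apply Cmod_le_1|].
      have -> : fst (w - z)%C = fst w - fst z by destruct w, z. have -> : snd (w - z)%C = snd w - snd z by destruct w, z. lra.
    - apply ccont_cdiff, Hf; apply Rabs_le_between in H1; apply Rabs_le_between in H2; apply Rabs_le; lra. }
  have C1 : on_sqframe (ccont (fun w => / (w - z))%C) z e.
  { apply: on_frame_impl Hin => w [Hw _]. have [D1 D2] := Dw w Hw. by apply ccont_cdiff, cdiff_inv. }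
  have C2 : on_sqframe (ccont (fun w => f w / (w - z))%C) z e.
  { apply: on_frame_impl Hin => w [Hw [_ D3]]. have [D1 D2] := Dw w Hw.
    apply ccont_mult => //. by apply ccont_cdiff, cdiff_inv. }
  have C3 : on_sqframe (ccont (fun w => f z * / (w - z))%C) z e.
  { apply: on_frame_impl C1 => w Hw. apply ccont_mult => //. apply ccont_const. }
  replace (SqI (fun w => f w / (w - z)) z e - SqI (fun z0 => / (z0 - z)) z e * f z)%C
   with (SqI (fun w => f w / (w - z) - f z * / (w - z))%C z e); last first.
  { unfold SqI. rewrite RectI_minus; try lra; try done. rewrite RectI_scal; try lra; try done. ring. }
  replace (8 * e) with (2 * (fst z + e - (fst z - e)) + 2 * (snd z + e - (snd z - e))) by ring.
  apply RectI_bound; try lra.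
  - apply: on_frame_impl (on_frame_and _ _ _ _ _ _ C2 C3) => w [h1 h2].
    have := ccont_plus _ _ _ h1 (ccont_mult _ _ _ (ccont_const (-(1))%C w) h2).
    move=> hc e1 He1. destruct (hc e1 He1) as [dd [h3 h4]]. exists dd. split=> // v Hv. have := h4 v Hv.
    match goal with |- Cmod ?A < _ -> Cmod ?B < _ => replace A with B by ring end. done.
  - apply: on_frame_impl Hin => w [Hw [Hd' _]]. have [D1 D2] := Dw w Hw.
    have P : 0 < Cmod (w - z)%C by apply Cmod_gt_0.
    replace (f w / (w - z) - f z * / (w - z))%C with ((f w - f z) / (w - z))%C by (unfold Cdiv; ring).
    rewrite Cmod_div //. apply Rmult_le_reg_r with (Cmod (w - z)%C) => //.
    unfold Rdiv. rewrite Rmult_assoc Rinv_l; [|lra]. rewrite Rmult_1_r.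
    replace (f w - f z)%C with ((f w - f z - l * (w - z)) + l * (w - z))%C by ring.
    eapply Rle_trans; [apply Cmod_triangle|]. rewrite Cmod_mult. have := K w Hd'. lra. }
have E : Cmod (SqI (fun w => f w / (w - z)) p h - twopii * f z)%C = 0.
{ apply Rle_antisym; [|apply Cmod_ge_0]. apply le_epsilon => eps He. rewrite Rplus_0_l.
  have P : 0 < eps / (8 * (Cmod l + 1)) by apply Rdiv_lt_0_compat; lra.
  eapply Rle_trans; [apply (Main (Rmin m (eps / (8 * (Cmod l + 1)))))|].
  - split; [by apply Rmin_glb_lt|apply Rmin_l].
  - apply Rle_trans with ((Cmod l + 1) * (8 * (eps / (8 * (Cmod l + 1))))).
    + apply Rmult_le_compat_l; [lra|]. apply Rmult_le_compat_l; [lra|apply Rmin_r].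
    + right. field. lra. }
apply Cmod_eq_0 in E.
match goal with |- ?A = ?B => replace A with ((A - B) + B)%C by ring; rewrite E; ring end.
Qed.

Lemma twopii_neq_0 : twopii <> 0%C.
Proof. move=> E. injection E. have := PI_RGT_0. lra. Qed.

Lemma Cmod_twopii : Cmod twopii = 2 * PI.
Proof.
have -> : twopii = (Ci * RtoC (2 * PI))%C by unfold twopii, Ci, Cmult, RtoC; simpl; f_equal; ring.
rewrite Cmod_mult Cmod_Ci Cmod_R Rabs_right; have := PI_RGT_0; lra.
Qed.

Lemma continuous_bounded (g : R -> R) a b : a <= b ->
  (forall t, a <= t <= b -> continuous g t) -> exists M, forall t, a <= t <= b -> g t <= M.
Proof.
move=> Hab H. have [m [Hm _]] := continuity_ab_maj g a b Hab (fun t Ht => proj2 (continuity_pt_filterlim _ _) (H t Ht)).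
by exists (g m).
Qed.

Lemma rcont_bounded (g : R -> C) a b : a <= b -> (forall t, a <= t <= b -> rcont g t) ->
  exists M, forall t, a <= t <= b -> Cmod (g t) <= M.
Proof.
move=> Hab H.
have [M1 H1] := continuous_bounded (fun t => Rabs (fst (g t))) a b Hab
  (fun t Ht => continuous_comp _ Rabs t (proj1 (H t Ht)) (continuous_Rabs _)).
have [M2 H2] := continuous_bounded (fun t => Rabs (snd (g t))) a b Hab
  (fun t Ht => continuous_comp _ Rabs t (proj2 (H t Ht)) (continuous_Rabs _)).
exists (M1 + M2) => t Ht. eapply Rle_trans; [apply Cmod_le_1|]. have := H1 t Ht. have := H2 t Ht. lra.
Qed.

Lemma frame_bounded f a b c d : a <= b -> c <= d -> on_frame (ccont f) a b c d ->
  exists M, 0 <= M /\ on_frame (fun z => Cmod (f z) <= M) a b c d.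
Proof.
move=> Hab Hcd [H1 H2].
have [M1 K1] := rcont_bounded (fun x => f (x, c)) a b Hab (fun t Ht => rcont_hor f _ _ (proj1 (H1 t Ht))).
have [M2 K2] := rcont_bounded (fun x => f (x, d)) a b Hab (fun t Ht => rcont_hor f _ _ (proj2 (H1 t Ht))).
have [M3 K3] := rcont_bounded (fun y => f (a, y)) c d Hcd (fun t Ht => rcont_ver f _ _ (proj1 (H2 t Ht))).
have [M4 K4] := rcont_bounded (fun y => f (b, y)) c d Hcd (fun t Ht => rcont_ver f _ _ (proj2 (H2 t Ht))).
exists (Rmax 0 (Rmax (Rmax M1 M2) (Rmax M3 M4))). split; [apply Rmax_l|].
have L0 := Rmax_r 0 (Rmax (Rmax M1 M2) (Rmax M3 M4)).
have L1 := Rmax_l (Rmax M1 M2) (Rmax M3 M4). have L2 := Rmax_r (Rmax M1 M2) (Rmax M3 M4).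
have L3 := Rmax_l M1 M2. have L4 := Rmax_r M1 M2. have L5 := Rmax_l M3 M4. have L6 := Rmax_r M3 M4.
split=> t Ht; split.
- have := K1 t Ht. lra.
- have := K2 t Ht. lra.
- have := K3 t Ht. lra.
- have := K4 t Ht. lra.
Qed.

(** * Geometric majorants and the Taylor expansion *)

Lemma rsum_geom s n : s <> 1 -> rsum (fun k => s ^ k) n = (1 - s ^ n) / (1 - s).
Proof. move=> Hs. elim: n => [|n IH] /=; [field; lra|]. rewrite IH. field. lra. Qed.

Lemma rsum_geom_le s n : 0 <= s < 1 -> rsum (fun k => s ^ k) n <= / (1 - s).
Proof.
move=> Hs. rewrite rsum_geom; [|lra]. have P : 0 <= s ^ n by apply pow_le; lra.
apply Rmult_le_reg_r with (1 - s); [lra|]. unfold Rdiv. rewrite Rmult_assoc Rinv_l; lra.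
Qed.

Lemma pow_lim0 s : 0 <= s < 1 -> is_lim_seq (fun n => s ^ n) 0.
Proof. move=> Hs. apply is_lim_seq_geom. rewrite Rabs_right; lra. Qed.

Lemma n_pow_bounded s n : 0 <= s < 1 -> INR n * s ^ n <= / (1 - s).
Proof.
move=> Hs. apply Rle_trans with (rsum (fun k => s ^ k) n); [|by apply rsum_geom_le].
rewrite -rsum_const. apply rsum_le => k Hk.
replace n with (k + (n - k))%nat by lia. rewrite pow_add.
have P : 0 <= s ^ k by apply pow_le; lra.
have Q : s ^ (n - k) <= 1 by rewrite -(pow1 (n - k)); apply pow_incr; lra. nra.
Qed.

Lemma n2_pow_summable s : 0 <= s < 1 -> exists B, 0 <= B /\ forall n, rsum (fun k => INR k ^ 2 * s ^ k) n <= B.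
Proof.
move=> Hs. set r := sqrt (sqrt s).
have P1 : 0 <= sqrt s by apply sqrt_pos. have P2 : 0 <= r by apply sqrt_pos.
have E1 : sqrt s * sqrt s = s by apply sqrt_sqrt; lra.
have E2 : r * r = sqrt s by apply sqrt_sqrt.
have L1 : sqrt s < 1 by nra. have L2 : r < 1 by nra.
have Q : 0 < / (1 - r) by apply Rinv_0_lt_compat; lra.
have Q2 : 0 < / (1 - sqrt s) by apply Rinv_0_lt_compat; lra.
exists ((/ (1 - r)) ^ 2 * / (1 - sqrt s)). split; [nra|]. move=> n.
apply Rle_trans with (rsum (fun k => (/ (1 - r)) ^ 2 * (sqrt s) ^ k) n).
- apply rsum_le => k _. have A := n_pow_bounded r k ltac:(lra).
  have B : 0 <= INR k * r ^ k by apply Rmult_le_pos; [apply pos_INR|apply pow_le].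
  have D : 0 <= sqrt s ^ k by apply pow_le.
  replace (INR k ^ 2 * s ^ k) with ((INR k * r ^ k) ^ 2 * sqrt s ^ k).
  + apply Rmult_le_compat_r => //. apply pow_incr. lra.
  + have -> : s ^ k = r ^ k * r ^ k * sqrt s ^ k by rewrite -!Rpow_mult_distr E2 E1.
    ring.
- rewrite rsum_scal. apply Rmult_le_compat_l; [nra|]. apply rsum_geom_le. lra.
Qed.

(* The coefficient bound [Cmod (c n) * h ^ n <= M] is kept because it is what all estimates use. *)
Definition PS_at (f : C -> C) (p : C) (h : R) (c : nat -> C) (M : R) : Prop :=
  (forall n, Cmod (c n) * h ^ n <= M) /\
  forall z, Cmod (z - p)%C < h -> clim (csum (fun n => c n * (z - p) ^ n)%C) (f z).

Lemma SqI_bound f p h M : 0 <= h -> on_sqframe (ccont f) p h -> on_sqframe (fun z => Cmod (f z) <= M) p h ->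
  Cmod (SqI f p h) <= M * (8 * h).
Proof.
move=> Hh H1 H2. replace (8 * h) with (2 * (fst p + h - (fst p - h)) + 2 * (snd p + h - (snd p - h))) by ring.
unfold SqI. apply RectI_bound; try lra; done.
Qed.

Lemma SqI_csum (f : nat -> C -> C) p h n : 0 <= h -> (forall k, on_sqframe (ccont (f k)) p h) ->
  SqI (fun z => csum (fun k => f k z) n) p h = csum (fun k => SqI (f k) p h) n /\
  on_sqframe (ccont (fun z => csum (fun k => f k z) n)) p h.
Proof.
move=> Hh Hf. elim: n => [|n [IH1 IH2]].
- split; [|apply on_frame_all => z; apply (ccont_const 0%C)]. simpl. unfold SqI.
  apply (RectI_primitive (fun _ => 0%C)); try lra; apply on_frame_all => z.
  apply (cderiv_const 0%C). apply (ccont_const 0%C).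
- split.
  + simpl. unfold SqI at 1. rewrite RectI_plus; try lra; [by rewrite -IH1|done|apply Hf].
  + apply: on_frame_impl (on_frame_and _ _ _ _ _ _ IH2 (Hf n)) => z [h1 h2]. by apply ccont_plus.
Qed.

Lemma Cpow_neq_0 (z : C) n : z <> 0%C -> (z ^ n)%C <> 0%C.
Proof. move=> H. apply Cmod_gt_0. rewrite Cmod_pow. apply pow_lt. by apply Cmod_gt_0. Qed.

(** Keeping the exact remainder lets the expanded Cauchy kernel be integrated as a finite sum. *)
Lemma geom_kernel (u w : C) N : u <> 0%C -> (u - w)%C <> 0%C ->
  (/ (u - w))%C = (csum (fun n => w ^ n * / u ^ S n) N + (w ^ N / u ^ N) / (u - w))%C.
Proof.
move=> Hu Hw. elim: N => [|N IH]; [simpl; field; auto|]. rewrite IH /=.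
have HN := Cpow_neq_0 u N Hu. field. auto.
Qed.

Lemma ccont_pow f n z : ccont f z -> ccont (fun w => f w ^ n)%C z.
Proof. move=> H. elim: n => [|n IH] /=; [apply ccont_const|by apply ccont_mult]. Qed.

Lemma ccont_sub_const p z : ccont (fun w => w - p)%C z.
Proof. apply ccont_cdiff, cdiff_minus; [apply cdiff_id|apply cdiff_const]. Qed.

Lemma fst_Cminus (a b : C) : fst (a - b)%C = fst a - fst b. Proof. by destruct a, b. Qed.
Lemma snd_Cminus (a b : C) : snd (a - b)%C = snd a - snd b. Proof. by destruct a, b. Qed.

Lemma clim_of_geom (u : nat -> C) l K s : 0 <= s < 1 -> 0 <= K ->
  (forall n, Cmod (u n - l)%C <= K * s ^ n) -> clim u l.
Proof.
move=> Hs HK H eps He.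
have /is_lim_seq_eps HL := pow_lim0 s Hs.
destruct (HL (eps / (K + 1))) as [N HN]; [apply Rdiv_lt_0_compat; lra|].
exists N => n Hn. have A := HN n Hn. rewrite Rminus_0_r Rabs_right in A; [|apply Rle_ge, pow_le; lra].
eapply Rle_lt_trans; [apply H|]. have P : 0 <= s ^ n by apply pow_le; lra.
apply Rle_lt_trans with ((K + 1) * s ^ n); [nra|].
replace eps with ((K + 1) * (eps / (K + 1))) by (field; lra). apply Rmult_lt_compat_l; lra.
Qed.

(** On the frame |w - p| >= h, which bounds the Cauchy coefficients by a multiple of h^(-n) and
    makes the remainder of the expanded kernel O((|z - p| / h)^N). *)
Lemma Cauchy_formula_PS f p h : 0 < h -> Cauchy_formula f p h -> exists c M, PS_at f p h c M.
Proof.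
move=> Hh [Hc HF].
have [M [HM0 HM]] : exists M, 0 <= M /\ on_sqframe (fun z => Cmod (f z) <= M) p h.
{ apply frame_bounded; try lra; done. }
set c := fun n => (SqI (fun w => f w * / (w - p) ^ S n) p h / twopii)%C.
have Hfr : on_sqframe (fun w => h <= Cmod (w - p)%C) p h.
{ apply sqframe_intro; [lra|]. move=> w _ _ [H|H].
  - rewrite -H -fst_Cminus. apply Rabs_fst_le.
  - rewrite -H -snd_Cminus. apply Rabs_snd_le. }
have Hk : forall n, on_sqframe (ccont (fun w => f w * / (w - p) ^ S n)%C) p h.
{ move=> n. apply: on_frame_impl (on_frame_and _ _ _ _ _ _ Hc Hfr) => w [h1 h2].
  apply ccont_mult => //. apply ccont_inv. apply ccont_pow, ccont_sub_const.
  apply Cpow_neq_0. apply Cmod_gt_0. lra. }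
have P2 := PI_RGT_0. have Htp := twopii_neq_0.
exists c, (M * 8 / (2 * PI)). split.
- move=> n. unfold c. rewrite Cmod_div // Cmod_twopii.
  have B : Cmod (SqI (fun w => f w * / (w - p) ^ S n)%C p h) <= M * / h ^ S n * (8 * h).
  { apply SqI_bound; [lra|apply Hk|].
    apply: on_frame_impl (on_frame_and _ _ _ _ _ _ HM Hfr) => w [h1 h2].
    have Hw : (w - p)%C <> 0%C by apply Cmod_gt_0; lra.
    rewrite Cmod_mult Cmod_inv; [|by apply Cpow_neq_0]. rewrite Cmod_pow.
    apply Rmult_le_compat => //; [apply Cmod_ge_0|apply Rlt_le, Rinv_0_lt_compat, pow_lt; lra|].
    apply Rinv_le_contravar; [by apply pow_lt|]. apply pow_incr. lra. }
  have Pn : 0 < h ^ n by apply pow_lt.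
  apply Rle_trans with (M * / h ^ S n * (8 * h) / (2 * PI) * h ^ n).
  + apply Rmult_le_compat_r; [lra|]. apply Rmult_le_compat_r; [apply Rlt_le, Rinv_0_lt_compat; lra|done].
  + right. simpl. field. lra.
- move=> z Hz. set w := (z - p)%C in Hz *.
  have Z1 : Rabs (fst z - fst p) < h by rewrite -fst_Cminus; eapply Rle_lt_trans; [apply Rabs_fst_le|apply Hz].
  have Z2 : Rabs (snd z - snd p) < h by rewrite -snd_Cminus; eapply Rle_lt_trans; [apply Rabs_snd_le|apply Hz].
  have E := HF z Z1 Z2.
  have Pw := Cmod_ge_0 w.
  apply (clim_of_geom _ _ (M / (h - Cmod w) * (8 * h) / (2 * PI)) (Cmod w / h)).
  + split. apply Rdiv_le_0_compat; lra. apply Rmult_lt_reg_r with h; [done|].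
    unfold Rdiv. rewrite Rmult_assoc Rinv_l; lra.
  + apply Rdiv_le_0_compat; [|lra]. apply Rmult_le_pos; [|lra]. apply Rdiv_le_0_compat; lra.
  + move=> N.
    set rem := fun v => (f v * ((w ^ N / (v - p) ^ N) / (v - z)))%C.
    have Hrem : on_sqframe (fun v => ccont rem v /\ Cmod (rem v) <= M / (h - Cmod w) * (Cmod w / h) ^ N /\
      (f v / (v - z) = csum (fun n => (w ^ n) * (f v * / (v - p) ^ S n)) N + rem v)%C) p h.
    { apply: on_frame_impl (on_frame_and _ _ _ _ _ _ (on_frame_and _ _ _ _ _ _ Hc HM) Hfr) => v [[h1 h2] h3].
      have Hvp : (v - p)%C <> 0%C by apply Cmod_gt_0; lra.
      have Evz : (v - z = (v - p) - w)%C by unfold w; ring.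
      have Tv : h - Cmod w <= Cmod (v - z)%C.
      { rewrite Evz. have := Cmod_triangle_rev (v - p)%C w. lra. }
      have Hvz : (v - z)%C <> 0%C by apply Cmod_gt_0; lra.
      have HvN := Cpow_neq_0 _ N Hvp.
      split; [|split].
      - unfold rem. apply ccont_mult => //. apply ccont_mult.
        + apply ccont_mult; [apply ccont_const|]. apply ccont_inv => //. apply ccont_pow, ccont_sub_const.
        + apply ccont_inv => //. apply ccont_sub_const.
      - unfold rem. rewrite Cmod_mult Cmod_div // Cmod_div // !Cmod_pow.
        replace (M / (h - Cmod w) * (Cmod w / h) ^ N) with (M * ((Cmod w / h) ^ N * / (h - Cmod w))) by (unfold Rdiv; ring).
        have Q1 : 0 <= Cmod w ^ N / Cmod (v - p)%C ^ N.
        { apply Rdiv_le_0_compat; [by apply pow_le|]. apply pow_lt; lra. }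
        apply Rmult_le_compat => //; [apply Cmod_ge_0| |].
        + apply Rmult_le_pos => //. apply Rlt_le, Rinv_0_lt_compat; lra.
        + apply Rmult_le_compat => //; [apply Rlt_le, Rinv_0_lt_compat; lra| |apply Rinv_le_contravar; lra].
          rewrite /Rdiv Rpow_mult_distr pow_inv. apply Rmult_le_compat_l; [by apply pow_le|].
          apply Rinv_le_contravar; [by apply pow_lt|]. apply pow_incr; lra.
      - unfold rem, Cdiv at 1. rewrite Evz (geom_kernel (v - p)%C w N) //; [|by rewrite -Evz].
        rewrite Cmult_plus_distr_l -csum_scal. f_equal. apply csum_ext => k _. ring. }
    have Hcs : forall k, on_sqframe (ccont (fun v => w ^ k * (f v * / (v - p) ^ S k))%C) p h.
    { move=> k. apply: on_frame_impl (Hk k) => v Hv. apply ccont_mult => //. apply ccont_const. }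
    have [S1 S2] := SqI_csum _ p h N ltac:(lra) Hcs.
    have Crem : on_sqframe (ccont rem) p h by apply: on_frame_impl Hrem => v; tauto.
    have E2 : (twopii * f z)%C = (csum (fun n => w ^ n * SqI (fun v => f v * / (v - p) ^ S n) p h) N + SqI rem p h)%C.
    { rewrite -E. unfold SqI at 1. rewrite (RectI_ext _ (fun v => csum (fun k => w ^ k * (f v * / (v - p) ^ S k)) N + rem v)%C); try lra.
      - rewrite RectI_plus; try lra; try done.
        change (RectI (fun z0 => csum (fun k => w ^ k * (f z0 * / (z0 - p) ^ S k)) N) (fst p - h) (fst p + h) (snd p - h) (snd p + h))%C
         with (SqI (fun z0 => csum (fun k => w ^ k * (f z0 * / (z0 - p) ^ S k)) N)%C p h).
        rewrite S1. f_equal. apply csum_ext => k _. unfold SqI. by rewrite RectI_scal; try lra; [|apply Hk].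
      - apply: on_frame_impl Hrem => v; tauto. }
    have E3 : (csum (fun n => c n * w ^ n) N - f z = - SqI rem p h / twopii)%C.
    { have -> : f z = (twopii * f z / twopii)%C by field.
      rewrite E2. have -> : csum (fun n => c n * w ^ n)%C N = (csum (fun n => w ^ n * SqI (fun v => f v * / (v - p) ^ S n) p h) N / twopii)%C.
      { unfold Cdiv. rewrite Cmult_comm -csum_scal. apply csum_ext => k _. unfold c. field. done. }
      field. done. }
    rewrite E3 Cmod_div // Cmod_opp Cmod_twopii.
    have B : Cmod (SqI rem p h) <= M / (h - Cmod w) * (Cmod w / h) ^ N * (8 * h).
    { apply SqI_bound; [lra|done|]. apply: on_frame_impl Hrem => v; tauto. }
    apply Rle_trans with (M / (h - Cmod w) * (Cmod w / h) ^ N * (8 * h) / (2 * PI)).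
    * apply Rmult_le_compat_r => //. apply Rlt_le, Rinv_0_lt_compat; lra.
    * right. field. lra.
Qed.

(** * Termwise differentiation of power series *)

(** The second order Taylor error of a power, by induction on n. The factor r^2 stands on the left
    to avoid the exponent n - 2 and a division by r. *)
Lemma Cpow_diff2 (x w : C) r n : 0 <= r -> Cmod x <= r -> Cmod w <= r ->
  Cmod (x ^ n - w ^ n - RtoC (INR n) * w ^ pred n * (x - w))%C * r ^ 2 <= INR n ^ 2 * r ^ n * Cmod (x - w)%C ^ 2.
Proof.
move=> Hr Hx Hw. elim: n => [|n IH].
- replace (x ^ 0 - w ^ 0 - RtoC (INR 0) * w ^ pred 0 * (x - w))%C with (RtoC 0) by (simpl; ring).
  rewrite Cmod_0. simpl. lra.
- have E : (x ^ S n - w ^ S n - RtoC (INR (S n)) * w ^ pred (S n) * (x - w))%C =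
    (x * (x ^ n - w ^ n - RtoC (INR n) * w ^ pred n * (x - w)) + RtoC (INR n) * w ^ pred n * (x - w) * (x - w))%C.
  { rewrite S_INR RtoC_plus. destruct n; simpl; ring. }
  rewrite E. set D := Cmod (x - w)%C. have PD := Cmod_ge_0 (x - w)%C. fold D in PD.
  set A := (x ^ n - w ^ n - RtoC (INR n) * w ^ pred n * (x - w))%C in IH *.
  have T := Cmod_triangle (x * A)%C (RtoC (INR n) * w ^ pred n * (x - w) * (x - w))%C.
  rewrite !Cmod_mult Cmod_R Rabs_right in T; [|apply Rle_ge, pos_INR]. fold D in T.
  have PA := Cmod_ge_0 A. have Pn := pos_INR n.
  have Q : INR n * Cmod (w ^ pred n)%C * r ^ 2 <= INR n * r ^ S n.
  { destruct n as [|n]; [simpl; lra|]. rewrite Rmult_assoc. apply Rmult_le_compat_l; [lra|].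
    rewrite Cmod_pow. simpl pred. replace (r ^ S (S n)) with (r ^ n * r ^ 2) by (simpl; ring).
    apply Rmult_le_compat_r; [apply pow2_ge_0|]. apply pow_incr. split; [apply Cmod_ge_0|lra]. }
  apply Rle_trans with ((r * Cmod A + INR n * Cmod (w ^ pred n)%C * D * D) * r ^ 2).
  { apply Rmult_le_compat_r; [apply pow2_ge_0|]. eapply Rle_trans; [apply T|].
    apply Rplus_le_compat_r. by apply Rmult_le_compat_r. }
  have Pr : 0 <= r ^ n by apply pow_le.
  apply Rle_trans with (r * (INR n ^ 2 * r ^ n * D ^ 2) + INR n * r ^ S n * (D * D)).
  { have h1 : r * (Cmod A * r ^ 2) <= r * (INR n ^ 2 * r ^ n * D ^ 2) by apply Rmult_le_compat_l.
    have h2 : INR n * Cmod (w ^ pred n)%C * r ^ 2 * (D * D) <= INR n * r ^ S n * (D * D) by apply Rmult_le_compat_r; nra.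
    nra. }
  rewrite S_INR. simpl. have P3 : 0 <= r * r ^ n * (D * D) by apply Rmult_le_pos; nra. nra.
Qed.

Definition PS_deriv (c : nat -> C) (w : C) : C := Clim (csum (fun n => RtoC (INR (S n)) * c (S n) * w ^ n)%C).

Lemma rsum_bounded_lim b B : (forall k, 0 <= b k) -> (forall n, rsum b n <= B) ->
  exists T : R, T <= B /\ is_lim_seq (rsum b) T /\ forall n, rsum b n <= T.
Proof.
move=> H0 HB. have [T [HT HL]] := rsum_lim_bounded b B H0 HB. exists T. repeat split=> //.
apply (is_lim_seq_le (rsum b) (fun _ => B) T B) => //. apply is_lim_seq_const.
Qed.

(** On a smaller radius the factor n + 1 is absorbed, because n s^n is bounded for s = h' / h <
    1. *)
Lemma PS_deriv_terms c M h h' : 0 < h' < h -> (forall n, Cmod (c n) * h ^ n <= M) ->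
  exists K, 0 <= K /\ (forall n, Cmod (RtoC (INR (S n)) * c (S n))%C * h' ^ n <= K).
Proof.
move=> Hh Hc. set s := h' / h.
have Hs : 0 <= s < 1.
{ split; [apply Rdiv_le_0_compat; lra|]. apply Rmult_lt_reg_r with h; [lra|]. unfold s, Rdiv. rewrite Rmult_assoc Rinv_l; lra. }
have HM : 0 <= M by have := Hc O; have := Cmod_ge_0 (c O); simpl; lra.
have Q : 0 < / (1 - s) by apply Rinv_0_lt_compat; lra.
have Q2 : 0 < / h' by apply Rinv_0_lt_compat; lra.
exists (M * / (1 - s) * / h'). split; [apply Rmult_le_pos; nra|]. move=> n.
rewrite Cmod_mult Cmod_R Rabs_right; [|apply Rle_ge, pos_INR].
have A := n_pow_bounded s (S n) Hs. have B := Hc (S n).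
have P1 : 0 < h ^ S n by apply pow_lt; lra.
have E : INR (S n) * Cmod (c (S n)) * h' ^ n = (Cmod (c (S n)) * h ^ S n) * (INR (S n) * s ^ S n) * / h'.
{ unfold s, Rdiv. rewrite Rpow_mult_distr pow_inv. simpl pow. field. have : 0 < h ^ n by apply pow_lt; lra. lra. }
rewrite E. apply Rmult_le_compat_r; [lra|]. apply Rmult_le_compat => //.
- apply Rmult_le_pos; [apply Cmod_ge_0|lra].
- apply Rmult_le_pos; [apply pos_INR|apply pow_le; lra].
Qed.

Lemma PS_conv c M h w : 0 < h -> (forall n, Cmod (c n) * h ^ n <= M) -> Cmod w < h ->
  clim (csum (fun n => c n * w ^ n)%C) (Clim (csum (fun n => c n * w ^ n)%C)).
Proof.
move=> Hh Hc Hw. have Pw := Cmod_ge_0 w.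
have HM : 0 <= M by have := Hc O; have := Cmod_ge_0 (c O); simpl; lra.
set s := Cmod w / h.
have Hs : 0 <= s < 1.
{ split; [apply Rdiv_le_0_compat; lra|]. apply Rmult_lt_reg_r with h; [lra|]. unfold s, Rdiv. rewrite Rmult_assoc Rinv_l; lra. }
have [T [_ [HT _]]] := rsum_bounded_lim (fun n => M * s ^ n) (M * / (1 - s)) ltac:(move=> k; apply Rmult_le_pos => //; apply pow_le; lra)
  ltac:(move=> n; rewrite rsum_scal; apply Rmult_le_compat_l => //; apply rsum_geom_le; lra).
apply (csum_majorant _ (fun n => M * s ^ n) T) => // n.
rewrite Cmod_mult Cmod_pow. have P : 0 < h ^ n by apply pow_lt.
replace (Cmod w ^ n) with (h ^ n * s ^ n).
- rewrite -Rmult_assoc. apply Rmult_le_compat_r => //. apply pow_le; lra.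
- rewrite -Rpow_mult_distr. f_equal. unfold s. field. lra.
Qed.

(** The second order errors of the powers add up to a quadratic error, since the sum of n^2 (r /
    h)^n converges for a radius [r] between |z - p| and h. *)
Lemma PS_cderiv f p h c M z : PS_at f p h c M -> Cmod (z - p)%C < h -> cderiv f z (PS_deriv c (z - p)%C).
Proof.
move=> [Hc Hf] Hz. set w := (z - p)%C in Hz *. have Pw := Cmod_ge_0 w.
have HM : 0 <= M by have := Hc O; have := Cmod_ge_0 (c O); simpl; lra.
set r := (Cmod w + h) / 2. have Hr : 0 < r < h by unfold r; lra.
have [K [HK Kb]] := PS_deriv_terms c M h r Hr Hc.
have CD : clim (csum (fun n => RtoC (INR (S n)) * c (S n) * w ^ n)%C) (PS_deriv c w).
{ apply (PS_conv (fun n => RtoC (INR (S n)) * c (S n))%C K r) => //; unfold r; lra. }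
set s := r / h.
have Hs : 0 <= s < 1.
{ split; [apply Rdiv_le_0_compat; lra|]. apply Rmult_lt_reg_r with h; [lra|]. unfold s, Rdiv. rewrite Rmult_assoc Rinv_l; lra. }
have [B [HB0 HB]] := n2_pow_summable s Hs.
have Key : forall x, Cmod (x - p)%C <= r -> Cmod (f x - f z - PS_deriv c w * (x - z))%C <= (M * B / r ^ 2) * Cmod (x - z)%C ^ 2.
{ move=> x Hx. set v := (x - p)%C in Hx.
  have Exz : (x - z = v - w)%C by unfold v, w; ring.
  have Lx : clim (csum (fun n => c n * v ^ n)%C) (f x) by apply Hf; unfold v in Hx; lra.
  have Lz : clim (csum (fun n => c n * w ^ n)%C) (f z) by apply Hf.
  (* The derived series gets a zero term at n = 0, so that it can be subtracted index by index from
     the series of [f]. *)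
  have Ld : clim (fun N => csum (fun n => RtoC (INR n) * c n * w ^ pred n)%C (N + 1)) (PS_deriv c w).
  { apply: clim_ext CD => N. rewrite Nat.add_comm csum_add /=. rewrite Cmult_0_l. ring_simplify. done. }
  apply clim_shift in Ld.
  have L := clim_minus _ _ _ _ (clim_minus _ _ _ _ Lx Lz) (clim_scal _ _ (x - z)%C Ld).
  rewrite (Cmult_comm (x - z)%C (PS_deriv c w)) in L.
  apply (clim_bound _ _ _ L). exists O => N _.
  rewrite -csum_scal -!csum_minus. eapply Rle_trans; [apply Cmod_csum_le|].
  have P2 : 0 < r ^ 2 by apply pow_lt; lra.
  apply Rle_trans with (rsum (fun n => M * Cmod (x - z)%C ^ 2 * / r ^ 2 * (INR n ^ 2 * s ^ n)) N); last first.
  { rewrite rsum_scal. replace (M * B / r ^ 2 * Cmod (x - z)%C ^ 2) with (M * Cmod (x - z)%C ^ 2 * / r ^ 2 * B) by (unfold Rdiv; ring).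
    apply Rmult_le_compat_l => //. apply Rmult_le_pos; [apply Rmult_le_pos => //; apply pow2_ge_0|apply Rlt_le, Rinv_0_lt_compat; lra]. }
  apply rsum_le => n _.
  replace (c n * v ^ n - c n * w ^ n - (x - z) * (RtoC (INR n) * c n * w ^ pred n))%C with
    (c n * (v ^ n - w ^ n - RtoC (INR n) * w ^ pred n * (v - w)))%C by (rewrite Exz; ring).
  rewrite Cmod_mult Exz.
  have D := Cpow_diff2 v w r n ltac:(lra) Hx ltac:(unfold r; lra).
  have Pc := Cmod_ge_0 (c n).
  apply Rmult_le_reg_r with (r ^ 2) => //.
  apply Rle_trans with (Cmod (c n) * (INR n ^ 2 * r ^ n * Cmod (v - w)%C ^ 2)).
  { rewrite Rmult_assoc. by apply Rmult_le_compat_l. }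
  replace (r ^ n) with (h ^ n * s ^ n); last first.
  { rewrite -Rpow_mult_distr. f_equal. unfold s. field. lra. }
  replace (M * Cmod (v - w)%C ^ 2 * / r ^ 2 * (INR n ^ 2 * s ^ n) * r ^ 2) with
    (M * (INR n ^ 2 * s ^ n * Cmod (v - w)%C ^ 2)) by (field; lra).
  replace (Cmod (c n) * (INR n ^ 2 * (h ^ n * s ^ n) * Cmod (v - w)%C ^ 2)) with
   (Cmod (c n) * h ^ n * (INR n ^ 2 * s ^ n * Cmod (v - w)%C ^ 2)) by ring.
  apply Rmult_le_compat_r => //. apply Rmult_le_pos; [|apply pow2_ge_0].
  apply Rmult_le_pos; [apply pow2_ge_0|apply pow_le; lra]. }
move=> eps He. set A := M * B / r ^ 2 in Key.
have PA : 0 <= A by unfold A; apply Rdiv_le_0_compat; [nra|apply pow_lt; lra].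
exists (Rmin (r - Cmod w) (eps / (A + 1))). split.
{ apply Rmin_glb_lt; [unfold r; lra|apply Rdiv_lt_0_compat; lra]. }
move=> x Hx. have H1 := Rlt_le_trans _ _ _ Hx (Rmin_l _ _). have H2 := Rlt_le_trans _ _ _ Hx (Rmin_r _ _).
eapply Rle_trans; [apply Key|].
- replace (x - p)%C with ((x - z) + w)%C by (unfold w; ring). eapply Rle_trans; [apply Cmod_triangle|]. lra.
- have Px := Cmod_ge_0 (x - z)%C. simpl. rewrite Rmult_1_r -Rmult_assoc. apply Rmult_le_compat_r => //.
  apply Rle_trans with ((A + 1) * (eps / (A + 1))); [|right; field; lra].
  apply Rle_trans with ((A + 1) * Cmod (x - z)%C); [nra|]. apply Rmult_le_compat_l; lra.
Qed.

Lemma cderiv_unique f z a b : cderiv f z a -> cderiv f z b -> a = b.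
Proof. move=> /cderiv_is_derive Ha /cderiv_is_derive Hb. by rewrite -(is_C_derive_unique _ _ _ Ha) (is_C_derive_unique _ _ _ Hb). Qed.

Lemma PS_cdiff f p h c M z : PS_at f p h c M -> Cmod (z - p)%C < h -> cdiff f z.
Proof. move=> H Hz. eexists. apply: PS_cderiv H Hz. Qed.

Lemma PS_deriv_PS c M h h' p : 0 < h' < h -> (forall n, Cmod (c n) * h ^ n <= M) ->
  exists K, PS_at (fun z => PS_deriv c (z - p)%C) p h' (fun n => RtoC (INR (S n)) * c (S n))%C K.
Proof.
move=> Hh Hc. have [K [HK0 HK]] := PS_deriv_terms c M h h' Hh Hc.
exists K. split=> // z Hz. apply: PS_conv HK Hz. lra.
Qed.

Lemma sq_in_disc (p z : C) h r : 2 * h <= r -> Rabs (fst z - fst p) <= h -> Rabs (snd z - snd p) <= h -> Cmod (z - p)%C <= r.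
Proof. move=> Hr H1 H2. eapply Rle_trans; [apply Cmod_le_1|]. rewrite fst_Cminus snd_Cminus. lra. Qed.

Lemma taylor_sq f p h : 0 < h -> on_sq (cdiff f) p h -> exists c M, PS_at f p h c M.
Proof. move=> Hh H. apply Cauchy_formula_PS => //. by apply Cauchy_formula_cdiff. Qed.

(** A square of half side r / 3 stays within distance 2 r / 3 of its centre, hence inside the
    disc. *)
Lemma taylor f p r : 0 < r -> (forall z, Cmod (z - p)%C < r -> cdiff f z) -> exists c M, PS_at f p (r / 3) c M.
Proof.
move=> Hr H. apply taylor_sq; [lra|]. move=> z H1 H2. apply H.
have := sq_in_disc p z (r / 3) (2 * r / 3) ltac:(lra) H1 H2. lra.
Qed.

(** The derivative is again the sum of a power series. This makes f' / f differentiable in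
    [log_PS]. *)
Lemma cderiv_cdiff f f' p r : 0 < r -> (forall z, Cmod (z - p)%C < r -> cderiv f z (f' z)) -> cdiff f' p.
Proof.
move=> Hr H. have [c [M HP]] := taylor f p r Hr (fun z Hz => ex_intro _ _ (H z Hz)).
have [K HK] := PS_deriv_PS c M (r / 3) (r / 6) p ltac:(lra) (proj1 HP).
apply (cdiff_ext_loc (fun z => PS_deriv c (z - p)%C)).
- exists (r / 3). split; [lra|]. move=> w Hw. apply (cderiv_unique f w).
  + apply: PS_cderiv HP Hw. + apply H. lra.
- apply: PS_cdiff HK _. replace (p - p)%C with (RtoC 0) by ring. rewrite Cmod_0. lra.
Qed.

(** * Locally uniform limits of holomorphic functions *)

Lemma ccont_unif_lim (fk : nat -> C -> C) f p r : 0 < r ->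
  (forall k, ccont (fk k) p) ->
  (forall eps, 0 < eps -> exists k, forall z, Cmod (z - p)%C < r -> Cmod (fk k z - f z)%C <= eps) ->
  ccont f p.
Proof.
move=> Hr Hk Hu eps He. destruct (Hu (eps / 4) ltac:(lra)) as [k Kk].
destruct (Hk k (eps / 4) ltac:(lra)) as [d [Hd Kd]].
exists (Rmin r d). split; [by apply Rmin_glb_lt|]. move=> w Hw.
have A := Kk w (Rlt_le_trans _ _ _ Hw (Rmin_l _ _)). have B := Kd w (Rlt_le_trans _ _ _ Hw (Rmin_r _ _)).
have D := Kk p. replace (p - p)%C with (RtoC 0) in D by ring. rewrite Cmod_0 in D. have {}D := D Hr.
have T1 := Cmod_triangle3 (f w) (fk k w) (f p). have T2 := Cmod_triangle3 (fk k w) (fk k p) (f p).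
rewrite (Cmod_sub_sym (f w) (fk k w)) in T1. lra.
Qed.

(** Weierstrass's theorem. Cauchy's formula survives the uniform limit, because the kernel is
    bounded by 1 / e on the frame, and the power series expansion follows from it. *)
Lemma cdiff_unif_lim (fk : nat -> C -> C) f p r : 0 < r ->
  (forall k z, Cmod (z - p)%C < r -> cdiff (fk k) z) ->
  (forall eps, 0 < eps -> exists K, forall k, (K <= k)%nat -> forall z, Cmod (z - p)%C < r -> Cmod (fk k z - f z)%C <= eps) ->
  cdiff f p.
Proof.
move=> Hr Hk Hu. set h := r / 3. have Hh : 0 < h by unfold h; lra.
have In : forall z, Rabs (fst z - fst p) <= h -> Rabs (snd z - snd p) <= h -> Cmod (z - p)%C < r.
{ move=> z H1 H2. have := sq_in_disc p z h (2 * r / 3) ltac:(unfold h; lra) H1 H2. lra. }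
have Cf : forall z, Cmod (z - p)%C < r -> ccont f z.
{ move=> z Hz. apply (ccont_unif_lim fk f z (r - Cmod (z - p)%C)); [lra|by move=> k; apply ccont_cdiff, Hk|].
  move=> eps He. destruct (Hu eps He) as [K HK]. exists K => w Hw. apply HK => //.
  have := Cmod_triangle3 w z p. lra. }
have CFf : Cauchy_formula f p h.
{ split. { apply sq_sqframe; [lra|]. move=> z H1 H2. by apply Cf, In. }
  move=> z Hz1 Hz2. have P2 := PI_RGT_0.
  have Zr : Cmod (z - p)%C < r by apply In; lra.
  set e := Rmin (h - Rabs (fst z - fst p)) (h - Rabs (snd z - snd p)).
  have He : 0 < e by apply Rmin_glb_lt; lra.
  have Hfar : on_sqframe (fun w => e <= Cmod (w - z)%C /\ Cmod (w - p)%C < r) p h.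
  { apply sqframe_intro; [lra|]. move=> w H1 H2 H3. split; [|by apply In]. case: H3 => H3.
    - eapply Rle_trans; [apply Rmin_l|]. eapply Rle_trans; [|apply Rabs_fst_le]. rewrite fst_Cminus -H3.
      have := Rabs_triang_inv (fst w - fst p) (fst z - fst p). replace (fst w - fst p - (fst z - fst p)) with (fst w - fst z) by ring. lra.
    - eapply Rle_trans; [apply Rmin_r|]. eapply Rle_trans; [|apply Rabs_snd_le]. rewrite snd_Cminus -H3.
      have := Rabs_triang_inv (snd w - snd p) (snd z - snd p). replace (snd w - snd p - (snd z - snd p)) with (snd w - snd z) by ring. lra. }
  have Cg : forall g, (forall w, Cmod (w - p)%C < r -> ccont g w) -> on_sqframe (ccont (fun w => g w / (w - z))%C) p h.
  { move=> g Hg. apply: on_frame_impl Hfar => w [h1 h2]. apply ccont_mult; [by apply Hg|].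
    apply ccont_inv; [apply ccont_sub_const|]. apply Cmod_gt_0. lra. }
  have E0 : Cmod (SqI (fun w => f w / (w - z)) p h - twopii * f z)%C = 0.
  { apply Rle_antisym; [|apply Cmod_ge_0]. apply le_epsilon => eps Heps. rewrite Rplus_0_l.
    set q := 8 * h / e + 2 * PI. have Pq : 0 < 8 * h / e by apply Rdiv_lt_0_compat; lra.
    have Hq : 0 < q by unfold q; lra.
    destruct (Hu (eps / q)) as [K HK]; [by apply Rdiv_lt_0_compat|].
    have KK := HK K (Nat.le_refl _).
    have [_ FK] := Cauchy_formula_cdiff (fk K) p h Hh (fun w h1 h2 => Hk K w (In w h1 h2)).
    have EK := FK z Hz1 Hz2.
    have C1 := Cg f Cf. have C2 := Cg (fk K) (fun w Hw => ccont_cdiff _ _ (Hk K w Hw)).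
    have C3 : on_sqframe (ccont (fun w => f w / (w - z) + (-(1)) * (fk K w / (w - z)))%C) p h.
    { apply: on_frame_impl (on_frame_and _ _ _ _ _ _ C1 C2) => w [h1 h2]. apply ccont_plus => //. apply ccont_mult => //. apply ccont_const. }
    have ES : SqI (fun w => f w / (w - z) + (-(1)) * (fk K w / (w - z)))%C p h = (SqI (fun w => f w / (w - z)) p h - twopii * fk K z)%C.
    { rewrite -EK. unfold SqI. rewrite RectI_plus; try lra; try done. rewrite RectI_scal; try lra; try done. ring.
      apply: on_frame_impl C2 => w h2. apply ccont_mult => //. apply ccont_const. }
    replace (SqI (fun w => f w / (w - z)) p h - twopii * f z)%C with
      (SqI (fun w => f w / (w - z) + (-(1)) * (fk K w / (w - z)))%C p h + twopii * (fk K z - f z))%C by (rewrite ES; ring).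
    eapply Rle_trans; [apply Cmod_triangle|]. rewrite Cmod_mult Cmod_twopii.
    have B : Cmod (SqI (fun w => f w / (w - z) + (-(1)) * (fk K w / (w - z)))%C p h) <= (eps / q / e) * (8 * h).
    { apply SqI_bound; [lra|done|]. apply: on_frame_impl Hfar => w [h1 h2].
      have Hwz : (w - z)%C <> 0%C by apply Cmod_gt_0; lra.
      replace (f w / (w - z) + (-(1)) * (fk K w / (w - z)))%C with (- (fk K w - f w) / (w - z))%C by (unfold Cdiv; ring).
      rewrite Cmod_div // Cmod_opp. apply Rmult_le_compat; [apply Cmod_ge_0|apply Rlt_le, Rinv_0_lt_compat; lra|by apply KK|].
      apply Rinv_le_contravar; lra. }
    have B2 := KK z Zr.
    apply Rle_trans with (eps / q / e * (8 * h) + 2 * PI * (eps / q)).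
    - apply Rplus_le_compat => //. apply Rmult_le_compat_l; lra.
    - right. transitivity (eps / q * (8 * h / e + 2 * PI)); [field; lra|fold q; unfold Rdiv; rewrite Rmult_assoc Rinv_l; lra]. }
  apply Cmod_eq_0 in E0.
  match goal with |- ?A = ?B => replace A with ((A - B) + B)%C by ring; rewrite E0; ring end. }
have [c [M HP]] := Cauchy_formula_PS f p h Hh CFf.
apply: PS_cdiff HP _. replace (p - p)%C with (RtoC 0) by ring. rewrite Cmod_0. lra.
Qed.

Lemma cdiff_csum (a : nat -> C -> C) n z : (forall k, cdiff (a k) z) -> cdiff (fun z => csum (fun k => a k z) n) z.
Proof. move=> H. elim: n => [|n IH] /=; [apply (cdiff_const 0%C)|by apply cdiff_plus]. Qed.

Lemma cdiff_series (a : nat -> C -> C) (b : nat -> R) B p r : 0 < r ->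
  (forall k z, Cmod (z - p)%C < r -> cdiff (a k) z) ->
  (forall k z, Cmod (z - p)%C < r -> Cmod (a k z) <= b k) ->
  (forall n, rsum b n <= B) ->
  cdiff (fun z => Clim (csum (fun k => a k z))) p.
Proof.
move=> Hr Ha Hb HB.
have Hp : Cmod (p - p)%C < r by replace (p - p)%C with (RtoC 0) by ring; rewrite Cmod_0.
have H0 : forall k, 0 <= b k by move=> k; have := Hb k p Hp; have := Cmod_ge_0 (a k p); lra.
have [T [_ [HT HL]]] := rsum_bounded_lim b B H0 HB.
apply (cdiff_unif_lim (fun n z => csum (fun k => a k z) n) _ p r) => //.
- move=> n z Hz. apply cdiff_csum => k. by apply Ha.
- move=> eps He. move/is_lim_seq_eps: (HT) => /(_ eps He) [N HN]. exists N => n Hn z Hz.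
  have [_ K] := csum_majorant (fun k => a k z) b T (fun k => Hb k z Hz) HT.
  rewrite Cmod_sub_sym. eapply Rle_trans; [apply K|]. have := HN n Hn. have := HL n. move=> h1 h2.
  rewrite Rabs_left1 in h2; lra.
Qed.

(** * Isolated zeros and the identity theorem *)

(** If the coefficients below m vanish, then at a zero p + w the coefficient c_m is minus the rest
    of the series divided by w^m, which is O(|w|); zeros arbitrarily close to [p] force it to be
    0. *)
Lemma PS_zero_coef f p h c M : 0 < h -> PS_at f p h c M ->
  (forall d, 0 < d -> exists z, z <> p /\ Cmod (z - p)%C < d /\ f z = 0%C) -> forall n, c n = 0%C.
Proof.
move=> Hh [Hc Hf] Hz.
have HM : 0 <= M by have := Hc O; have := Cmod_ge_0 (c O); simpl; lra.
apply: (well_founded_induction Wf_nat.lt_wf) => m IH.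
apply Cmod_eq_0. apply Rle_antisym; [|apply Cmod_ge_0]. apply le_epsilon => eps He. rewrite Rplus_0_l.
have Pm : 0 < h ^ S m by apply pow_lt.
set A := 2 * M / h ^ S m. have PA : 0 <= A by apply Rdiv_le_0_compat; lra.
(* The bound h / 2 makes the rest of the series geometric with ratio 1 / 2, the other one makes A
   |w| at most eps. *)
destruct (Hz (Rmin (h / 2) (eps / (A + 1)))) as [z [Hzp [Hzd Hz0]]].
{ apply Rmin_glb_lt; [lra|apply Rdiv_lt_0_compat; lra]. }
have H1 := Rlt_le_trans _ _ _ Hzd (Rmin_l _ _). have H2 := Rlt_le_trans _ _ _ Hzd (Rmin_r _ _).
set w := (z - p)%C in H1 H2 Hzd. have Hw : w <> 0%C by apply Csub_neq_0.
have Pw : 0 < Cmod w by apply Cmod_gt_0.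
have L := Hf z ltac:(fold w; lra). rewrite Hz0 in L. fold w in L.
apply Rle_trans with (A * Cmod w); last first.
{ apply Rle_trans with ((A + 1) * (eps / (A + 1))); [|right; field; lra].
  apply Rle_trans with ((A + 1) * Cmod w); [nra|]. apply Rmult_le_compat_l; lra. }
have Hwm := Cpow_neq_0 w m Hw. have Pwm : 0 < Cmod w ^ m by apply pow_lt.
have L2 : clim (fun N => c m - csum (fun n => c n * w ^ n) (S m + N) / w ^ m)%C (c m - 0)%C.
{ apply clim_minus; [apply clim_const|]. replace (RtoC 0) with (/ w ^ m * 0)%C by ring.
  have := clim_scal _ _ (/ w ^ m)%C (proj2 (clim_shift _ _ (S m)) L). apply clim_ext => n. rewrite (Nat.add_comm (S m)). unfold Cdiv. ring. }
replace (c m) with (c m - 0)%C by ring. apply (clim_bound _ _ _ L2). exists O => N _.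
rewrite csum_add /=. rewrite (csum_ext _ (fun _ => 0%C) m); [|move=> k Hk; rewrite IH //; ring].
rewrite csum_const. replace (c m - _)%C with (- csum (fun k => c (S (m + k)) * (w * w ^ (m + k))) N / w ^ m)%C by (field; done).
rewrite Cmod_div // Cmod_opp Cmod_pow.
apply Rmult_le_reg_r with (Cmod w ^ m) => //. unfold Rdiv. rewrite Rmult_assoc Rinv_l; [|lra]. rewrite Rmult_1_r.
eapply Rle_trans; [apply Cmod_csum_le|].
apply Rle_trans with (rsum (fun k => M / h ^ S m * Cmod w ^ S m * (1 / 2) ^ k) N).
- apply rsum_le => k _. rewrite Cmod_mult Cmod_mult Cmod_pow.
  have Hk := Hc (S (m + k)). have Pk : 0 < h ^ S (m + k) by apply pow_lt.
  have Q : Cmod w ^ k <= (h / 2) ^ k by apply pow_incr; lra.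
  have E1 : h ^ S (m + k) = h ^ S m * h ^ k by rewrite -pow_add.
  have E2 : Cmod w * Cmod w ^ (m + k) = Cmod w ^ S m * Cmod w ^ k by rewrite -pow_add.
  rewrite E2. have Pk2 : 0 < h ^ k by apply pow_lt.
  have E3 : (h / 2) ^ k = h ^ k * (1 / 2) ^ k by rewrite -Rpow_mult_distr; f_equal; field.
  rewrite E3 in Q. have P4 : 0 < Cmod w ^ S m by apply pow_lt. have Pc := Cmod_ge_0 (c (S (m + k))).
  have P5 : 0 < (1 / 2) ^ k by apply pow_lt; lra.
  apply Rle_trans with (Cmod (c (S (m + k))) * (Cmod w ^ S m * (h ^ k * (1 / 2) ^ k))).
  { apply Rmult_le_compat_l => //. apply Rmult_le_compat_l; lra. }
  apply Rmult_le_reg_r with (h ^ S m) => //.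
  replace (M / h ^ S m * Cmod w ^ S m * (1 / 2) ^ k * h ^ S m) with (M * (Cmod w ^ S m * (1 / 2) ^ k)) by (field; lra).
  replace (Cmod (c (S (m + k))) * (Cmod w ^ S m * (h ^ k * (1 / 2) ^ k)) * h ^ S m) with
    (Cmod (c (S (m + k))) * h ^ S (m + k) * (Cmod w ^ S m * (1 / 2) ^ k)) by (rewrite E1; ring).
  apply Rmult_le_compat_r => //. nra.
- rewrite rsum_scal. unfold A.
  apply Rle_trans with (M / h ^ S m * Cmod w ^ S m * 2).
  + apply Rmult_le_compat_l. apply Rmult_le_pos; [apply Rdiv_le_0_compat; lra|apply pow_le; lra].
    have := rsum_geom_le (1 / 2) N ltac:(lra). replace (/ (1 - 1 / 2)) with 2 by field. done.
  + right. simpl. field. split; [apply pow_nonzero; lra|lra].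
Qed.

Lemma PS_at_center (c : nat -> C) (p : C) h (w : C) : 0 < h -> Cmod (w - p)%C < h -> (forall n, c n = 0%C) -> forall f M, PS_at f p h c M -> f w = 0%C.
Proof.
move=> Hh Hw Hc f M [_ Hf]. have L := Hf w Hw. apply: clim_unique L _.
apply (clim_ext (fun _ => 0%C)); [|apply clim_const].
move=> n. rewrite (csum_ext _ (fun _ => 0%C)); [|move=> k _; rewrite Hc; ring]. rewrite csum_const. ring.
Qed.

Lemma isolated_zeros f p r : 0 < r -> (forall z, Cmod (z - p)%C < r -> cdiff f z) ->
  (forall d, 0 < d -> exists z, z <> p /\ Cmod (z - p)%C < d /\ f z = 0%C) ->
  forall z, Cmod (z - p)%C < r / 3 -> f z = 0%C.
Proof.
move=> Hr Hf Hz z Hzd. have [c [M HP]] := taylor f p r Hr Hf.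
refine (PS_at_center c p (r / 3) z _ Hzd _ f M HP); [lra|].
apply: (PS_zero_coef _ _ _ _ _ _ HP) => //. lra.
Qed.

Definition convex (U : C -> Prop) : Prop :=
  forall z w t, U z -> U w -> 0 <= t <= 1 -> U (z + RtoC t * (w - z))%C.

Definition copen (U : C -> Prop) : Prop :=
  forall z, U z -> exists r, 0 < r /\ forall w, Cmod (w - z)%C < r -> U w.

(** [T] is the supremum of the parameters up to which [f] vanishes on the segment from [p] to [q].
    Zeros accumulate at [g T], so [f] vanishes on a disc there, which contradicts the choice of [T]
    unless T = 1. *)
Lemma identity_theorem (U : C -> Prop) f p : convex U -> copen U -> (forall z, U z -> cdiff f z) ->
  U p -> (exists r, 0 < r /\ forall z, Cmod (z - p)%C < r -> f z = 0%C) -> forall q, U q -> f q = 0%C.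
Proof.
move=> HU Ho Hf Hp [r0 [Hr0 Hz0]] q Hq.
destruct (Req_dec (Cmod (q - p)%C) 0) as [E|E]; [apply Hz0; lra|].
have PL := Cmod_ge_0 (q - p)%C. set L := Cmod (q - p)%C in E PL.
set g := fun t => (p + RtoC t * (q - p))%C.
have Dg : forall s t, (g s - g t = RtoC (s - t) * (q - p))%C by move=> s t; unfold g; rewrite RtoC_minus; ring.
have Ng : forall s t, Cmod (g s - g t)%C = Rabs (s - t) * L by move=> s t; rewrite Dg Cmod_mult Cmod_R.
set Es := fun t => 0 <= t <= 1 /\ forall s, 0 <= s <= t -> f (g s) = 0%C.
have E0 : Es 0.
{ split; [lra|]. move=> s Hs. replace s with 0 by lra. apply Hz0. replace (g 0 - p)%C with (RtoC 0) by (unfold g; ring). by rewrite Cmod_0. }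
destruct (completeness Es) as [T [Tub Tl]].
{ exists 1. move=> t [Ht _]. lra. } { by exists 0. }
have HT : 0 <= T <= 1. { split; [by apply Tub|]. apply Tl. move=> t [Ht _]. lra. }
have Below : forall s, 0 <= s < T -> f (g s) = 0%C.
{ move=> s Hs. destruct (Classical_Prop.classic (exists t, Es t /\ s < t)) as [[t [[_ Ht] Hst]]|N].
  - apply Ht. lra.
  - exfalso. have : T <= s; [|lra]. apply Tl => t Ht. destruct (Rle_dec t s) => //. exfalso. apply N. exists t. split=> //. lra. }
have Tpos : 0 < T.
{ set t0 := Rmin 1 (r0 / (2 * L)). have P0 : 0 < r0 / (2 * L) by apply Rdiv_lt_0_compat; lra.
  have P1 : 0 < t0 by apply Rmin_glb_lt; lra.
  apply Rlt_le_trans with t0 => //. apply Tub. split; [split; [lra|apply Rmin_l]|].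
  move=> s Hs. apply Hz0. replace p with (g 0) at 1 by (unfold g; ring). rewrite Ng.
  rewrite Rminus_0_r Rabs_right; [|lra].
  apply Rle_lt_trans with (r0 / (2 * L) * L); [|replace (r0 / (2 * L) * L) with (r0 / 2) by (field; lra); lra].
  apply Rmult_le_compat_r; [lra|]. have := Rmin_r 1 (r0 / (2 * L)). fold t0. lra. }
have UT : U (g T) by apply HU.
have [r [Hr HrU]] := Ho _ UT.
have Disc : forall z, Cmod (z - g T)%C < r / 3 -> f z = 0%C.
{ apply isolated_zeros => //. { move=> z Hz. by apply Hf, HrU. }
  move=> d Hd. set s := Rmax 0 (T - d / (2 * L)).
  have P0 : 0 < d / (2 * L) by apply Rdiv_lt_0_compat; lra.
  have Hs : 0 <= s < T by split; [apply Rmax_l|apply Rmax_lub_lt; lra].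
  have Hs2 : T - s <= d / (2 * L) by have := Rmax_r 0 (T - d / (2 * L)); fold s; lra.
  exists (g s). have N : Cmod (g s - g T)%C = (T - s) * L by rewrite Ng Rabs_left1; lra.
  split; [|split; [|by apply Below]].
  - move=> Eq. rewrite Eq in N. replace (g T - g T)%C with (RtoC 0) in N by ring. rewrite Cmod_0 in N. nra.
  - rewrite N. apply Rle_lt_trans with (d / (2 * L) * L); [apply Rmult_le_compat_r; lra|].
    replace (d / (2 * L) * L) with (d / 2) by (field; lra). lra. }
destruct (Rlt_dec T 1) as [HT1|HT1].
- exfalso. set t1 := Rmin 1 (T + r / (6 * L)).
  have P0 : 0 < r / (6 * L) by apply Rdiv_lt_0_compat; lra.
  have P1 : T < t1 by apply Rmin_glb_lt; lra.
  have : t1 <= T; [|lra]. apply Tub. split; [split; [lra|apply Rmin_l]|].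
  move=> s Hs. destruct (Rlt_dec s T); [apply Below; lra|]. apply Disc. rewrite Ng Rabs_right; [|lra].
  have : t1 <= T + r / (6 * L) by apply Rmin_r. move=> h.
  apply Rle_lt_trans with (r / (6 * L) * L); [apply Rmult_le_compat_r; lra|].
  replace (r / (6 * L) * L) with (r / 6) by (field; lra). lra.
- have ET : T = 1 by lra. have -> : q = g T by rewrite ET; unfold g; ring. apply Disc.
  replace (g T - g T)%C with (RtoC 0) by ring. rewrite Cmod_0. lra.
Qed.

(** * Complex powers *)

Lemma Cexp_add (a b : C) : Cexp (a + b)%C = (Cexp a * Cexp b)%C.
Proof.
destruct a as [a1 a2], b as [b1 b2]. unfold Cexp, Cmult. simpl. rewrite exp_plus cos_plus sin_plus. f_equal; ring.
Qed.

Lemma Cmod_Cexp (z : C) : Cmod (Cexp z) = exp (Re z).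
Proof.
destruct z as [x y]. unfold Cexp, Cmod. simpl.
have H := sin2_cos2 y. unfold Rsqr in H.
replace (exp x * cos y * (exp x * cos y * 1) + exp x * sin y * (exp x * sin y * 1)) with
  (exp x * exp x * (sin y * sin y + cos y * cos y)) by ring.
rewrite H Rmult_1_r. apply sqrt_square. apply Rlt_le, exp_pos.
Qed.

Lemma Cexp_RtoC (x : R) : Cexp (RtoC x) = RtoC (exp x).
Proof. unfold Cexp, RtoC. simpl. rewrite cos_0 sin_0. f_equal; ring. Qed.

Lemma Cexp_0 : Cexp 0%C = 1%C.
Proof. by rewrite Cexp_RtoC exp_0. Qed.

Lemma Cexp_neq_0 (z : C) : Cexp z <> 0%C.
Proof. apply Cmod_gt_0. rewrite Cmod_Cexp. apply exp_pos. Qed.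

Lemma Cexp_opp (z : C) : Cexp (- z)%C = (/ Cexp z)%C.
Proof.
have H : (Cexp (- z) * Cexp z)%C = 1%C. { rewrite -Cexp_add. replace (- z + z)%C with (RtoC 0) by ring. apply Cexp_0. }
have N := Cexp_neq_0 z. replace (Cexp (- z))%C with ((Cexp (- z) * Cexp z) / Cexp z)%C by (field; done). rewrite H. field. done.
Qed.

Lemma rderiv_Cexp_line (z : C) t : rderiv (fun u => Cexp (RtoC u * z)%C) t (z * Cexp (RtoC t * z))%C.
Proof.
destruct z as [x y]. split; unfold Cexp; simpl.
- auto_derive; [done|]. simpl. replace (t * x + - (0 * y)) with (t * x - 0 * y) by ring. ring.
- auto_derive; [done|]. simpl. replace (t * x + - (0 * y)) with (t * x - 0 * y) by ring. ring.
Qed.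

Lemma exp_le x y : x <= y -> exp x <= exp y.
Proof. case=> [H| ->]; [by apply Rlt_le, exp_increasing|lra]. Qed.

Lemma Cexp_minus_1 (w : C) : Cmod (Cexp w - 1)%C <= Cmod w * exp (Cmod w).
Proof.
have P := Cmod_ge_0 w.
have := MVT_C (fun u => Cexp (RtoC u * w)%C) _ 0 1 (Cmod w * exp (Cmod w)) ltac:(lra) (fun t _ => rderiv_Cexp_line w t).
replace (RtoC 1 * w)%C with w by ring. replace (RtoC 0 * w)%C with (RtoC 0) by ring. rewrite Cexp_0 Rminus_0_r Rmult_1_r.
apply. move=> t Ht. rewrite Cmod_mult Cmod_Cexp. apply Rmult_le_compat_l => //. apply exp_le.
eapply Rle_trans; [apply Rle_abs|]. eapply Rle_trans; [apply re_le_Cmod|]. rewrite Cmod_mult Cmod_R Rabs_right; nra.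
Qed.

Lemma Cexp_minus_1_id (w : C) : Cmod (Cexp w - 1 - w)%C <= Cmod w ^ 2 * exp (Cmod w).
Proof.
have P := Cmod_ge_0 w.
have := MVT_C (fun u => Cexp (RtoC u * w) - RtoC u * w)%C (fun u => w * Cexp (RtoC u * w) - w)%C 0 1 (Cmod w ^ 2 * exp (Cmod w)) ltac:(lra).
replace (RtoC 1 * w)%C with w by ring. replace (RtoC 0 * w)%C with (RtoC 0) by ring. rewrite Cexp_0 Rminus_0_r Rmult_1_r.
replace (Cexp w - w - (1 - 0))%C with (Cexp w - 1 - w)%C by ring. apply.
- move=> t _. apply: rderiv_minus; [apply rderiv_Cexp_line|].
  apply: rderiv_ext (rderiv_line 0%C w t) => u. ring.
- move=> t Ht. replace (w * Cexp (RtoC t * w) - w)%C with (w * (Cexp (RtoC t * w) - 1))%C by ring. rewrite Cmod_mult.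
  have A := Cexp_minus_1 (RtoC t * w)%C. rewrite Cmod_mult Cmod_R Rabs_right in A; [|lra].
  have E : exp (t * Cmod w) <= exp (Cmod w) by apply exp_le; nra.
  have E0 := exp_pos (t * Cmod w). simpl. rewrite Rmult_1_r Rmult_assoc. apply Rmult_le_compat_l => //.
  eapply Rle_trans; [apply A|]. apply Rmult_le_compat; nra.
Qed.

Lemma cderiv_Cexp (z : C) : cderiv Cexp z (Cexp z).
Proof.
move=> eps He. have P : 0 < Cmod (Cexp z) by rewrite Cmod_Cexp; apply exp_pos.
have E1 := exp_pos 1.
exists (Rmin 1 (eps / (Cmod (Cexp z) * exp 1))). split.
{ apply Rmin_glb_lt; [lra|]. apply Rdiv_lt_0_compat; nra. }
move=> w Hw. have H1 := Rlt_le_trans _ _ _ Hw (Rmin_l _ _). have H2 := Rlt_le_trans _ _ _ Hw (Rmin_r _ _).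
replace (Cexp w - Cexp z - Cexp z * (w - z))%C with (Cexp z * (Cexp (w - z) - 1 - (w - z)))%C; last first.
{ replace (Cexp w) with (Cexp z * Cexp (w - z))%C; [ring|]. rewrite -Cexp_add. f_equal. ring. }
rewrite Cmod_mult. set d := Cmod (w - z)%C in Hw H1 H2 *. have Pd : 0 <= d by apply Cmod_ge_0.
have A := Cexp_minus_1_id (w - z)%C. fold d in A.
have E : exp d <= exp 1 by apply exp_le; lra.
apply Rle_trans with (Cmod (Cexp z) * (d ^ 2 * exp 1)).
{ apply Rmult_le_compat_l; [lra|]. eapply Rle_trans; [apply A|]. apply Rmult_le_compat_l => //. apply pow2_ge_0. }
replace (Cmod (Cexp z) * (d ^ 2 * exp 1)) with ((Cmod (Cexp z) * exp 1 * d) * d) by ring.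
apply Rmult_le_compat_r => //.
apply Rle_trans with (Cmod (Cexp z) * exp 1 * (eps / (Cmod (Cexp z) * exp 1))); [|right; field; lra].
apply Rmult_le_compat_l; nra.
Qed.

Lemma cdiff_Cexp z : cdiff Cexp z. Proof. eexists; apply cderiv_Cexp. Qed.

Lemma cdiff_Rcpower x f z : cdiff f z -> cdiff (fun s => Rcpower x (f s)) z.
Proof.
move=> H. unfold Rcpower. apply (cdiff_comp Cexp (fun s => f s * RtoC (ln x))%C); [|apply cdiff_Cexp].
apply cdiff_mult => //. apply cdiff_const.
Qed.

Lemma Rcpower_add x a b : Rcpower x (a + b)%C = (Rcpower x a * Rcpower x b)%C.
Proof. unfold Rcpower. rewrite -Cexp_add. f_equal. ring. Qed.

Lemma Rcpower_opp x a : Rcpower x (- a)%C = (/ Rcpower x a)%C.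
Proof. unfold Rcpower. rewrite -Cexp_opp. f_equal. ring. Qed.

Lemma Rcpower_minus x a b : Rcpower x (a - b)%C = (Rcpower x a / Rcpower x b)%C.
Proof. unfold Cminus. by rewrite Rcpower_add Rcpower_opp. Qed.

Lemma Rcpower_mult_base x y s : 0 < x -> 0 < y -> Rcpower (x * y) s = (Rcpower x s * Rcpower y s)%C.
Proof. move=> Hx Hy. unfold Rcpower. rewrite -Cexp_add ln_mult // RtoC_plus. f_equal. ring. Qed.

Lemma Rcpower_RtoC x a : Rcpower x (RtoC a) = RtoC (Rpower x a).
Proof. unfold Rcpower, Rpower. by rewrite -RtoC_mult Cexp_RtoC. Qed.

Lemma Rcpower_1 x : 0 < x -> Rcpower x 1%C = RtoC x.
Proof. move=> H. by rewrite Rcpower_RtoC Rpower_1. Qed.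

Lemma Rcpower_base_1 s : Rcpower 1 s = 1%C.
Proof. unfold Rcpower. rewrite ln_1. replace (s * RtoC 0)%C with (RtoC 0) by ring. apply Cexp_0. Qed.

Lemma Cmod_Rcpower x s : Cmod (Rcpower x s) = Rpower x (Re s).
Proof. unfold Rcpower, Rpower. rewrite Cmod_Cexp. f_equal. apply re_scal_r. Qed.

Lemma rderiv_Rcpower s x : 0 < x -> rderiv (fun u => Rcpower u s) x (s * Rcpower x (s - 1)%C)%C.
Proof.
move=> Hx. unfold Rcpower at 1.
replace (s * Rcpower x (s - 1))%C with (Cexp (s * RtoC (ln x)) * (s * RtoC (/ x)))%C; last first.
{ rewrite Rcpower_minus Rcpower_1 //. unfold Rcpower. rewrite RtoC_inv; unfold Cdiv; try ring; lra. }
apply (rderiv_cderiv Cexp (fun u => s * RtoC (ln u))%C); [|apply cderiv_Cexp].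
apply rderiv_scal, rderiv_RtoC. auto_derive => //. field. lra.
Qed.

Lemma Rpower_pos x a : 0 < Rpower x a. Proof. apply exp_pos. Qed.

Lemma Rpower_anti a b e : 0 < a <= b -> e <= 0 -> Rpower b e <= Rpower a e.
Proof.
move=> [Ha Hab] He. unfold Rpower. apply exp_le.
have : ln a <= ln b by apply ln_le. nra.
Qed.

Lemma Rpower_mono a b e : 0 < a <= b -> 0 <= e -> Rpower a e <= Rpower b e.
Proof.
move=> [Ha Hab] He. unfold Rpower. apply exp_le.
have : ln a <= ln b by apply ln_le. nra.
Qed.

Lemma Rpower_base_1 e : Rpower 1 e = 1.
Proof. by rewrite /Rpower ln_1 Rmult_0_r exp_0. Qed.

Lemma Rpower_inv_base x e : 0 < x -> Rpower (/ x) e = Rpower x (- e).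
Proof. move=> H. unfold Rpower. rewrite ln_Rinv //. f_equal. ring. Qed.

Lemma Rpower_div x y e : 0 < x -> 0 < y -> Rpower (x / y) e = Rpower x e * Rpower y (- e).
Proof. move=> Hx Hy. have P := Rinv_0_lt_compat _ Hy. rewrite -Rpower_inv_base //. by rewrite Rpower_mult_distr. Qed.

Lemma Rpower_small d eps : 0 < d -> 0 < eps -> exists X, 1 <= X /\ forall x, X <= x -> Rpower x (- d) < eps.
Proof.
move=> Hd He. exists (1 + Rpower eps (- / d)). have P := Rpower_pos eps (- / d). split; [lra|].
move=> x Hx. have E : Rpower (Rpower eps (- / d)) (- d) = eps.
{ rewrite Rpower_mult. replace (- / d * - d) with 1 by (field; lra). by rewrite Rpower_1. }
rewrite -E. unfold Rpower at 1 2. apply exp_increasing.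
have : ln (Rpower eps (- / d)) < ln x by apply ln_increasing; lra. nra.
Qed.

Lemma INR_S_pos n : 0 < INR (S n). Proof. apply lt_0_INR. lia. Qed.

Lemma INR_S_ge1 n : 1 <= INR (S n). Proof. rewrite S_INR. have := pos_INR n. lra. Qed.

Lemma Rpower_seq_lim0 d : 0 < d -> is_lim_seq (fun n => Rpower (INR (S n)) (- d)) 0.
Proof.
move=> Hd. apply is_lim_seq_eps => eps He. have [X [HX K]] := Rpower_small d eps Hd He.
have [N HN] := INR_unbounded X. exists N => n Hn. have P := Rpower_pos (INR (S n)) (- d).
rewrite Rminus_0_r Rabs_right; [|lra]. apply K. have : INR N <= INR (S n) by apply le_INR; lia. lra.
Qed.

Lemma Rpower_MVT a b e : 0 < a <= b -> exists c, a <= c <= b /\ Rpower b e - Rpower a e = e * Rpower c (e - 1) * (b - a).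
Proof.
move=> [Ha Hab].
destruct (MVT_gen (fun x => Rpower x e) a b (fun x => e * Rpower x (e - 1))) as [c [Hc E]].
- rewrite Rmin_left // Rmax_right // => x Hx. apply is_derive_Reals. apply derivable_pt_lim_power. lra.
- rewrite Rmin_left // Rmax_right // => x Hx. apply derivable_continuous_pt. exists (e * Rpower x (e - 1)). apply derivable_pt_lim_power. lra.
- rewrite Rmin_left // Rmax_right // in Hc. by exists c.
Qed.

(** Comparison with the integral, in the form of telescoping differences of x^(- d) / d. *)
Lemma rsum_Rpower_le d n : 0 < d -> rsum (fun k => Rpower (INR (S k)) (- 1 - d)) n <= 1 + / d.
Proof.
move=> Hd. have Pd : 0 < / d by apply Rinv_0_lt_compat.
destruct n as [|n]; [simpl; lra|].
have H : forall m, rsum (fun k => Rpower (INR (S k)) (- 1 - d)) (S m) <= 1 + / d * (1 - Rpower (INR (S m)) (- d)).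
{ elim=> [|m IH].
  - change (0 + Rpower (INR 1) (- 1 - d) <= 1 + / d * (1 - Rpower (INR 1) (- d))). change (INR 1) with 1. rewrite !Rpower_base_1. lra.
  - change (rsum (fun k => Rpower (INR (S k)) (- 1 - d)) (S m) + Rpower (INR (S (S m))) (-1 - d) <= 1 + / d * (1 - Rpower (INR (S (S m))) (- d))).
    have P1 := INR_S_pos m.
    have [c [Hc E]] := Rpower_MVT (INR (S m)) (INR (S (S m))) (- d) ltac:(split; [done|apply le_INR; lia]).
    have M : Rpower (INR (S (S m))) (- 1 - d) <= Rpower c (- d - 1).
    { replace (- 1 - d) with (- d - 1) by ring. apply Rpower_anti; lra. }
    have E1 : INR (S (S m)) - INR (S m) = 1 by rewrite (S_INR (S m)); ring. rewrite E1 in E.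
    have E2 : Rpower c (- d - 1) = / d * (Rpower (INR (S m)) (- d) - Rpower (INR (S (S m))) (- d)).
    { replace (Rpower (INR (S m)) (- d) - Rpower (INR (S (S m))) (- d)) with (d * Rpower c (- d - 1)) by lra. field. lra. }
    rewrite E2 in M. lra. }
have := H n. have := Rpower_pos (INR (S n)) (- d). nra.
Qed.

Lemma Rcpower_diff a b s : 0 < a <= b -> Re s <= 1 ->
  Cmod (Rcpower b s - Rcpower a s)%C <= Cmod s * Rpower a (Re s - 1) * (b - a).
Proof.
move=> [Ha Hab] Hs. apply (MVT_C (fun u => Rcpower u s) (fun u => s * Rcpower u (s - 1))%C) => //.
- move=> t Ht. apply rderiv_Rcpower. lra.
- move=> t Ht. rewrite Cmod_mult Cmod_Rcpower. apply Rmult_le_compat_l; [apply Cmod_ge_0|].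
  have -> : Re (s - 1)%C = Re s - 1 by destruct s; simpl; ring. apply Rpower_anti; lra.
Qed.

(** * The zeta function on the right half plane *)

(** (s - 1) times the difference between n^(-s) and the integral of u^(-s) over [n, n + 1], with the
    integral evaluated so that s = 1 is allowed. *)
Definition zterm (n : nat) (s : C) : C :=
  ((s - 1) * Rcpower (INR n) (- s) + Rcpower (INR (S n)) (1 - s) - Rcpower (INR n) (1 - s))%C.

(* The continuation of (s - 1) zeta(s) to Re s > 0; it takes the value 1 at s = 1. *)
Definition Zf (s : C) : C := (1 + Clim (csum (fun k => zterm (S k) s)))%C.

Lemma Re_opp (s : C) : Re (- s)%C = - Re s. Proof. by destruct s. Qed.
Lemma Re_plus (s t : C) : Re (s + t)%C = Re s + Re t. Proof. by destruct s, t. Qed.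
Lemma Re_minus (s t : C) : Re (s - t)%C = Re s - Re t. Proof. by destruct s, t. Qed.
Lemma Re_RtoC (x : R) : Re (RtoC x) = x. Proof. done. Qed.

(** The mean value inequality is applied twice, to [g] over [n, n + 1] and to the difference of
    powers in its derivative. This gains a factor 1 / n over the terms n^(-s) and gives convergence
    for Re s > 0. *)
Lemma zterm_bound n s : (1 <= n)%nat -> - 1 <= Re s ->
  Cmod (zterm n s) <= Cmod (s - 1)%C * Cmod s * Rpower (INR n) (- 1 - Re s).
Proof.
move=> Hn Hs. have Pn : 0 < INR n by apply lt_0_INR; lia.
set g := fun u => (Rcpower u (1 - s) + (s - 1) * Rcpower (INR n) (- s) * RtoC u)%C.
have E : zterm n s = (g (INR (S n)) - g (INR n))%C.
{ unfold zterm, g. rewrite S_INR RtoC_plus. ring. }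
rewrite E.
replace (Cmod (s - 1)%C * Cmod s * Rpower (INR n) (- 1 - Re s)) with
  (Cmod (s - 1)%C * Cmod s * Rpower (INR n) (- 1 - Re s) * (INR (S n) - INR n)) by (rewrite S_INR; ring).
apply (MVT_C g (fun u => (1 - s) * Rcpower u (1 - s - 1) + (s - 1) * Rcpower (INR n) (- s) * 1)%C); [apply le_INR; lia|..].
- move=> t Ht. apply rderiv_plus; [apply rderiv_Rcpower; lra|]. apply rderiv_scal, rderiv_RtoC. apply: is_derive_id.
- move=> t Ht. replace (1 - s - 1)%C with (- s)%C by ring.
  replace ((1 - s) * Rcpower t (- s) + (s - 1) * Rcpower (INR n) (- s) * 1)%C with
   (- (s - 1) * (Rcpower t (- s) - Rcpower (INR n) (- s)))%C by ring.
  rewrite Cmod_mult Cmod_opp Rmult_assoc. apply Rmult_le_compat_l; [apply Cmod_ge_0|].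
  eapply Rle_trans; [apply Rcpower_diff; [lra|rewrite Re_opp; lra]|]. rewrite Cmod_opp Re_opp S_INR in Ht *.
  replace (- Re s - 1) with (- 1 - Re s) by ring.
  rewrite -{2}(Rmult_1_r (Cmod s * Rpower (INR n) (- 1 - Re s))). apply Rmult_le_compat_l; [|lra].
  apply Rmult_le_pos; [apply Cmod_ge_0|apply Rlt_le, Rpower_pos].
Qed.

Lemma cdiff_zterm n s : cdiff (zterm n) s.
Proof.
unfold zterm. apply cdiff_minus; [apply cdiff_plus|].
- apply cdiff_mult; [apply cdiff_minus; [apply cdiff_id|apply cdiff_const]|]. apply cdiff_Rcpower, cdiff_opp, cdiff_id.
- apply cdiff_Rcpower, cdiff_minus; [apply cdiff_const|apply cdiff_id].
- apply cdiff_Rcpower, cdiff_minus; [apply cdiff_const|apply cdiff_id].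
Qed.

Lemma Cmod_sub_1_le s : Cmod (s - 1)%C <= Cmod s + 1.
Proof. eapply Rle_trans; [apply Cmod_triangle_sub|]. rewrite Cmod_1. lra. Qed.

Lemma zterm_clim s : 0 < Re s -> clim (csum (fun k => zterm (S k) s)) (Clim (csum (fun k => zterm (S k) s))) /\
  Cmod (Clim (csum (fun k => zterm (S k) s))) <= Cmod (s - 1)%C * Cmod s * (1 + / Re s).
Proof.
move=> Hs. set A := Cmod (s - 1)%C * Cmod s. have PA : 0 <= A by apply Rmult_le_pos; apply Cmod_ge_0.
have [T [TB [HT HL]]] := rsum_bounded_lim (fun k => A * Rpower (INR (S k)) (- 1 - Re s)) (A * (1 + / Re s))
  ltac:(move=> k; apply Rmult_le_pos => //; apply Rlt_le, Rpower_pos) ltac:(move=> n; rewrite rsum_scal; apply Rmult_le_compat_l => //; by apply rsum_Rpower_le).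
have [H1 H2] := csum_majorant (fun k => zterm (S k) s) (fun k => A * Rpower (INR (S k)) (- 1 - Re s)) T
  (fun k => zterm_bound (S k) s ltac:(lia) ltac:(lra)) HT.
split=> //. have := H2 O. simpl. replace (Clim (csum (fun k => zterm (S k) s)) - 0)%C with (Clim (csum (fun k => zterm (S k) s))) by ring. lra.
Qed.

Lemma Zf_bound s : 0 < Re s -> Cmod (Zf s) <= 1 + Cmod (s - 1)%C * Cmod s * (1 + / Re s).
Proof.
move=> Hs. have [_ B] := zterm_clim s Hs. eapply Rle_trans; [apply Cmod_triangle|]. rewrite Cmod_1. lra.
Qed.

Lemma Re_ball s z r : Cmod (z - s)%C < r -> Re s - r < Re z < Re s + r.
Proof. move=> H. have := re_le_Cmod (z - s)%C. rewrite Re_minus => K. have := Rabs_lt_both (Re z) (Re s) r ltac:(lra). lra. Qed.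

Lemma cdiff_Zf s : 0 < Re s -> cdiff Zf s.
Proof.
move=> Hs. unfold Zf. apply cdiff_plus; [apply cdiff_const|].
set r := Re s / 2. set A := (Cmod s + r + 1) * (Cmod s + r).
have Ps := Cmod_ge_0 s.
apply (cdiff_series (fun k => zterm (S k)) (fun k => A * Rpower (INR (S k)) (- 1 - r)) (A * (1 + / r)) s r).
- unfold r; lra.
- move=> k z _. apply cdiff_zterm.
- move=> k z Hz. have Hr := Re_ball s z r Hz.
  eapply Rle_trans; [apply zterm_bound; [lia|unfold r in Hr; lra]|].
  have Mz : Cmod z <= Cmod s + r by have := Cmod_triangle_rev z s; lra.
  have M1 := Cmod_sub_1_le z. have P1 := Cmod_ge_0 z. have P2 := Cmod_ge_0 (z - 1)%C.
  apply Rmult_le_compat; [by apply Rmult_le_pos|apply Rlt_le, Rpower_pos|apply Rmult_le_compat; lra|].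
  apply Rle_Rpower; [apply INR_S_ge1|unfold r in *; lra].
- move=> n. rewrite rsum_scal. apply Rmult_le_compat_l; [unfold A, r; nra|]. apply rsum_Rpower_le. unfold r; lra.
Qed.

Lemma Zf_1 : Zf 1%C = 1%C.
Proof.
unfold Zf. rewrite (clim_Clim _ 0%C); [ring|].
apply (clim_ext (fun _ => 0%C)); [|apply clim_const]. move=> n.
rewrite (csum_ext _ (fun _ => 0%C)); [by rewrite csum_const; ring|]. move=> k _. unfold zterm.
replace (1 - 1)%C with (RtoC 0) by ring. rewrite !Rcpower_RtoC !Rpower_O; try apply INR_S_pos. ring.
Qed.

Lemma csum_zterm s n : csum (fun k => zterm (S k) s) n =
  ((s - 1) * csum (fun k => Rcpower (INR (S k)) (- s)) n + Rcpower (INR (S n)) (1 - s) - 1)%C.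
Proof.
elim: n => [|n IH].
- simpl csum. change (INR 1) with 1. rewrite Rcpower_base_1. ring.
- change (csum (fun k => zterm (S k) s) (S n)) with (csum (fun k => zterm (S k) s) n + zterm (S n) s)%C.
  change (csum (fun k => Rcpower (INR (S k)) (- s)) (S n))%C with (csum (fun k => Rcpower (INR (S k)) (- s)) n + Rcpower (INR (S n)) (- s))%C.
  rewrite IH. unfold zterm. ring.
Qed.

Lemma Rcpower_seq_lim0 s : Re s < 0 -> clim (fun n => Rcpower (INR (S n)) s) 0%C.
Proof.
move=> Hs eps He. have /is_lim_seq_eps H := Rpower_seq_lim0 (- Re s) ltac:(lra).
destruct (H eps He) as [N K]. exists N => n Hn. have := K n Hn.
replace (Rcpower (INR (S n)) s - 0)%C with (Rcpower (INR (S n)) s) by ring.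
rewrite Rminus_0_r Cmod_Rcpower Ropp_involutive Rabs_right //. apply Rle_ge, Rlt_le, Rpower_pos.
Qed.

Lemma dirichlet_zeta s : 1 < Re s -> clim (csum (fun k => Rcpower (INR (S k)) (- s)%C)) (Zf s / (s - 1))%C.
Proof.
move=> Hs. have [H _] := zterm_clim s ltac:(lra).
have Hs1 : (s - 1)%C <> 0%C. { move=> E. have : Re (s - 1)%C = 0 by rewrite E. rewrite Re_minus Re_RtoC. lra. }
have L := Rcpower_seq_lim0 (1 - s)%C ltac:(rewrite Re_minus Re_RtoC; lra).
have := clim_scal _ _ (/ (s - 1))%C (clim_minus _ _ _ _ (clim_plus _ _ _ _ (clim_const 1%C) H) L).
replace (/ (s - 1) * (1 + Clim (csum (fun k => zterm (S k) s)) - 0))%C with (Zf s / (s - 1))%C by (unfold Zf; field; done).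
apply clim_ext => n. rewrite csum_zterm. field. done.
Qed.

(** * The Moebius function *)

(** The table up to N is extended by one value at a time, which makes a recursion over proper
    divisors structural. *)
Fixpoint mu_table (N : nat) : nat -> R :=
  match N with
  | O => fun _ => 0
  | S M => fun n =>
      match Nat.eqb n (S M) with
      | true => (match M with O => 1 | _ => 0 end) -
        rsum (fun k => match Nat.eqb (S M mod S (S k)) 0 with true => mu_table M (S M / S (S k)) | false => 0 end) M
      | false => mu_table M n
      end
  end.

(* The Dirichlet inverse of the constant 1, by recursion over cofactors; primes are never needed. *)
Definition mu (n : nat) : R := mu_table n n.

Lemma mu_table_mu N n : (1 <= n <= N)%nat -> mu_table N n = mu n.
Proof.
elim: N n => [|N IH] n Hn; [lia|]. simpl. case: (Nat.eqb_spec n (S N)) => [->|E].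
- unfold mu. simpl. by rewrite Nat.eqb_refl.
- apply IH. lia.
Qed.

Lemma mu_rec M : mu (S M) = (match M with O => 1 | _ => 0 end) -
  rsum (fun k => match Nat.eqb (S M mod S (S k)) 0 with true => mu (S M / S (S k)) | false => 0 end) M.
Proof.
unfold mu at 1. simpl mu_table. rewrite Nat.eqb_refl. f_equal. apply rsum_ext => k Hk.
case: (Nat.eqb_spec (S M mod S (S k)) 0) => // E. apply mu_table_mu.
have D := Nat.div_mod_eq (S M) (S (S k)). rewrite E in D. split.
- destruct (S M / S (S k))%nat; lia.
- apply Nat.lt_succ_r. apply Nat.div_lt; lia.
Qed.

Lemma mu_1 : mu 1 = 1. Proof. rewrite mu_rec. simpl. ring. Qed.

Definition divb (d n : nat) : bool := Nat.eqb (n mod d) 0.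

Lemma mu_sum n : rsum (fun d => match divb (S d) (S n) with true => mu (S n / S d) | false => 0 end) (S n) =
  match n with O => 1 | _ => 0 end.
Proof.
have E1 : forall f, rsum f 1 = f O by move=> f /=; ring.
change (S n) with (1 + n)%nat at 3. rewrite rsum_add E1.
have -> : divb 1 (S n) = true by rewrite /divb Nat.mod_1_r.
rewrite Nat.div_1_r mu_rec.
have -> : rsum (fun k => match divb (S (1 + k)) (S n) with true => mu (S n / S (1 + k)) | false => 0 end) n =
  rsum (fun k => match Nat.eqb (S n mod S (S k)) 0 with true => mu (S n / S (S k)) | false => 0 end) n by apply rsum_ext.
ring.
Qed.

Lemma rsum_inv_sq n : rsum (fun k => / (INR (S (S k)) ^ 2)) n <= 1 - / INR (S n).
Proof.
elim: n => [|n IH]; [simpl; lra|].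
change (rsum (fun k => / (INR (S (S k)) ^ 2)) n + / (INR (S (S n)) ^ 2) <= 1 - / INR (S (S n))).
have P := INR_S_pos n. have P1 := INR_S_pos (S n). have E : INR (S (S n)) = INR (S n) + 1 by rewrite (S_INR (S n)).
have : / INR (S (S n)) ^ 2 <= / INR (S n) - / INR (S (S n)); [|lra].
replace (/ INR (S n) - / INR (S (S n))) with (/ (INR (S n) * INR (S (S n)))) by (rewrite E; field; lra).
apply Rinv_le_contravar; [nra|]. rewrite E. nra.
Qed.

(** Induction over the cofactors, with the sum of 1 / d^2 over d >= 2 at most 1. The sharper |mu| <=
    1 would call for prime factorisation; the quadratic bound is paid for by using absolute
    convergence only on Re s >= 5. *)
Lemma mu_bound n : (1 <= n)%nat -> Rabs (mu n) <= INR n ^ 2.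
Proof.
move: n. apply: (well_founded_induction lt_wf) => n IH Hn. destruct n as [|M]; [lia|].
destruct M as [|M].
{ rewrite mu_1 Rabs_R1. simpl. lra. }
rewrite mu_rec Rminus_0_l Rabs_Ropp. eapply Rle_trans; [apply Rabs_rsum_le|].
have PM := INR_S_pos (S M).
apply Rle_trans with (rsum (fun k => INR (S (S M)) ^ 2 * / (INR (S (S k)) ^ 2)) (S M)).
- apply rsum_le => k Hk. have Pk := INR_S_pos (S k). have P2 : 0 < INR (S (S k)) ^ 2 by apply pow_lt.
  case: (Nat.eqb_spec (S (S M) mod S (S k)) 0) => E; last first.
  { rewrite Rabs_R0. apply Rmult_le_pos; [apply pow2_ge_0|apply Rlt_le, Rinv_0_lt_compat; lra]. }
  have D := Nat.div_mod_eq (S (S M)) (S (S k)). rewrite E Nat.add_0_r in D.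
  set q := (S (S M) / S (S k))%nat in D *.
  have Hq : (q < S (S M))%nat by apply Nat.div_lt; lia.
  eapply Rle_trans; [apply IH => //; destruct q; lia|].
  have D' : INR (S (S M)) = INR (S (S k)) * INR q by rewrite {1}D mult_INR.
  rewrite D'. right. field. lra.
- rewrite rsum_scal. have := rsum_inv_sq (S M). have : 0 < / INR (S (S M)) by apply Rinv_0_lt_compat.
  have : 0 < INR (S (S M)) ^ 2 by apply pow_lt. nra.
Qed.

Lemma div_succ d N : (0 < d)%nat -> (S N / d = N / d + (match divb d (S N) with true => 1 | false => 0 end))%nat.
Proof.
move=> Hd. have D := Nat.div_mod_eq (S N) d. have L := Nat.mod_upper_bound (S N) d ltac:(lia).
unfold divb. case: (Nat.eqb_spec (S N mod d) 0) => E.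
- set q := (S N / d)%nat in D *. have Hq : (0 < q)%nat by destruct q; lia.
  have -> : (N / d = q - 1)%nat; [|lia]. symmetry. apply (Nat.div_unique N d (q - 1) (d - 1)); nia.
- rewrite Nat.add_0_r. apply (Nat.div_unique N d (S N / d) (S N mod d - 1)); nia.
Qed.

(** Pairs with product at most N, collected by product on the left and by first factor on the right.
    In the induction the floor of N / d grows by one exactly at the divisors of N + 1. *)
Lemma dirichlet_hyperbola (f : nat -> nat -> C) N :
  csum (fun n => csum (fun d => match divb (S d) (S n) with true => f (S d) (S n / S d)%nat | false => 0%C end) (S n)) N =
  csum (fun d => csum (fun j => f (S d) (S j)) (N / S d)) N.
Proof.
set g := fun n d => match divb (S d) (S n) with true => f (S d) (S n / S d)%nat | false => 0%C end.
elim: N => [//|N IH].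
transitivity (csum (fun n => csum (g n) (S n)) N + csum (g N) (S N))%C; [reflexivity|].
have {}IH : csum (fun n => csum (g n) (S n)) N = csum (fun d => csum (fun j => f (S d) (S j)) (N / S d)) N := IH.
rewrite IH.
have E : forall d, csum (fun j => f (S d) (S j)) (S N / S d) = (csum (fun j => f (S d) (S j)) (N / S d) + g N d)%C.
{ move=> d. unfold g. rewrite (div_succ (S d) N); [|lia]. case Ed: (divb (S d) (S N)).
  - rewrite Nat.add_1_r. done.
  - rewrite Nat.add_0_r. ring. }
rewrite (csum_ext (fun d => csum (fun j => f (S d) (S j)) (S N / S d)) _ (S N) (fun d _ => E d)).
rewrite csum_plus. f_equal.
change (csum (fun d => csum (fun j => f (S d) (S j)) (N / S d)) N =
  csum (fun d => csum (fun j => f (S d) (S j)) (N / S d)) N + csum (fun j => f (S N) (S j)) (N / S N))%C.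
rewrite (Nat.div_small N (S N)); [simpl; ring|lia].
Qed.

Definition mertens (N : nat) : R := rsum (fun k => mu (S k) / INR (S k)) N.

Definition mu_partial (s : C) (N : nat) : C := csum (fun k => RtoC (mu (S k)) * Rcpower (INR (S k)) (- s))%C N.

Lemma INR_div_mult n d : divb (S d) (S n) = true -> INR (S n) = INR (S d) * INR (S n / S d) /\ (1 <= S n / S d)%nat.
Proof.
move/Nat.eqb_eq => E. have D := Nat.div_mod_eq (S n) (S d). rewrite E Nat.add_0_r in D. split.
- by rewrite {1}D mult_INR.
- destruct (S n / S d)%nat; lia.
Qed.

(** The finite form of zeta(s) times 1 / zeta(s) = 1: the pairs with product n contribute n^(-s)
    times the sum of [mu] over the divisors of n. *)
Lemma mu_zeta_finite s N : (1 <= N)%nat ->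
  csum (fun d => Rcpower (INR (S d)) (- s) * mu_partial s (N / S d))%C N = 1%C.
Proof.
move=> HN. rewrite (csum_ext _ (fun d => csum (fun j => (fun d j => Rcpower (INR d) (- s) * (RtoC (mu j) * Rcpower (INR j) (- s)))%C (S d) (S j)) (N / S d))).
2:{ move=> d _. unfold mu_partial. by rewrite -csum_scal. }
rewrite -(dirichlet_hyperbola (fun d j => Rcpower (INR d) (- s) * (RtoC (mu j) * Rcpower (INR j) (- s)))%C N).
have E : forall n, csum (fun d => match divb (S d) (S n) with true => Rcpower (INR (S d)) (- s) * (RtoC (mu (S n / S d)) * Rcpower (INR (S n / S d)) (- s)) | false => 0%C end)%C (S n)
  = (Rcpower (INR (S n)) (- s) * RtoC (match n with O => 1 | _ => 0 end))%C.
{ move=> n. rewrite -mu_sum -csum_RtoC -csum_scal. apply csum_ext => d _.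
  case Ed: (divb (S d) (S n)); [|ring]. have [D1 D2] := INR_div_mult n d Ed.
  rewrite D1 Rcpower_mult_base; [ring|apply INR_S_pos|apply lt_0_INR; lia]. }
rewrite (csum_ext _ _ N (fun n _ => E n)). destruct N as [|N]; [lia|]. change (S N) with (1 + N)%nat. rewrite csum_add.
rewrite (csum_ext (fun k => _) (fun _ => 0%C) N); [|move=> k _ /=; ring].
rewrite csum_const. simpl csum. change (INR 1) with 1. rewrite Rcpower_base_1. ring.
Qed.

Lemma mu_term_bound s k : 5 <= Re s -> Cmod (RtoC (mu (S k)) * Rcpower (INR (S k)) (- s))%C <= Rpower (INR (S k)) (- 3).
Proof.
move=> Hs. rewrite Cmod_mult Cmod_R Cmod_Rcpower Re_opp. have P := INR_S_pos k.
apply Rle_trans with (Rpower (INR (S k)) 2 * Rpower (INR (S k)) (- 5)).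
- apply Rmult_le_compat; [apply Rabs_pos|apply Rlt_le, Rpower_pos| |].
  + rewrite (Rpower_pow 2) //. apply mu_bound. lia.
  + apply Rle_Rpower; [apply INR_S_ge1|lra].
- rewrite -Rpower_plus. right. f_equal. ring.
Qed.

(** A telescoping majorant, which makes the tail 2 / (n + 1) of the series of [mu] explicit. *)
Lemma Rpower_m3_le k : Rpower (INR (S k)) (- 3) <= 2 * (/ INR (S k) - / INR (S (S k))).
Proof.
have P := INR_S_pos k. have P1 := INR_S_ge1 k. have E : INR (S (S k)) = INR (S k) + 1 by rewrite (S_INR (S k)).
replace (- 3) with (- INR 3) by (simpl; ring). rewrite Rpower_Ropp Rpower_pow //.
replace (/ INR (S k) - / INR (S (S k))) with (/ (INR (S k) * INR (S (S k)))) by (rewrite E; field; lra).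
set x := INR (S k) in P P1 E *. rewrite E.
apply Rmult_le_reg_r with (x ^ 3 * (x * (x + 1))). { apply Rmult_lt_0_compat; [by apply pow_lt|nra]. }
have N : x ^ 3 <> 0 by apply pow_nonzero; lra.
replace (/ x ^ 3 * (x ^ 3 * (x * (x + 1)))) with (x * (x + 1)) by (field; lra).
replace (2 * / (x * (x + 1)) * (x ^ 3 * (x * (x + 1)))) with (2 * x ^ 3) by (field; lra). simpl. nra.
Qed.

Lemma mu_partial_limit s : 5 <= Re s -> exists L, clim (mu_partial s) L /\ Cmod L <= 2 /\
  forall n, Cmod (L - mu_partial s n)%C <= 2 * / INR (S n).
Proof.
move=> Hs. set b := fun k => 2 * (/ INR (S k) - / INR (S (S k))).
have HT : is_lim_seq (rsum b) 2.
{ have E : forall n, rsum b n = 2 - 2 * / INR (S n).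
  { elim=> [|n IH]; [simpl; lra|]. change (rsum b n + b n = 2 - 2 * / INR (S (S n))). rewrite IH. unfold b. ring. }
  apply (is_lim_seq_ext (fun n => 2 - 2 * / INR (S n))) => //.
  apply is_lim_seq_eps => eps He. have [N HN] := INR_unbounded (2 / eps). exists N => n Hn.
  have P := INR_S_pos n. have : INR N <= INR (S n) by apply le_INR; lia. move=> h.
  have P2 : 0 < / INR (S n) by apply Rinv_0_lt_compat.
  replace (2 - 2 * / INR (S n) - 2) with (- (2 * / INR (S n))) by ring. rewrite Rabs_Ropp Rabs_right; [|lra].
  apply Rmult_lt_reg_r with (INR (S n)) => //. rewrite Rmult_assoc Rinv_l; [|lra].
  apply Rmult_lt_reg_r with (/ eps); [by apply Rinv_0_lt_compat|]. rewrite Rmult_1_r.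
  replace (eps * INR (S n) * / eps) with (INR (S n)) by (field; lra). unfold Rdiv in HN. lra. }
have Hb : forall k, Cmod (RtoC (mu (S k)) * Rcpower (INR (S k)) (- s))%C <= b k.
{ move=> k. eapply Rle_trans; [by apply mu_term_bound|apply Rpower_m3_le]. }
have Eb : forall n, rsum b n = 2 - 2 * / INR (S n).
{ elim=> [|n IH]; [simpl; lra|]. change (rsum b n + b n = 2 - 2 * / INR (S (S n))). rewrite IH. unfold b. ring. }
have [H1 H2] := csum_majorant _ b 2 Hb HT.
exists (Clim (mu_partial s)). split; [exact H1|]. split.
- have h := H2 O. rewrite Eb in h. replace (2 - (2 - 2 * / INR 1)) with 2 in h by (simpl; field).
  eapply Rle_trans; [|apply h]. right. f_equal. change (Clim (mu_partial s) = Clim (mu_partial s) - 0)%C. ring.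
- move=> n. have h := H2 n. rewrite Eb in h. replace (2 - (2 - 2 * / INR (S n))) with (2 * / INR (S n)) in h by ring. exact h.
Qed.

(** The finite identity is subtracted from [L] times the partial sum of zeta. The d-th term is at
    most d^(-4) times the tail of the series of [mu] beyond N / d, hence O(d^(-3) / N). *)
Lemma mu_zeta s L : 5 <= Re s -> clim (mu_partial s) L -> (L * (Zf s / (s - 1)))%C = 1%C.
Proof.
move=> Hs HL. have [L' [HL' [_ HB]]] := mu_partial_limit s Hs.
have E := clim_unique _ _ _ HL HL'. subst L'. clear HL'.
have HZ := dirichlet_zeta s ltac:(lra). set z := (Zf s / (s - 1))%C in HZ *.
have H := clim_scal _ _ L HZ. apply: clim_unique H _.
move=> eps He. have [N0 HN0] := INR_unbounded (4 / eps). exists (max 1 N0) => N HN.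
rewrite -(mu_zeta_finite s N); [|lia]. rewrite -csum_scal -csum_minus.
eapply Rle_lt_trans; [apply Cmod_csum_le|].
have PN : 0 < INR N by apply lt_0_INR; lia.
apply Rle_lt_trans with (rsum (fun k => 2 * / INR N * (2 * (/ INR (S k) - / INR (S (S k))))) N).
- apply rsum_le => k Hk. replace (L * Rcpower (INR (S k)) (- s) - Rcpower (INR (S k)) (- s) * mu_partial s (N / S k))%C with
    ((L - mu_partial s (N / S k)) * Rcpower (INR (S k)) (- s))%C by ring.
  rewrite Cmod_mult Cmod_Rcpower Re_opp.
  have P := INR_S_pos k. have B := HB (N / S k)%nat.
  have Q : / INR (S (N / S k)) <= INR (S k) * / INR N.
  { have P2 := INR_S_pos (N / S k). apply Rmult_le_reg_r with (INR (S (N / S k)) * INR N); [nra|].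
    replace (/ INR (S (N / S k)) * (INR (S (N / S k)) * INR N)) with (INR N) by (field; lra).
    replace (INR (S k) * / INR N * (INR (S (N / S k)) * INR N)) with (INR (S k) * INR (S (N / S k))) by (field; lra).
    rewrite -mult_INR. apply le_INR. have := Nat.div_mod_eq N (S k). have := Nat.mod_upper_bound N (S k) ltac:(lia). nia. }
  apply Rle_trans with (2 * (INR (S k) * / INR N) * Rpower (INR (S k)) (- 4)).
  + apply Rmult_le_compat; [apply Cmod_ge_0|apply Rlt_le, Rpower_pos|lra|]. apply Rle_Rpower; [apply INR_S_ge1|lra].
  + apply Rle_trans with (2 * / INR N * Rpower (INR (S k)) (- 3)).
    * right. rewrite -{1}(Rpower_1 (INR (S k))) //. replace (- 3) with (1 + - 4) by ring. rewrite Rpower_plus. ring.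
    * apply Rmult_le_compat_l; [|apply Rpower_m3_le]. have := Rinv_0_lt_compat _ PN. lra.
- rewrite rsum_scal rsum_scal.
  have -> : rsum (fun k => / INR (S k) - / INR (S (S k))) N = 1 - / INR (S N).
  { clear. elim: N => [|n IH]; [simpl; lra|]. change (rsum (fun k => / INR (S k) - / INR (S (S k))) n + (/ INR (S n) - / INR (S (S n))) = 1 - / INR (S (S n))). rewrite IH. ring. }
  have P1 : 0 < / INR (S N) by apply Rinv_0_lt_compat, INR_S_pos.
  have P2 : 0 < / INR N by apply Rinv_0_lt_compat.
  have h : INR N0 <= INR N by apply le_INR; lia.
  apply Rle_lt_trans with (4 * / INR N); [nra|].
  apply Rmult_lt_reg_r with (INR N) => //. rewrite Rmult_assoc Rinv_l; [|lra].
  apply Rmult_lt_reg_r with (/ eps); [by apply Rinv_0_lt_compat|].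
  replace (eps * INR N * / eps) with (INR N) by (field; lra). unfold Rdiv in HN0. lra.
Qed.

(** * Consequences of square root cancellation *)

Definition mertens_bound : Prop := forall eps, 0 < eps ->
  exists K, forall n, Rabs (mertens (S n)) <= K * Rpower (INR (S n)) (- 1 / 2 + eps).

(** Summation by parts of (mu(k) / k) k^(1-s) against [mertens]; the boundary term, which tends to
    0, is kept apart in [mu_partial_abel]. *)
Definition Fterm (s : C) (k : nat) : C :=
  (RtoC (mertens (S k)) * (Rcpower (INR (S k)) (1 - s) - Rcpower (INR (S (S k))) (1 - s)))%C.

Definition Ff (s : C) : C := Clim (csum (Fterm s)).

Lemma RtoC_neq_0 (x : R) : x <> 0 -> RtoC x <> 0%C.
Proof. move=> H E. by injection E. Qed.

Lemma mu_partial_abel s n : mu_partial s (S n) = (csum (Fterm s) n + RtoC (mertens (S n)) * Rcpower (INR (S n)) (1 - s))%C.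
Proof.
have T : forall k, Rcpower (INR (S k)) (1 - s)%C = (RtoC (INR (S k)) * Rcpower (INR (S k)) (- s))%C.
{ move=> k. unfold Cminus. rewrite Rcpower_add Rcpower_1 //. apply INR_S_pos. }
have M : forall k, (RtoC (mu (S k)) * Rcpower (INR (S k)) (- s) = RtoC (mu (S k) / INR (S k)) * Rcpower (INR (S k)) (1 - s))%C.
{ move=> k. rewrite T. unfold Rdiv. rewrite RtoC_mult RtoC_inv; [|apply Rgt_not_eq, INR_S_pos]. field.
  apply RtoC_neq_0, Rgt_not_eq, INR_S_pos. }
elim: n => [|n IH].
- change (0 + RtoC (mu 1) * Rcpower (INR 1) (- s) = 0 + RtoC (0 + mu 1 / INR 1)%R * Rcpower (INR 1) (1 - s))%C.
  rewrite M Rplus_0_l. ring.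
- change (mu_partial s (S (S n))) with (mu_partial s (S n) + RtoC (mu (S (S n))) * Rcpower (INR (S (S n))) (- s))%C.
  rewrite IH M. change (csum (Fterm s) (S n)) with (csum (Fterm s) n + Fterm s n)%C.
  change (mertens (S (S n))) with (mertens (S n) + mu (S (S n)) / INR (S (S n))). rewrite RtoC_plus. unfold Fterm. ring.
Qed.

Lemma Fterm_bound s k K e : 0 <= Re s -> (forall n, Rabs (mertens (S n)) <= K * Rpower (INR (S n)) (- 1 / 2 + e)) ->
  Cmod (Fterm s k) <= K * Cmod (1 - s)%C * Rpower (INR (S k)) (- 1 - (Re s - 1 / 2 - e)).
Proof.
move=> Hs HK. unfold Fterm. rewrite Cmod_mult Cmod_R Cmod_sub_sym. have P := INR_S_pos k.
have D := Rcpower_diff (INR (S k)) (INR (S (S k))) (1 - s)%C ltac:(split; [done|apply le_INR; lia]) ltac:(rewrite Re_minus Re_RtoC; lra).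
rewrite Re_minus Re_RtoC (S_INR (S k)) in D. rewrite (S_INR (S k)).
replace (INR (S k) + 1 - INR (S k)) with 1 in D by ring.
apply Rle_trans with ((K * Rpower (INR (S k)) (- 1 / 2 + e)) * (Cmod (1 - s)%C * Rpower (INR (S k)) (1 - Re s - 1) * 1)).
- apply Rmult_le_compat => //; [apply Rabs_pos|apply Cmod_ge_0].
- right. replace (- 1 - (Re s - 1 / 2 - e)) with ((- 1 / 2 + e) + (1 - Re s - 1)) by field. rewrite (Rpower_plus (- 1 / 2 + e) (1 - Re s - 1)). ring.
Qed.

Lemma mertens_K_pos K e : (forall n, Rabs (mertens (S n)) <= K * Rpower (INR (S n)) (- 1 / 2 + e)) -> 0 <= K.
Proof.
move=> H. have := H O. change (INR 1) with 1. rewrite Rpower_base_1 Rmult_1_r. have := Rabs_pos (mertens 1). lra.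
Qed.

Lemma Ff_clim s : mertens_bound -> 1 / 2 < Re s -> clim (mu_partial s) (Ff s).
Proof.
(* Half of the distance to the line Re s = 1 / 2 goes into the exponent of the hypothesis, the other
   half into convergence. *)
move=> HM Hs. set e := (Re s - 1 / 2) / 2. have He : 0 < e by unfold e; lra.
have [K HK] := HM e He. have K0 := mertens_K_pos K e HK.
have EE : Re s - 1 / 2 - e = e by unfold e; field.
set A := K * Cmod (1 - s)%C. have PA : 0 <= A by apply Rmult_le_pos => //; apply Cmod_ge_0.
have [T [_ [HT HL]]] := rsum_bounded_lim (fun k => A * Rpower (INR (S k)) (- 1 - e)) (A * (1 + / e))
  ltac:(move=> k; apply Rmult_le_pos => //; apply Rlt_le, Rpower_pos) ltac:(move=> n; rewrite rsum_scal; apply Rmult_le_compat_l => //; by apply rsum_Rpower_le).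
have [H1 _] := csum_majorant (Fterm s) _ T (fun k => eq_ind _ (fun x => Cmod (Fterm s k) <= A * Rpower (INR (S k)) (- 1 - x)) (Fterm_bound s k K e ltac:(lra) HK) _ EE) HT.
apply (proj1 (clim_shift _ _ 1)).
apply (clim_ext (fun n => csum (Fterm s) n + RtoC (mertens (S n)) * Rcpower (INR (S n)) (1 - s))%C).
{ move=> n. by rewrite Nat.add_1_r mu_partial_abel. }
replace (Ff s) with (Ff s + 0)%C by ring. apply clim_plus => //.
move=> eps Heps. have /is_lim_seq_eps L := Rpower_seq_lim0 e He.
destruct (L (eps / (K + 1))) as [N HN]; [apply Rdiv_lt_0_compat; lra|]. exists N => n Hn. have := HN n Hn.
have P := Rpower_pos (INR (S n)) (- e). rewrite Rminus_0_r Rabs_right; [|lra]. move=> h.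
replace (RtoC (mertens (S n)) * Rcpower (INR (S n)) (1 - s) - 0)%C with (RtoC (mertens (S n)) * Rcpower (INR (S n)) (1 - s))%C by ring.
rewrite Cmod_mult Cmod_R Cmod_Rcpower Re_minus Re_RtoC.
apply Rle_lt_trans with (K * Rpower (INR (S n)) (- e)).
- apply Rle_trans with (K * Rpower (INR (S n)) (- 1 / 2 + e) * Rpower (INR (S n)) (1 - Re s)).
  + apply Rmult_le_compat_r; [apply Rlt_le, Rpower_pos|apply HK].
  + rewrite Rmult_assoc -Rpower_plus. right. do 2 f_equal. unfold e. field.
- apply Rle_lt_trans with ((K + 1) * Rpower (INR (S n)) (- e)); [nra|].
  replace eps with ((K + 1) * (eps / (K + 1))) by (field; lra). apply Rmult_lt_compat_l; lra.
Qed.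

Lemma cdiff_Ff s : mertens_bound -> 1 / 2 < Re s -> cdiff Ff s.
Proof.
move=> HM Hs. set e := (Re s - 1 / 2) / 4. have He : 0 < e by unfold e; lra.
have [K HK] := HM e He. have K0 := mertens_K_pos K e HK. have Ps := Cmod_ge_0 s.
set A := K * (Cmod s + e + 1). have PA : 0 <= A by apply Rmult_le_pos; lra.
unfold Ff. apply (cdiff_series (fun k s => Fterm s k) (fun k => A * Rpower (INR (S k)) (- 1 - e)) (A * (1 + / e)) s e) => //.
- move=> k z _. unfold Fterm. apply cdiff_mult; [apply cdiff_const|].
  apply cdiff_minus; apply cdiff_Rcpower, cdiff_minus; try apply cdiff_const; apply cdiff_id.
- move=> k z Hz. have Hr := Re_ball s z e Hz.
  eapply Rle_trans; [apply (Fterm_bound z k K e) => //; unfold e in *; lra|].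
  apply Rmult_le_compat; [apply Rmult_le_pos => //; apply Cmod_ge_0|apply Rlt_le, Rpower_pos| |].
  + apply Rmult_le_compat_l => //. rewrite Cmod_sub_sym. have := Cmod_sub_1_le z. have := Cmod_triangle_rev z s. lra.
  + apply Rle_Rpower; [apply INR_S_ge1|unfold e in *; lra].
- move=> n. rewrite rsum_scal. apply Rmult_le_compat_l => //. by apply rsum_Rpower_le.
Qed.

Lemma Re_convex c : convex (fun z => c < Re z).
Proof.
move=> z w t Hz Hw Ht. have -> : Re (z + RtoC t * (w - z))%C = (1 - t) * Re z + t * Re w.
{ destruct z, w. simpl. ring. }
have h2 : 0 <= (1 - t) * (Re z - c) by apply Rmult_le_pos; lra.
destruct (Req_dec t 0) as [->|Hn]; [lra|].
have h1 : 0 < t * (Re w - c) by apply Rmult_lt_0_compat; lra. lra.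
Qed.

Lemma Re_copen c : copen (fun z => c < Re z).
Proof.
move=> z Hz. exists (Re z - c). split; [lra|]. move=> w Hw. have := Re_ball z w _ Hw. lra.
Qed.

(** The disc of radius 1 about 6 lies in Re s >= 5, where the two Dirichlet series are known to have
    product 1; the rest of the half plane follows by continuation. *)
Lemma Ff_Zf s : mertens_bound -> 1 / 2 < Re s -> (Ff s * Zf s)%C = (s - 1)%C.
Proof.
move=> HM Hs.
have H : (Ff s * Zf s - (s - 1))%C = 0%C.
{ apply (identity_theorem (fun z => 1 / 2 < Re z) (fun s => Ff s * Zf s - (s - 1))%C (RtoC 6)) => //.
  - apply Re_convex.
  - apply Re_copen.
  - move=> z Hz. apply cdiff_minus; [apply cdiff_mult|].
    + by apply cdiff_Ff. + apply cdiff_Zf. lra.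
    + apply cdiff_minus; [apply cdiff_id|apply cdiff_const].
  - rewrite Re_RtoC. lra.
  - exists 1. split; [lra|]. move=> z Hz. have := Re_ball _ _ _ Hz. rewrite Re_RtoC => Hr.
    have E := mu_zeta z (Ff z) ltac:(lra) (Ff_clim z HM ltac:(lra)).
    have Hz1 : (z - 1)%C <> 0%C. { move=> E0. have : Re (z - 1)%C = 0 by rewrite E0. rewrite Re_minus Re_RtoC. lra. }
    replace (Ff z * Zf z)%C with ((Ff z * (Zf z / (z - 1))) * (z - 1))%C by (field; done). rewrite E. ring. }
replace (Ff s * Zf s)%C with ((Ff s * Zf s - (s - 1)) + (s - 1))%C by ring. rewrite H. ring.
Qed.

(** * Nonvanishing and growth of zeta under the Riemann hypothesis *)

Lemma sum_n_csum (a : nat -> C) n : sum_n (G := C_AbelianMonoid) a n = csum a (S n).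
Proof.
elim: n => [|n IH].
- rewrite sum_O. simpl. by rewrite Cplus_0_l.
- rewrite sum_Sn IH. done.
Qed.

Lemma filterlim_clim (u : nat -> C) l : filterlim u eventually (locally (T := C_UniformSpace) l) <-> clim u l.
Proof.
split.
- move=> H eps He. have := H (fun w => Cmod (w - l)%C < eps) => {}H.
  destruct H as [N HN]. { apply locally_C_Cmod. by exists eps. } by exists N.
- move=> H P /locally_C_Cmod [r [Hr HP]]. destruct (H r Hr) as [N HN]. exists N => n Hn. by apply HP, HN.
Qed.

Lemma is_series_clim (a : nat -> C) l : is_series (K := C_AbsRing) (V := C_NormedModule) a l <-> clim (csum a) l.
Proof.
unfold is_series.
rewrite -(clim_shift (csum a) l 1). rewrite -filterlim_clim. split; apply filterlim_ext => n; by rewrite Nat.add_1_r -sum_n_csum.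
Qed.

(** The half plane without 1 is not convex. It is covered by four convex pieces on which the
    identity theorem can be applied in turn. *)
Lemma Re_half_planes_cover (P : C -> Prop) : (forall s : C, 1 < Re s -> P s) ->
  (forall s : C, 0 < Re s -> 0 < Im s -> P s) -> (forall s : C, 0 < Re s -> Im s < 0 -> P s) -> (forall s : C, 0 < Re s < 1 -> P s) ->
  forall s : C, 0 < Re s -> s <> 1%C -> P s.
Proof.
move=> H1 H2 H3 H4 s Hs Hs1. destruct (Rtotal_order (Im s) 0) as [h|[h|h]]; [by apply H3| |by apply H2].
destruct (Rtotal_order (Re s) 1) as [k|[k|k]]; [apply H4; lra| |by apply H1].
exfalso. apply Hs1. destruct s as [x y]. simpl in *. by rewrite h k.
Qed.

Lemma Im_ball s z r : Cmod (z - s)%C < r -> Im s - r < Im z < Im s + r.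
Proof. move=> H. have K := Rabs_snd_le (z - s)%C. rewrite snd_Cminus in K. have := Rabs_lt_both (snd z) (snd s) r ltac:(lra). done. Qed.

(** Uniqueness of the continuation, linking an arbitrary zeta to the explicit series. The vanishing
    of the difference spreads from Re s > 1 to the two quadrants, and from the upper quadrant to the
    strip. *)
Lemma zeta_Zf zeta : is_Riemann_zeta zeta -> forall s : C, 0 < Re s -> s <> 1%C -> (zeta s * (s - 1))%C = Zf s.
Proof.
move=> [Hser Hhol].
set f := fun s => (zeta s * (s - 1) - Zf s)%C.
have Hf : forall s : C, 0 < Re s -> s <> 1%C -> cdiff f s.
{ move=> s Hs Hs1. apply cdiff_minus; [apply cdiff_mult|by apply cdiff_Zf].
  - destruct (proj1 (holomorphic_at_iff _ _) (Hhol s Hs1)) as [r [Hr K]]. apply K. replace (s - s)%C with (RtoC 0) by ring. by rewrite Cmod_0.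
  - apply cdiff_minus; [apply cdiff_id|apply cdiff_const]. }
have nz : forall s : C, Im s <> 0 \/ Re s <> 1 -> s <> 1%C.
{ move=> s H E. subst s. simpl in H. lra. }
have A1 : forall s : C, 1 < Re s -> f s = 0%C.
{ move=> s Hs. have H1 : (s - 1)%C <> 0%C. { move=> E. have : Re (s - 1)%C = 0 by rewrite E. rewrite Re_minus Re_RtoC. lra. }
  have L := proj1 (is_series_clim _ _) (Hser s Hs). have L2 := dirichlet_zeta s Hs.
  unfold f. rewrite (clim_unique _ _ _ L L2). field. done. }
have Conv : forall c, convex (fun z => 0 < Re z /\ 0 < c * Im z).
{ move=> c z w t [z1 z2] [w1 w2] Ht. split; [by apply (Re_convex 0)|].
  have -> : c * Im (z + RtoC t * (w - z))%C = (1 - t) * (c * Im z) + t * (c * Im w). { destruct z, w. simpl. ring. }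
  have := Re_convex 0 (RtoC (c * Im z)) (RtoC (c * Im w)) t z2 w2 Ht. simpl. lra. }
have Open : forall c, c = 1 \/ c = -1 -> copen (fun z => 0 < Re z /\ 0 < c * Im z).
{ move=> c Hc z [z1 z2]. exists (Rmin (Re z) (c * Im z)). split; [by apply Rmin_glb_lt|]. move=> w Hw.
  have := Re_ball z w _ (Rlt_le_trans _ _ _ Hw (Rmin_l _ _)). have := Im_ball z w _ (Rlt_le_trans _ _ _ Hw (Rmin_r _ _)).
  case: Hc z2 => ->; lra. }
have A2 : forall c, c = 1 \/ c = -1 -> forall s : C, 0 < Re s /\ 0 < c * Im s -> f s = 0%C.
{ move=> c Hc. apply (identity_theorem _ f (2, c)); [apply Conv|by apply Open| | |].
  - move=> z [z1 z2]. apply Hf => //. apply nz. left. move=> E. rewrite E in z2. lra.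
  - simpl. case: Hc => ->; lra.
  - exists (1/2). split; [lra|]. move=> z Hz. apply A1. have := Re_ball _ _ _ Hz. simpl. lra. }
have A3 : forall s : C, 0 < Re s < 1 -> f s = 0%C.
{ apply (identity_theorem _ f (1/2, 1/2)).
  - move=> z w t [z1 z2] [w1 w2] Ht. split; [by apply (Re_convex 0)|].
    have := Re_convex (-1) (- z)%C (- w)%C t ltac:(cbv beta; rewrite Re_opp; lra) ltac:(cbv beta; rewrite Re_opp; lra) Ht.
    replace (- z + RtoC t * (- w - - z))%C with (- (z + RtoC t * (w - z)))%C by ring. rewrite Re_opp. lra.
  - move=> z [z1 z2]. exists (Rmin (Re z) (1 - Re z)). split; [apply Rmin_glb_lt; lra|]. move=> w Hw.
    have := Re_ball z w _ (Rlt_le_trans _ _ _ Hw (Rmin_l _ _)). have := Re_ball z w _ (Rlt_le_trans _ _ _ Hw (Rmin_r _ _)). lra.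
  - move=> z Hz. apply Hf; [lra|]. apply nz. right. lra.
  - simpl. lra.
  - exists (1/4). split; [lra|]. move=> z Hz. apply (A2 1); [by left|]. have := Re_ball _ _ _ Hz. have := Im_ball _ _ _ Hz. simpl. lra. }
move=> s Hs Hs1. have H0 : f s = 0%C.
{ apply (Re_half_planes_cover (fun s => f s = 0%C)) => //.
  - move=> z h1 h2. apply (A2 1); [by left|lra].
  - move=> z h1 h2. apply (A2 (-1)); [by right|lra]. }
unfold f in H0. replace (zeta s * (s - 1))%C with ((zeta s * (s - 1) - Zf s) + Zf s)%C by ring. rewrite H0. ring.
Qed.

Lemma RH_Zf : Riemann_hypothesis -> forall s : C, 1 / 2 < Re s -> Zf s <> 0%C.
Proof.
move=> [zeta [Hz HRH]] s Hs H0. destruct (Classical_Prop.classic (s = 1%C)) as [->|H1].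
- rewrite Zf_1 in H0. injection H0. lra.
- have E := zeta_Zf zeta Hz s ltac:(lra) H1. rewrite H0 in E.
  have Hs1 : (s - 1)%C <> 0%C by apply Csub_neq_0.
  have Z : zeta s = 0%C. { replace (zeta s) with ((zeta s * (s - 1)) / (s - 1))%C by (field; done). rewrite E. field. done. }
  have : Re s = 1 / 2; [|lra]. apply HRH => // m Em. rewrite Em Re_RtoC in Hs. have := INR_S_pos m. lra.
Qed.

(** * The Borel-Caratheodory inequality *)

Definition cis (x : R) : C := (cos x, sin x).

Lemma cis_add x y : cis (x + y) = (cis x * cis y)%C.
Proof. unfold cis, Cmult. simpl. rewrite cos_plus sin_plus. f_equal; ring. Qed.

Lemma cis_0 : cis 0 = 1%C. Proof. by rewrite /cis cos_0 sin_0. Qed.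

Lemma cis_pow x n : (cis x ^ n)%C = cis (INR n * x).
Proof.
elim: n => [|n IH]; [by rewrite /= Rmult_0_l cis_0|].
rewrite S_INR Rmult_plus_distr_r Rmult_1_l cis_add -IH /=. ring.
Qed.

Lemma Cmod_cis x : Cmod (cis x) = 1.
Proof.
unfold cis, Cmod. simpl. have H := sin2_cos2 x. unfold Rsqr in H.
replace (cos x * (cos x * 1) + sin x * (sin x * 1)) with (sin x * sin x + cos x * cos x) by ring. by rewrite H sqrt_1.
Qed.

Lemma cis_2PI_n (n : nat) : cis (2 * PI * INR n) = 1%C.
Proof.
elim: n => [|n IH]; [by rewrite Rmult_0_r cis_0|].
rewrite S_INR Rmult_plus_distr_l cis_add IH Rmult_1_r. have -> : cis (2 * PI) = 1%C by rewrite /cis cos_2PI sin_2PI. ring.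
Qed.

Lemma cis_opp x : cis (- x) = Cconj (cis x).
Proof. unfold cis, Cconj. simpl. by rewrite cos_neg sin_neg. Qed.

Lemma cis_neq_1 x : 0 < Rabs x < 2 * PI -> cis x <> 1%C.
Proof.
move=> H E. injection E => _ Ec. replace x with (2 * (x / 2)) in Ec by field. rewrite cos_2a_sin in Ec.
have S0 : sin (x / 2) = 0 by nra.
have P : 0 < Rabs (x / 2) < PI. { unfold Rdiv. rewrite Rabs_mult (Rabs_right (/ 2)); lra. }
have : 0 < sin (Rabs (x / 2)) by apply sin_gt_0; lra.
unfold Rabs. case: Rcase_abs => _; [rewrite sin_neg|]; lra.
Qed.

(** [k] is real so that differences of indices, of either sign, can serve as frequencies. *)
Lemma root_unity_sum (N : nat) (k : R) : cis (INR N * (2 * PI * k / INR N)) = 1%C -> 0 < Rabs k < INR N ->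
  csum (fun j => cis (INR j * (2 * PI * k / INR N))) N = 0%C.
Proof.
move=> H1 Hk. have PN : 0 < INR N by lra. have P := PI_RGT_0.
set x := 2 * PI * k / INR N in H1 *.
have Hq : cis x <> 1%C.
{ apply cis_neq_1. have Pi : 0 < / INR N by apply Rinv_0_lt_compat.
  have -> : Rabs x = 2 * PI * (Rabs k * / INR N).
  { unfold x, Rdiv. rewrite Rmult_assoc Rabs_mult (Rabs_right (2 * PI)); [|lra]. by rewrite Rabs_mult (Rabs_right (/ INR N)); [|lra]. }
  have Q : Rabs k * / INR N < 1.
  { apply Rmult_lt_reg_r with (INR N) => //. rewrite Rmult_assoc Rinv_l; lra. }
  have Q2 : 0 < Rabs k * / INR N by apply Rmult_lt_0_compat; lra. split; nra. }
have E : forall n, ((cis x - 1) * csum (fun j => cis (INR j * x)) n)%C = (cis (INR n * x) - 1)%C.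
{ elim=> [|n IH].
  - simpl. rewrite Rmult_0_l cis_0. ring.
  - change (csum (fun j => cis (INR j * x)) (S n)) with (csum (fun j => cis (INR j * x)) n + cis (INR n * x))%C. rewrite Cmult_plus_distr_l IH S_INR Rmult_plus_distr_r Rmult_1_l cis_add. ring. }
have := E N. rewrite H1. replace (1 - 1)%C with (RtoC 0) by ring. move=> E0.
have Hd := Csub_neq_0 _ _ Hq.
replace (csum _ N) with (((cis x - 1) * csum (fun j => cis (INR j * x)) N) / (cis x - 1))%C by (field; done).
rewrite E0. field. done.
Qed.

Lemma csum_swap (f : nat -> nat -> C) m n : csum (fun i => csum (fun j => f i j) n) m = csum (fun j => csum (fun i => f i j) m) n.
Proof.
elim: m => [|m IH]; [simpl; rewrite csum_const; ring|]. simpl. by rewrite IH -csum_plus.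
Qed.

Lemma csum_single (f : nat -> C) n K : (n < K)%nat -> (forall m, m <> n -> f m = 0%C) -> csum f K = f n.
Proof.
move=> Hn H. rewrite (csum_split f n K); [|lia]. replace (K - n)%nat with (1 + (K - n - 1))%nat by lia. rewrite csum_add.
rewrite (csum_ext f (fun _ => 0%C) n); [|move=> k Hk; apply H; lia].
rewrite (csum_ext (fun k => f (n + (1 + k))%nat) (fun _ => 0%C)); [|move=> k Hk; apply H; lia].
rewrite !csum_const /= Nat.add_0_r. ring.
Qed.

(* Averaging over the roots of unity of order 2K replaces Fourier integrals on the circle:
   it extracts the coefficient of index n, and kills it for the conjugate polynomial. *)
Lemma borel_caratheodory_poly (g : nat -> C) K r A : 0 < r -> 0 <= A -> g O = 0%C ->
  (forall w, Cmod w = r -> Re (csum (fun m => g m * w ^ m)%C K) <= A) ->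
  forall n, (1 <= n < K)%nat -> Cmod (g n) * r ^ n <= 4 * A.
Proof.
(* With 2 K nodes, the sum of two indices below [K] stays below the order, so no nonzero frequency
   is mistaken for 0. *)
move=> Hr HA Hg0 HP n Hn. set N := (2 * K)%nat. set P := fun w => csum (fun m => g m * w ^ m)%C K in HP *.
have PN : 0 < INR N by apply lt_0_INR; unfold N; lia.
set th := fun j => INR j * (2 * PI / INR N).
set w := fun j => (RtoC r * cis (th j))%C.
have Hw : forall j, Cmod (w j) = r by move=> j; unfold w; rewrite Cmod_mult Cmod_cis Cmod_R Rabs_right; lra.
have wpow : forall j m, (w j ^ m)%C = (RtoC (r ^ m) * cis (INR m * th j))%C.
{ move=> j m. unfold w. rewrite -cis_pow RtoC_pow. elim: m => [|m IH] /=; [ring|rewrite IH; ring]. }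
have Orth : forall a b : nat, (a < N)%nat -> (b < N)%nat -> a <> b -> csum (fun j => cis ((INR a - INR b) * th j)) N = 0%C.
{ move=> a b Ha Hb Hab.
  rewrite (csum_ext _ (fun j => cis (INR j * (2 * PI * (INR a - INR b) / INR N)))).
  2:{ move=> j _. f_equal. unfold th. field. lra. }
  apply root_unity_sum.
  - replace (INR N * (2 * PI * (INR a - INR b) / INR N)) with (2 * PI * INR a + - (2 * PI * INR b)) by (field; lra).
    rewrite cis_add cis_opp !cis_2PI_n. unfold Cconj, RtoC, Cmult. simpl. f_equal; ring.
  - have h1 : INR a < INR N by apply lt_INR. have h2 : INR b < INR N by apply lt_INR.
    have h3 := pos_INR a. have h4 := pos_INR b. split; [|apply Rabs_def1; lra].
    apply Rabs_pos_lt. have := not_INR a b Hab. lra. }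
have Ex : forall x, csum (fun j => P (w j) * cis (x * th j))%C N =
   csum (fun m => g m * RtoC (r ^ m) * csum (fun j => cis ((INR m + x) * th j)) N)%C K.
{ move=> x. rewrite (csum_ext _ (fun j => csum (fun m => g m * RtoC (r ^ m) * cis ((INR m + x) * th j))%C K)).
  2:{ move=> j _. unfold P. rewrite Cmult_comm -csum_scal. apply csum_ext => m _. rewrite wpow Rmult_plus_distr_r cis_add. ring. }
  rewrite csum_swap. apply csum_ext => m _. by rewrite csum_scal. }
have S1 : csum (fun j => P (w j) * cis (- INR n * th j))%C N = (RtoC (INR N) * (g n * RtoC (r ^ n)))%C.
{ rewrite Ex (csum_ext _ (fun m => match Nat.eqb m n with true => RtoC (INR N) * (g n * RtoC (r ^ n)) | false => 0 end)%C).
  - rewrite (csum_single _ n); [by rewrite Nat.eqb_refl|lia|]. move=> m Hm. by case: (Nat.eqb_spec m n).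
  - move=> m Hm. case: (Nat.eqb_spec m n) => [->|E].
    + rewrite (csum_ext (fun j => cis _) (fun _ => 1%C)); [rewrite csum_const; ring|].
      move=> j _. rewrite Rplus_opp_r Rmult_0_l. apply cis_0.
    + rewrite Orth; [ring|unfold N; lia|unfold N; lia|done]. }
have S2 : csum (fun j => P (w j) * cis (INR n * th j))%C N = 0%C.
{ rewrite Ex (csum_ext _ (fun _ => 0%C)); [rewrite csum_const; ring|]. move=> m Hm.
  rewrite (csum_ext (fun j => cis _) (fun j => cis ((INR (m + n) - INR 0) * th j))).
  - rewrite Orth; [ring|unfold N; lia|unfold N; lia|lia].
  - move=> j _. rewrite plus_INR. simpl. f_equal. ring. }
have S3 : csum (fun j => P (w j)) N = 0%C.
{ rewrite (csum_ext _ (fun j => P (w j) * cis (0 * th j))%C); [|move=> j _; rewrite Rmult_0_l cis_0; ring].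
  rewrite Ex (csum_ext _ (fun _ => 0%C)); [rewrite csum_const; ring|]. move=> m Hm. destruct m as [|m]; [rewrite Hg0; ring|].
  rewrite (csum_ext (fun j => cis _) (fun j => cis ((INR (S m) - INR 0) * th j))).
  - rewrite Orth; [ring|unfold N; lia|unfold N; lia|lia].
  - move=> j _. f_equal. simpl (INR 0). ring. }
have Conj : forall f M, Cconj (csum f M) = csum (fun j => Cconj (f j)) M.
{ move=> f M. elim: M => [|M IH] /=; [unfold Cconj, RtoC; simpl; f_equal; ring|]. by rewrite Cplus_conj IH. }
(* Adding the conjugate of the vanishing sum [S2] replaces the polynomial by twice its real part,
   the only quantity under control. *)
have S4 : (RtoC (INR N) * (g n * RtoC (r ^ n)))%C = csum (fun j => RtoC (2 * Re (P (w j))) * cis (- INR n * th j))%C N.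
{ rewrite -S1. replace (csum (fun j => P (w j) * cis (- INR n * th j))%C N) with
   (csum (fun j => P (w j) * cis (- INR n * th j))%C N + Cconj (csum (fun j => P (w j) * cis (INR n * th j))%C N))%C; last first.
  { rewrite S2. unfold Cconj, RtoC, Cplus. simpl. destruct (csum _ N). simpl. f_equal; ring. }
  rewrite Conj -csum_plus. apply csum_ext => j _.
  replace (- INR n * th j) with (- (INR n * th j)) by ring. rewrite cis_opp Cmult_conj.
  destruct (P (w j)). unfold Cconj, RtoC, Cmult, Cplus. simpl. f_equal; ring. }
have S5 : rsum (fun j => Re (P (w j))) N = 0.
{ have E : forall f M, Re (csum f M) = rsum (fun j => Re (f j)) M.
  { move=> f M. elim: M => [//|M IH]. change (Re (csum f M + f M)%C = rsum (fun j => Re (f j)) M + Re (f M)). by rewrite Re_plus IH. }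
  by rewrite -E S3. }
have Main : INR N * (Cmod (g n) * r ^ n) <= INR N * (4 * A).
{ have -> : INR N * (Cmod (g n) * r ^ n) = Cmod (RtoC (INR N) * (g n * RtoC (r ^ n)))%C.
  { rewrite !Cmod_mult !Cmod_R (Rabs_right (INR N)) ?(Rabs_right (r ^ n)) //; [apply Rle_ge, pow_le; lra|lra]. }
  rewrite S4. eapply Rle_trans; [apply Cmod_csum_le|].
  (* Re P <= A implies |2 Re P| <= 4 A - 2 Re P, and Re P has mean 0 because the constant
     coefficient vanishes. *)
  apply Rle_trans with (rsum (fun j => 4 * A - 2 * Re (P (w j))) N).
  - apply rsum_le => j _. rewrite Cmod_mult Cmod_cis Cmod_R Rmult_1_r.
    have h : Re (P (w j)) <= A := HP (w j) (Hw j). apply Rabs_le. lra.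
  - rewrite rsum_minus rsum_const rsum_scal S5. lra. }
apply Rmult_le_reg_l with (INR N) => //.
Qed.

(** The Taylor polynomials converge uniformly on the circle; the truncation error is charged to the
    bound as A + eps / 4. *)
Lemma borel_caratheodory f p h g M r A : PS_at f p h g M -> g O = 0%C -> 0 < r < h -> 0 <= A ->
  (forall z, Cmod (z - p)%C = r -> Re (f z) <= A) -> forall n, (1 <= n)%nat -> Cmod (g n) * r ^ n <= 4 * A.
Proof.
move=> [Hg Hf] Hg0 Hr HA HRe n Hn. apply le_epsilon => eps He.
have HM : 0 <= M by have := Hg O; have := Cmod_ge_0 (g O); simpl; lra.
set s := r / h.
have Hs : 0 <= s < 1.
{ split; [apply Rdiv_le_0_compat; lra|]. apply Rmult_lt_reg_r with h; [lra|]. unfold s, Rdiv. rewrite Rmult_assoc Rinv_l; lra. }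
have [T [_ [HT HL]]] := rsum_bounded_lim (fun n => M * s ^ n) (M * / (1 - s)) ltac:(move=> k; apply Rmult_le_pos => //; apply pow_le; lra)
  ltac:(move=> k; rewrite rsum_scal; apply Rmult_le_compat_l => //; apply rsum_geom_le; lra).
move/is_lim_seq_eps: (HT) => /(_ (eps / 4) ltac:(lra)) [N HN].
set K := (N + n + 1)%nat.
replace (4 * A + eps) with (4 * (A + eps / 4)) by field.
apply (borel_caratheodory_poly g K r (A + eps / 4)) => //; [lra|lra| |unfold K; lia].
move=> w Hw. set z := (p + w)%C. have Ez : (z - p)%C = w by unfold z; ring.
have B : forall k, Cmod (g k * w ^ k)%C <= M * s ^ k.
{ move=> k. rewrite Cmod_mult Cmod_pow Hw. have P : 0 < h ^ k by apply pow_lt; lra.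
  replace (r ^ k) with (h ^ k * s ^ k); [|rewrite -Rpow_mult_distr; f_equal; unfold s; field; lra].
  rewrite -Rmult_assoc. apply Rmult_le_compat_r => //. apply pow_le; lra. }
have [_ C2] := csum_majorant _ _ T B HT. have L := Hf z ltac:(rewrite Ez Hw; lra). rewrite Ez in L.
rewrite (clim_Clim _ _ L) in C2. have D := C2 K. have HK := HN K ltac:(unfold K; lia). have HLK := HL K.
rewrite Rabs_left1 in HK; [|lra].
have R1 := HRe z ltac:(by rewrite Ez). have R2 := re_le_Cmod (f z - csum (fun n => g n * w ^ n)%C K)%C.
rewrite Re_minus in R2. have := Rabs_le_between (Re (f z) - Re (csum (fun n => g n * w ^ n)%C K)) (eps / 4). lra.
Qed.

Lemma cderiv_C_derive f z : cdiff f z -> cderiv f z (C_derive f z).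
Proof. move=> [l Hl]. by rewrite (is_C_derive_unique _ _ _ (proj1 (cderiv_is_derive _ _ _) Hl)). Qed.

Lemma cderiv_zero_const f p r z : (forall w, Cmod (w - p)%C < r -> cderiv f w 0%C) -> Cmod (z - p)%C < r -> f z = f p.
Proof.
move=> H Hz. have P := Cmod_ge_0 (z - p)%C.
have := MVT_C (fun t => f (p + RtoC t * (z - p))%C) (fun t => 0 * (z - p))%C 0 1 0 ltac:(lra).
replace (p + RtoC 1 * (z - p))%C with z by ring. replace (p + RtoC 0 * (z - p))%C with p by ring.
move=> K. have E : Cmod (f z - f p)%C = 0.
{ apply Rle_antisym; [|apply Cmod_ge_0]. rewrite -(Rmult_0_l (1 - 0)). apply K.
  - move=> t Ht. apply (rderiv_cderiv f (fun t => p + RtoC t * (z - p))%C); [apply rderiv_line|]. apply H.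
    replace (p + RtoC t * (z - p) - p)%C with (RtoC t * (z - p))%C by ring. rewrite Cmod_mult Cmod_R Rabs_right; nra.
  - move=> t _. rewrite Cmult_0_l Cmod_0. lra. }
apply Cmod_eq_0 in E. replace (f z) with ((f z - f p) + f p)%C by ring. rewrite E. ring.
Qed.

(** * Local logarithms and the growth of 1 / zeta *)

(** The Taylor series of f' / f is integrated term by term into G, and f exp(- G) has derivative 0.
    Only the moduli are compared, since the bounds on 1 / zeta concern nothing else. *)
Lemma log_PS (U : C -> Prop) f p h : copen U -> 0 < h -> on_sq U p h -> (forall z, U z -> cdiff f z /\ f z <> 0%C) ->
  exists G g M, PS_at G p h g M /\ g O = 0%C /\ forall z, Cmod (z - p)%C < h -> Cmod (f z) = Cmod (f p) * exp (Re (G z)).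
Proof.
move=> HU Hh Hsq Hf. set Q := fun z => (C_derive f z / f z)%C.
have HQ : forall z, U z -> cdiff Q z.
{ move=> z Hz. have [f1 f2] := Hf z Hz. have [r [Hr Kr]] := HU z Hz. apply cdiff_div => //.
  apply (cderiv_cdiff f _ z r) => // w Hw. by apply cderiv_C_derive, Hf, Kr. }
have [q [M [Hq HQs]]] := taylor_sq Q p h Hh (fun z h1 h2 => HQ z (Hsq z h1 h2)).
have HM : 0 <= M by have := Hq O; have := Cmod_ge_0 (q O); simpl; lra.
set g := fun n => match n return C with O => RtoC 0 | S m => (q m / RtoC (INR (S m)))%C end.
have Nz : forall m, RtoC (INR (S m)) <> 0%C by move=> m; apply RtoC_neq_0, Rgt_not_eq, INR_S_pos.
have Hg : forall n, Cmod (g n) * h ^ n <= M * h.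
{ case=> [|m]; [rewrite /= Cmod_0; nra|]. unfold g. rewrite Cmod_div // Cmod_R Rabs_right; [|apply Rle_ge, Rlt_le, INR_S_pos].
  have P := INR_S_ge1 m. have Pq := Cmod_ge_0 (q m). have Ph : 0 < h ^ m by apply pow_lt.
  apply Rle_trans with (Cmod (q m) * h ^ m * h); [|apply Rmult_le_compat_r; [lra|done]].
  have : Cmod (q m) / INR (S m) <= Cmod (q m). { apply Rmult_le_reg_r with (INR (S m)); [lra|]. unfold Rdiv. rewrite Rmult_assoc Rinv_l; nra. }
  move=> k. change (h ^ S m) with (h * h ^ m). have : 0 < h * h ^ m by nra. nra. }
set G := fun z => Clim (csum (fun n => g n * (z - p) ^ n)%C).
have HG : PS_at G p h g (M * h) by split=> // z Hz; apply: PS_conv Hh Hg Hz.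
have DG : forall z, Cmod (z - p)%C < h -> cderiv G z (Q z).
{ move=> z Hz. have D := PS_cderiv _ _ _ _ _ z HG Hz. suff <- : PS_deriv g (z - p)%C = Q z by [].
  apply clim_Clim. apply: clim_ext (HQs z Hz) => n. apply csum_ext => k _. unfold g. field. apply Nz. }
exists G, g, (M * h). split=> //. split=> //. move=> z Hz.
have InU : forall w, Cmod (w - p)%C < h -> U w.
{ move=> w Hw. apply Hsq; rewrite -?fst_Cminus -?snd_Cminus; [have := Rabs_fst_le (w - p)%C|have := Rabs_snd_le (w - p)%C]; lra. }
have E : (f z * Cexp (- G z))%C = (f p * Cexp (- G p))%C.
{ apply (cderiv_zero_const (fun z => f z * Cexp (- G z))%C p h z) => // w Hw.
  have [f1 f2] := Hf w (InU w Hw). have D1 := cderiv_C_derive f w f1.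
  have D2 := cderiv_comp Cexp (fun z => - G z)%C w _ _ (cderiv_opp _ _ _ (DG w Hw)) (cderiv_Cexp _).
  have D := cderiv_mult _ _ _ _ _ D1 D2. simpl in D.
  suff <- : (C_derive f w * Cexp (- G w) + f w * (Cexp (- G w) * - Q w))%C = 0%C by []. unfold Q. field. done. }
have G0 : G p = 0%C.
{ unfold G. apply clim_Clim. replace (p - p)%C with (RtoC 0) by ring.
  apply (clim_ext (fun _ => 0%C)); [|apply clim_const]. move=> n.
  rewrite (csum_ext _ (fun _ => 0%C)); [by rewrite csum_const Cmult_0_r|]. case=> [|k] _; unfold g; simpl; ring. }
rewrite G0 in E. replace (- 0)%C with (RtoC 0) in E by ring. rewrite Cexp_0 Cmult_1_r in E.
rewrite -E Cmod_mult Cmod_Cexp Re_opp Rmult_assoc -exp_plus.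
replace (- Re (G z) + Re (G z)) with 0 by ring. rewrite exp_0. ring.
Qed.

(* The factor (s - 1) / (s + 1) removes the pole and is bounded by 1, so that Yf is bounded to the right of Re s = 2. *)
Definition Yf (s : C) : C := (Zf s / (s + 1))%C.

Lemma Cplus1_neq_0 (s : C) : 0 < Re s -> (s + 1)%C <> 0%C.
Proof. move=> H E. have : Re (s + 1)%C = 0 by rewrite E. rewrite Re_plus Re_RtoC. lra. Qed.

Lemma Cminus1_neq_0 (s : C) : 1 < Re s -> (s - 1)%C <> 0%C.
Proof. move=> H E. have : Re (s - 1)%C = 0 by rewrite E. rewrite Re_minus Re_RtoC. lra. Qed.

Lemma Cmod_minus1_plus1 (s : C) : 0 <= Re s -> Cmod (s - 1)%C <= Cmod (s + 1)%C.
Proof.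
move=> H. apply Rsqr_incr_0_var; [|apply Cmod_ge_0]. unfold Rsqr. rewrite !Cmod_sqr. destruct s as [x y]. simpl in *. nra.
Qed.

Lemma Yf_zeta (s : C) : 1 < Re s -> Yf s = (Zf s / (s - 1) * ((s - 1) / (s + 1)))%C.
Proof. move=> H. unfold Yf. field. split; [apply Cplus1_neq_0; lra|by apply Cminus1_neq_0]. Qed.

Lemma Yf_le_2 (s : C) : 2 <= Re s -> Cmod (Yf s) <= 2.
Proof.
move=> Hs. rewrite Yf_zeta; [|lra]. rewrite Cmod_mult (Cmod_div (s - 1)%C (s + 1)%C); [|apply Cplus1_neq_0; lra].
have P : 0 < Cmod (s + 1)%C by apply Cmod_gt_0, Cplus1_neq_0; lra.
have Q : Cmod (s - 1)%C / Cmod (s + 1)%C <= 1.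
{ apply Rmult_le_reg_r with (Cmod (s + 1)%C) => //. unfold Rdiv. rewrite Rmult_assoc Rinv_l; [|lra]. have := Cmod_minus1_plus1 s. lra. }
have Z : Cmod (Zf s / (s - 1))%C <= 2.
{ apply (clim_bound _ _ _ (dirichlet_zeta s ltac:(lra))). exists O => n _. eapply Rle_trans; [apply Cmod_csum_le|].
  have B := rsum_Rpower_le 1 n ltac:(lra). replace (1 + / 1) with 2 in B by field. eapply Rle_trans; [|apply B].
  apply rsum_le => k _. rewrite Cmod_Rcpower Re_opp. apply Rle_Rpower; [apply INR_S_ge1|lra]. }
have P0 : 0 <= Cmod (s - 1)%C / Cmod (s + 1)%C by apply Rdiv_le_0_compat => //; apply Cmod_ge_0.
have := Cmod_ge_0 (Zf s / (s - 1))%C. nra.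
Qed.

(** 1 / 3 = (1 / 2) (2 / 3): the series of [mu] gives |1 / zeta| <= 2, and |(s - 1) / (s + 1)| >= 4
    / 6 on Re s = 5. *)
Lemma Yf_lower (s : C) : Re s = 5 -> 1 / 3 <= Cmod (Yf s).
Proof.
move=> Hs. rewrite Yf_zeta; [|lra]. have [L [HL [LB _]]] := mu_partial_limit s ltac:(lra). have E := mu_zeta s L ltac:(lra) HL.
have P : 0 < Cmod (s + 1)%C by apply Cmod_gt_0, Cplus1_neq_0; lra.
have Z : 1 / 2 <= Cmod (Zf s / (s - 1))%C.
{ have : Cmod L * Cmod (Zf s / (s - 1))%C = 1 by rewrite -Cmod_mult E Cmod_1. have := Cmod_ge_0 (Zf s / (s - 1))%C. have := Cmod_ge_0 L. nra. }
have Q : 2 / 3 <= Cmod ((s - 1) / (s + 1))%C.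
{ rewrite Cmod_div; [|apply Cplus1_neq_0; lra]. apply Rmult_le_reg_r with (Cmod (s + 1)%C) => //. unfold Rdiv at 2. rewrite Rmult_assoc Rinv_l; [|lra]. rewrite Rmult_1_r.
  apply Rsqr_incr_0_var; [|apply Cmod_ge_0]. unfold Rsqr.
  replace (2 / 3 * Cmod (s + 1)%C * (2 / 3 * Cmod (s + 1)%C)) with (4 / 9 * (Cmod (s + 1)%C * Cmod (s + 1)%C)) by field.
  rewrite !Cmod_sqr. destruct s as [x y]. simpl in *. subst x. have := Rle_0_sqr y. unfold Rsqr. nra. }
rewrite Cmod_mult. nra.
Qed.

Lemma Yf_growth (s : C) : 1 / 2 <= Re s -> Cmod (Yf s) <= 4 * (1 + Cmod s) ^ 2.
Proof.
move=> Hs. have P := Cmod_ge_0 s. have B := Zf_bound s ltac:(lra). have M := Cmod_sub_1_le s. have P1 := Cmod_ge_0 (s - 1)%C.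
have H1 : 1 <= Cmod (s + 1)%C. { have K := re_le_Cmod (s + 1)%C. rewrite Re_plus Re_RtoC Rabs_right in K; lra. }
unfold Yf. rewrite Cmod_div; [|apply Cplus1_neq_0; lra].
apply Rmult_le_reg_r with (Cmod (s + 1)%C); [lra|]. unfold Rdiv. rewrite Rmult_assoc Rinv_l; [|lra]. rewrite Rmult_1_r.
have I : / Re s <= 2. { rewrite -(Rinv_inv 2). apply Rinv_le_contravar; lra. }
have I0 : 0 < / Re s by apply Rinv_0_lt_compat; lra.
have P2 : 0 <= Cmod (s - 1)%C * Cmod s by nra.
have : Cmod (Zf s) <= 1 + (Cmod s + 1) * Cmod s * 3 by nra. nra.
Qed.

Lemma Cmod_cplane (x y : R) : Cmod (x, y) <= Rabs x + Rabs y.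
Proof. apply (Cmod_le_1 (x, y)). Qed.

Lemma rsum_geom_tail q N K : 0 <= q < 1 -> (N <= K)%nat -> rsum (fun k => q ^ (N + k)) (K - N) <= q ^ N * / (1 - q).
Proof.
move=> Hq HN. rewrite (rsum_ext _ (fun k => q ^ N * q ^ k)); [|move=> k _; by rewrite pow_add].
rewrite rsum_scal. apply Rmult_le_compat_l; [apply pow_le; lra|by apply rsum_geom_le].
Qed.

(* Coefficients are bounded both on a fixed disc to the right of the critical strip, uniformly in t, and on a large disc,
   with a factor log t; splitting the series far enough makes the coefficient of log t arbitrarily small. *)
Lemma Yf_inv_bound (HZ : forall s : C, 1 / 2 < Re s -> Zf s <> 0%C) (d eta : R) : 0 < d < 1 -> 0 < eta ->
  exists K, 0 < K /\ forall x t, 1 / 2 + d <= x <= 5 -> / Cmod (Yf (x, t)) <= K * Rpower (16 + Rabs t) eta.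
Proof.
move=> Hd Heta.
(* About 5 + i t the radius [r] reaches the line Re s = 1 / 2 + d. [R0], for the circle in
   Borel-Caratheodory, and [h], for the power series, are larger but stay below the distance 9 / 2
   to the line Re s = 1 / 2. *)
set r := 9 / 2 - d. set R0 := 9 / 2 - d / 2. set h := 9 / 2 - d / 4.
set q := r / R0. have HR0 : 0 < R0 by unfold R0; lra.
have Hq : 0 <= q < 1.
{ split; [apply Rdiv_le_0_compat; unfold r; lra|]. apply Rmult_lt_reg_r with R0; [lra|]. unfold q, Rdiv. rewrite Rmult_assoc Rinv_l; unfold r, R0 in *; lra. }
have Hq1 : 0 < / (1 - q) by apply Rinv_0_lt_compat; lra.
(* The factor 8 = 4 * 2 combines the 4 of Borel-Caratheodory with the quadratic growth of [Yf]: it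
   is the resulting coefficient of ln(16 + |t|). *)
have [N HN] : exists N, 8 * (q ^ N * / (1 - q)) <= eta.
{ have /is_lim_seq_eps L := pow_lim0 q Hq. destruct (L (eta / (8 * / (1 - q)))) as [N K]; [apply Rdiv_lt_0_compat; lra|].
  exists N. have := K N (Nat.le_refl _). have P : 0 <= q ^ N by apply pow_le; lra. rewrite Rminus_0_r Rabs_right; [|lra]. move=> k.
  replace (8 * (q ^ N * / (1 - q))) with (q ^ N * (8 * / (1 - q))) by ring.
  replace eta with (eta / (8 * / (1 - q)) * (8 * / (1 - q))) by (field; lra). apply Rmult_le_compat_r; lra. }
set C0 := rsum (fun n => 4 * ln 6 * (r / 3) ^ n) N.
set B0 := ln 3 + C0 + eta / 2 * ln 12.
exists (exp B0). split; [apply exp_pos|]. move=> x t Hx.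
set p := (5, t) : C. set s := (x, t) : C.
have Pt := Rabs_pos t.
set U := fun z : C => 1 / 2 < Re z.
have [G [g [M [HG [Hg0 HY]]]]] : exists G g M, PS_at G p h g M /\ g O = 0%C /\ forall z, Cmod (z - p)%C < h -> Cmod (Yf z) = Cmod (Yf p) * exp (Re (G z)).
{ apply (log_PS U); [apply Re_copen|unfold h; lra| |].
  - move=> z h1 h2. unfold U. simpl in h1. apply Rabs_le_between in h1. unfold h in h1. change (Re z) with (fst z). lra.
  - move=> z Hz. unfold U in Hz. have N1 := Cplus1_neq_0 z ltac:(lra). split.
    + apply cdiff_div => //; [apply cdiff_Zf; lra|]. apply cdiff_plus; [apply cdiff_id|apply cdiff_const].
    + unfold Yf. apply Cmult_neq_0; [by apply HZ|by apply Cinv_neq_0]. }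
have Yp : 1 / 3 <= Cmod (Yf p) by apply Yf_lower.
have ReG : forall z B, 0 < B -> Cmod (z - p)%C < h -> Cmod (Yf z) <= B -> Re (G z) <= ln (3 * B).
{ move=> z B HB Hz HB2. have E := HY z Hz. have Pe := exp_pos (Re (G z)).
  have : exp (Re (G z)) <= 3 * B by nra. move=> k. rewrite -(ln_exp (Re (G z))). by apply ln_le. }
set AR := ln (3 * (4 * (16 + Rabs t) ^ 2)).
have L6 : 0 <= ln 6 by rewrite -ln_1; apply ln_le; lra.
have PAR : 0 <= AR. { unfold AR. rewrite -ln_1. apply ln_le; [lra|]. nra. }
(* On the circle of radius 3 one has Re s >= 2 and |Yf| <= 2; relative to |Yf p| >= 1 / 3 this gives
   the quotient 6. *)
have BC1 : forall n, (1 <= n)%nat -> Cmod (g n) * 3 ^ n <= 4 * ln 6.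
{ apply (borel_caratheodory G p h g M 3) => //; [unfold h; lra|]. move=> z Hz. replace 6 with (3 * 2) by ring. apply ReG; [lra|unfold h; lra|].
  apply Yf_le_2. have A := re_le_Cmod (z - p)%C. rewrite Re_minus in A. change (Re p) with 5 in A. rewrite Hz in A. apply Rabs_le_between in A. lra. }
have BC2 : forall n, (1 <= n)%nat -> Cmod (g n) * R0 ^ n <= 4 * AR.
{ apply (borel_caratheodory G p h g M R0) => //; [unfold R0, h; lra|]. move=> z Hz. apply ReG; [nra|unfold R0, h in *; lra|].
  have A := re_le_Cmod (z - p)%C. rewrite Re_minus in A. change (Re p) with 5 in A. rewrite Hz in A. apply Rabs_le_between in A.
  eapply Rle_trans; [apply Yf_growth; unfold R0 in A; lra|].
  have T := Cmod_triangle_rev z p. rewrite Hz in T. have Tp := Cmod_cplane 5 t. fold p in Tp. rewrite (Rabs_right 5) in Tp; [|lra].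
  apply Rmult_le_compat_l; [lra|]. apply pow_incr. have := Cmod_ge_0 z. unfold R0 in T. lra. }
have Esp : (s - p)%C = RtoC (x - 5). { unfold s, p, Cminus, Cplus, Copp, RtoC. simpl. f_equal; ring. }
have Hsp : Cmod (s - p)%C <= r. { rewrite Esp Cmod_R Rabs_left1; unfold r; lra. }
have GB : Cmod (G s) <= C0 + 4 * AR * (q ^ N * / (1 - q)).
{ have L := proj2 HG s ltac:(unfold r, h in *; lra). apply (clim_bound _ _ _ L). exists N => K HK.
  eapply Rle_trans; [apply Cmod_csum_le|]. rewrite (rsum_split _ N K) //.
  have T1 : forall n, Cmod (g n * (s - p) ^ n)%C <= Cmod (g n) * r ^ n.
  { move=> n. rewrite Cmod_mult Cmod_pow. apply Rmult_le_compat_l; [apply Cmod_ge_0|]. apply pow_incr. split; [apply Cmod_ge_0|done]. }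
  have Pr : 0 < r by unfold r; lra.
  apply Rplus_le_compat.
  - apply rsum_le => n _. eapply Rle_trans; [apply T1|]. have P3 : 0 < 3 ^ n by apply pow_lt; lra.
    have E : r ^ n = 3 ^ n * (r / 3) ^ n by rewrite -Rpow_mult_distr; f_equal; field.
    rewrite E -Rmult_assoc. apply Rmult_le_compat_r; [apply pow_le; lra|]. destruct n; [rewrite Hg0 Cmod_0; lra|apply BC1; lia].
  - apply Rle_trans with (rsum (fun k => 4 * AR * q ^ (N + k)) (K - N)).
    + apply rsum_le => k _. eapply Rle_trans; [apply T1|].
      have E : r ^ (N + k) = R0 ^ (N + k) * q ^ (N + k) by rewrite -Rpow_mult_distr; f_equal; unfold q; field; lra.
      rewrite E -Rmult_assoc. apply Rmult_le_compat_r; [apply pow_le; lra|].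
      destruct (N + k)%nat eqn:En; [rewrite Hg0 Cmod_0; lra|apply BC2; lia].
    + rewrite rsum_scal. apply Rmult_le_compat_l; [lra|]. by apply rsum_geom_tail. }
have EY := HY s ltac:(unfold r, h in *; lra).
have ReB : - (C0 + eta / 2 * AR) <= Re (G s).
{ have A := re_le_Cmod (G s). apply Rabs_le_between in A. nra. }
have EAR : AR = ln 12 + 2 * ln (16 + Rabs t).
{ unfold AR. replace (3 * (4 * (16 + Rabs t) ^ 2)) with (12 * ((16 + Rabs t) * (16 + Rabs t))) by ring.
  rewrite ln_mult; [|lra|nra]. rewrite ln_mult; lra. }
have E2 : exp B0 * Rpower (16 + Rabs t) eta = 3 * exp (C0 + eta / 2 * AR).
{ unfold Rpower. rewrite -exp_plus -(exp_ln 3); [|lra]. rewrite -exp_plus. f_equal. rewrite EAR. unfold B0. field. }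
rewrite E2 EY Rinv_mult -exp_Ropp. apply Rmult_le_compat.
- apply Rlt_le, Rinv_0_lt_compat. lra.
- apply Rlt_le, exp_pos.
- rewrite -(Rinv_inv 3). apply Rinv_le_contravar; lra.
- apply exp_le. lra.
Qed.

(** * Perron's formula *)

Lemma RectI_cauchy F (z : C) a b c d : (forall w, cdiff F w) -> a < fst z < b -> c < snd z < d ->
  RectI (fun w => F w / (w - z))%C a b c d = (twopii * F z)%C.
Proof.
move=> HF Ha Hc. set e := Rmin (Rmin (fst z - a) (b - fst z)) (Rmin (snd z - c) (d - snd z)).
have He : 0 < e by unfold e; repeat apply Rmin_glb_lt; lra.
have M1 : e <= Rmin (fst z - a) (b - fst z) by apply Rmin_l. have M2 : e <= Rmin (snd z - c) (d - snd z) by apply Rmin_r.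
have M3 := Rmin_l (fst z - a) (b - fst z). have M4 := Rmin_r (fst z - a) (b - fst z).
have M5 := Rmin_l (snd z - c) (d - snd z). have M6 := Rmin_r (snd z - c) (d - snd z).
rewrite (RectI_shrink _ z _ _ _ _ e); try lra.
- apply (Cauchy_formula_cdiff F z e He (fun w _ _ => HF w)); rewrite Rminus_diag Rabs_R0; lra.
- move=> w _ _ Hw. apply cdiff_div => //; [|by apply Csub_neq_0]. apply cdiff_minus; [apply cdiff_id|apply cdiff_const].
Qed.

(** The decay |s|^(-2) makes the vertical integrals converge absolutely. The residues y at 0 and -1
    at -1 add up to y - 1. *)
Definition perron_kernel (y : R) (s : C) : C := (Rcpower y (s + 1) / (s * (s + 1)))%C.

Lemma Cneq_im (s z : C) : snd s <> snd z -> s <> z.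
Proof. by move=> H E; apply H; rewrite E. Qed.

Lemma Cneq_re (s z : C) : fst s <> fst z -> s <> z.
Proof. by move=> H E; apply H; rewrite E. Qed.

Lemma cdiff_perron_kernel y (s : C) : s <> 0%C -> (s + 1)%C <> 0%C -> cdiff (perron_kernel y) s.
Proof.
move=> H1 H2. unfold perron_kernel. have D : cdiff (fun s => s + 1)%C s by apply cdiff_plus; [apply cdiff_id|apply cdiff_const].
apply cdiff_div; [by apply cdiff_Rcpower|apply cdiff_mult => //; apply cdiff_id|by apply Cmult_neq_0].
Qed.

Lemma Cmod_fst_snd_ge (s : C) m : m <= Rabs (fst s) \/ m <= Rabs (snd s) -> m <= Cmod s.
Proof. have := Rabs_fst_le s. have := Rabs_snd_le s. lra. Qed.

Lemma perron_kernel_bound y (s : C) m B : 0 < m -> Cmod (Rcpower y (s + 1)%C) <= B -> m <= Cmod s -> m <= Cmod (s + 1)%C ->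
  Cmod (perron_kernel y s) <= B / m ^ 2.
Proof.
move=> Hm HB H1 H2. unfold perron_kernel.
have N1 : s <> 0%C by apply Cmod_gt_0; lra. have N2 : (s + 1)%C <> 0%C by apply Cmod_gt_0; lra.
rewrite Cmod_div; [|by apply Cmult_neq_0]. rewrite Cmod_mult. unfold Rdiv.
apply Rmult_le_compat => //; [apply Cmod_ge_0|apply Rlt_le, Rinv_0_lt_compat; nra|].
apply Rinv_le_contravar; [nra|]. simpl. nra.
Qed.

Lemma CI_ver_bound f x T M : 0 <= T -> (forall t, - T <= t <= T -> cdiff f (x, t)) ->
  (forall t, - T <= t <= T -> Cmod (f (x, t)) <= M) -> Cmod (CI (fun t => f (x, t)) (- T) T) <= M * (2 * T).
Proof.
move=> HT Hf HM. replace (M * (2 * T)) with (M * (T - - T)) by ring. apply CI_bound; [lra| |move=> t Ht; apply HM; lra].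
apply exCI_cont; [lra|]. move=> t Ht. by apply (rcont_ver f), ccont_cdiff, Hf.
Qed.

Lemma CI_hor_bound f y a b M : a <= b -> (forall t, a <= t <= b -> cdiff f (t, y)) ->
  (forall t, a <= t <= b -> Cmod (f (t, y)) <= M) -> Cmod (CI (fun t => f (t, y)) a b) <= M * (b - a).
Proof.
move=> Hab Hf HM. apply CI_bound => //; [|move=> t Ht; apply HM; lra].
apply exCI_cont => // t Ht. by apply (rcont_hor f), ccont_cdiff, Hf.
Qed.

Lemma Cmod_Rcpower_le1 y s : 0 < y <= 1 -> 0 <= Re s -> Cmod (Rcpower y s) <= 1.
Proof. move=> Hy Hs. rewrite Cmod_Rcpower -(Rpower_base_1 (Re s)). by apply Rpower_mono. Qed.

Lemma Cmod_Rcpower_base_ge1 y s : 1 <= y -> Re s <= 0 -> Cmod (Rcpower y s) <= 1.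
Proof. move=> Hy Hs. rewrite Cmod_Rcpower -(Rpower_base_1 (Re s)). apply Rpower_anti; lra. Qed.

Lemma Cmod_Ci_mult z : Cmod (Ci * z)%C = Cmod z.
Proof. by rewrite Cmod_mult Cmod_Ci Rmult_1_l. Qed.

(** The abscissa 4 puts s + 1 on the line Re = 5, where the series of [mu] converges absolutely. *)
Definition perron_int (y T : R) : C := CI (fun t => perron_kernel y (4, t)) (- T) T.

(** The contour is closed on the right at abscissa [B], where |y^(s+1)| <= 1 and no pole is
    enclosed. *)
Lemma perron_le1 y T B : 0 < y <= 1 -> 1 <= T -> 4 <= B ->
  Cmod (perron_int y T) <= 2 * T / B ^ 2 + 2 * (B - 4) / T ^ 2.
Proof.
move=> Hy HT HB.
have D : forall s : C, 4 <= fst s -> cdiff (perron_kernel y) s.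
{ move=> s Hs. apply cdiff_perron_kernel; apply Cneq_re; destruct s; simpl in *; lra. }
have E := Goursat (perron_kernel y) 4 B (- T) T ltac:(lra) ltac:(lra) (fun x t Hx _ => D (x, t) (proj1 Hx)).
unfold RectI in E. fold (perron_int y T) in E.
have N1 : forall s : C, 4 <= fst s -> Cmod (Rcpower y (s + 1)%C) <= 1.
{ move=> s Hs. apply Cmod_Rcpower_le1 => //. rewrite Re_plus Re_RtoC. unfold Re. lra. }
have H1 : Cmod (CI (fun x => perron_kernel y (x, (- T)%R)) 4 B) <= 1 / T ^ 2 * (B - 4).
{ apply (CI_hor_bound (perron_kernel y)) => // t Ht; [apply D; simpl; lra|].
  apply perron_kernel_bound; [lra|apply N1; simpl; lra|..]; apply Cmod_fst_snd_ge; right; simpl; rewrite Rabs_left1; lra. }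
have H2 : Cmod (CI (fun x => perron_kernel y (x, T)) 4 B) <= 1 / T ^ 2 * (B - 4).
{ apply (CI_hor_bound (perron_kernel y)) => // t Ht; [apply D; simpl; lra|].
  apply perron_kernel_bound; [lra|apply N1; simpl; lra|..]; apply Cmod_fst_snd_ge; right; simpl; rewrite Rabs_right; lra. }
have H3 : Cmod (CI (fun t => perron_kernel y (B, t)) (- T) T) <= 1 / B ^ 2 * (2 * T).
{ apply (CI_ver_bound (perron_kernel y)); [lra|move=> t _; apply D; simpl; lra|]. move=> t _.
  apply perron_kernel_bound; [lra|apply N1; simpl; lra|..]; apply Cmod_fst_snd_ge; left; simpl; rewrite Rabs_right; lra. }
have E2 : (Ci * perron_int y T)%C = (CI (fun x => perron_kernel y (x, (- T)%R)) 4 B + Ci * CI (fun t => perron_kernel y (B, t)) (- T) T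
   - CI (fun x => perron_kernel y (x, T)) 4 B)%C.
{ replace (Ci * perron_int y T)%C with (0 + Ci * perron_int y T)%C by ring. rewrite -E. ring. }
rewrite -(Cmod_Ci_mult (perron_int y T)) E2.
eapply Rle_trans; [apply Cmod_triangle_sub|]. eapply Rle_trans; [apply Rplus_le_compat_r, Cmod_triangle|].
rewrite Cmod_mult Cmod_Ci. lra.
Qed.

(** Closing on the left encloses 0 and -1. The partial fractions 1 / s - 1 / (s + 1) reduce the
    residues to two instances of Cauchy's formula, with the values y and 1. *)
Lemma perron_ge1 y T B : 1 <= y -> 1 <= T -> 4 <= B ->
  Cmod (perron_int y T - RtoC (2 * PI * (y - 1)))%C <= 2 * T / (B - 1) ^ 2 + 2 * Rpower y 5 * (B + 4) / T ^ 2.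
Proof.
move=> Hy HT HB.
have Nz : forall s : C, (fst s <> 0 /\ fst s <> -1) \/ snd s <> 0 -> s <> 0%C /\ (s + 1)%C <> 0%C.
{ move=> s Hs. split; [case: Hs => Hs; [apply Cneq_re|apply Cneq_im]|case: Hs => Hs; [apply Cneq_re|apply Cneq_im]]; destruct s; simpl in *; lra. }
have D : forall s : C, (fst s <> 0 /\ fst s <> -1) \/ snd s <> 0 -> cdiff (perron_kernel y) s.
{ move=> s /Nz [h1 h2]. by apply cdiff_perron_kernel. }
set F := fun s => Rcpower y (s + 1)%C.
have DF : forall s, cdiff F s by move=> s; apply cdiff_Rcpower, cdiff_plus; [apply cdiff_id|apply cdiff_const].
have E0 := RectI_cauchy F (RtoC 0) (- B) 4 (- T) T DF ltac:(simpl; lra) ltac:(simpl; lra).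
have E1 := RectI_cauchy F (RtoC (- 1)) (- B) 4 (- T) T DF ltac:(simpl; lra) ltac:(simpl; lra).
have Fr : on_frame (fun s : C => (fst s <> 0 /\ fst s <> -1) \/ snd s <> 0) (- B) 4 (- T) T.
{ split=> t Ht; split; simpl; lra. }
have Cz : forall z : C, z = RtoC 0 \/ z = RtoC (- 1) -> on_frame (ccont (fun s => F s / (s - z))%C) (- B) 4 (- T) T.
{ move=> z Hz. apply: on_frame_impl Fr => s /Nz [h1 h2]. apply ccont_cdiff, cdiff_div => //.
  - apply cdiff_minus; [apply cdiff_id|apply cdiff_const].
  - apply Csub_neq_0. case: Hz => -> //. move=> Es. apply h2. rewrite Es -RtoC_plus. f_equal. ring. }
have E := RectI_minus _ _ (- B) 4 (- T) T ltac:(lra) ltac:(lra) (Cz _ (or_introl eq_refl)) (Cz _ (or_intror eq_refl)).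
rewrite E0 E1 in E.
have EF0 : F (RtoC 0) = RtoC y. { unfold F. rewrite -RtoC_plus Rcpower_RtoC. f_equal. rewrite Rplus_0_l Rpower_1; lra. }
have EF1 : F (RtoC (- 1)) = 1%C. { unfold F. rewrite -RtoC_plus Rcpower_RtoC. f_equal. replace (- 1 + 1) with 0 by ring. apply Rpower_O. lra. }
rewrite EF0 EF1 in E.
have E2 : RectI (perron_kernel y) (- B) 4 (- T) T = (twopii * RtoC y - twopii * 1)%C.
{ rewrite -E. apply RectI_ext; [lra|lra|]. apply: on_frame_impl Fr => s /Nz [h1 h2]. unfold perron_kernel. fold (F s).
  replace (s - RtoC 0)%C with s by ring. replace (s - RtoC (- 1))%C with (s + 1)%C by (destruct s; unfold Cminus, Cplus, Copp, RtoC; simpl; f_equal; ring). field. done. }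
unfold RectI in E2. fold (perron_int y T) in E2.
have Py := Rpower_pos y 5.
have N5 : forall s : C, fst s <= 4 -> Cmod (Rcpower y (s + 1)%C) <= Rpower y 5.
{ move=> s Hs. rewrite Cmod_Rcpower Re_plus Re_RtoC. apply Rle_Rpower => //. unfold Re. lra. }
have H1 : Cmod (CI (fun x => perron_kernel y (x, (- T)%R)) (- B) 4) <= Rpower y 5 / T ^ 2 * (4 - - B).
{ apply (CI_hor_bound (perron_kernel y)); [lra|move=> t Ht; apply D; simpl; lra|]. move=> t Ht.
  apply perron_kernel_bound; [lra|apply N5; simpl; lra|..]; apply Cmod_fst_snd_ge; right; simpl; rewrite Rabs_left1; lra. }
have H2 : Cmod (CI (fun x => perron_kernel y (x, T)) (- B) 4) <= Rpower y 5 / T ^ 2 * (4 - - B).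
{ apply (CI_hor_bound (perron_kernel y)); [lra|move=> t Ht; apply D; simpl; lra|]. move=> t Ht.
  apply perron_kernel_bound; [lra|apply N5; simpl; lra|..]; apply Cmod_fst_snd_ge; right; simpl; rewrite Rabs_right; lra. }
have H3 : Cmod (CI (fun t => perron_kernel y ((- B)%R, t)) (- T) T) <= 1 / (B - 1) ^ 2 * (2 * T).
{ apply (CI_ver_bound (perron_kernel y)); [lra|move=> t _; apply D; simpl; lra|]. move=> t _.
  apply perron_kernel_bound; [lra|apply Cmod_Rcpower_base_ge1 => //; simpl; lra|..]; apply Cmod_fst_snd_ge; left; simpl; rewrite Rabs_left1; lra. }
have Et : (twopii * RtoC y - twopii * 1)%C = (Ci * RtoC (2 * PI * (y - 1)))%C.
{ unfold twopii, Ci, RtoC, Cminus, Cplus, Copp, Cmult. simpl. f_equal; ring. }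
rewrite Et in E2.
have E3 : (Ci * (perron_int y T - RtoC (2 * PI * (y - 1))))%C = (CI (fun x => perron_kernel y (x, T)) (- B) 4 + Ci * CI (fun t => perron_kernel y ((- B)%R, t)) (- T) T
   - CI (fun x => perron_kernel y (x, (- T)%R)) (- B) 4)%C.
{ replace (Ci * (perron_int y T - RtoC (2 * PI * (y - 1))))%C with (Ci * perron_int y T - Ci * RtoC (2 * PI * (y - 1)))%C by ring. rewrite -E2. ring. }
rewrite -(Cmod_Ci_mult (perron_int y T - _)%C) E3.
eapply Rle_trans; [apply Cmod_triangle_sub|]. eapply Rle_trans; [apply Rplus_le_compat_r, Cmod_triangle|].
rewrite Cmod_mult Cmod_Ci. lra.
Qed.

(** With x = k + 1, heights T = x^2 and far sides at distance about x^3 make both T / B^2 and B /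
    T^2 tend to 0. *)
Definition Tseq (k : nat) : R := INR (S k) ^ 2.

Lemma clim_inv_bound u l K : 0 <= K -> (forall k, (3 <= k)%nat -> Cmod (u k - l)%C <= K * / INR (S k)) -> clim u l.
Proof.
move=> HK H eps He. have [N HN] := INR_unbounded ((K + 1) / eps). exists (max 3 N) => k Hk.
eapply Rle_lt_trans; [apply H; lia|]. have P := INR_S_pos k. have h : INR N <= INR (S k) by apply le_INR; lia.
apply Rmult_lt_reg_r with (INR (S k)) => //. rewrite Rmult_assoc Rinv_l; [|lra]. rewrite Rmult_1_r.
have : (K + 1) / eps * eps < INR (S k) * eps by apply Rmult_lt_compat_r; lra.
unfold Rdiv. rewrite Rmult_assoc Rinv_l; lra.
Qed.

Lemma perron_limit y : 0 < y -> clim (fun k => perron_int y (Tseq k)) (RtoC (2 * PI * Rmax (y - 1) 0)).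
Proof.
move=> Hy. have X : forall k, (3 <= k)%nat -> 4 <= INR (S k).
{ move=> k Hk. have -> : 4 = INR 4 by simpl; ring. apply le_INR. lia. }
destruct (Rle_dec y 1) as [H1|H1].
- rewrite Rmax_right; [|lra]. rewrite Rmult_0_r. apply (clim_inv_bound _ _ 4); [lra|]. move=> k Hk. have Hx := X k Hk. set x := INR (S k) in Hx *.
  replace (perron_int y (Tseq k) - 0)%C with (perron_int y (Tseq k)) by ring.
  eapply Rle_trans; [apply (perron_le1 y _ (4 + x ^ 3)); unfold Tseq; fold x; [lra|nra|have : 0 < x ^ 3 by apply pow_lt; lra]; lra|].
  unfold Tseq. fold x. have P3 : 0 < x ^ 3 by apply pow_lt; lra.
  have A : 2 * x ^ 2 / (4 + x ^ 3) ^ 2 <= 2 * / x.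
  { apply Rmult_le_reg_r with ((4 + x ^ 3) ^ 2 * x); [nra|]. replace (2 * x ^ 2 / (4 + x ^ 3) ^ 2 * ((4 + x ^ 3) ^ 2 * x)) with (2 * x ^ 3) by (field; lra).
    replace (2 * / x * ((4 + x ^ 3) ^ 2 * x)) with (2 * (4 + x ^ 3) ^ 2) by (field; lra). nra. }
  have B : 2 * (4 + x ^ 3 - 4) / (x ^ 2) ^ 2 = 2 * / x by field; lra. lra.
- rewrite Rmax_left; [|lra]. have Py := Rpower_pos y 5.
  apply (clim_inv_bound _ _ (2 + 4 * Rpower y 5)); [lra|]. move=> k Hk. have Hx := X k Hk. set x := INR (S k) in Hx *.
  have P3 : 0 < x ^ 3 by apply pow_lt; lra.
  eapply Rle_trans; [apply (perron_ge1 y _ (4 + x ^ 3)); unfold Tseq; fold x; [lra|nra|lra]|].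
  unfold Tseq. fold x.
  have A : 2 * x ^ 2 / (4 + x ^ 3 - 1) ^ 2 <= 2 * / x.
  { apply Rmult_le_reg_r with ((4 + x ^ 3 - 1) ^ 2 * x); [nra|]. replace (2 * x ^ 2 / (4 + x ^ 3 - 1) ^ 2 * ((4 + x ^ 3 - 1) ^ 2 * x)) with (2 * x ^ 3) by (field; lra).
    replace (2 * / x * ((4 + x ^ 3 - 1) ^ 2 * x)) with (2 * (4 + x ^ 3 - 1) ^ 2) by (field; lra). nra. }
  have B : 2 * Rpower y 5 * (4 + x ^ 3 + 4) / (x ^ 2) ^ 2 <= 4 * Rpower y 5 * / x.
  { replace (2 * Rpower y 5 * (4 + x ^ 3 + 4) / (x ^ 2) ^ 2) with (2 * Rpower y 5 * ((x ^ 3 + 8) / x ^ 4)) by (field; lra).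
    replace (4 * Rpower y 5 * / x) with (2 * Rpower y 5 * (2 * x ^ 3 / x ^ 4)) by (field; lra).
    apply Rmult_le_compat_l; [lra|]. apply Rmult_le_compat_r; [apply Rlt_le, Rinv_0_lt_compat, pow_lt; lra|]. nra. }
  lra.
Qed.

(* The difference quotient of Perron kernels at N + 1 and N, divided by zeta(s + 1); the zero of
   1 / zeta(s + 1) at s = 0 cancels the factor s of the kernel. *)
Definition Wf (N : nat) (s : C) : C :=
  ((Rcpower (INR (S N)) (s + 1) - Rcpower (INR N) (s + 1)) / ((s + 1) * Zf (s + 1)))%C.

(** * Shifting the contour to the critical line *)

Section Contour.

Variable HZ : forall s : C, 1 / 2 < Re s -> Zf s <> 0%C.

Lemma cdiff_Wf N (s : C) : - 1 / 2 < Re s -> cdiff (Wf N) s.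
Proof.
move=> Hs. have D : cdiff (fun s => s + 1)%C s by apply cdiff_plus; [apply cdiff_id|apply cdiff_const].
have R1 : 1 / 2 < Re (s + 1)%C by rewrite Re_plus Re_RtoC; lra.
unfold Wf. apply cdiff_div.
- apply cdiff_minus; by apply cdiff_Rcpower.
- apply cdiff_mult => //. apply (cdiff_comp Zf (fun s => s + 1)%C) => //. apply cdiff_Zf. lra.
- apply Cmult_neq_0; [|by apply HZ]. move=> E. rewrite E in R1. simpl in R1. lra.
Qed.

(** Writing Zf(s + 1) through [Yf] brings out a second denominator s + 2, so that two powers of |s|
    stand against the growth of 1 / [Yf]. *)
Lemma Wf_Yf N (s : C) : - 1 / 2 < Re s -> Cmod (Wf N s) =
  Cmod (Rcpower (INR (S N)) (s + 1) - Rcpower (INR N) (s + 1))%C * / Cmod (s + 1)%C * / Cmod (s + 2)%C * / Cmod (Yf (s + 1)%C).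
Proof.
move=> Hs. have N1 : (s + 1)%C <> 0%C. { move=> E. have : Re (s + 1)%C = 0 by rewrite E. rewrite Re_plus Re_RtoC. lra. }
have N2 : (s + 2)%C <> 0%C. { move=> E. have : Re (s + 2)%C = 0 by rewrite E. rewrite Re_plus Re_RtoC. lra. }
have NZ := HZ (s + 1)%C ltac:(rewrite Re_plus Re_RtoC; lra).
unfold Wf. rewrite Cmod_div; [|by apply Cmult_neq_0]. rewrite Cmod_mult.
unfold Yf. replace (s + 1 + 1)%C with (s + 2)%C by ring. rewrite Cmod_div // Rinv_div.
have P1 : 0 < Cmod (s + 1)%C by apply Cmod_gt_0. have P2 : 0 < Cmod (s + 2)%C by apply Cmod_gt_0.
have P3 : 0 < Cmod (Zf (s + 1)%C) by apply Cmod_gt_0. field. lra.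
Qed.

Lemma Rmin_interp x A B th : 0 <= x <= A -> x <= B -> 0 < A -> 0 < B -> 0 <= th <= 1 ->
  x <= Rpower A (1 - th) * Rpower B th.
Proof.
move=> Hx HB PA PB Hth. destruct (Req_dec x 0) as [->|Hn].
- apply Rmult_le_pos; apply Rlt_le, Rpower_pos.
- have E : x = Rpower x (1 - th) * Rpower x th by rewrite -Rpower_plus; replace (1 - th + th) with 1 by ring; rewrite Rpower_1; lra.
  rewrite {1}E. apply Rmult_le_compat; try (apply Rlt_le, Rpower_pos); apply Rpower_mono; lra.
Qed.

Lemma Rpower_base_mult_le x c y e : 0 < x -> 0 < c -> c * x <= y -> 0 <= e -> Rpower y (- e) <= Rpower c (- e) * Rpower x (- e).
Proof. move=> Hx Hc Hy He. rewrite Rpower_mult_distr //. apply Rpower_anti; [nra|lra]. Qed.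

(** The sign treats both half lines at once: 16 + |t| is 16 + sg t on each of them. *)
Lemma Rpower_bound_integral sg e a b : sg = 1 \/ sg = -1 -> 0 < e -> a <= b -> (forall t, a <= t <= b -> 1 <= 16 + sg * t) ->
  ex_RInt (fun t => Rpower (16 + sg * t) (- 1 - e)) a b /\ RInt (fun t => Rpower (16 + sg * t) (- 1 - e)) a b <= / e.
Proof.
move=> Hsg He Hab H1.
have D : forall t, a <= t <= b -> is_derive (fun t => - sg / e * Rpower (16 + sg * t) (- e)) t (Rpower (16 + sg * t) (- 1 - e)).
{ move=> t Ht. have P := H1 t Ht. unfold Rpower. auto_derive; [lra|].
  replace ((- 1 - e) * ln (16 + sg * t)) with (- e * ln (16 + sg * t) + - ln (16 + sg * t)) by ring.
  rewrite exp_plus exp_Ropp exp_ln; [|lra]. case: Hsg P => -> P; field; lra. }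
have H : is_RInt (fun t => Rpower (16 + sg * t) (- 1 - e)) a b (minus (- sg / e * Rpower (16 + sg * b) (- e)) (- sg / e * Rpower (16 + sg * a) (- e))).
{ apply (is_RInt_derive (fun t => - sg / e * Rpower (16 + sg * t) (- e))); rewrite Rmin_left // Rmax_right // => t Ht.
  have P := H1 t Ht. apply: ex_derive_continuous. unfold Rpower. auto_derive. lra. }
split; [eexists; exact H|]. rewrite (is_RInt_unique _ _ _ _ H) /minus /plus /opp /=.
have Q : forall t, a <= t <= b -> 0 < Rpower (16 + sg * t) (- e) <= 1.
{ move=> t Ht. split; [apply Rpower_pos|]. rewrite -(Rpower_base_1 (- e)). have := H1 t Ht. move=> h. apply Rpower_anti; lra. }
have Qa := Q a ltac:(lra). have Qb := Q b ltac:(lra).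
have Pe : 0 < / e by apply Rinv_0_lt_compat. unfold Rdiv. case: Hsg Qa Qb => -> Qa Qb; nra.
Qed.

Lemma CI_even_bound (f : R -> C) K e T : 0 <= K -> 0 < e -> 0 <= T -> (forall t, rcont f t) ->
  (forall t, Cmod (f t) <= K * Rpower (16 + Rabs t) (- 1 - e)) -> Cmod (CI f (- T) T) <= 2 * K * / e.
Proof.
move=> HK He HT Hc Hb.
have Half : forall sg a b, sg = 1 \/ sg = -1 -> a <= b -> (forall t, a <= t <= b -> Rabs t = sg * t) -> Cmod (CI f a b) <= K * / e.
{ move=> sg a b Hsg Hab Habs.
  have [X B] := Rpower_bound_integral sg e a b Hsg He Hab (fun t Ht => ltac:(rewrite -(Habs t Ht); have := Rabs_pos t; lra)).
  eapply Rle_trans; [apply (CI_bound_fun f (fun t => K * Rpower (16 + sg * t) (- 1 - e)) a b Hab)|].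
  - by apply exCI_cont.
  - by apply ex_RInt_scal_R.
  - move=> t Ht. rewrite -Habs; [done|lra].
  - rewrite RInt_scal_R //. by apply Rmult_le_compat_l. }
rewrite -(CI_Chasles f (- T) 0 T); try (apply exCI_cont => //; lra).
have H1 := Half (-1) (- T) 0 (or_intror eq_refl) ltac:(lra) ltac:(move=> t Ht; rewrite Rabs_left1; lra).
have H2 := Half 1 0 T (or_introl eq_refl) ltac:(lra) ltac:(move=> t Ht; rewrite Rabs_right; lra).
eapply Rle_trans; [apply Cmod_triangle|]. lra.
Qed.

(** With the factor 1 / 40 the constant part 16 / 40 stays below 1 / 2, which the real part
    provides. *)
Lemma Cmod_shift_ge (s : C) x0 : 1 / 2 <= Rabs (Re s + x0) -> / 40 * (16 + Rabs (snd s)) <= Cmod (s + RtoC x0)%C.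
Proof.
move=> H. have A : Rabs (Re s + x0) <= Cmod (s + RtoC x0)%C. { have := re_le_Cmod (s + RtoC x0)%C. by rewrite Re_plus Re_RtoC. }
have B : Rabs (snd s) <= Cmod (s + RtoC x0)%C. { have := Rabs_snd_le (s + RtoC x0)%C. destruct s. simpl. by rewrite Rplus_0_r. }
have := Rabs_pos (snd s). lra.
Qed.

(* On the vertical line Re s = -1/2 + d, the numerator is bounded both trivially and by the mean value theorem;
   interpolating between the two bounds gains |s|^(-th) at the cost of N^th. *)
Lemma Wf_vertical d eta : 0 < d < 1 / 2 -> 0 < eta <= 1 / 2 -> exists K, 0 <= K /\
  forall N T, (1 <= N)%nat -> 0 <= T -> Cmod (CI (fun t => Wf N (- 1 / 2 + d, t)) (- T) T) <= K * Rpower (INR N) (- 1 / 2 + d + 2 * eta).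
Proof.
move=> Hd Heta. have [K0 [HK0 HY]] := Yf_inv_bound HZ d eta ltac:(lra) ltac:(lra).
(* One [eta] pays for the growth of 1 / zeta, the other brings the exponent of 16 + |t| below -1. *)
set x := - 1 / 2 + d. set th := 2 * eta.
set K1 := K0 * Rpower 4 th * (Rpower (/ 40) (- th) * 40).
have PK1 : 0 <= K1.
{ unfold K1. apply Rmult_le_pos; [apply Rmult_le_pos; [lra|apply Rlt_le, Rpower_pos]|]. have := Rpower_pos (/ 40) (- th). lra. }
exists (2 * K1 * / eta). split; [apply Rmult_le_pos; [lra|apply Rlt_le, Rinv_0_lt_compat; lra]|].
move=> N T HN HT. have PN : 1 <= INR N by apply (le_INR 1).
replace (2 * K1 * / eta * Rpower (INR N) (x + th)) with (2 * (K1 * Rpower (INR N) (x + th)) * / eta) by ring.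
have PA := Rpower_pos (INR N) (x + th).
apply (CI_even_bound (fun t => Wf N (x, t))) => //; [nra|lra| |].
{ move=> t. apply (rcont_ver (Wf N)), ccont_cdiff, cdiff_Wf. unfold Re, x. simpl. lra. }
move=> t. set s := (x, t) : C. have Rs : Re s = x by []. have Pt := Rabs_pos t.
rewrite Wf_Yf; [|rewrite Rs; unfold x; lra].
have E1 : / 40 * (16 + Rabs t) <= Cmod (s + 1)%C by apply (Cmod_shift_ge s 1); rewrite Rs Rabs_right; unfold x; lra.
have E2 : / 40 * (16 + Rabs t) <= Cmod (s + 2)%C by apply (Cmod_shift_ge s 2); rewrite Rs Rabs_right; unfold x; lra.
have EY : / Cmod (Yf (s + 1)%C) <= K0 * Rpower (16 + Rabs t) eta.
{ have -> : (s + 1)%C = (1 / 2 + d, t) by unfold s, x, Cplus, RtoC; simpl; f_equal; field. apply HY. lra. }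
set D := Cmod (Rcpower (INR (S N)) (s + 1) - Rcpower (INR N) (s + 1))%C.
set u := Cmod (s + 1)%C in E1 *. set v := Cmod (s + 2)%C in E2 *. set g := 16 + Rabs t in E1 E2 EY *.
have Pg : 16 <= g by unfold g; lra. have Pu : 0 < u by lra. have Pv : 0 < v by lra.
have SN : INR (S N) = INR N + 1 by rewrite S_INR.
have R1 : Re (s + 1)%C = x + 1 by rewrite Re_plus Re_RtoC Rs.
have B1 : D <= u * Rpower (INR N) x.
{ have := Rcpower_diff (INR N) (INR (S N)) (s + 1)%C ltac:(rewrite SN; lra) ltac:(rewrite R1; unfold x; lra).
  rewrite R1 SN. replace (x + 1 - 1) with x by ring. replace (INR N + 1 - INR N) with 1 by ring. rewrite Rmult_1_r. rewrite -SN. done. }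
have B2 : D <= 4 * Rpower (INR N) (x + 1).
{ eapply Rle_trans; [apply Cmod_triangle_sub|]. rewrite !Cmod_Rcpower R1.
  have Q1 : Rpower (INR (S N)) (x + 1) <= Rpower (2 * INR N) (x + 1) by apply Rpower_mono; unfold x; lra.
  rewrite -Rpower_mult_distr in Q1; [|lra|lra].
  have Q2 : Rpower 2 (x + 1) <= Rpower 2 1 by apply Rle_Rpower; unfold x; lra. rewrite Rpower_1 in Q2; [|lra].
  have := Rpower_pos (INR N) (x + 1). nra. }
have PD : 0 <= D by apply Cmod_ge_0.
have Px := Rpower_pos (INR N) x. have Px1 := Rpower_pos (INR N) (x + 1).
have I := Rmin_interp D _ _ th (conj PD B1) B2 ltac:(nra) ltac:(nra) ltac:(unfold th; lra).
rewrite -(Rpower_mult_distr u) -?(Rpower_mult_distr 4) in I; try lra.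
have EN : Rpower (Rpower (INR N) x) (1 - th) * Rpower (Rpower (INR N) (x + 1)) th = Rpower (INR N) (x + th).
{ rewrite !Rpower_mult -Rpower_plus. f_equal. ring. }
have I2 : D * / u <= Rpower 4 th * Rpower (INR N) (x + th) * (Rpower (/ 40) (- th) * Rpower g (- th)).
{ have Eu : Rpower u (1 - th) * / u = Rpower u (- th).
  { replace (/ u) with (Rpower u (- (1))) by (rewrite Rpower_Ropp Rpower_1 //). rewrite -Rpower_plus. f_equal. ring. }
  apply Rle_trans with (Rpower u (1 - th) * Rpower (Rpower (INR N) x) (1 - th) * (Rpower 4 th * Rpower (Rpower (INR N) (x + 1)) th) * / u).
  - apply Rmult_le_compat_r; [apply Rlt_le, Rinv_0_lt_compat; lra|exact I].
  - replace (Rpower u (1 - th) * Rpower (Rpower (INR N) x) (1 - th) * (Rpower 4 th * Rpower (Rpower (INR N) (x + 1)) th) * / u) with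
     (Rpower 4 th * (Rpower (Rpower (INR N) x) (1 - th) * Rpower (Rpower (INR N) (x + 1)) th) * (Rpower u (1 - th) * / u)) by ring.
    rewrite EN Eu. apply Rmult_le_compat_l; [apply Rmult_le_pos; apply Rlt_le, Rpower_pos|].
    apply Rpower_base_mult_le; unfold th; lra. }
have I3 : / v <= 40 * Rpower g (- (1)).
{ rewrite Rpower_Ropp Rpower_1; [|lra]. replace (40 * / g) with (/ (/ 40 * g)) by (field; lra). apply Rinv_le_contravar; lra. }
have P1 : 0 <= D * / u by apply Rmult_le_pos => //; apply Rlt_le, Rinv_0_lt_compat.
have PY : 0 <= / Cmod (Yf (s + 1)%C).
{ destruct (Req_dec (Cmod (Yf (s + 1)%C)) 0) as [->|h]; [rewrite Rinv_0; lra|]. have := Cmod_ge_0 (Yf (s + 1)%C). move=> k. apply Rlt_le, Rinv_0_lt_compat. lra. }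
apply Rle_trans with ((Rpower 4 th * Rpower (INR N) (x + th) * (Rpower (/ 40) (- th) * Rpower g (- th))) * (40 * Rpower g (- (1))) * (K0 * Rpower g eta)).
- apply Rmult_le_compat => //; [apply Rmult_le_pos => //; apply Rlt_le, Rinv_0_lt_compat => //|].
  apply Rmult_le_compat => //. apply Rlt_le, Rinv_0_lt_compat => //.
- right. have -> : Rpower g (- 1 - eta) = Rpower g (- th) * Rpower g (- (1)) * Rpower g eta.
  { rewrite -!Rpower_plus. f_equal. unfold th. ring. }
  unfold K1. ring.
Qed.

(** Here [N] is fixed while the height grows, so K may depend on N and the crude exponent 1 for the
    growth of 1 / zeta suffices against T^2. *)
Lemma Wf_horizontal d N : 0 < d < 1 / 2 -> (1 <= N)%nat -> exists K, 0 <= K /\ forall T y, 1 <= T -> y = T \/ y = - T ->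
  Cmod (CI (fun x => Wf N (x, y)) (- 1 / 2 + d) 4) <= K * (16 + T) / T ^ 2.
Proof.
move=> Hd HN. have [K0 [HK0 HY]] := Yf_inv_bound HZ d 1 ltac:(lra) ltac:(lra).
have PN : 1 <= INR N by apply (le_INR 1). have SN : INR (S N) = INR N + 1 by rewrite S_INR.
set B := 2 * Rpower (INR (S N)) 5. have PB : 0 < B by have := Rpower_pos (INR (S N)) 5; unfold B; lra.
exists (B * K0 * 5). split; [nra|]. move=> T y HT Hy.
have Ay : Rabs y = T by case: Hy => ->; [rewrite Rabs_right|rewrite Rabs_left1]; lra.
have PT2 : 0 < T ^ 2 by nra.
apply Rle_trans with ((B * K0 * (16 + T) / T ^ 2) * (4 - (- 1 / 2 + d))).
- apply (CI_hor_bound (Wf N)); [lra|move=> t Ht; apply cdiff_Wf; unfold Re; simpl; lra|]. move=> t Ht.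
  rewrite Wf_Yf; [|unfold Re; simpl; lra]. set s := (t, y) : C.
  have E1 : T <= Cmod (s + 1)%C. { have := Rabs_snd_le (s + 1)%C. simpl. rewrite Rplus_0_r. lra. }
  have E2 : T <= Cmod (s + 2)%C. { have := Rabs_snd_le (s + 2)%C. simpl. rewrite Rplus_0_r. lra. }
  have EY : / Cmod (Yf (s + 1)%C) <= K0 * (16 + T).
  { have -> : (s + 1)%C = (t + 1, y) by unfold s, Cplus, RtoC; simpl; f_equal; ring.
    have := HY (t + 1) y ltac:(lra). rewrite Ay Rpower_1; lra. }
  have ED : Cmod (Rcpower (INR (S N)) (s + 1) - Rcpower (INR N) (s + 1))%C <= B.
  { have R1 : Re (s + 1)%C = t + 1 by rewrite Re_plus Re_RtoC. eapply Rle_trans; [apply Cmod_triangle_sub|]. rewrite !Cmod_Rcpower R1.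
    have Q1 : Rpower (INR (S N)) (t + 1) <= Rpower (INR (S N)) 5 by apply Rle_Rpower; lra.
    have Q2 : Rpower (INR N) (t + 1) <= Rpower (INR (S N)) (t + 1) by apply Rpower_mono; lra. unfold B. lra. }
  have P1 : 0 < / Cmod (s + 1)%C by apply Rinv_0_lt_compat; lra. have P2 : 0 < / Cmod (s + 2)%C by apply Rinv_0_lt_compat; lra.
  have I1 : / Cmod (s + 1)%C <= / T by apply Rinv_le_contravar; lra. have I2 : / Cmod (s + 2)%C <= / T by apply Rinv_le_contravar; lra.
  have PD := Cmod_ge_0 (Rcpower (INR (S N)) (s + 1) - Rcpower (INR N) (s + 1))%C.
  replace (B * K0 * (16 + T) / T ^ 2) with (B * / T * / T * (K0 * (16 + T))) by (field; lra).
  have Q : 0 <= / Cmod (Yf (s + 1)%C).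
  { destruct (Req_dec (Cmod (Yf (s + 1)%C)) 0) as [->|h]; [rewrite Rinv_0; lra|]. have := Cmod_ge_0 (Yf (s + 1)%C). move=> k. apply Rlt_le, Rinv_0_lt_compat. lra. }
  repeat apply Rmult_le_compat => //; try lra; try (apply Rmult_le_pos; try lra). apply Rmult_le_pos; lra.
- have P : 0 <= B * K0 * (16 + T) / T ^ 2 by apply Rdiv_le_0_compat; [|lra]; apply Rmult_le_pos; nra.
  replace (B * K0 * 5 * (16 + T) / T ^ 2) with (B * K0 * (16 + T) / T ^ 2 * 5) by (field; lra). apply Rmult_le_compat_l; lra.
Qed.

Lemma CI_csum (c : nat -> C) (f : nat -> R -> C) a b n : a <= b -> (forall k t, rcont (f k) t) ->
  CI (fun t => csum (fun k => c k * f k t)%C n) a b = csum (fun k => c k * CI (f k) a b)%C n /\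
  exCI (fun t => csum (fun k => c k * f k t)%C n) a b.
Proof.
move=> Hab Hf. elim: n => [|n [IH1 IH2]].
- simpl. rewrite CI_const. split; [ring|]. split; apply ex_RInt_const.
- have X : exCI (fun t => c n * f n t)%C a b by apply exCI_scal, exCI_cont.
  simpl csum. split; [|by apply exCI_plus]. rewrite CI_plus // IH1 CI_scal //. by apply exCI_cont.
Qed.

Lemma RInt_inv_1_sqr T : 0 <= T -> ex_RInt (fun t => / (1 + t ^ 2)) (- T) T /\ RInt (fun t => / (1 + t ^ 2)) (- T) T <= 4.
Proof.
move=> HT. have H : is_RInt (fun t => / (1 + t ^ 2)) (- T) T (minus (atan T) (atan (- T))).
{ apply (is_RInt_derive atan) => t _.
  - apply is_derive_Reals. have := derivable_pt_lim_atan t. by replace (/ (1 + t ^ 2)) with (/ (1 + t²)) by (unfold Rsqr; f_equal; ring).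
  - apply: ex_derive_continuous. auto_derive. nra. }
split; [eexists; exact H|]. rewrite (is_RInt_unique _ _ _ _ H) /minus /plus /opp /=.
have := atan_bound T. have := atan_bound (- T). have := PI_4. lra.
Qed.

Lemma clim_approx (u : nat -> C) l : (forall eps, 0 < eps -> exists v, clim v l /\ forall k, Cmod (u k - v k)%C <= eps) -> clim u l.
Proof.
move=> H eps He. destruct (H (eps / 2) ltac:(lra)) as [v [Hv K]]. destruct (Hv (eps / 2) ltac:(lra)) as [N HN].
exists N => n Hn. have := Cmod_triangle3 (u n) (v n) l. have := K n. have := HN n Hn. lra.
Qed.

Lemma clim_csum (f : nat -> nat -> C) (l : nat -> C) P : (forall j, clim (fun k => f j k) (l j)) ->
  clim (fun k => csum (fun j => f j k) P) (csum l P).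
Proof.
move=> H. elim: P => [|P IH]; [apply (clim_const 0%C)|]. simpl. by apply clim_plus.
Qed.

(** x -> max(x / k - 1, 0) vanishes up to k and is linear from there on, so its increment from N to
    N + 1 is exactly 1 / k or 0. This is how the smoothed formula yields a sharp cutoff. *)
Lemma perron_weight N k : (1 <= N)%nat ->
  Rmax (INR (S N) / INR (S k) - 1) 0 - Rmax (INR N / INR (S k) - 1) 0 = match Nat.leb (S k) N with true => / INR (S k) | false => 0 end.
Proof.
move=> HN. have P := INR_S_pos k. have Pi : 0 < / INR (S k) by apply Rinv_0_lt_compat.
have E : forall m, INR m / INR (S k) - 1 = (INR m - INR (S k)) * / INR (S k) by move=> m; field; lra.
rewrite !E. case: (Nat.leb_spec (S k) N) => H.
- have h1 : INR (S k) <= INR N by apply le_INR. rewrite !Rmax_left; rewrite ?(S_INR N); nra.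
- have h1 : INR (S N) <= INR (S k) by apply le_INR; lia. have h2 : INR N <= INR (S k) by apply le_INR; lia.
  rewrite !Rmax_right; nra.
Qed.

(** The series of 1 / zeta(s + 1) is cut at [P] with an error uniform in the height, because the
    kernel is integrable; the finitely many terms left are covered by [perron_limit]. *)
Lemma perron_mertens N : (1 <= N)%nat ->
  clim (fun k => CI (fun t => Wf N (4, t)) (- Tseq k) (Tseq k)) (RtoC (2 * PI * mertens N)).
Proof.
move=> HN. have PN : 1 <= INR N by apply (le_INR 1).
set b5 := Rpower (INR (S N)) 5. have Pb5 : 0 < b5 by apply Rpower_pos.
apply clim_approx => eps He.
(* 16 = 2 * 2 * 4, from the numerator at most 2 b5, the tail 2 / (P + 1) of the series, and the
   integral of 1 / (1 + t^2) at most 4. *)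
have [P0 HP0] := INR_unbounded (16 * b5 / eps). set P := (P0 + N)%nat.
set f := fun k t => (perron_kernel (INR (S N) / INR (S k)) (4, t) - perron_kernel (INR N / INR (S k)) (4, t))%C.
have Cpk : forall y t, rcont (fun t => perron_kernel y (4, t)) t.
{ move=> y t. apply (rcont_ver (perron_kernel y)), ccont_cdiff, cdiff_perron_kernel; apply Cneq_re; simpl; lra. }
have Cf : forall k t, rcont (f k) t.
{ move=> k t. apply (rcont_ver (fun s => perron_kernel (INR (S N) / INR (S k)) s - perron_kernel (INR N / INR (S k)) s)%C).
  apply ccont_cdiff, cdiff_minus; apply cdiff_perron_kernel; apply Cneq_re; simpl; lra. }
exists (fun k => CI (fun t => csum (fun j => RtoC (mu (S j)) * f j t)%C P) (- Tseq k) (Tseq k)).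
have PT : forall k, 0 <= Tseq k by move=> k; apply pow2_ge_0.
split.
- have E : forall k, csum (fun j => RtoC (mu (S j)) * (perron_int (INR (S N) / INR (S j)) (Tseq k) - perron_int (INR N / INR (S j)) (Tseq k)))%C P =
    CI (fun t => csum (fun j => RtoC (mu (S j)) * f j t)%C P) (- Tseq k) (Tseq k).
  { move=> k. have PTk := PT k. have [-> _] := CI_csum (fun j => RtoC (mu (S j))) f (- Tseq k) (Tseq k) P ltac:(lra) Cf.
    apply csum_ext => j _. f_equal. unfold f. rewrite CI_minus //; apply exCI_cont => //; lra. }
  apply (clim_ext _ _ _ E).
  replace (RtoC (2 * PI * mertens N)) with
    (csum (fun j => RtoC (mu (S j)) * (RtoC (2 * PI * Rmax (INR (S N) / INR (S j) - 1) 0) - RtoC (2 * PI * Rmax (INR N / INR (S j) - 1) 0)))%C P).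
  + apply clim_csum => j. apply clim_scal, clim_minus; apply perron_limit; apply Rdiv_lt_0_compat; try apply INR_S_pos; lra.
  + rewrite (csum_ext _ (fun j => RtoC (2 * PI * (match Nat.leb (S j) N with true => mu (S j) / INR (S j) | false => 0 end)))).
    2:{ move=> j _. rewrite -RtoC_minus -RtoC_mult. f_equal.
        replace (2 * PI * Rmax (INR (S N) / INR (S j) - 1) 0 - 2 * PI * Rmax (INR N / INR (S j) - 1) 0) with
          (2 * PI * (Rmax (INR (S N) / INR (S j) - 1) 0 - Rmax (INR N / INR (S j) - 1) 0)) by ring.
        rewrite perron_weight //. case: Nat.leb; unfold Rdiv; ring. }
    rewrite csum_RtoC rsum_scal. do 2 f_equal. rewrite (rsum_split _ N P); [|unfold P; lia].
    rewrite (rsum_ext _ (fun k => mu (S k) / INR (S k)) N); [|by move=> k Hk; rewrite (proj2 (Nat.leb_le _ _) Hk)].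
    rewrite (rsum_ext _ (fun _ => 0) (P - N)); [rewrite rsum_const; unfold mertens; ring|].
    move=> k _. rewrite (proj2 (Nat.leb_gt _ _)) //. lia.
- move=> k. have PTk := PT k. have [_ X] := CI_csum (fun j => RtoC (mu (S j))) f (- Tseq k) (Tseq k) P ltac:(lra) Cf.
  have XW : exCI (fun t => Wf N (4, t)) (- Tseq k) (Tseq k).
  { apply exCI_cont; [lra|]. move=> t _. apply (rcont_ver (Wf N)), ccont_cdiff, cdiff_Wf. unfold Re; simpl; lra. }
  rewrite -CI_minus //. have [R1 R2] := RInt_inv_1_sqr (Tseq k) PTk.
  apply Rle_trans with (2 * b5 * (2 * / INR (S P)) * RInt (fun t => / (1 + t ^ 2)) (- Tseq k) (Tseq k)).
  + rewrite -RInt_scal_R //. apply CI_bound_fun; [lra|by apply exCI_minus|by apply ex_RInt_scal_R|]. move=> t _.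
    set s := (4, t) : C. have Rs : Re (s + 1)%C = 5. { rewrite Re_plus Re_RtoC. unfold Re. simpl. ring. }
    have N1 : s <> 0%C by apply Cneq_re; simpl; lra. have N2 : (s + 1)%C <> 0%C by apply Cneq_re; simpl; lra.
    have NZ := HZ (s + 1)%C ltac:(rewrite Rs; lra).
    have [L [HL [_ HB]]] := mu_partial_limit (s + 1)%C ltac:(lra). have EL := mu_zeta (s + 1)%C L ltac:(lra) HL.
    replace (s + 1 - 1)%C with s in EL by ring.
    have EL2 : L = (s / Zf (s + 1))%C. { replace L with (L * (Zf (s + 1) / s) * (s / Zf (s + 1)))%C by (field; done). rewrite EL. ring. }
    set kap := ((Rcpower (INR (S N)) (s + 1) - Rcpower (INR N) (s + 1)) / (s * (s + 1)))%C.
    have EW : Wf N s = (kap * L)%C. { unfold Wf, kap. rewrite EL2. field. done. }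
    have EP : csum (fun j => RtoC (mu (S j)) * f j t)%C P = (kap * mu_partial (s + 1) P)%C.
    { unfold mu_partial. rewrite -csum_scal. apply csum_ext => j _. unfold f, perron_kernel, kap. fold s.
      have Pj := INR_S_pos j. have Pji : 0 < / INR (S j) by apply Rinv_0_lt_compat.
      have D : forall x, 0 < x -> Rcpower (x / INR (S j)) (s + 1) = (Rcpower x (s + 1) * Rcpower (INR (S j)) (- (s + 1)))%C.
      { move=> x Hx. unfold Rdiv. rewrite Rcpower_mult_base //. f_equal. unfold Rcpower. rewrite ln_Rinv // RtoC_opp. f_equal. ring. }
      rewrite !D; [field; done|lra|apply INR_S_pos]. }
    rewrite EW EP. replace (kap * L - kap * mu_partial (s + 1) P)%C with (kap * (L - mu_partial (s + 1) P))%C by ring. rewrite Cmod_mult.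
    have K : Cmod kap <= 2 * b5 * / (1 + t ^ 2).
    { unfold kap. rewrite Cmod_div; [|by apply Cmult_neq_0].
      have ED : Cmod (Rcpower (INR (S N)) (s + 1) - Rcpower (INR N) (s + 1))%C <= 2 * b5.
      { eapply Rle_trans; [apply Cmod_triangle_sub|]. rewrite !Cmod_Rcpower Rs.
        have : Rpower (INR N) 5 <= b5 by apply Rpower_mono; rewrite ?S_INR; lra. unfold b5. lra. }
      have Q : 1 + t ^ 2 <= Cmod (s * (s + 1))%C.
      { rewrite Cmod_mult. have Q1 : (1 + t ^ 2) <= Cmod s * Cmod s by rewrite Cmod_sqr; simpl; lra.
        have Q2 : Cmod s <= Cmod (s + 1)%C. { apply Rsqr_incr_0_var; [|apply Cmod_ge_0]. unfold Rsqr. rewrite !Cmod_sqr. simpl. lra. }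
        have := Cmod_ge_0 s. nra. }
      have Pt : 0 < 1 + t ^ 2 by nra.
      apply Rmult_le_compat => //; [apply Cmod_ge_0|apply Rlt_le, Rinv_0_lt_compat; lra|by apply Rinv_le_contravar]. }
    have B := HB P. replace (2 * b5 * (2 * / INR (S P)) * / (1 + t ^ 2)) with ((2 * b5 * / (1 + t ^ 2)) * (2 * / INR (S P))) by ring.
    apply Rmult_le_compat => //; apply Cmod_ge_0.
  + have PP := INR_S_pos P. have PPi : 0 < / INR (S P) by apply Rinv_0_lt_compat.
    apply Rle_trans with (2 * b5 * (2 * / INR (S P)) * 4); [apply Rmult_le_compat_l; [nra|done]|].
    have h : INR P0 <= INR (S P) by apply le_INR; unfold P; lia.
    apply Rmult_le_reg_r with (INR (S P)) => //. replace (2 * b5 * (2 * / INR (S P)) * 4 * INR (S P)) with (16 * b5) by (field; lra).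
    have : 16 * b5 / eps * eps < INR (S P) * eps by apply Rmult_lt_compat_r; lra.
    unfold Rdiv. rewrite Rmult_assoc Rinv_l; lra.
Qed.

(** The line Re s = 4 is moved to Re s = -1 / 2 + d. [Wf] is holomorphic in between, also at 0, so
    no residue appears and the bound on the new line is the result. *)
Lemma mertens_bound_of_nonvanishing : mertens_bound.
Proof.
(* Chosen so that d + 2 eta <= eps within the ranges that [Wf_vertical] allows. *)
move=> eps Heps. set d := Rmin (eps / 2) (1 / 4). set eta := Rmin (eps / 4) (1 / 2).
have Hd : 0 < d <= 1 / 4 by split; [apply Rmin_glb_lt; lra|apply Rmin_r].
have Heta : 0 < eta <= 1 / 2 by split; [apply Rmin_glb_lt; lra|apply Rmin_r].
have Hd2 : d <= eps / 2 by apply Rmin_l. have Heta2 : eta <= eps / 4 by apply Rmin_l.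
have [K [HK HV]] := Wf_vertical d eta ltac:(lra) Heta.
exists K => n. set N := S n. have HN : (1 <= N)%nat by unfold N; lia.
have [K2 [HK2 HH]] := Wf_horizontal d N ltac:(lra) HN.
have PN : 1 <= INR N by apply (le_INR 1).
have L := perron_mertens N HN. have P2 := PI_RGT_0.
have B : Cmod (RtoC (2 * PI * mertens N)) <= K * Rpower (INR N) (- 1 / 2 + d + 2 * eta).
{ apply le_epsilon => e He. apply (clim_bound _ _ _ L).
  have [M HM] := INR_unbounded (34 * K2 / e). exists M => k Hk. set T := Tseq k.
  have Hx := INR_S_ge1 k. have HT : 1 <= T by unfold T, Tseq; nra.
  have E := Goursat (Wf N) (- 1 / 2 + d) 4 (- T) T ltac:(lra) ltac:(lra) (fun x t Hx _ => cdiff_Wf N (x, t) ltac:(unfold Re; simpl; lra)).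
  unfold RectI in E.
  have H1 := HH T (- T) HT (or_intror eq_refl). have H2 := HH T T HT (or_introl eq_refl). have H3 := HV N T HN ltac:(lra).
  set I4 := CI (fun t => Wf N (4, t)) (- T) T in E *. set I1 := CI (fun t => Wf N (- 1 / 2 + d, t)) (- T) T in E H3.
  set J1 := CI (fun x => Wf N (x, - T)) (- 1 / 2 + d) 4 in E H1. set J2 := CI (fun x => Wf N (x, T)) (- 1 / 2 + d) 4 in E H2.
  have E2 : (Ci * I4)%C = (J2 + Ci * I1 - J1)%C. { replace (Ci * I4)%C with (J2 + Ci * I1 - J1 + (J1 + Ci * I4 - J2 - Ci * I1))%C by ring. rewrite E. ring. }
  rewrite -(Cmod_Ci_mult I4) E2. eapply Rle_trans; [apply Cmod_triangle_sub|]. eapply Rle_trans; [apply Rplus_le_compat_r, Cmod_triangle|].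
  rewrite Cmod_Ci_mult.
  have Q : K2 * (16 + T) / T ^ 2 <= e / 2.
  { have h : INR M <= INR (S k) by apply le_INR; lia.
    have hT : INR (S k) <= T by unfold T, Tseq; nra.
    apply Rle_trans with (17 * K2 * / T).
    - apply Rmult_le_reg_r with (T ^ 2); [nra|]. replace (K2 * (16 + T) / T ^ 2 * T ^ 2) with (K2 * (16 + T)) by (field; lra).
      replace (17 * K2 * / T * T ^ 2) with (K2 * (17 * T)) by (field; lra). apply Rmult_le_compat_l; lra.
    - apply Rmult_le_reg_r with T; [lra|]. rewrite Rmult_assoc Rinv_l; [|lra].
      have : 34 * K2 / e * e < T * e by apply Rmult_lt_compat_r; lra. unfold Rdiv. rewrite Rmult_assoc Rinv_l; lra. }
  lra. }
rewrite Cmod_R Rabs_mult (Rabs_right (2 * PI)) in B; [|lra].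
have PI3 : 1 <= 2 * PI by have := PI2_1; lra.
apply Rle_trans with (2 * PI * Rabs (mertens N)); [have := Rabs_pos (mertens N); nra|].
eapply Rle_trans; [apply B|]. apply Rmult_le_compat_l => //. apply Rle_Rpower => //. lra.
Qed.

End Contour.

Lemma RH_mertens : Riemann_hypothesis -> mertens_bound.
Proof. move=> H. apply mertens_bound_of_nonvanishing. by apply RH_Zf. Qed.

(** * The associated sequence of the Ingham function *)

Lemma csum_guard (f : nat -> C) (b : nat -> bool) m n : (m <= n)%nat -> (forall j, (j < n)%nat -> b j = Nat.ltb j m) ->
  csum (fun j => match b j with true => f j | false => 0%C end) n = csum f m.
Proof.
move=> Hmn Hb. rewrite (csum_split _ m n) //.
rewrite (csum_ext _ f m); [|by move=> j Hj; rewrite Hb ?(proj2 (Nat.ltb_lt _ _)) //; lia].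
rewrite (csum_ext _ (fun _ => 0%C) (n - m)); [rewrite csum_const; ring|].
move=> j Hj. rewrite Hb; [|lia]. by rewrite (proj2 (Nat.ltb_ge _ _)) //; lia.
Qed.

Lemma leb_div N d j : Nat.leb (S d * S j) N = Nat.ltb j (N / S d).
Proof.
have D := Nat.div_mod_eq N (S d). have L := Nat.mod_upper_bound N (S d) ltac:(lia). set q := (N / S d)%nat in D *.
case: (Nat.ltb_spec j q) => H; [apply Nat.leb_le|apply Nat.leb_gt]; nia.
Qed.

Lemma div_le_self N d : (N / S d <= N)%nat.
Proof. apply Nat.Div0.div_le_upper_bound. lia. Qed.

(** Both sides run over the pairs with (d + 1) (j + 1) <= N. *)
Lemma hyperbola_sym (f : nat -> nat -> C) N :
  csum (fun d => csum (fun j => f d j) (N / S d)) N = csum (fun j => csum (fun d => f d j) (N / S j)) N.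
Proof.
transitivity (csum (fun d => csum (fun j => match Nat.leb (S d * S j) N with true => f d j | false => 0%C end) N) N).
- apply csum_ext => d _. symmetry. apply csum_guard; [apply div_le_self|]. move=> j _. apply leb_div.
- rewrite csum_swap. apply csum_ext => j _. apply csum_guard; [apply div_le_self|]. move=> d _. by rewrite Nat.mul_comm leb_div.
Qed.

Lemma csum_inj2 f N M : csum (fun d => csum (fun j => RtoC (f d j)) (M d)) N = RtoC (rsum (fun d => rsum (fun j => f d j) (M d)) N).
Proof. rewrite -csum_RtoC. apply csum_ext => d _. by rewrite csum_RtoC. Qed.

Lemma hyperbola_sym_R (f : nat -> nat -> R) N :
  rsum (fun d => rsum (fun j => f d j) (N / S d)) N = rsum (fun j => rsum (fun d => f d j) (N / S j)) N.
Proof. apply RtoC_inj. rewrite -!csum_inj2. apply (hyperbola_sym (fun d j => RtoC (f d j))). Qed.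

Lemma dirichlet_hyperbola_R (f : nat -> nat -> R) N :
  rsum (fun n => rsum (fun d => match divb (S d) (S n) with true => f (S d) (S n / S d)%nat | false => 0 end) (S n)) N =
  rsum (fun d => rsum (fun j => f (S d) (S j)) (N / S d)) N.
Proof.
apply RtoC_inj. rewrite -!csum_inj2 -(dirichlet_hyperbola (fun d j => RtoC (f d j))).
apply csum_ext => n _. apply csum_ext => d _. by case: divb.
Qed.

(** The case s = 0 of [mu_zeta_finite], with the order of summation exchanged. *)
Lemma mu_floor_sum N : (1 <= N)%nat -> rsum (fun j => mu (S j) * INR (N / S j)) N = 1.
Proof.
move=> HN. transitivity (rsum (fun j => rsum (fun d => mu (S j)) (N / S j)) N).
{ apply rsum_ext => j _. rewrite rsum_const. ring. }
rewrite -(hyperbola_sym_R (fun d j => mu (S j))). apply RtoC_inj. rewrite -(mu_zeta_finite 0%C N HN) -csum_inj2.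
apply csum_ext => d _. have E : forall k, Rcpower (INR (S k)) (- 0)%C = 1%C.
{ move=> k. unfold Rcpower. replace (- 0 * RtoC (ln (INR (S k))))%C with (RtoC 0) by ring. apply Cexp_0. }
rewrite E Cmult_1_l. apply csum_ext => j _. rewrite E. ring.
Qed.

(** The coefficient belongs to the integer k + 1. The first one is set apart because [Rpower 0] does
    not take the value 0. *)
Definition cb (beta : R) (k : nat) : R :=
  match k with O => 1 | S _ => Rpower (INR (S k)) (1 - beta) - Rpower (INR k) (1 - beta) end.

Lemma rsum_cb beta n : rsum (cb beta) (S n) = Rpower (INR (S n)) (1 - beta).
Proof.
elim: n => [|n IH]; [change (0 + 1 = Rpower 1 (1 - beta)); rewrite Rpower_base_1; ring|].
change (rsum (cb beta) (S n) + cb beta (S n) = Rpower (INR (S (S n))) (1 - beta)). rewrite IH. unfold cb. ring.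
Qed.

Definition aseq (beta : R) (n : nat) : R :=
  rsum (fun d => match divb (S d) n with true => cb beta d * mu (n / S d) | false => 0 end) n / INR n.

Definition Asum (beta : R) (N : nat) : R := rsum (fun n => aseq beta (S n)) N.

(** The weight [h] is instantiated twice: 1 / n gives the summatory function, the floor of N / n
    checks the defining equations. *)
Lemma aseq_weighted beta (h : nat -> R) N :
  rsum (fun n => INR (S n) * aseq beta (S n) * h (S n)) N = rsum (fun d => rsum (fun j => cb beta d * mu (S j) * h (S d * S j)%nat) (N / S d)) N.
Proof.
rewrite -(dirichlet_hyperbola_R (fun d j => cb beta (pred d) * mu j * h (d * j)%nat)).
apply rsum_ext => n _. unfold aseq. have P := INR_S_pos n.
replace (INR (S n) * (rsum (fun d => match divb (S d) (S n) with true => cb beta d * mu (S n / S d) | false => 0 end) (S n) / INR (S n)) * h (S n))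
 with (h (S n) * rsum (fun d => match divb (S d) (S n) with true => cb beta d * mu (S n / S d) | false => 0 end) (S n)) by (field; lra).
rewrite -rsum_scal. apply rsum_ext => d _. case Ed: (divb (S d) (S n)); [|ring].
move/Nat.eqb_eq: Ed => E. have D := Nat.div_mod_eq (S n) (S d). rewrite E Nat.add_0_r in D. rewrite -D. simpl pred. ring.
Qed.

Lemma Asum_eq beta N : Asum beta N = rsum (fun d => cb beta d / INR (S d) * mertens (N / S d)) N.
Proof.
transitivity (rsum (fun n => INR (S n) * aseq beta (S n) * (fun k => / INR k) (S n)) N).
{ apply rsum_ext => n _. have P := INR_S_pos n. field. lra. }
rewrite (aseq_weighted beta (fun k => / INR k)). apply rsum_ext => d _. unfold mertens. rewrite -rsum_scal. apply rsum_ext => j _. rewrite mult_INR.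
have P := INR_S_pos d. have P2 := INR_S_pos j. field. lra.
Qed.

Lemma sum_n_m_rsum (f : nat -> R) n : sum_n_m f 1 n = rsum (fun k => f (S k)) n.
Proof.
elim: n => [|n IH]; [by rewrite sum_n_m_zero //; lia|]. rewrite sum_n_Sm; [|lia]. by rewrite IH.
Qed.

Lemma sum_n_m_csum (f : nat -> C) n : sum_n_m (G := C_AbelianMonoid) f 1 n = csum (fun k => f (S k)) n.
Proof.
elim: n => [|n IH]; [by rewrite sum_n_m_zero //; lia|]. rewrite sum_n_Sm; [|lia]. by rewrite IH.
Qed.

Lemma Zfloor_INR_div n k : Zfloor (/ (INR (S k) / INR (S n))) = Z.of_nat (S n / S k).
Proof.
have P := INR_S_pos k. have P2 := INR_S_pos n. apply Zfloor_eq.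
replace (/ (INR (S k) / INR (S n))) with (INR (S n) / INR (S k)) by (field; lra).
have D := Nat.div_mod_eq (S n) (S k). have L := Nat.mod_upper_bound (S n) (S k) ltac:(lia). set q := (S n / S k)%nat in D *.
rewrite -INR_IZR_INZ.
have E1 : (S k * q <= S n)%nat by lia. have E2 : (S n < S k * S q)%nat by nia.
apply le_INR in E1. apply lt_INR in E2. rewrite mult_INR in E1. rewrite mult_INR (S_INR q) in E2.
split; [apply Rmult_le_reg_r with (INR (S k))|apply Rmult_lt_reg_r with (INR (S k))] => //; unfold Rdiv; rewrite Rmult_assoc Rinv_l; lra.
Qed.

Lemma Ingham_value n k : Ingham (INR (S k) / INR (S n)) = INR (S k) / INR (S n) * INR (S n / S k).
Proof. unfold Ingham. by rewrite Zfloor_INR_div -INR_IZR_INZ. Qed.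

Definition Gker (n k : nat) : R := Ingham (INR k / INR n).

(** Multiplied by n, the equation says that the sum of k a_k floor(n / k) is n^(1-beta). The factor
    [mu] in the convolution cancels the floors by [mu_floor_sum], and the increments [cb]
    telescope. *)
Lemma associated_aseq beta : associated_sequence Gker beta (aseq beta).
Proof.
split.
- unfold aseq. simpl. rewrite mu_1. field.
- move=> n Hn. destruct n as [|n]; [lia|]. rewrite sum_n_m_rsum. have P := INR_S_pos n.
  rewrite (rsum_ext _ (fun k => / INR (S n) * (INR (S k) * aseq beta (S k) * (fun m => INR (S n / m)) (S k)))).
  2:{ move=> k _. unfold Gker. rewrite Ingham_value. unfold Rdiv. ring. }
  rewrite rsum_scal (aseq_weighted beta (fun m => INR (S n / m))) (rsum_ext _ (cb beta)).
  + rewrite rsum_cb. have -> : Rpower (INR (S n)) (1 - beta) = INR (S n) * Rpower (INR (S n)) (- beta).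
    { unfold Rminus. rewrite Rpower_plus Rpower_1 //. }
    match goal with |- ?u = ?v => change (@eq R u v) end. field. lra.
  + move=> d Hd. rewrite (rsum_ext _ (fun j => cb beta d * (mu (S j) * INR ((S n / S d) / S j)))).
    * rewrite rsum_scal mu_floor_sum; [ring|]. apply Nat.div_le_lower_bound; lia.
    * move=> j _. rewrite Nat.Div0.div_div. ring.
Qed.

(** The equations form a triangular system with diagonal [Gker n n] = 1. *)
Lemma associated_unique beta a b : associated_sequence Gker beta a -> associated_sequence Gker beta b ->
  forall n, (1 <= n)%nat -> b n = a n.
Proof.
move=> [A1 A2] [B1 B2]. apply: (well_founded_induction lt_wf) => n IH Hn.
destruct n as [|[|n]]; [lia|by rewrite A1 B1|].
have EA := A2 (S (S n)) ltac:(lia). have EB := B2 (S (S n)) ltac:(lia).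
rewrite sum_n_m_rsum in EA. rewrite sum_n_m_rsum in EB. simpl rsum in EA. simpl rsum in EB.
have Gnn : Gker (S (S n)) (S (S n)) = 1.
{ unfold Gker. rewrite Ingham_value Nat.div_same; [|lia]. simpl (INR 1). field. apply Rgt_not_eq, INR_S_pos. }
have E : rsum (fun k => b (S k) * Gker (S (S n)) (S k)) (S n) = rsum (fun k => a (S k) * Gker (S (S n)) (S k)) (S n).
{ apply rsum_ext => k Hk. rewrite IH //; lia. }
simpl rsum in E. rewrite Gnn in EA. rewrite Gnn in EB. lra.
Qed.

Lemma aseq_1_mu n : aseq 1 (S n) = mu (S n) / INR (S n).
Proof.
unfold aseq. f_equal. have E : forall k, cb 1 (S k) = 0.
{ move=> k. unfold cb. rewrite Rminus_diag !Rpower_O; try apply INR_S_pos. ring. }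
have E1 : forall f, rsum f 1 = f O by move=> f /=; ring.
change (S n) with (1 + n)%nat at 3. rewrite rsum_add E1.
have -> : divb 1 (S n) = true by rewrite /divb Nat.mod_1_r.
rewrite Nat.div_1_r (rsum_ext _ (fun _ => 0) n); [rewrite rsum_const /=; ring|].
move=> k _. change (1 + k)%nat with (S k). rewrite E. case: divb; ring.
Qed.

(** All increments are 1, so the convolution is the divisor sum of [mu]. This settles beta = 0,
    where [cb_primitive] would divide by 0. *)
Lemma aseq_0 n : aseq 0 (S n) = match n with O => 1 | _ => 0 end.
Proof.
have E : forall k, cb 0 k = 1.
{ case=> [//|k]. unfold cb. rewrite Rminus_0_r !Rpower_1; try apply INR_S_pos. rewrite (S_INR (S k)). ring. }
unfold aseq. rewrite (rsum_ext _ (fun d => match divb (S d) (S n) with true => mu (S n / S d) | false => 0 end)).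
- rewrite mu_sum. destruct n; simpl; field. have := INR_S_pos (S n). simpl. lra.
- move=> d _. rewrite E. case: divb; ring.
Qed.

(** * Elementary estimates *)

(** The factor kap^|e| covers both signs of the exponent, so that floors can be replaced by their
    arguments in any power. *)
Lemma Rpower_near kap u x e : 1 <= kap -> 0 < x -> x / kap <= u <= x -> Rpower u e <= Rpower kap (Rabs e) * Rpower x e.
Proof.
move=> Hk Hx Hu. have P0 : 0 < x / kap by apply Rdiv_lt_0_compat; lra. have Px := Rpower_pos x e.
destruct (Rle_dec 0 e) as [He|He].
- have A : Rpower u e <= Rpower x e by apply Rpower_mono; lra.
  have B : 1 <= Rpower kap (Rabs e). { rewrite -(Rpower_base_1 (Rabs e)). apply Rpower_mono; [lra|apply Rabs_pos]. } nra.
- rewrite Rabs_left; [|lra]. rewrite Rmult_comm -Rpower_div //; [|lra]. apply Rpower_anti; lra.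
Qed.

Lemma rsum_Rpower_growth g n : 0 < g -> (1 <= n)%nat -> rsum (fun k => Rpower (INR (S k)) (g - 1)) n <= (1 + / g) * Rpower (INR n) g.
Proof.
move=> Hg Hn. have Pn : 1 <= INR n by apply (le_INR 1). have Pg : 0 < / g by apply Rinv_0_lt_compat. have PR := Rpower_pos (INR n) g.
destruct (Rle_dec 1 g) as [H1|H1].
- apply Rle_trans with (rsum (fun _ => Rpower (INR n) (g - 1)) n).
  + apply rsum_le => k Hk. apply Rpower_mono; [split; [apply INR_S_pos|apply le_INR; lia]|lra].
  + rewrite rsum_const -{1}(Rpower_1 (INR n)) -?Rpower_plus; [|lra]. replace (1 + (g - 1)) with g by ring. nra.
- have H : forall m, rsum (fun k => Rpower (INR (S k)) (g - 1)) (S m) <= 1 + / g * (Rpower (INR (S m)) g - 1).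
  { elim=> [|m IH].
    - change (0 + Rpower 1 (g - 1) <= 1 + / g * (Rpower 1 g - 1)). rewrite !Rpower_base_1. lra.
    - change (rsum (fun k => Rpower (INR (S k)) (g - 1)) (S m) + Rpower (INR (S (S m))) (g - 1) <= 1 + / g * (Rpower (INR (S (S m))) g - 1)).
      have P1 := INR_S_pos m. have [c [Hc E]] := Rpower_MVT (INR (S m)) (INR (S (S m))) g ltac:(split; [done|apply le_INR; lia]).
      have M : Rpower (INR (S (S m))) (g - 1) <= Rpower c (g - 1) by apply Rpower_anti; lra.
      have E1 : INR (S (S m)) - INR (S m) = 1 by rewrite (S_INR (S m)); ring. rewrite E1 in E.
      have E2 : Rpower c (g - 1) = / g * (Rpower (INR (S (S m))) g - Rpower (INR (S m)) g) by rewrite E; field; lra. lra. }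
  destruct n as [|n]; [lia|]. eapply Rle_trans; [apply H|]. have : 1 <= Rpower (INR (S n)) g.
  { rewrite -(Rpower_base_1 g). apply Rpower_mono; lra. } nra.
Qed.

Lemma cb_bound beta : exists K, 0 <= K /\ forall k, Rabs (cb beta k) <= K * Rpower (INR (S k)) (- beta).
Proof.
set A := Rabs (1 - beta) * Rpower 2 (Rabs (- beta)). have PA : 0 <= A by apply Rmult_le_pos; [apply Rabs_pos|apply Rlt_le, Rpower_pos].
exists (1 + A). split; [lra|]. case=> [|k].
- change (Rabs 1 <= (1 + A) * Rpower 1 (- beta)). rewrite Rpower_base_1 Rabs_R1. lra.
- unfold cb. have P := INR_S_ge1 k. have [c [Hc E]] := Rpower_MVT (INR (S k)) (INR (S (S k))) (1 - beta) ltac:(split; [lra|apply le_INR; lia]).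
  rewrite E. have E1 : INR (S (S k)) = INR (S k) + 1 by rewrite (S_INR (S k)). replace (INR (S (S k)) - INR (S k)) with 1 by lra. rewrite Rmult_1_r.
  rewrite Rabs_mult (Rabs_right (Rpower _ _)); [|apply Rle_ge, Rlt_le, Rpower_pos]. replace (1 - beta - 1) with (- beta) by ring.
  have N := Rpower_near 2 c (INR (S (S k))) (- beta) ltac:(lra) ltac:(lra) ltac:(lra).
  have PR := Rpower_pos (INR (S (S k))) (- beta). have P1 := Rabs_pos (1 - beta). unfold A. nra.
Qed.

Lemma floor_half N d : (S d <= N)%nat -> INR N / INR (S d) / 2 <= INR (N / S d) <= INR N / INR (S d) /\ (1 <= N / S d)%nat.
Proof.
move=> H. have P := INR_S_pos d. have D := Nat.div_mod_eq N (S d). have L := Nat.mod_upper_bound N (S d) ltac:(lia).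
set q := (N / S d)%nat in D *. have Hq : (1 <= q)%nat by destruct q; lia.
have E1 : (S d * q <= N)%nat by lia. have E2 : (N <= S d * (2 * q))%nat by nia.
apply le_INR in E1. apply le_INR in E2. rewrite mult_INR in E1. rewrite mult_INR (mult_INR 2) in E2. change (INR 2) with 2 in E2.
split => //. split.
- apply Rmult_le_reg_r with (2 * INR (S d)); [lra|]. replace (INR N / INR (S d) / 2 * (2 * INR (S d))) with (INR N) by (field; lra). lra.
- apply Rmult_le_reg_r with (INR (S d)) => //. unfold Rdiv. rewrite Rmult_assoc Rinv_l; lra.
Qed.

Lemma mertens_floor_bound : mertens_bound -> forall th, 0 < th < 1 / 2 -> exists K, 0 <= K /\
  forall N d, (S d <= N)%nat -> Rabs (mertens (N / S d)) <= K * (Rpower (INR N) (- th) * Rpower (INR (S d)) th).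
Proof.
move=> HM th Hth. have [K HK] := HM (1 / 2 - th) ltac:(lra). have K0 := mertens_K_pos K _ HK.
exists (K * Rpower 2 (Rabs (- th))). split; [apply Rmult_le_pos => //; apply Rlt_le, Rpower_pos|]. move=> N d Hd.
have [F1 F2] := floor_half N d Hd. have P := INR_S_pos d. have PN : 0 < INR N by apply lt_0_INR; lia.
destruct (N / S d)%nat as [|q] eqn:Eq; [lia|]. eapply Rle_trans; [apply HK|]. replace (- 1 / 2 + (1 / 2 - th)) with (- th) by field.
rewrite Rmult_assoc. apply Rmult_le_compat_l => //.
have PQ : 0 < INR N / INR (S d) by apply Rdiv_lt_0_compat.
eapply Rle_trans; [apply (Rpower_near 2 _ (INR N / INR (S d))); lra|]. rewrite Rpower_div // Ropp_involutive. lra.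
Qed.

(** Used with D = N when beta > th, where the sum over d stays bounded, and with D about N / K as
    the head in the hyperbola method. *)
Lemma Asum_head_bound beta : mertens_bound -> forall th, 0 < th < 1 / 2 -> exists K, 0 <= K /\ forall N D, (D <= N)%nat ->
  Rabs (rsum (fun d => cb beta d / INR (S d) * mertens (N / S d)) D) <=
  K * Rpower (INR N) (- th) * rsum (fun d => Rpower (INR (S d)) (th - beta - 1)) D.
Proof.
move=> HM th Hth. have [K1 [P1 H1]] := cb_bound beta. have [K2 [P2 H2]] := mertens_floor_bound HM th Hth.
exists (K1 * K2). split; [nra|]. move=> N D HD. eapply Rle_trans; [apply Rabs_rsum_le|]. rewrite -rsum_scal. apply rsum_le => d Hd.
have P := INR_S_pos d. have Pi : 0 < / INR (S d) by apply Rinv_0_lt_compat.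
unfold Rdiv. rewrite !Rabs_mult (Rabs_right (/ _)); [|lra].
have A := H1 d. have B := H2 N d ltac:(lia).
apply Rle_trans with ((K1 * Rpower (INR (S d)) (- beta)) * / INR (S d) * (K2 * (Rpower (INR N) (- th) * Rpower (INR (S d)) th))).
- apply Rmult_le_compat => //; [apply Rmult_le_pos; [apply Rabs_pos|lra]|apply Rabs_pos|]. by apply Rmult_le_compat_r; [lra|].
- right. replace (/ INR (S d)) with (Rpower (INR (S d)) (- (1))) by (rewrite Rpower_Ropp Rpower_1 //).
  replace (th - beta - 1) with (- beta + - (1) + th) by ring. rewrite !Rpower_plus. ring.
Qed.

Lemma Asum_bound_large beta th : mertens_bound -> 0 < th < 1 / 2 -> th < beta -> exists K, 0 <= K /\
  forall N, Rabs (Asum beta N) <= K * Rpower (INR N) (- th).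
Proof.
move=> HM Hth Hb. have [K [PK HK]] := Asum_head_bound beta HM th Hth. have Pi : 0 < / (beta - th) by apply Rinv_0_lt_compat; lra.
exists (K * (1 + / (beta - th))). split; [nra|]. move=> N. rewrite Asum_eq. eapply Rle_trans; [apply HK; lia|].
have := rsum_Rpower_le (beta - th) N ltac:(lra). replace (- 1 - (beta - th)) with (th - beta - 1) by ring.
have PR := Rpower_pos (INR N) (- th). move=> B.
replace (K * (1 + / (beta - th)) * Rpower (INR N) (- th)) with (K * Rpower (INR N) (- th) * (1 + / (beta - th))) by ring.
apply Rmult_le_compat_l => //. nra.
Qed.

(* The primitive of the summand c_n / n of the outer sum, up to an error O(n^(-beta-2)). *)
Lemma cb_primitive beta : beta <> 0 -> exists K, 0 <= K /\ forall n,
  Rabs (cb beta (S n) / INR (S (S n)) - (1 - beta) / - beta * (Rpower (INR (S (S n))) (- beta) - Rpower (INR (S n)) (- beta))) <=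
  K * Rpower (INR (S (S n))) (- beta - 2).
Proof.
move=> Hb. set A := Rabs (1 - beta) * Rpower 2 (Rabs (- beta - 1)).
have PA : 0 <= A by apply Rmult_le_pos; [apply Rabs_pos|apply Rlt_le, Rpower_pos].
exists A. split => // n. set x := INR (S (S n)). have Ex : x = INR (S n) + 1 by unfold x; rewrite (S_INR (S n)). have P := INR_S_ge1 n.
set rho := (1 - beta) / - beta.
have DP : forall e u, 0 < u -> is_derive (fun u => Rpower u e) u (e * Rpower u (e - 1)).
{ move=> e u Hu. apply is_derive_Reals. by apply derivable_pt_lim_power. }
(* The increment of [f] over [x - 1, x] is the error to be bounded; its derivative contains 1 / x -
   1 / u, which is O(x^(-2)). *)
set f := fun u => / x * Rpower u (1 - beta) - rho * Rpower u (- beta).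
set f' := fun u => (1 - beta) * (Rpower u (- beta) * (/ x - / u)).
have Df : forall u, 0 < u -> is_derive f u (f' u).
{ move=> u Hu. have D := is_derive_minus _ _ u _ _ (is_derive_scal _ u (/ x) _ (DP (1 - beta) u Hu)) (is_derive_scal _ u rho _ (DP (- beta) u Hu)).
  eapply eq_ind; [exact D|]. rewrite /minus /plus /opp /scal /= /mult /=. unfold f', rho.
  replace (1 - beta - 1) with (- beta) by ring. replace (- beta - 1) with (- beta + - (1)) by ring.
  rewrite Rpower_plus (Rpower_Ropp u 1) Rpower_1 //. field. lra. }
destruct (MVT_gen f (INR (S n)) x f') as [c [Hc E]].
- rewrite Rmin_left ?Rmax_right; try lra. move=> u Hu. apply Df. lra.
- rewrite Rmin_left ?Rmax_right; try lra. move=> u Hu. apply continuity_pt_filterlim. apply: ex_derive_continuous. eexists. apply Df. lra.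
- rewrite Rmin_left ?Rmax_right in Hc; try lra.
  replace (cb beta (S n) / x - rho * (Rpower x (- beta) - Rpower (INR (S n)) (- beta))) with (f x - f (INR (S n))); last first.
  { unfold f, cb. fold x. unfold Rdiv. ring. }
  rewrite E. replace (x - INR (S n)) with 1 by lra. rewrite Rmult_1_r. unfold f'. rewrite !Rabs_mult (Rabs_right (Rpower _ _)); [|apply Rle_ge, Rlt_le, Rpower_pos].
  have Pc : 0 < c by lra. have Px : 0 < x by lra.
  have E1 : Rabs (/ x - / c) <= / x * / c.
  { replace (/ x - / c) with ((c - x) * (/ x * / c)) by (field; lra). have Q : 0 < / x * / c by apply Rmult_lt_0_compat; apply Rinv_0_lt_compat.
    rewrite Rabs_mult (Rabs_right (/ x * / c)); [|lra]. have : Rabs (c - x) <= 1 by apply Rabs_le; lra. nra. }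
  have N := Rpower_near 2 c x (- beta - 1) ltac:(lra) Px ltac:(lra).
  have Ec : Rpower c (- beta) * (/ x * / c) = / x * Rpower c (- beta - 1).
  { unfold Rminus at 1. rewrite Rpower_plus (Rpower_Ropp c 1) Rpower_1 //. ring. }
  have Exx : / x * Rpower x (- beta - 1) = Rpower x (- beta - 2).
  { replace (- beta - 2) with (- (1) + (- beta - 1)) by ring. rewrite Rpower_plus (Rpower_Ropp x 1) Rpower_1 //. }
  unfold A. rewrite Rmult_assoc. apply Rmult_le_compat_l; [apply Rabs_pos|].
  apply Rle_trans with (Rpower c (- beta) * (/ x * / c)); [apply Rmult_le_compat_l; [apply Rlt_le, Rpower_pos|done]|].
  rewrite Ec -Exx. have Q : 0 < / x by apply Rinv_0_lt_compat. nra.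
Qed.

(** * Asymptotics of the summatory function *)

Definition Ssum (beta : R) (N : nat) : R := rsum (fun d => cb beta d / INR (S d)) N.

Lemma Ssum_diff beta : beta <> 0 -> exists K, 0 <= K /\ forall D M, (1 <= D <= M)%nat ->
  Rabs (Ssum beta M - Ssum beta D - (1 - beta) / - beta * (Rpower (INR M) (- beta) - Rpower (INR D) (- beta))) <=
  K * rsum (fun k => Rpower (INR (S (D + k))) (- beta - 2)) (M - D).
Proof.
move=> Hb. have [K [PK HK]] := cb_primitive beta Hb. exists K. split => // D M [HD HM].
replace M with (D + (M - D))%nat at 1 2 by lia. elim: (M - D)%nat => [|k IH].
- rewrite Nat.add_0_r /= !Rminus_diag Rmult_0_r Rminus_diag Rabs_R0. lra.
- rewrite Nat.add_succ_r. change (Ssum beta (S (D + k))) with (Ssum beta (D + k) + cb beta (D + k) / INR (S (D + k))).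
  change (rsum (fun k => Rpower (INR (S (D + k))) (- beta - 2)) (S k)) with (rsum (fun k => Rpower (INR (S (D + k))) (- beta - 2)) k + Rpower (INR (S (D + k))) (- beta - 2)).
  destruct (D + k)%nat as [|m] eqn:Em; [lia|]. have B := HK m.
  match type of IH with Rabs ?u <= _ => match type of B with Rabs ?v <= _ => match goal with |- Rabs ?w <= _ => replace w with (u + v) by ring end end end.
  eapply Rle_trans; [apply Rabs_triang|]. lra.
Qed.

Lemma is_lim_seq_inv_n (K : R) : is_lim_seq (fun n => K * / INR (S n)) 0.
Proof.
apply is_lim_seq_eps => eps He. have [N HN] := INR_unbounded (Rabs K / eps). exists N => n Hn.
have P := INR_S_pos n. have h : INR N <= INR (S n) by apply le_INR; lia. rewrite Rminus_0_r Rabs_mult (Rabs_right (/ _)); [|apply Rle_ge, Rlt_le, Rinv_0_lt_compat => //].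
apply Rmult_lt_reg_r with (INR (S n)) => //. rewrite Rmult_assoc Rinv_l; [|lra]. rewrite Rmult_1_r.
have : Rabs K / eps * eps < INR (S n) * eps by apply Rmult_lt_compat_r; lra. unfold Rdiv. rewrite Rmult_assoc Rinv_l; lra.
Qed.

Lemma floor_ratio_lim j : is_lim_seq (fun n => INR (S n / S j) / INR (S n)) (/ INR (S j)).
Proof.
have PJ := INR_S_pos j.
apply (is_lim_seq_le_le (fun n => / INR (S j) - 1 * / INR (S n)) _ (fun n => / INR (S j) + 1 * / INR (S n))).
- move=> n. have P := INR_S_pos n. have D := Nat.div_mod_eq (S n) (S j). have L := Nat.mod_upper_bound (S n) (S j) ltac:(lia). set q := (S n / S j)%nat in D *.
  have E1 : (S j * q <= S n)%nat by lia. have E2 : (S n < S j * S q)%nat by nia.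
  apply le_INR in E1. apply lt_INR in E2. rewrite mult_INR in E1. rewrite mult_INR (S_INR q) in E2.
  have PJi : 0 < / INR (S j) by apply Rinv_0_lt_compat.
  have Q1 : INR q <= / INR (S j) * INR (S n). { apply Rmult_le_reg_l with (INR (S j)) => //. rewrite -Rmult_assoc Rinv_r; lra. }
  have Q2 : / INR (S j) * INR (S n) <= INR q + 1. { apply Rmult_le_reg_l with (INR (S j)) => //. rewrite -Rmult_assoc Rinv_r; lra. }
  split; apply Rmult_le_reg_r with (INR (S n)) => //.
  + replace ((/ INR (S j) - 1 * / INR (S n)) * INR (S n)) with (/ INR (S j) * INR (S n) - 1) by (field; lra).
    replace (INR q / INR (S n) * INR (S n)) with (INR q) by (field; lra). lra.
  + replace ((/ INR (S j) + 1 * / INR (S n)) * INR (S n)) with (/ INR (S j) * INR (S n) + 1) by (field; lra).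
    replace (INR q / INR (S n) * INR (S n)) with (INR q) by (field; lra). lra.
- replace (Finite (/ INR (S j))) with (Finite (/ INR (S j) - 0)) by (f_equal; ring).
  apply is_lim_seq_minus'; [apply is_lim_seq_const|apply is_lim_seq_inv_n].
- replace (Finite (/ INR (S j))) with (Finite (/ INR (S j) + 0)) by (f_equal; ring).
  apply is_lim_seq_plus'; [apply is_lim_seq_const|apply is_lim_seq_inv_n].
Qed.

Lemma continuous_Rpower e x : 0 < x -> continuous (fun u => Rpower u e) x.
Proof. move=> H. apply: ex_derive_continuous. exists (e * Rpower x (e - 1)). apply is_derive_Reals. by apply derivable_pt_lim_power. Qed.

Lemma floor_power_lim j beta : is_lim_seq (fun n => Rpower (INR (S n)) beta * Rpower (INR (S n / S j)) (- beta)) (Rpower (INR (S j)) beta).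
Proof.
have PJ := INR_S_pos j. have L := floor_ratio_lim j.
have L2 : is_lim_seq (fun n => Rpower (INR (S n / S j) / INR (S n)) (- beta)) (Rpower (/ INR (S j)) (- beta)).
{ apply (is_lim_seq_continuous (fun u => Rpower u (- beta))) => //. apply continuity_pt_filterlim. by apply continuous_Rpower, Rinv_0_lt_compat. }
rewrite Rpower_inv_base // Ropp_involutive in L2.
apply: is_lim_seq_ext_loc L2. exists (S j) => n Hn. have P := INR_S_pos n. have [_ Hq] := floor_half (S n) j ltac:(lia).
have Pq : 0 < INR (S n / S j) by apply lt_0_INR; lia. rewrite Rpower_div // Ropp_involutive. ring.
Qed.

(** Only differences are used: for beta > 0 an unknown additive constant cancels, for beta < 0 the
    sums grow. At most N errors of size N^(-beta-2) become O(1 / N) after multiplication by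
    N^beta. *)
Lemma Ssum_lim beta j K : beta <> 0 -> (j <= K)%nat ->
  is_lim_seq (fun n => Rpower (INR (S n)) beta * (Ssum beta (S n / S j) - Ssum beta (S n / S K)))
    ((1 - beta) / - beta * (Rpower (INR (S j)) beta - Rpower (INR (S K)) beta)).
Proof.
move=> Hb Hj. have [C0 [PC HC]] := Ssum_diff beta Hb. set rho := (1 - beta) / - beta in HC *.
set A := C0 * Rpower (INR (S K)) (Rabs (- beta - 2)). have PK := INR_S_ge1 K.
have PA : 0 <= A by apply Rmult_le_pos => //; apply Rlt_le, Rpower_pos.
have Main : is_lim_seq (fun n => rho * (Rpower (INR (S n)) beta * Rpower (INR (S n / S j)) (- beta) - Rpower (INR (S n)) beta * Rpower (INR (S n / S K)) (- beta)))
   (rho * (Rpower (INR (S j)) beta - Rpower (INR (S K)) beta)).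
{ apply (is_lim_seq_scal_l _ rho (Finite (Rpower (INR (S j)) beta - Rpower (INR (S K)) beta))). apply is_lim_seq_minus'; apply floor_power_lim. }
apply is_lim_seq_eps => eps He.
move/is_lim_seq_eps: Main => /(_ (eps / 2) ltac:(lra)) [N1 H1].
move/is_lim_seq_eps: (is_lim_seq_inv_n A) => /(_ (eps / 2) ltac:(lra)) [N2 H2].
exists (max (max N1 N2) (S K)) => n Hn. have h1 := H1 n ltac:(lia). have h2 := H2 n ltac:(lia).
set x := INR (S n) in h1 h2 *. have Px : 0 < x by apply INR_S_pos.
set D := (S n / S K)%nat in h1 *. set M := (S n / S j)%nat in h1 *.
have HDM : (D <= M)%nat by apply Nat.div_le_compat_l; lia. have HD : (1 <= D)%nat by apply Nat.div_le_lower_bound; lia.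
have HMn : (M <= S n)%nat by apply div_le_self.
have B := HC D M ltac:(lia).
have S1 : rsum (fun k => Rpower (INR (S (D + k))) (- beta - 2)) (M - D) <= x * (Rpower (INR (S K)) (Rabs (- beta - 2)) * Rpower x (- beta - 2)).
{ apply Rle_trans with (rsum (fun _ => Rpower (INR (S K)) (Rabs (- beta - 2)) * Rpower x (- beta - 2)) (M - D)).
  - apply rsum_le => k Hk. apply Rpower_near => //. split; [|apply le_INR; lia].
    apply Rmult_le_reg_r with (INR (S K)); [lra|]. unfold Rdiv. rewrite Rmult_assoc Rinv_l; [|lra]. rewrite Rmult_1_r.
    rewrite -mult_INR. apply le_INR. have DD := Nat.div_mod_eq (S n) (S K). have LL := Nat.mod_upper_bound (S n) (S K) ltac:(lia). fold D in DD. nia.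
  - rewrite rsum_const. apply Rmult_le_compat_r; [apply Rmult_le_pos; apply Rlt_le, Rpower_pos|]. apply le_INR. lia. }
have E : Rpower x beta * (x * Rpower x (- beta - 2)) = / x.
{ rewrite -{2}(Rpower_1 x) // -!Rpower_plus. replace (beta + (1 + (- beta - 2))) with (- (1)) by ring. by rewrite Rpower_Ropp Rpower_1. }
set dl := Ssum beta M - Ssum beta D - rho * (Rpower (INR M) (- beta) - Rpower (INR D) (- beta)) in B.
have PR := Rpower_pos x beta.
have B2 : Rabs (Rpower x beta * dl) <= A * / x.
{ rewrite Rabs_mult (Rabs_right (Rpower x beta)); [|lra]. rewrite -E. unfold A.
  apply Rle_trans with (Rpower x beta * (C0 * (x * (Rpower (INR (S K)) (Rabs (- beta - 2)) * Rpower x (- beta - 2))))).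
  - apply Rmult_le_compat_l; [lra|]. eapply Rle_trans; [apply B|]. by apply Rmult_le_compat_l.
  - right. ring. }
rewrite Rminus_0_r Rabs_right in h2; [|apply Rle_ge, Rmult_le_pos => //; apply Rlt_le, Rinv_0_lt_compat => //].
replace (Rpower x beta * (Ssum beta M - Ssum beta D) - rho * (Rpower (INR (S j)) beta - Rpower (INR (S K)) beta)) with
  (Rpower x beta * dl + (rho * (Rpower x beta * Rpower (INR M) (- beta) - Rpower x beta * Rpower (INR D) (- beta)) - rho * (Rpower (INR (S j)) beta - Rpower (INR (S K)) beta))) by (unfold dl; ring).
eapply Rle_lt_trans; [apply Rabs_triang|]. lra.
Qed.

(* Dirichlet's hyperbola method with a fixed number K of small cofactors. *)
Lemma Asum_split beta N K : Asum beta N =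
  rsum (fun d => cb beta d / INR (S d) * mertens (N / S d)) (N / S K) +
  rsum (fun j => mu (S j) / INR (S j) * (Ssum beta (N / S j) - Ssum beta (N / S K))) (Nat.min K N).
Proof.
set D := (N / S K)%nat. have HD : (D <= N)%nat by apply div_le_self.
rewrite Asum_eq (rsum_split _ D N) //. f_equal.
set g := fun d j => match Nat.leb D d with true => cb beta d / INR (S d) * (mu (S j) / INR (S j)) | false => 0 end.
transitivity (rsum (fun d => rsum (fun j => g d j) (N / S d)) N).
{ rewrite (rsum_split (fun d => rsum (fun j => g d j) (N / S d)) D N) //.
  rewrite (rsum_ext (fun d => rsum (fun j => g d j) (N / S d)) (fun _ => 0) D).
  2:{ move=> d Hd. rewrite (rsum_ext _ (fun _ => 0)); [rewrite rsum_const; ring|]. move=> j _. unfold g. by rewrite (proj2 (Nat.leb_gt _ _)). }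
  rewrite rsum_const Rmult_0_r Rplus_0_l. apply rsum_ext => k _. unfold mertens. rewrite -rsum_scal. apply rsum_ext => j _. unfold g.
  rewrite (proj2 (Nat.leb_le _ _)) //. lia. }
rewrite hyperbola_sym_R (rsum_split _ (Nat.min K N) N); [|lia].
rewrite (rsum_ext (fun k => rsum _ (N / S (Nat.min K N + k))) (fun _ => 0)).
2:{ move=> j Hj. rewrite (rsum_ext _ (fun _ => 0)); [rewrite rsum_const; ring|]. move=> d Hd. unfold g. rewrite (proj2 (Nat.leb_gt _ _)) //.
    eapply Nat.lt_le_trans; [apply Hd|]. apply Nat.div_le_compat_l. lia. }
rewrite rsum_const Rmult_0_r Rplus_0_r. apply rsum_ext => j Hj.
have HDM : (D <= N / S j)%nat by apply Nat.div_le_compat_l; lia.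
rewrite (rsum_split _ D (N / S j)) // (rsum_ext _ (fun _ => 0) D).
2:{ move=> d Hd. unfold g. by rewrite (proj2 (Nat.leb_gt _ _)). }
rewrite rsum_const Rmult_0_r Rplus_0_l. unfold Ssum. rewrite (rsum_split (fun d => cb beta d / INR (S d)) D (N / S j)) //.
rewrite (rsum_ext _ (fun k => mu (S j) / INR (S j) * (cb beta (D + k) / INR (S (D + k))))).
- rewrite rsum_scal. ring.
- move=> k _. unfold g. rewrite (proj2 (Nat.leb_le _ _)); [ring|lia].
Qed.

Lemma is_lim_seq_rsum (f : nat -> nat -> R) (l : nat -> R) P : (forall j, (j < P)%nat -> is_lim_seq (fun n => f j n) (l j)) ->
  is_lim_seq (fun n => rsum (fun j => f j n) P) (rsum l P).
Proof.
elim: P => [|P IH] H; [apply is_lim_seq_const|]. simpl. apply (is_lim_seq_plus' _ _ (rsum l P) (l P)); [apply IH; intros; apply H; lia|apply H; lia].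
Qed.

Lemma mu_partial_real beta K : mu_partial (RtoC (1 - beta)) K = RtoC (rsum (fun j => mu (S j) / INR (S j) * Rpower (INR (S j)) beta) K).
Proof.
unfold mu_partial. rewrite -csum_RtoC. apply csum_ext => j _. have P := INR_S_pos j.
rewrite -RtoC_opp Rcpower_RtoC -RtoC_mult. f_equal. replace (- (1 - beta)) with (- (1) + beta) by ring.
rewrite Rpower_plus (Rpower_Ropp _ 1) Rpower_1 //. unfold Rdiv. ring.
Qed.

(** K is fixed before n grows. The head is O(K^(- g)) uniformly in n; the rest tends to rho (F_K -
    K^beta mertens(K)), where F_K is a partial sum of 1 / zeta at 1 - beta and the subtracted term
    is again O(K^(- g)). *)
Lemma Asum_asymptotic beta : mertens_bound -> beta <> 0 -> beta < 1 / 2 ->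
  clim (fun n => RtoC (Rpower (INR (S n)) beta * Asum beta (S n))) (RtoC ((1 - beta) / - beta) * Ff (RtoC (1 - beta)))%C.
Proof.
move=> HM Hb Hb2. set rho := (1 - beta) / - beta.
(* Below 1 / 2 for the bound on [mertens], positive, and above beta so that g > 0 gives decay in
   K. *)
set th := (Rmax beta 0 + 1 / 2) / 2.
have Hth : 0 < th < 1 / 2 /\ beta < th. { have := Rmax_l beta 0. have := Rmax_r beta 0. have : Rmax beta 0 < 1 / 2 by apply Rmax_lub_lt; lra. unfold th. lra. }
set g := th - beta. have Hg : 0 < g by unfold g; lra. have Pgi : 0 < / g by apply Rinv_0_lt_compat.
have [C1 [PC1 HC1]] := Asum_head_bound beta HM th ltac:(lra). have [C2 [PC2 HC2]] := mertens_floor_bound HM th ltac:(lra).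
have LF := Ff_clim (RtoC (1 - beta)) HM ltac:(rewrite Re_RtoC; lra).
move=> eps He.
set T2 := Rpower 2 (Rabs (- th)). have PT2 : 0 < T2 by apply Rpower_pos.
(* The sum of the constants in front of the four errors, each of which is then allowed eps / (4
   q). *)
set q := C1 * (1 + / g) + Rabs rho * (C2 * T2) + 1 + Rabs rho. have Prho := Rabs_pos rho. have Pq : 1 <= q by unfold q; have := Rmult_le_pos _ _ Prho (Rmult_le_pos _ _ PC2 (Rlt_le _ _ PT2)); nra.
have He1 : 0 < eps / (4 * q) by apply Rdiv_lt_0_compat; lra.
destruct (LF (eps / (4 * q)) He1) as [K1 HK1].
move/is_lim_seq_eps: (Rpower_seq_lim0 g Hg) => /(_ (eps / (4 * q)) He1) [K2 HK2].
set K := S (max K1 K2). have PK := INR_S_pos K.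
have hK2 := HK2 K ltac:(unfold K; lia). rewrite Rminus_0_r Rabs_right in hK2; [|apply Rle_ge, Rlt_le, Rpower_pos].
have hK1 := HK1 K ltac:(unfold K; lia).
set FK := rsum (fun j => mu (S j) / INR (S j) * Rpower (INR (S j)) beta) K.
have EFK : mu_partial (RtoC (1 - beta)) K = RtoC FK by apply mu_partial_real. rewrite EFK in hK1.
have EL : rsum (fun j => mu (S j) / INR (S j) * (rho * (Rpower (INR (S j)) beta - Rpower (INR (S K)) beta))) K = rho * (FK - Rpower (INR (S K)) beta * mertens K).
{ unfold FK, mertens. rewrite -(rsum_scal (Rpower (INR (S K)) beta)) -rsum_minus -rsum_scal. apply rsum_ext => j _. ring. }
have L' : is_lim_seq (fun n => rsum (fun j => mu (S j) / INR (S j) * (Rpower (INR (S n)) beta * (Ssum beta (S n / S j) - Ssum beta (S n / S K)))) K) (Finite (rho * (FK - Rpower (INR (S K)) beta * mertens K))).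
{ rewrite -EL. apply (is_lim_seq_rsum (fun j n => mu (S j) / INR (S j) * (Rpower (INR (S n)) beta * (Ssum beta (S n / S j) - Ssum beta (S n / S K))))) => j Hj.
  apply (is_lim_seq_scal_l _ (mu (S j) / INR (S j)) (Finite (rho * (Rpower (INR (S j)) beta - Rpower (INR (S K)) beta)))). apply Ssum_lim => //. lia. }
move/is_lim_seq_eps: L' => /(_ (eps / (4 * q)) He1) [N1 HN1].
exists (max N1 (S K)) => n Hn. have h1 := HN1 n ltac:(lia). set x := INR (S n) in h1 *. have Px : 0 < x by apply INR_S_pos.
rewrite (Asum_split beta (S n) K). have -> : Nat.min K (S n) = K by lia.
set H1 := rsum (fun d => cb beta d / INR (S d) * mertens (S n / S d)) (S n / S K).
set H2 := rsum (fun j => mu (S j) / INR (S j) * (Ssum beta (S n / S j) - Ssum beta (S n / S K))) K.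
have E2 : rsum (fun j => mu (S j) / INR (S j) * (Rpower x beta * (Ssum beta (S n / S j) - Ssum beta (S n / S K)))) K = Rpower x beta * H2.
{ unfold H2. rewrite -rsum_scal. apply rsum_ext => j _. ring. }
rewrite E2 in h1.
have PR := Rpower_pos x beta.
have [F1 F2] := floor_half (S n) K ltac:(lia). have PD : 0 < INR (S n / S K) by apply lt_0_INR; lia.
have B1 : Rabs (Rpower x beta * H1) <= C1 * (1 + / g) * (eps / (4 * q)).
{ rewrite Rabs_mult (Rabs_right (Rpower x beta)); [|lra].
  have A := HC1 (S n) (S n / S K)%nat ltac:(apply div_le_self).
  have G := rsum_Rpower_growth g (S n / S K) Hg F2. unfold g in G.
  have G2 : Rpower (INR (S n / S K)) g <= Rpower x g * Rpower (INR (S K)) (- g).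
  { rewrite -Rpower_div //. fold x in F1. apply Rpower_mono; lra. }
  have PT := Rpower_pos x (- th).
  apply Rle_trans with (Rpower x beta * (C1 * Rpower x (- th) * ((1 + / g) * (Rpower x g * Rpower (INR (S K)) (- g))))).
  - apply Rmult_le_compat_l; [lra|]. eapply Rle_trans; [apply A|]. apply Rmult_le_compat_l; [nra|].
    eapply Rle_trans; [apply G|]. apply Rmult_le_compat_l; [fold g; lra|done].
  - have E : Rpower x beta * (Rpower x (- th) * Rpower x g) = 1.
    { rewrite -!Rpower_plus. replace (beta + (- th + g)) with 0 by (unfold g; ring). by apply Rpower_O. }
    replace (Rpower x beta * (C1 * Rpower x (- th) * ((1 + / g) * (Rpower x g * Rpower (INR (S K)) (- g))))) with
      ((Rpower x beta * (Rpower x (- th) * Rpower x g)) * (C1 * (1 + / g) * Rpower (INR (S K)) (- g))) by ring.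
    rewrite E Rmult_1_l. apply Rmult_le_compat_l; [nra|lra]. }
have B2 : Rabs (rho * (Rpower (INR (S K)) beta * mertens K)) <= Rabs rho * (C2 * T2) * (eps / (4 * q)).
{ rewrite (Rabs_mult rho) (Rabs_mult (Rpower _ _)) (Rabs_right (Rpower _ _)); [|apply Rle_ge, Rlt_le, Rpower_pos]. rewrite (Rmult_assoc (Rabs rho)). apply Rmult_le_compat_l => //.
  have P1 := INR_S_ge1 (max K1 K2). have SK := S_INR K.
  have A := HC2 K 0%nat ltac:(unfold K; lia). change (INR 1) with 1 in A. rewrite Nat.div_1_r Rpower_base_1 Rmult_1_r in A.
  have NN := Rpower_near 2 (INR K) (INR (S K)) (- th) ltac:(lra) PK ltac:(fold K in P1; lra). fold T2 in NN.
  apply Rle_trans with (Rpower (INR (S K)) beta * (C2 * (T2 * Rpower (INR (S K)) (- th)))).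
  { apply Rmult_le_compat_l; [apply Rlt_le, Rpower_pos|]. eapply Rle_trans; [apply A|]. by apply Rmult_le_compat_l. }
  have E1 : Rpower (INR (S K)) beta * Rpower (INR (S K)) (- th) = Rpower (INR (S K)) (- g) by rewrite -Rpower_plus; f_equal; unfold g; ring.
  replace (Rpower (INR (S K)) beta * (C2 * (T2 * Rpower (INR (S K)) (- th)))) with (C2 * T2 * (Rpower (INR (S K)) beta * Rpower (INR (S K)) (- th))) by ring.
  rewrite E1. apply Rmult_le_compat_l; [|lra]. apply Rmult_le_pos; lra. }
have B3 : Rabs rho * Cmod (RtoC FK - Ff (RtoC (1 - beta)))%C <= Rabs rho * (eps / (4 * q)) by apply Rmult_le_compat_l => //; apply Rlt_le.
have Etot : C1 * (1 + / g) * (eps / (4 * q)) + Rabs rho * (C2 * T2) * (eps / (4 * q)) + eps / (4 * q) + Rabs rho * (eps / (4 * q)) = eps / 4. { have E0 : q * (eps / (4 * q)) = eps / 4 by field; lra. unfold q at 1 in E0. lra. }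
replace (RtoC (Rpower x beta * (H1 + H2)) - RtoC rho * Ff (RtoC (1 - beta)))%C with
  (RtoC (Rpower x beta * H1) + (RtoC (Rpower x beta * H2 - rho * (FK - Rpower (INR (S K)) beta * mertens K)) - RtoC (rho * (Rpower (INR (S K)) beta * mertens K))) + RtoC rho * (RtoC FK - Ff (RtoC (1 - beta))))%C.
2:{ move: (Ff _) => F. rewrite Rmult_plus_distr_l Rmult_minus_distr_l !(RtoC_plus, RtoC_minus, RtoC_mult). ring. }
eapply Rle_lt_trans; [apply Cmod_triangle|]. rewrite Cmod_mult !Cmod_R.
have T1 := Cmod_triangle (RtoC (Rpower x beta * H1)) (RtoC (Rpower x beta * H2 - rho * (FK - Rpower (INR (S K)) beta * mertens K)) - RtoC (rho * (Rpower (INR (S K)) beta * mertens K)))%C.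
have T3 := Cmod_triangle (RtoC (Rpower x beta * H2 - rho * (FK - Rpower (INR (S K)) beta * mertens K))) (- RtoC (rho * (Rpower (INR (S K)) beta * mertens K)))%C.
rewrite Cmod_opp !Cmod_R in T3. rewrite !Cmod_R in T1. unfold Cminus at 1 2 in T1.
unfold Cminus at 1. lra.
Qed.

(** * The Mellin transform and regularity under the Riemann hypothesis *)

(** Dominated convergence for sums whose length grows with n: beyond a fixed [P] all terms together
    are at most a tail of [b]. *)
Lemma tannery (f : nat -> nat -> C) (l : nat -> C) b B L : (forall n m, Cmod (f n m) <= b m) -> (forall n, rsum b n <= B) ->
  (forall m, clim (fun n => f n m) (l m)) -> clim (csum l) L -> clim (fun n => csum (f n) (S n)) L.
Proof.
move=> Hb HB Hf HL eps He.
have b0 : forall m, 0 <= b m by move=> m; eapply Rle_trans; [apply Cmod_ge_0|apply (Hb O m)].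
have [T [_ [HT1 HT2]]] := rsum_bounded_lim b B b0 HB.
move/is_lim_seq_eps: HT1 => /(_ (eps / 4) ltac:(lra)) [P1 HP1]. destruct (HL (eps / 4) ltac:(lra)) as [P2 HP2].
set P := max P1 P2. have h1 := HP1 P ltac:(unfold P; lia). have h2 := HP2 P ltac:(unfold P; lia).
have Hfin : clim (fun n => csum (f n) P) (csum l P).
{ clear - Hf. elim: P => [|P IH]; [exact (clim_const 0%C)|]. exact (clim_plus _ _ _ _ IH (Hf P)). }
destruct (Hfin (eps / 4) ltac:(lra)) as [N HN]. exists (max N P) => n Hn. have h3 := HN n ltac:(lia).
have D := csum_diff_le (f n) b P (S n) ltac:(lia) (Hb n). have h4 := HT2 (S n). have := Rabs_def2 _ _ h1 => [[h5 h6]].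
replace (csum (f n) (S n) - L)%C with ((csum (f n) (S n) - csum (f n) P) + (csum (f n) P - csum l P) + (csum l P - L))%C by ring.
eapply Rle_lt_trans; [apply Cmod_triangle|]. have := Cmod_triangle (csum (f n) (S n) - csum (f n) P) (csum (f n) P - csum l P). lra.
Qed.

Definition Tpow (w : C) (M : nat) : C := csum (fun k => Rcpower (INR (S k)) w) M.

(** Two mean value inequalities: the increment of x^(w+1) differs from (w + 1) x^w by one power
    less, so that summation gives the leading term of the sum of k^w. *)
Lemma Rcpower_step w : 0 < Re w -> exists K, 0 <= K /\ forall k,
  Cmod (Rcpower (INR (S (S k))) (w + 1) - Rcpower (INR (S k)) (w + 1) - (w + 1) * Rcpower (INR (S (S k))) w)%C <= K * Rpower (INR (S (S k))) (Re w - 1).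
Proof.
move=> Hw. set A := Rpower 2 (Rabs (Re w - 1)). have PA : 0 < A by apply Rpower_pos.
exists (Cmod (w + 1)%C * (Cmod w * A)). have W0 := Cmod_ge_0 w. have W1 := Cmod_ge_0 (w + 1)%C. split; [apply Rmult_le_pos => //; nra|] => k.
set x := INR (S (S k)). have Ex : x = INR (S k) + 1 by unfold x; rewrite (S_INR (S k)). have P := INR_S_ge1 k. set a := INR (S k) in Ex P *.
have PR := Rpower_pos x (Re w - 1).
have In : forall u, a <= u <= x -> Cmod (Rcpower x w - Rcpower u w)%C <= Cmod w * (A * Rpower x (Re w - 1)).
{ move=> u Hu. have M := MVT_C (fun v => Rcpower v w) _ u x (Cmod w * (A * Rpower x (Re w - 1))) ltac:(lra) (fun t Ht => rderiv_Rcpower w t ltac:(lra)).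
  eapply Rle_trans; [apply M|].
  - move=> t Ht. rewrite Cmod_mult Cmod_Rcpower. apply Rmult_le_compat_l => //. rewrite Re_minus Re_RtoC. apply Rpower_near; lra.
  - have Q : 0 <= Cmod w * (A * Rpower x (Re w - 1)) by apply Rmult_le_pos => //; nra. nra. }
set c := ((w + 1) * Rcpower x w)%C.
have D : forall t, a <= t <= x -> rderiv (fun u => Rcpower u (w + 1) - RtoC u * c)%C t ((w + 1) * Rcpower t (w + 1 - 1) - c)%C.
{ move=> t Ht. apply rderiv_minus; [apply rderiv_Rcpower; lra|]. eapply rderiv_ext; [|apply (rderiv_line 0%C c)]. move=> u /=. ring. }
have M := MVT_C _ _ a x (Cmod (w + 1)%C * (Cmod w * A) * Rpower x (Re w - 1)) ltac:(lra) D.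
replace (Rcpower x (w + 1) - Rcpower a (w + 1) - c)%C with ((Rcpower x (w + 1) - RtoC x * c) - (Rcpower a (w + 1) - RtoC a * c))%C by (rewrite Ex RtoC_plus; ring).
eapply Rle_trans; [apply M|].
- move=> t Ht. replace (w + 1 - 1)%C with w by ring. replace ((w + 1) * Rcpower t w - c)%C with ((w + 1) * (Rcpower t w - Rcpower x w))%C by (unfold c; ring).
  rewrite Cmod_mult Rmult_assoc. apply Rmult_le_compat_l => //. rewrite Cmod_sub_sym Rmult_assoc. by apply In.
- replace (x - a) with 1 by lra. lra.
Qed.

Lemma Tpow_asymp w : 0 < Re w -> exists K, 0 <= K /\ forall M,
  Cmod ((w + 1) * Tpow w (S M) - Rcpower (INR (S M)) (w + 1))%C <= K * Rpower (INR (S M)) (Re w).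
Proof.
move=> Hw. have [K [PK HK]] := Rcpower_step w Hw. have W0 := Cmod_ge_0 w. have Pi : 0 < / Re w by apply Rinv_0_lt_compat.
exists (Cmod w + K * (1 + / Re w)). split; [nra|] => M.
have B : Cmod ((w + 1) * Tpow w (S M) - Rcpower (INR (S M)) (w + 1))%C <= Cmod w + K * rsum (fun k => Rpower (INR (S k)) (Re w - 1)) (S M).
{ elim: M => [|M IH].
  - unfold Tpow. simpl. rewrite !Rcpower_base_1. replace ((w + 1) * (0 + 1) - 1)%C with w by ring. have := Rpower_pos 1 (Re w - 1). nra.
  - change (Tpow w (S (S M))) with (Tpow w (S M) + Rcpower (INR (S (S M))) w)%C.
    change (rsum (fun k => Rpower (INR (S k)) (Re w - 1)) (S (S M))) with (rsum (fun k => Rpower (INR (S k)) (Re w - 1)) (S M) + Rpower (INR (S (S M))) (Re w - 1)).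
    have S0 := HK M. match type of IH with Cmod ?u <= _ => match type of S0 with Cmod ?v <= _ => match goal with |- Cmod ?g <= _ => replace g with (u - v)%C by ring end end end.
    eapply Rle_trans; [apply Cmod_triangle_sub|]. lra. }
have G := rsum_Rpower_growth (Re w) (S M) Hw ltac:(lia). have R1 : 1 <= Rpower (INR (S M)) (Re w).
{ rewrite -(Rpower_base_1 (Re w)). apply Rpower_mono; [|lra]. have := INR_S_ge1 M. lra. }
eapply Rle_trans; [apply B|]. nra.
Qed.

Lemma Tpow_bound w M : 0 < Re w -> Cmod (Tpow w M) <= INR M * Rpower (INR M) (Re w).
Proof.
move=> Hw. eapply Rle_trans; [apply Cmod_csum_le|]. rewrite -rsum_const. apply rsum_le => k Hk. rewrite Cmod_Rcpower. apply Rpower_mono; [|lra].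
split; [apply INR_S_pos|apply le_INR; lia].
Qed.

Lemma Rcpower_ratio x y s : 0 < x -> 0 < y -> (Rcpower x s * Rcpower y (- s))%C = Rcpower (x / y) s.
Proof.
move=> Hx Hy. unfold Rdiv. rewrite Rcpower_mult_base //; [|by apply Rinv_0_lt_compat]. f_equal. unfold Rcpower. rewrite ln_Rinv //. f_equal. rewrite RtoC_opp. ring.
Qed.

Lemma Tpow_lim w m : 0 < Re w ->
  clim (fun n => Rcpower (INR (S n)) (- (w + 1)) * Tpow w (S n / S m))%C (/ (w + 1) * Rcpower (INR (S m)) (- (w + 1)))%C.
Proof.
move=> Hw. have [K [PK HK]] := Tpow_asymp w Hw. have Pm := INR_S_pos m.
have Nw : (w + 1)%C <> 0%C. { move=> E. have : Re (w + 1)%C = 0 by rewrite E. rewrite Re_plus Re_RtoC. lra. }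
have L1 : clim (fun n => Rcpower (INR (S n / S m) / INR (S n)) (w + 1)) (Rcpower (/ INR (S m)) (w + 1)).
{ move=> eps He. have RC := rderiv_rcont _ _ _ (rderiv_Rcpower (w + 1)%C (/ INR (S m)) (Rinv_0_lt_compat _ Pm)).
  destruct (proj1 (rcont_eps _ _) RC eps He) as [d [Hd H]]. move/is_lim_seq_eps: (floor_ratio_lim m) => /(_ d Hd) [N HN]. exists N => n Hn. apply H. by apply HN. }
have L2 : clim (fun n => (w + 1) * (Rcpower (INR (S n)) (- (w + 1)) * Tpow w (S n / S m)))%C (Rcpower (/ INR (S m)) (w + 1)).
{ move=> eps He. destruct (L1 (eps / 2) ltac:(lra)) as [N1 H1]. move/is_lim_seq_eps: (is_lim_seq_inv_n K) => /(_ (eps / 2) ltac:(lra)) [N2 H2].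
  exists (max (max N1 N2) (S m)) => n Hn. have h1 := H1 n ltac:(lia). have h2 := H2 n ltac:(lia). have Pn := INR_S_pos n.
  rewrite Rminus_0_r Rabs_right in h2; [|apply Rle_ge, Rmult_le_pos => //; apply Rlt_le, Rinv_0_lt_compat => //].
  have [_ F] := floor_half (S n) m ltac:(lia). have HMn := div_le_self (S n) m. destruct (S n / S m)%nat as [|M]; [lia|].
  have PM := INR_S_pos M. rewrite -Rcpower_ratio // in h1.
  match type of h1 with Cmod (?u - ?v)%C < _ => replace ((w + 1) * (Rcpower (INR (S n)) (- (w + 1)) * Tpow w (S M)) - v)%C with
    ((u - v) + Rcpower (INR (S n)) (- (w + 1)) * ((w + 1) * Tpow w (S M) - Rcpower (INR (S M)) (w + 1)))%C by ring end.
  eapply Rle_lt_trans; [apply Cmod_triangle|]. rewrite Cmod_mult Cmod_Rcpower Re_opp Re_plus Re_RtoC.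
  have B : Rpower (INR (S n)) (- (Re w + 1)) * Cmod ((w + 1) * Tpow w (S M) - Rcpower (INR (S M)) (w + 1))%C <= K * / INR (S n); [|lra].
  apply Rle_trans with (Rpower (INR (S n)) (- (Re w + 1)) * (K * Rpower (INR (S n)) (Re w))).
  - apply Rmult_le_compat_l; [apply Rlt_le, Rpower_pos|]. eapply Rle_trans; [apply HK|]. apply Rmult_le_compat_l => //. apply Rpower_mono; [|lra]. split => //. by apply le_INR.
  - right. rewrite (Rmult_comm K) -Rmult_assoc -Rpower_plus. replace (- (Re w + 1) + Re w) with (- (1)) by ring. rewrite Rpower_Ropp Rpower_1 //. ring. }
have L3 := clim_scal _ _ (/ (w + 1))%C L2.
have -> : Rcpower (INR (S m)) (- (w + 1)) = Rcpower (/ INR (S m)) (w + 1).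
{ unfold Rcpower. rewrite ln_Rinv // RtoC_opp. f_equal. ring. }
eapply clim_ext; [|apply L3]. move=> n /=. field. done.
Qed.

(** With w = - z, exchanging k with the cofactor counted by the floor turns the mean into w n^(-w-1)
    times the sum over m of [Tpow w (n / m)]. Termwise the limit is m^(-w-1) / (w + 1), and zeta(w +
    1) = Zf(w + 1) / w. *)
Lemma mellin_limit z : Re z < 0 -> clim (mellin_mean Gker z) (Zf (1 - z) / (1 - z))%C.
Proof.
move=> Hz. set w := (- z)%C. have Hw : 0 < Re w by unfold w; rewrite Re_opp; lra.
have N1 : (w + 1)%C <> 0%C. { move=> E. have : Re (w + 1)%C = 0 by rewrite E. rewrite Re_plus Re_RtoC. lra. }
have N0 : w <> 0%C. { move=> E. move: Hw. rewrite E /=. lra. }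
apply (clim_shift _ _ 1).
have T := tannery (fun n m => Rcpower (INR (S n)) (- (w + 1)) * Tpow w (S n / S m))%C (fun m => / (w + 1) * Rcpower (INR (S m)) (- (w + 1)))%C
  (fun m => Rpower (INR (S m)) (- 1 - Re w)) (1 + / Re w) (/ (w + 1) * (Zf (w + 1) / (w + 1 - 1)))%C.
have L := T _ (fun n => rsum_Rpower_le (Re w) n Hw) (fun m => Tpow_lim w m Hw).
have {T} L := clim_scal _ _ w (L _ _).
have EL : (w * (/ (w + 1) * (Zf (w + 1) / (w + 1 - 1))))%C = (Zf (1 - z) / (1 - z))%C.
{ unfold w in N0, N1 |- *. replace (1 - z)%C with (- z + 1)%C by ring. field. split => //. replace (- z + 1 - 1)%C with (- z)%C by ring. done. }
rewrite -EL. eapply clim_ext; [|apply L].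
- move=> n. cbv beta. rewrite Nat.add_1_r. unfold mellin_mean. fold w. rewrite sum_n_m_csum csum_scal. have Pn := INR_S_pos n.
  have NC : RtoC (INR (S n)) <> 0%C by apply RtoC_neq_0; lra.
  unfold Tpow. rewrite (hyperbola_sym (fun _ k => Rcpower (INR (S k)) w) (S n)).
  rewrite (csum_ext (fun k => RtoC (Gker (S n) (S k)) * Rcpower (INR (S k) / INR (S n)) (w - 1))%C (fun k => (RtoC (INR (S n)) * Rcpower (INR (S n)) (- (w + 1))) * csum (fun _ => Rcpower (INR (S k)) w) (S n / S k))%C).
  + rewrite csum_scal. unfold w. field. done.
  + move=> k _. have Pk := INR_S_pos k. have NCk : RtoC (INR (S k)) <> 0%C by apply RtoC_neq_0; lra.
    have EA : Rcpower (INR (S k)) w = (Rcpower (INR (S k)) (w - 1) * RtoC (INR (S k)))%C by rewrite -(Rcpower_1 (INR (S k))) // -Rcpower_add; f_equal; ring.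
    have EB : Rcpower (INR (S n)) (- (w - 1)) = (Rcpower (INR (S n)) (- (w + 1)) * (RtoC (INR (S n)) * RtoC (INR (S n))))%C by rewrite -(Rcpower_1 (INR (S n))) // -!Rcpower_add; f_equal; ring.
    rewrite csum_const /Gker Ingham_value RtoC_mult -Rcpower_ratio // EA EB RtoC_div; [|lra]. field. done.
Unshelve.
(* The majorant: the term is at most (floor(n / m) / n)^(1 + Re w), and floor(n / m) / n <= 1 /
   m. *)
- move=> n m. rewrite Cmod_mult Cmod_Rcpower Re_opp Re_plus Re_RtoC. have Pn := INR_S_pos n. have Pm := INR_S_pos m.
  destruct (S n / S m)%nat as [|M] eqn:EM; [rewrite Cmod_0 Rmult_0_r; apply Rlt_le, Rpower_pos|].
  have PM := INR_S_pos M. apply Rle_trans with (Rpower (INR (S n)) (- (Re w + 1)) * (INR (S M) * Rpower (INR (S M)) (Re w))).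
  { apply Rmult_le_compat_l; [apply Rlt_le, Rpower_pos|]. by apply Tpow_bound. }
  rewrite -{1}(Rpower_1 (INR (S M))) // -Rpower_plus. replace (- 1 - Re w) with (- (1 + Re w)) by ring. rewrite -(Rpower_inv_base (INR (S m))) //.
  replace (- (Re w + 1)) with (- (1 + Re w)) by ring. rewrite Rmult_comm -Rpower_div //. apply Rpower_mono; [|lra]. split; [by apply Rdiv_lt_0_compat|].
  apply Rmult_le_reg_r with (INR (S n)) => //. apply Rmult_le_reg_r with (INR (S m)) => //.
  replace (INR (S M) / INR (S n) * INR (S n) * INR (S m)) with (INR (S M) * INR (S m)) by (field; lra). replace (/ INR (S m) * INR (S n) * INR (S m)) with (INR (S n)) by (field; lra).
  rewrite -mult_INR. apply le_INR. have := Nat.div_mod_eq (S n) (S m). rewrite EM. nia.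
- have DZ := dirichlet_zeta (w + 1)%C ltac:(rewrite Re_plus Re_RtoC; lra).
  have DS := clim_scal _ _ (/ (w + 1))%C DZ. eapply clim_ext; [|apply DS]. move=> n. symmetry. apply csum_scal.
Qed.

Lemma summatory_aseq beta x : summatory (aseq beta) x = Asum beta (Z.to_nat (Zfloor x)).
Proof. apply sum_n_m_rsum. Qed.

Lemma floor_to_nat x : 1 <= x -> exists n, Z.to_nat (Zfloor x) = S n /\ INR (S n) <= x < INR (S n) + 1.
Proof.
move=> Hx. have [B1 B2] := Zfloor_bound x.
have HZ : (1 <= Zfloor x)%Z. { have : (0 < Zfloor x)%Z by apply lt_IZR; lra. lia. }
exists (pred (Z.to_nat (Zfloor x))). have E : Z.to_nat (Zfloor x) = S (pred (Z.to_nat (Zfloor x))) by lia.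
split => //. rewrite -E INR_IZR_INZ Z2Nat.id; [|lia]. lra.
Qed.

(** The factor (x / floor(x))^beta tends to 1, which carries a limit along the integers over to real
    arguments. *)
Lemma clim_floor beta (A : nat -> R) (l : C) : clim (fun n => RtoC (Rpower (INR (S n)) beta * A (S n))) l ->
  forall eps, 0 < eps -> exists X, forall x, X < x -> Cmod (RtoC (Rpower x beta * A (Z.to_nat (Zfloor x))) - l)%C <= eps.
Proof.
move=> H eps He. have L0 := Cmod_ge_0 l.
have CR := continuous_Rpower beta 1 Rlt_0_1.
have RC : rcont (fun u => RtoC (Rpower u beta)) 1 by split => //=; apply continuous_const.
destruct (proj1 (rcont_eps _ _) RC (Rmin 1 (eps / (2 * (Cmod l + 1))))) as [d [Hd Kd]].
{ apply Rmin_glb_lt; [lra|]. apply Rdiv_lt_0_compat; lra. }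
destruct (H (eps / 4) ltac:(lra)) as [N HN].
have Pd : 0 < / d by apply Rinv_0_lt_compat.
exists (INR N + 2 + / d) => x Hx. have PN := pos_INR N. have [n [En [B1 B2]]] := floor_to_nat x ltac:(lra). rewrite En.
have HnN : (N <= n)%nat. { apply INR_le. rewrite S_INR in B2. lra. }
have h1 := HN n HnN. have Pn := INR_S_pos n. have Hnd : / d < INR (S n) by lra.
have Px : 0 < x by lra.
have Hq : Rabs (x / INR (S n) - 1) < d.
{ replace (x / INR (S n) - 1) with ((x - INR (S n)) * / INR (S n)) by (field; lra). have Pi : 0 < / INR (S n) by apply Rinv_0_lt_compat.
  rewrite Rabs_right; [|apply Rle_ge, Rmult_le_pos; lra]. apply Rlt_trans with (1 * / INR (S n)); [apply Rmult_lt_compat_r; lra|].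
  rewrite Rmult_1_l -(Rinv_inv d). apply Rinv_lt_contravar => //. by apply Rmult_lt_0_compat. }
have h2 := Kd _ Hq. cbv beta in h2. rewrite Rpower_base_1 -RtoC_minus Cmod_R in h2.
have h3 := Rlt_le_trans _ _ _ h2 (Rmin_l _ _). have h4 := Rlt_le_trans _ _ _ h2 (Rmin_r _ _).
set v := Rpower (x / INR (S n)) beta in h2 h3 h4. set u := Rpower (INR (S n)) beta * A (S n) in h1.
have -> : Rpower x beta * A (S n) = v * u.
{ unfold v, u. rewrite -Rmult_assoc Rpower_mult_distr //; last by apply Rdiv_lt_0_compat. f_equal. f_equal. field. lra. }
replace (RtoC (v * u) - l)%C with (RtoC v * (RtoC u - l) + RtoC (v - 1) * l)%C by (rewrite RtoC_mult RtoC_minus; ring).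
eapply Rle_trans; [apply Cmod_triangle|]. rewrite !Cmod_mult !Cmod_R.
have E1 : Rabs v <= 2. { apply Rabs_le. move/Rabs_def2: h3 => [h5 h6]. lra. }
have E2 : Rabs (v - 1) * Cmod l <= eps / (2 * (Cmod l + 1)) * (Cmod l + 1) by apply Rmult_le_compat; try lra; apply Rabs_pos.
have E3 : eps / (2 * (Cmod l + 1)) * (Cmod l + 1) = eps / 2 by field; lra.
have := Cmod_ge_0 (RtoC u - l)%C. nra.
Qed.

(** Since [Ff] at 1 - beta is - beta / Zf(1 - beta), the factor - beta cancels the denominator of
    the asymptotic constant. At beta = 0 the sequence is 1, 0, 0, ... and the limit is immediate. *)
Lemma Asum_limit beta : mertens_bound -> (forall s : C, 1 / 2 < Re s -> Zf s <> 0%C) -> beta < 1 / 2 ->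
  clim (fun n => RtoC (Rpower (INR (S n)) beta * Asum beta (S n))) (/ (Zf (1 - RtoC beta) / (1 - RtoC beta)))%C.
Proof.
move=> HM HZ Hb. have Eb : (1 - RtoC beta)%C = RtoC (1 - beta) by rewrite RtoC_minus.
have NZ := HZ (RtoC (1 - beta)) ltac:(rewrite Re_RtoC; lra).
have N1 : RtoC (1 - beta) <> 0%C by apply RtoC_neq_0; lra.
destruct (Req_dec beta 0) as [->|B0].
- rewrite Rminus_0_r in NZ N1. replace (1 - RtoC 0)%C with (RtoC 1) by ring. rewrite Zf_1. replace (/ (1 / 1))%C with (RtoC 1) by (field; apply RtoC_neq_0; lra).
  eapply clim_ext; [|apply clim_const]. move=> n /=. f_equal. rewrite Rpower_O; [|apply INR_S_pos]. rewrite Rmult_1_l.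
  unfold Asum. elim: n => [|n IH]; [by rewrite /= aseq_0; ring|]. change (rsum (fun n => aseq 0 (S n)) (S (S n))) with (rsum (fun n => aseq 0 (S n)) (S n) + aseq 0 (S (S n))).
  rewrite -IH aseq_0. ring.
- have A := Asum_asymptotic beta HM B0 Hb. have F := Ff_Zf (RtoC (1 - beta)) HM ltac:(rewrite Re_RtoC; lra).
  eapply eq_ind; [apply A|]. rewrite Eb.
  have -> : Ff (RtoC (1 - beta)) = (- RtoC beta / Zf (RtoC (1 - beta)))%C.
  { replace (- RtoC beta)%C with (RtoC (1 - beta) - 1)%C by (rewrite RtoC_minus; ring). rewrite -F. field. done. }
  have NB : RtoC beta <> 0%C by apply RtoC_neq_0.
  rewrite RtoC_div; [|lra]. rewrite RtoC_opp. field. repeat split => //.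
Qed.

(** This is z zeta(1 - z) / (z - 1). The value 1 at z = 0 removes the singularity, as zeta has a
    simple pole with residue 1 at 1; the given [zeta] has an arbitrary value there. *)
Definition mellin_of_zeta (zeta : C -> C) (z : C) : C :=
  match Ceq_dec z 0%C with left _ => 1%C | right _ => (zeta (1 - z) * (- z) / (1 - z))%C end.

Lemma mellin_of_zeta_Zf zeta (z : C) : is_Riemann_zeta zeta -> Re z < 1 -> mellin_of_zeta zeta z = (Zf (1 - z) / (1 - z))%C.
Proof.
move=> HZ Hz. unfold mellin_of_zeta. destruct (Ceq_dec z 0%C) as [->|N].
- replace (1 - 0)%C with (RtoC 1) by ring. rewrite Zf_1. by field.
- rewrite -(zeta_Zf zeta HZ (1 - z)%C).
  + f_equal. f_equal. ring.
  + rewrite Re_minus Re_RtoC. lra.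
  + move=> E. apply N. replace z with (1 - (1 - z))%C by ring. rewrite E. ring.
Qed.

(** For Re z < 1 the function agrees with Zf(1 - z) / (1 - z), which takes care of z = 0; any other
    point stays away from 0 and 1, and the quotient is differentiated directly. *)
Lemma holomorphic_mellin_of_zeta zeta (z : C) : is_Riemann_zeta zeta -> z <> 1%C -> holomorphic_at (mellin_of_zeta zeta) z.
Proof.
move=> HZ Hz. apply holomorphic_at_iff. destruct (Rlt_dec (Re z) 1) as [H|H].
- exists ((1 - Re z) / 2). split; [lra|] => w Hw. have := Re_ball _ _ _ Hw => Hw2.
  apply (cdiff_ext_loc (fun w => Zf (1 - w) / (1 - w))%C).
  + exists ((1 - Re z) / 2). split; [lra|] => v Hv. have := Re_ball _ _ _ Hv => Hv2. symmetry. apply mellin_of_zeta_Zf => //. lra.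
  + have D : cdiff (fun w => 1 - w)%C w by apply cdiff_minus; [apply cdiff_const|apply cdiff_id].
    apply cdiff_div => //.
    * apply (cdiff_comp Zf) => //. apply cdiff_Zf. rewrite Re_minus Re_RtoC. lra.
    * move=> E. have : Re (1 - w)%C = 0 by rewrite E. rewrite Re_minus Re_RtoC. lra.
- have N0 : z <> 0%C by move=> E; apply H; rewrite E /=; lra.
  have N1 : (1 - z)%C <> 0%C by move=> E; apply Hz; transitivity (1 - (1 - z))%C; [ring|rewrite E; ring].
  have N2 : (1 - z)%C <> 1%C by move=> E; apply N0; transitivity (1 - (1 - z))%C; [ring|rewrite E; ring].
  destruct (proj1 (holomorphic_at_iff _ _) (proj2 HZ _ N2)) as [r [Hr Kr]].
  have P0 : 0 < Cmod z by apply Cmod_gt_0. have P1 : 0 < Cmod (1 - z)%C by apply Cmod_gt_0.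
  have Hd : 0 < Rmin r (Rmin (Cmod z) (Cmod (1 - z)%C) / 2) by repeat apply Rmin_glb_lt => //; have := Rmin_glb_lt _ _ _ P0 P1; lra.
  have NZ : forall v, Cmod (v - z)%C < Cmod z -> v <> 0%C.
  { move=> v Hv E. rewrite E in Hv. move: Hv. replace (0 - z)%C with (- z)%C by ring. rewrite Cmod_opp. lra. }
  have M1 := Rmin_l r (Rmin (Cmod z) (Cmod (1 - z)%C) / 2). have M2 := Rmin_r r (Rmin (Cmod z) (Cmod (1 - z)%C) / 2).
  have M3 := Rmin_l (Cmod z) (Cmod (1 - z)%C). have M4 := Rmin_r (Cmod z) (Cmod (1 - z)%C).
  exists (Rmin r (Rmin (Cmod z) (Cmod (1 - z)%C) / 2)). split => // w Hw.
  apply (cdiff_ext_loc (fun w => zeta (1 - w) * (- w) / (1 - w))%C).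
  + exists (Cmod z / 2). split; [lra|] => v Hv. unfold mellin_of_zeta. destruct (Ceq_dec v 0%C) as [E|] => //. exfalso.
    apply (NZ v) => //. have := Cmod_triangle3 v w z. lra.
  + have D : cdiff (fun w => 1 - w)%C w by apply cdiff_minus; [apply cdiff_const|apply cdiff_id].
    apply cdiff_div => //; [apply cdiff_mult; [|apply cdiff_opp, cdiff_id]|].
    * apply (cdiff_comp zeta) => //. apply Kr. replace (1 - w - (1 - z))%C with (z - w)%C by ring. rewrite (Cmod_sub_sym z w). lra.
    * move=> E. have : Cmod (1 - z)%C <= Cmod (w - z)%C by right; f_equal; replace w with (1 - (1 - w))%C by ring; rewrite E; ring. lra.
Qed.

Theorem RH_FGV : Riemann_hypothesis -> FGV Ingham (1 / 2).
Proof.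
move=> RH. have HM := RH_mertens RH. have HN := RH_Zf RH. destruct RH as [zeta [HZ _]].
have NB : forall beta, beta < 1 / 2 -> Zf (1 - RtoC beta)%C <> 0%C by move=> beta Hb; apply HN; rewrite Re_minus !Re_RtoC; lra.
exists (mellin_of_zeta zeta). split.
- repeat split.
  + move=> z Hz. apply filterlim_clim. rewrite mellin_of_zeta_Zf //; [|lra]. by apply mellin_limit.
  + move=> z Hz. apply holomorphic_mellin_of_zeta => // E. rewrite E /= in Hz. lra.
  (* The only possible singularity is z = 1, so a constant enumeration will do. *)
  + exists (fun _ => 1%C) => z Hz. exists O. destruct (Ceq_dec z 1%C) as [->|N] => //. exfalso. apply Hz. by apply holomorphic_mellin_of_zeta.
  + apply holomorphic_mellin_of_zeta => // E. injection E. lra.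
- move=> beta. exists (aseq beta). split; [apply associated_aseq|]. split; [|split].
  + move=> b Hb n Hn. apply (associated_unique beta) => //. apply associated_aseq.
  + move=> Hb. have E := mellin_of_zeta_Zf zeta (RtoC beta) HZ ltac:(rewrite Re_RtoC; lra).
    have N1 : (1 - RtoC beta)%C <> 0%C by rewrite -RtoC_minus; apply RtoC_neq_0; lra. have NZ := NB beta Hb.
    have NG : mellin_of_zeta zeta (RtoC beta) <> 0%C.
    { rewrite E => E0. apply NZ. replace (Zf (1 - RtoC beta))%C with (Zf (1 - RtoC beta) / (1 - RtoC beta) * (1 - RtoC beta))%C by (field; done). rewrite E0. ring. }
    split; [|split => //].
    * apply holomorphic_mellin_of_zeta => // E1. injection E1. lra.
    * move=> eps. have NI := Cinv_neq_0 _ NG. have PG := proj1 (Cmod_gt_0 _) NI.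
      have L := Asum_limit beta HM HN Hb. rewrite -E in L. have Pe := cond_pos eps.
      destruct (clim_floor beta (Asum beta) _ L (eps * Cmod (/ mellin_of_zeta zeta (RtoC beta))%C)) as [X HX]; [by apply Rmult_lt_0_compat|].
      exists (Rmax X 0) => x Hx. have Hx1 := Rmax_l X 0. have Hx2 := Rmax_r X 0. have B := HX x ltac:(lra).
      rewrite summatory_aseq. have PR := Rpower_pos x (- beta). have ER : Rpower x (- beta) * Rpower x beta = 1 by rewrite -Rpower_plus; replace (- beta + beta) with 0 by ring; apply Rpower_O; lra.
      set A := Asum beta _ in B *. set G := (/ mellin_of_zeta zeta (RtoC beta))%C in B *.
      (* Asymptotic equivalence unfolds to an error relative to the main term; multiplication by
         x^beta turns it into the convergence just obtained. *)
      change (Cmod (G * RtoC (Rpower x (- beta)) - RtoC A)%C <= eps * Cmod (G * RtoC (Rpower x (- beta)))%C).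
      rewrite (Cmod_sub_sym _ (RtoC A)). replace (RtoC A - G * RtoC (Rpower x (- beta)))%C with (RtoC (Rpower x (- beta)) * (RtoC (Rpower x beta * A) - G))%C.
      2:{ have EA : A = Rpower x (- beta) * Rpower x beta * A by rewrite ER; ring. symmetry. rewrite {1}EA !RtoC_mult. ring. }
      rewrite !Cmod_mult Cmod_R Rabs_right; [|lra]. nra.
  (* The cap 1 / 4 keeps th in (0, 1 / 2), and then th < 1 / 2 <= beta. *)
  + move=> Hb eps He. set th := 1 / 2 - Rmin eps (1 / 4).
    have E1 := Rmin_l eps (1 / 4). have E2 := Rmin_r eps (1 / 4). have E3 : 0 < Rmin eps (1 / 4) by apply Rmin_glb_lt; lra.
    destruct (Asum_bound_large beta th HM ltac:(unfold th; lra) ltac:(unfold th; lra)) as [K [PK HK]].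
    exists (K * Rpower 2 (Rabs (- th))), 1 => x Hx. rewrite summatory_aseq. have [n [En [B1 B2]]] := floor_to_nat x ltac:(lra). rewrite En.
    have Pn := INR_S_ge1 n. have B := HK (S n).
    have R := Rpower_near 2 (INR (S n)) x (- th) ltac:(lra) ltac:(lra) ltac:(lra).
    have R2 : Rpower x (- th) <= Rpower x (- (1 / 2) + eps) by apply Rle_Rpower; unfold th; lra.
    eapply Rle_trans; [apply B|]. rewrite Rmult_assoc. apply Rmult_le_compat_l => //. eapply Rle_trans; [apply R|].
    apply Rmult_le_compat_l => //. apply Rlt_le, Rpower_pos.
Qed.

Lemma finite_bound (u : nat -> R) N : exists B, forall n, (n < N)%nat -> u n <= B.
Proof.
elim: N => [|N [B HB]]; [exists 0; lia|]. exists (Rmax B (u N)) => n Hn.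
destruct (Nat.eq_dec n N) as [->|E]; [apply Rmax_r|]. eapply Rle_trans; [apply HB; lia|apply Rmax_l].
Qed.

(** The value beta = 1 lies above the index 1 / 2, and its associated sequence is mu(n) / n. The
    hypothesis bounds the sum only for large x; the finitely many other n are absorbed into the
    constant. *)
Lemma FGV_mertens : FGV Ingham (1 / 2) -> mertens_bound.
Proof.
move=> [Gs [_ H]] eps He. destruct (H 1) as [a [Ha [_ [_ Hbig]]]].
destruct (Hbig ltac:(lra) eps He) as [M [X HX]].
destruct (INR_unbounded X) as [N HN].
destruct (finite_bound (fun n => Rabs (mertens (S n)) / Rpower (INR (S n)) (- 1 / 2 + eps)) N) as [B HB].
exists (Rmax M B) => n. have PR := Rpower_pos (INR (S n)) (- 1 / 2 + eps).
destruct (Nat.lt_ge_cases n N) as [L|L].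
- have b := HB n L. cbv beta in b. apply Rle_trans with (B * Rpower (INR (S n)) (- 1 / 2 + eps)).
  + apply Rmult_le_reg_r with (/ Rpower (INR (S n)) (- 1 / 2 + eps)); [by apply Rinv_0_lt_compat|]. rewrite Rmult_assoc Rinv_r; [|lra]. unfold Rdiv in b. lra.
  + apply Rmult_le_compat_r; [lra|apply Rmax_r].
- have h : X < INR (S n) by apply Rlt_le_trans with (INR N) => //; apply le_INR; lia.
  have b := HX _ h. replace (- (1 / 2) + eps) with (- 1 / 2 + eps) in b by lra.
  have E : summatory a (INR (S n)) = mertens (S n).
  { unfold summatory. rewrite INR_IZR_INZ Zfloor.ZfloorZ Nat2Z.id sum_n_m_rsum. apply rsum_ext => k _.
    rewrite (associated_unique 1 (aseq 1) a) //; [apply aseq_1_mu|apply associated_aseq|lia]. }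
  rewrite E in b. eapply Rle_trans; [apply b|]. apply Rmult_le_compat_r; [lra|apply Rmax_l].
Qed.

(** * Infinite products and the reciprocal Gamma function *)

Fixpoint cprod (f : nat -> C) (n : nat) : C := match n with O => 1%C | S m => (cprod f m * f m)%C end.

(** Telescoping turns the product into a series, to which the majorant test for holomorphic series
    applies. *)
Lemma cprod_csum f n : cprod f n = (1 + csum (fun k => cprod f k * (f k - 1)) n)%C.
Proof. elim: n => [|n IH]; [simpl; ring|]. simpl. rewrite {1}IH. rewrite {1}(_ : (1 + csum (fun k => cprod f k * (f k - 1)) n)%C = cprod f n) //. ring_simplify. rewrite IH. ring. Qed.

Lemma cprod_bound f c n : (forall k, Cmod (f k - 1)%C <= c k) -> Cmod (cprod f n) <= exp (rsum c n).
Proof.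
move=> H. elim: n => [|n IH]; [rewrite /= Cmod_1 exp_0; lra|]. simpl. rewrite Cmod_mult exp_plus.
apply Rmult_le_compat; [apply Cmod_ge_0|apply Cmod_ge_0|done|]. replace (f n) with (1 + (f n - 1))%C by ring. eapply Rle_trans; [apply Cmod_triangle|].
rewrite Cmod_1. have := H n. have := exp_ineq1_le (c n). lra.
Qed.

Lemma infinite_product (f : nat -> C -> C) (c : nat -> R) B p r : 0 < r ->
  (forall k z, Cmod (z - p)%C < r -> cdiff (f k) z) ->
  (forall k z, Cmod (z - p)%C < r -> Cmod (f k z - 1)%C <= c k) -> (forall n, rsum c n <= B) ->
  (forall z, Cmod (z - p)%C < r -> clim (cprod (fun k => f k z)) (Clim (cprod (fun k => f k z)))) /\
  cdiff (fun z => Clim (cprod (fun k => f k z))) p.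
Proof.
move=> Hr Hd Hc HB.
have Hp : Cmod (p - p)%C < r by replace (p - p)%C with (RtoC 0) by ring; rewrite Cmod_0.
have c0 : forall k, 0 <= c k by move=> k; eapply Rle_trans; [apply Cmod_ge_0|apply (Hc k p Hp)].
have HE : forall z k, Cmod (z - p)%C < r -> Cmod (cprod (fun k => f k z) k * (f k z - 1))%C <= exp B * c k.
{ move=> z k Hz. rewrite Cmod_mult. apply Rmult_le_compat; [apply Cmod_ge_0|apply Cmod_ge_0| |by apply Hc].
  eapply Rle_trans; [apply (cprod_bound _ c)|apply exp_le, HB] => j. by apply Hc. }
have HS : forall n, rsum (fun k => exp B * c k) n <= exp B * B by move=> n; rewrite rsum_scal; apply Rmult_le_compat_l => //; apply Rlt_le, exp_pos.
have [T [_ [HT _]]] := rsum_bounded_lim (fun k => exp B * c k) _ (fun k => Rmult_le_pos _ _ (Rlt_le _ _ (exp_pos B)) (c0 k)) HS.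
have HL : forall z, Cmod (z - p)%C < r -> clim (cprod (fun k => f k z)) (1 + Clim (csum (fun k => cprod (fun k => f k z) k * (f k z - 1))%C))%C.
{ move=> z Hz. eapply clim_ext; [move=> n; symmetry; apply cprod_csum|]. apply clim_plus; [apply clim_const|].
  apply (proj1 (csum_majorant _ _ T (fun k => HE z k Hz) HT)). }
split.
- move=> z Hz. have L := HL z Hz. by rewrite (clim_Clim _ _ L).
- apply (cdiff_ext_loc (fun z => 1 + Clim (csum (fun k => cprod (fun k => f k z) k * (f k z - 1))%C))%C).
  + exists r. split => // z Hz. symmetry. apply clim_Clim, HL => //.
  + apply cdiff_plus; [apply cdiff_const|]. apply (cdiff_series (fun k z => cprod (fun k => f k z) k * (f k z - 1))%C (fun k => exp B * c k) (exp B * B) p r) => //.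
    * move=> k z Hz. apply cdiff_mult; [|apply cdiff_minus; [by apply Hd|apply cdiff_const]].
      elim: k => [|k IH]; [exact (cdiff_const 1%C z)|exact (cdiff_mult _ _ _ IH (Hd _ _ Hz))].
    * move=> k z Hz. by apply HE.
Qed.

(** A product of factors 1 - c_k is at least 1 minus the sum of the c_k; a negative right-hand
    factor is harmless, which the case distinction covers. *)
Lemma cprod_lower f (c : nat -> R) N : (forall k, (N <= k)%nat -> Cmod (f k - 1)%C <= c k) ->
  forall m, Cmod (cprod f N) * (1 - rsum (fun k => c (N + k)%nat) m) <= Cmod (cprod f (N + m)).
Proof.
move=> Hc. have c0 : forall k, (N <= k)%nat -> 0 <= c k by move=> k Hk; eapply Rle_trans; [apply Cmod_ge_0|apply (Hc k Hk)].
elim=> [|m IH]; [rewrite Nat.add_0_r /=; lra|]. rewrite Nat.add_succ_r /= Cmod_mult.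
have P := Cmod_ge_0 (cprod f N). have P2 := Cmod_ge_0 (cprod f (N + m)).
set S := rsum (fun k => c (N + k)%nat) m in IH *. set cm := c (N + m)%nat.
have S0 : 0 <= S by apply rsum_ge0 => k _; apply c0; lia. have cm0 : 0 <= cm by apply c0; lia.
have F : 1 - cm <= Cmod (f (N + m)%nat). { have := Hc (N + m)%nat ltac:(lia). have := Cmod_triangle_rev 1%C (f (N + m)%nat). rewrite Cmod_1 Cmod_sub_sym. unfold cm. lra. }
destruct (Rle_dec (1 - cm) 0) as [H|H].
- apply Rle_trans with 0; [|apply Rmult_le_pos => //; apply Cmod_ge_0]. have : 1 - (S + cm) <= 0 by lra. nra.
- apply Rle_trans with (Cmod (cprod f (N + m)) * (1 - cm)); [|apply Rmult_le_compat_l => //].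
  apply Rle_trans with (Cmod (cprod f N) * (1 - S) * (1 - cm)); [|apply Rmult_le_compat_r => //; lra].
  rewrite Rmult_assoc. apply Rmult_le_compat_l => //. nra.
Qed.

Lemma cprod_neq_0 (f : nat -> C) n : (forall k, (k < n)%nat -> f k <> 0%C) -> cprod f n <> 0%C.
Proof.
elim: n => [|n IH] H; [move=> E; injection E; lra|]. simpl. apply Cmult_neq_0; [apply IH => k Hk; apply H; lia|apply H; lia].
Qed.

(** From some index on the c_k add up to at most 1 / 2, so the partial products stay above half the
    modulus of a nonzero head. *)
Lemma infinite_product_neq_0 (f : nat -> C) (c : nat -> R) B (l : C) : (forall k, Cmod (f k - 1)%C <= c k) -> (forall n, rsum c n <= B) ->
  (forall k, f k <> 0%C) -> clim (cprod f) l -> l <> 0%C.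
Proof.
move=> Hc HB Hf HL E.
have c0 : forall k, 0 <= c k by move=> k; eapply Rle_trans; [apply Cmod_ge_0|apply (Hc k)].
have [T [_ [HT1 HT2]]] := rsum_bounded_lim c B c0 HB.
move/is_lim_seq_eps: HT1 => /(_ (1 / 2) ltac:(lra)) [N HN]. have h := Rabs_def2 _ _ (HN N ltac:(lia)).
have P : 0 < Cmod (cprod f N) by apply Cmod_gt_0, cprod_neq_0.
destruct (HL (Cmod (cprod f N) * (1 / 2)) ltac:(lra)) as [N2 HN2].
have b := HN2 (N + N2)%nat ltac:(lia). rewrite E in b. replace (cprod f (N + N2) - 0)%C with (cprod f (N + N2)) in b by ring.
have L := cprod_lower f c N (fun k _ => Hc k) N2.
have S := rsum_add c N N2. have := HT2 (N + N2)%nat. rewrite S => h2.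
have : rsum (fun k => c (N + k)%nat) N2 <= 1 / 2 by lra. nra.
Qed.

(* The factors of the Gauss product for 1 / Gamma(s + 1). *)
Definition qfac (k : nat) (s : C) : C := ((1 + s * RtoC (/ INR (S k))) * Rcpower (INR (S (S k)) / INR (S k)) (- s))%C.

Lemma ln_1p_bounds u : 0 < u -> u - u * u <= ln (1 + u) <= u.
Proof.
move=> Hu. split.
- have E := exp_ineq1_le (- ln (1 + u)). rewrite exp_Ropp exp_ln in E; [|lra].
  have : 1 - / (1 + u) >= u - u * u; [|lra]. apply Rle_ge. have P : 0 < / (1 + u) by apply Rinv_0_lt_compat; lra.
  have I : / (1 + u) * (1 + u) = 1 by apply Rinv_l; lra. nra.
- have E := exp_ineq1_le (ln (1 + u)). rewrite exp_ln in E; lra.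
Qed.

(** With u = 1 / (k + 1), the first order terms s u and - s ln(1 + u) cancel up to O(u^2), which
    makes the product converge. *)
Lemma qfac_bound (s : C) R k : 0 <= R -> Cmod s <= R ->
  Cmod (qfac k s - 1)%C <= ((1 + R) * (R * R * exp R) + R + R * R) * Rpower (INR (S k)) (- 1 - 1).
Proof.
move=> HR Hs. have P := INR_S_pos k. have P1 := INR_S_ge1 k. set u := / INR (S k). have Pu : 0 < u by apply Rinv_0_lt_compat.
have Pu1 : u <= 1 by unfold u; rewrite -Rinv_1; apply Rinv_le_contravar; lra.
have -> : Rpower (INR (S k)) (- 1 - 1) = u * u by replace (- 1 - 1) with (- (1) + - (1)) by ring; rewrite Rpower_plus Rpower_Ropp Rpower_1.
unfold qfac. fold u. have -> : INR (S (S k)) / INR (S k) = 1 + u by rewrite (S_INR (S k)); unfold u; field; lra.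
set L := ln (1 + u). have [L1 L2] := ln_1p_bounds u Pu. fold L in L1, L2. have L0 : 0 <= L by nra.
unfold Rcpower. fold L. have S0 := Cmod_ge_0 s.
set w := (- s * RtoC L)%C. have Ew : Cmod w = Cmod s * L by unfold w; rewrite Cmod_mult Cmod_opp Cmod_R Rabs_right //; lra.
have Hw : Cmod w <= R * u by rewrite Ew; apply Rmult_le_compat.
have W0 := Cmod_ge_0 w. have HwR : Cmod w <= R by nra.
have B := Cexp_minus_1_id w.
have B2 : Cmod (Cexp w - 1 - w)%C <= R * R * exp R * (u * u).
{ eapply Rle_trans; [apply B|]. replace (R * R * exp R * (u * u)) with ((R * u) ^ 2 * exp R) by ring. apply Rmult_le_compat; [apply pow2_ge_0|apply Rlt_le, exp_pos|by apply pow_incr|by apply exp_le]. }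
replace ((1 + s * RtoC u) * Cexp w - 1)%C with ((1 + s * RtoC u) * (Cexp w - 1 - w) + (s * RtoC (u - L) - s * s * RtoC (u * L)))%C.
2:{ unfold w. rewrite RtoC_minus RtoC_mult. ring. }
have A1 : Cmod (1 + s * RtoC u)%C <= 1 + R.
{ eapply Rle_trans; [apply Cmod_triangle|]. rewrite Cmod_1 Cmod_mult Cmod_R Rabs_right; [nra|lra]. }
have A2 : Cmod (s * RtoC (u - L))%C <= R * (u * u). { rewrite Cmod_mult Cmod_R Rabs_right; [apply Rmult_le_compat|]; lra. }
have A3 : Cmod (s * s * RtoC (u * L))%C <= R * R * (u * u).
{ rewrite !Cmod_mult Cmod_R Rabs_right; [|nra]. apply Rmult_le_compat; nra. }
eapply Rle_trans; [apply Cmod_triangle|]. have T := Cmod_triangle_sub (s * RtoC (u - L)) (s * s * RtoC (u * L)). rewrite Cmod_mult.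
have A4 := Rmult_le_compat _ _ _ _ (Cmod_ge_0 _) (Cmod_ge_0 _) A1 B2. lra.
Qed.

(* qG s = 1 / Gamma(s + 1) *)
Definition qG (s : C) : C := Clim (cprod (fun k => qfac k s)).

Lemma qfac_sum A n : 0 <= A -> rsum (fun k => A * Rpower (INR (S k)) (- 1 - 1)) n <= A * (1 + / 1).
Proof. move=> HA. rewrite rsum_scal. apply Rmult_le_compat_l => //. apply rsum_Rpower_le. lra. Qed.

Lemma cdiff_qfac k s : cdiff (qfac k) s.
Proof.
apply cdiff_mult; [apply cdiff_plus; [apply cdiff_const|apply cdiff_mult; [apply cdiff_id|apply cdiff_const]]|]. apply cdiff_Rcpower, cdiff_opp, cdiff_id.
Qed.

Lemma qG_spec (s : C) : clim (cprod (fun k => qfac k s)) (qG s) /\ cdiff qG s.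
Proof.
set R := Cmod s + 1. have S0 := Cmod_ge_0 s. have HR : 0 <= R by unfold R; lra.
set A := (1 + R) * (R * R * exp R) + R + R * R.
have PA : 0 <= A. { have := exp_pos R. unfold A => E. have : 0 <= R * R by nra. have : 0 <= R * R * exp R by nra. nra. }
have [H1 H2] := infinite_product qfac (fun k => A * Rpower (INR (S k)) (- 1 - 1)) (A * (1 + / 1)) s 1 Rlt_0_1 (fun k z _ => cdiff_qfac k z)
  (fun k z Hz => qfac_bound z R k HR ltac:(have := Cmod_triangle_rev z s; unfold R; lra)) (fun n => qfac_sum A n PA).
split; [|exact H2]. apply H1. replace (s - s)%C with (RtoC 0) by ring. rewrite Cmod_0. lra.
Qed.

Lemma qG_neq_0 (s : C) : - 1 < Re s -> qG s <> 0%C.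
Proof.
move=> Hs. set R := Cmod s. have HR : 0 <= R by apply Cmod_ge_0.
set A := (1 + R) * (R * R * exp R) + R + R * R.
have PA : 0 <= A. { have := exp_pos R. unfold A => E. have : 0 <= R * R by nra. have : 0 <= R * R * exp R by nra. nra. }
apply (infinite_product_neq_0 (fun k => qfac k s) (fun k => A * Rpower (INR (S k)) (- 1 - 1)) (A * (1 + / 1))).
- move=> k. apply qfac_bound => //. unfold R. lra.
- move=> n. by apply qfac_sum.
- move=> k. apply Cmult_neq_0; [|apply Cexp_neq_0]. move=> E. have P := INR_S_ge1 k.
  have Pi : 0 < / INR (S k) by apply Rinv_0_lt_compat; lra. have Pi1 : / INR (S k) <= 1 by rewrite -Rinv_1; apply Rinv_le_contravar; lra.
  set u := / INR (S k) in E Pi Pi1. have E2 : Re (1 + s * RtoC u)%C = 0 by rewrite E.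
  destruct s as [x y]. simpl in Hs, E2. have := Rmult_lt_0_compat (x + 1) u ltac:(lra) Pi. lra.
- apply qG_spec.
Qed.

(** The constant Taylor coefficient is 0, and the shifted coefficients represent the quotient near
    [p], including [p] itself. *)
Lemma removable_quotient (f : C -> C) (p : C) : (exists r, 0 < r /\ forall z, Cmod (z - p)%C < r -> cdiff f z) -> f p = 0%C ->
  exists g, cdiff g p /\ forall z, (f z = g z * (z - p))%C /\ (z <> p -> g z = f z / (z - p))%C.
Proof.
move=> [r [Hr Hf]] Hp. destruct (taylor f p r Hr Hf) as [c [M [HM HL]]]. set h := r / 3 in HM HL. have Hh : 0 < h by unfold h; lra.
have C0 : c O = 0%C.
{ have L := HL p ltac:(replace (p - p)%C with (RtoC 0) by ring; rewrite Cmod_0; lra). rewrite Hp in L. apply (clim_unique (csum (fun n => c n * (p - p) ^ n)%C)) => //.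
  apply (clim_shift _ _ 1). eapply clim_ext; [|apply clim_const]. move=> n /=. rewrite Nat.add_1_r. elim: n => [|n IH]; [simpl; ring|].
  rewrite {1}IH. simpl. ring. }
set g := fun z => match Ceq_dec z p with left _ => c 1%nat | right _ => (f z / (z - p))%C end. exists g.
have Hg : forall z, z <> p -> g z = (f z / (z - p))%C by move=> z Hz; unfold g; destruct (Ceq_dec z p).
split.
2:{ move=> z. split; [|by apply Hg]. destruct (Ceq_dec z p) as [->|N]; [rewrite Hp; ring|]. rewrite Hg //. field. by apply Csub_neq_0. }
apply (PS_cdiff g p h (fun n => c (S n)) (M / h)).
- split.
  + move=> n. apply Rmult_le_reg_r with h => //. unfold Rdiv. rewrite (Rmult_assoc M) Rinv_l; [|lra]. have := HM (S n). simpl. lra.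
  + move=> z Hz. destruct (Ceq_dec z p) as [->|N].
    * unfold g. destruct (Ceq_dec p p) => //. apply (clim_shift _ _ 1). eapply clim_ext; [|apply clim_const]. move=> n /=. rewrite Nat.add_1_r.
      elim: n => [|n IH]; [simpl; ring|]. rewrite {1}IH. simpl. ring.
    * rewrite Hg //. have N2 := Csub_neq_0 _ _ N. have L := clim_scal _ _ (/ (z - p))%C (proj2 (clim_shift _ _ 1) (HL z Hz)).
      replace (f z / (z - p))%C with (/ (z - p) * f z)%C by (unfold Cdiv; ring). eapply clim_ext; [|apply L]. move=> n. cbv beta.
      have E : csum (fun n => c n * (z - p) ^ n)%C (n + 1) = ((z - p) * csum (fun n => c (S n) * (z - p) ^ n) n)%C.
      { rewrite Nat.add_1_r. elim: n => [|n IH]; [rewrite /= C0; ring|].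
        change (csum (fun n => c n * (z - p) ^ n)%C (S (S n))) with (csum (fun n => c n * (z - p) ^ n) (S n) + c (S n) * ((z - p) * (z - p) ^ n))%C.
        rewrite IH. simpl. ring. }
      rewrite E. field. done.
- replace (p - p)%C with (RtoC 0) by ring. by rewrite Cmod_0.
Qed.

(** * Partial fractions of the cotangent *)

Lemma x_cos_le_sin x : 0 <= x <= PI / 2 -> x * cos x <= sin x.
Proof.
move=> Hx. have P := PI_RGT_0.
set f := fun u => sin u - u * cos u.
have D : forall u, is_derive f u (u * sin u) by move=> u; unfold f; auto_derive => //; ring.
destruct (MVT_gen f 0 x (fun u => u * sin u)) as [c [Hc E]].
- move=> u _. apply D.
- move=> u _. apply continuity_pt_filterlim. apply: ex_derive_continuous. eexists. apply D.
- rewrite Rmin_left ?Rmax_right in Hc; try lra. unfold f in E. rewrite sin_0 in E. have S0 : 0 <= sin c by apply sin_ge_0; lra.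
  have := Rmult_le_pos _ _ (Rmult_le_pos c _ ltac:(lra) S0) (ltac:(lra) : 0 <= x - 0). lra.
Qed.

(** From u cos u <= sin u <= u on (0, PI / 2], after squaring and writing cos^2 as 1 - sin^2. *)
Lemma inv_sin2_bounds u : u <> 0 -> - (PI / 2) <= u <= PI / 2 -> 0 <= / (sin u) ^ 2 - / u ^ 2 <= 1.
Proof.
move=> Hu Hb. wlog P : u Hu Hb / 0 < u.
{ move=> W. destruct (Rlt_dec 0 u) as [H|H]; [by apply W|]. have := W (- u) ltac:(lra) ltac:(lra) ltac:(lra). rewrite sin_neg. by replace ((- sin u) ^ 2) with (sin u ^ 2) by ring; replace ((- u) ^ 2) with (u ^ 2) by ring. }
have PP := PI_RGT_0. have S : 0 < sin u by apply sin_gt_0; lra. have L := sin_lt_x u P. have C := x_cos_le_sin u ltac:(lra).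
have C0 : 0 <= cos u by apply cos_ge_0; lra. have Q := sin2_cos2 u. unfold Rsqr in Q.
split.
- have : / u ^ 2 <= / sin u ^ 2; [|lra]. apply Rinv_le_contravar; [by apply pow_lt|]. apply pow_incr. lra.
- have E : / sin u ^ 2 - / u ^ 2 - 1 = (u * u * (cos u * cos u) - sin u * sin u) * / (sin u ^ 2 * u ^ 2).
  { replace (u * u * (cos u * cos u)) with (u * u * (1 - sin u * sin u)) by (rewrite -Q; ring). field. lra. }
  have I : 0 < / (sin u ^ 2 * u ^ 2) by apply Rinv_0_lt_compat, Rmult_lt_0_compat; apply pow_lt.
  have : u * cos u * (u * cos u) <= sin u * sin u by apply Rmult_le_compat; nra. nra.
Qed.

Lemma sin_half_neq0 x : sin x <> 0 -> sin (x / 2) <> 0 /\ cos (x / 2) <> 0.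
Proof. move=> H. split => E; apply H; replace x with (2 * (x / 2)) by field; rewrite sin_2a E; ring. Qed.

Lemma sin_plus_kPI x k : sin x <> 0 -> sin (x + INR k * PI) <> 0.
Proof.
move=> H. elim: k => [|k IH]; [by rewrite Rmult_0_l Rplus_0_r|]. replace (x + INR (S k) * PI) with (x + INR k * PI + PI) by (rewrite S_INR; ring). rewrite neg_sin. lra.
Qed.

Lemma sin_pow2_neq0 x n : sin x <> 0 -> sin (x / 2 ^ n) <> 0.
Proof.
move=> H. elim: n => [|n IH]; [by rewrite /= Rdiv_1_r|]. replace (x / 2 ^ S n) with (x / 2 ^ n / 2) by (simpl; field; apply pow_nonzero; lra).
apply (proj1 (sin_half_neq0 _ IH)).
Qed.

Lemma inv_sin2_half x : sin x <> 0 -> / sin (x / 2) ^ 2 + / sin ((x + PI) / 2) ^ 2 = 4 * / sin x ^ 2.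
Proof.
move=> H. have [H1 H2] := sin_half_neq0 x H. replace ((x + PI) / 2) with (PI / 2 + x / 2) by field. rewrite -cos_sin.
have E : sin x = 2 * sin (x / 2) * cos (x / 2) by rewrite -sin_2a; f_equal; field. rewrite E.
have Q := sin2_cos2 (x / 2). unfold Rsqr in Q. have N := H1. have N2 := H2.
replace (/ sin (x / 2) ^ 2 + / cos (x / 2) ^ 2) with ((sin (x / 2) * sin (x / 2) + cos (x / 2) * cos (x / 2)) * / (sin (x / 2) ^ 2 * cos (x / 2) ^ 2)) by (field; done).
rewrite Q. field. done.
Qed.

(** Each step splits 4 / sin^2(y) into the values at y / 2 and (y + PI) / 2; the second ones are the
    new indices k + 2^n. *)
Lemma inv_sin2_dyadic n x : sin x <> 0 -> rsum (fun k => / sin ((x + INR k * PI) / 2 ^ n) ^ 2) (2 ^ n) = 4 ^ n * / sin x ^ 2.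
Proof.
move=> H. elim: n => [|n IH]; [simpl; rewrite Rmult_0_l !Rplus_0_r Rplus_0_l Rdiv_1_r; ring|].
have E2 : (2 ^ S n)%nat = (2 ^ n + 2 ^ n)%nat by simpl; lia. rewrite E2 rsum_add -rsum_plus.
have P : (2:R) ^ n <> 0 by apply pow_nonzero; lra.
rewrite (rsum_ext _ (fun k => 4 * / sin ((x + INR k * PI) / 2 ^ n) ^ 2)).
- rewrite rsum_scal IH. simpl. ring.
- move=> k _. rewrite -inv_sin2_half; [|by apply sin_pow2_neq0, sin_plus_kPI]. f_equal; f_equal; f_equal; f_equal.
  + simpl. field. done.
  + rewrite plus_INR pow_INR. change (INR 2) with 2. simpl. field. done.
Qed.

Lemma rsum_two_sided (h : R -> R) N : rsum (fun k => h (INR k - INR N)) (N + N) = rsum (fun n => h (INR n) + h (- INR n - 1)) N.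
Proof.
have r1 : forall f : nat -> R, rsum f 1 = f O by move=> f /=; ring.
elim: N => [|N IH] //. replace (S N + S N)%nat with (1 + ((N + N) + 1))%nat by lia. rewrite (rsum_add _ 1) (rsum_add _ (N + N) 1) !r1.
rewrite (rsum_ext (fun k => h (INR (1 + k) - INR (S N))) (fun k => h (INR k - INR N))).
- rewrite IH Nat.add_0_r. change (1 + (N + N))%nat with (S (N + N)). change (rsum (fun n => h (INR n) + h (- INR n - 1)) (S N)) with (rsum (fun n => h (INR n) + h (- INR n - 1)) N + (h (INR N) + h (- INR N - 1))).
  rewrite !S_INR plus_INR. change (INR 0) with 0.
  replace (0 - (INR N + 1)) with (- INR N - 1) by ring. replace (INR N + INR N + 1 - (INR N + 1)) with (INR N) by ring. ring.
- move=> k _. f_equal. change (1 + k)%nat with (S k). rewrite !S_INR. ring.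
Qed.

Lemma sin_minus_nPI x n : sin (x - INR n * PI) ^ 2 = sin x ^ 2.
Proof.
elim: n => [|n IH]; [rewrite Rmult_0_l Rminus_0_r //|]. rewrite -IH. replace (x - INR n * PI) with (x - INR (S n) * PI + PI) by (rewrite S_INR; ring).
rewrite neg_sin. ring.
Qed.

Definition cotR (x : R) : R := PI * cos (PI * x) / sin (PI * x).
(** The poles - n and n + 1 are paired, so that the term is O(n^(-2)) and vanishes at 1 / 2. *)
Definition cot_term (n : nat) (x : R) : R := / (x + INR n) + / (x - INR n - 1).

Lemma sin_PI_pos x : 0 < x < 1 -> 0 < sin (PI * x).
Proof. move=> Hx. have P := PI_RGT_0. apply sin_gt_0; nra. Qed.

(** The finite identity is translated by N PI, with N = 2^j, so that its 2 N points v lie in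
    [- N, N]. There 1 / sin^2(u) exceeds 1 / u^2 by at most 1, and 2 N such errors scaled by PI^2 /
    (2 N)^2 are O(1 / N). *)
Lemma inv_sin2_series x j : 0 < x < 1 ->
  0 <= PI ^ 2 / sin (PI * x) ^ 2 - rsum (fun n => / (x + INR n) ^ 2 + / (x - INR n - 1) ^ 2) (2 ^ j) <= PI ^ 2 / 2 ^ j.
Proof.
move=> Hx. have P := PI_RGT_0. have S := sin_PI_pos x Hx. set N := (2 ^ j)%nat. have EN : INR N = 2 ^ j by unfold N; rewrite pow_INR.
have PN : 0 < INR N by rewrite EN; apply pow_lt; lra.
have NZ : sin (PI * x - INR N * PI) <> 0. { move=> E. have := sin_minus_nPI (PI * x) N. rewrite E. have := pow_lt _ 2 S. simpl. lra. }
have A := inv_sin2_dyadic (Datatypes.S j) (PI * x - INR N * PI) NZ. rewrite sin_minus_nPI in A.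
have E2 : (2 ^ Datatypes.S j)%nat = (N + N)%nat by simpl; unfold N; lia. rewrite E2 in A.
have E3 : (2:R) ^ Datatypes.S j = 2 * INR N by rewrite EN. have E4 : (4:R) ^ Datatypes.S j = (2 * INR N) ^ 2.
{ rewrite -E3. replace 4 with (2 * 2) by lra. rewrite Rpow_mult_distr. simpl. ring. }
rewrite E3 E4 in A.
have B := rsum_two_sided (fun h => / (x + h) ^ 2) N.
have -> : rsum (fun n => / (x + INR n) ^ 2 + / (x - INR n - 1) ^ 2) N = rsum (fun k => / (x + (INR k - INR N)) ^ 2) (N + N).
{ rewrite B. apply rsum_ext => n _. by replace (x + (- INR n - 1)) with (x - INR n - 1) by ring. }
set c := PI ^ 2 / (2 * INR N) ^ 2. have Pc : 0 < c by apply Rdiv_lt_0_compat; apply pow_lt; lra.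
have -> : PI ^ 2 / sin (PI * x) ^ 2 = rsum (fun k => c * / sin ((PI * x - INR N * PI + INR k * PI) / (2 * INR N)) ^ 2) (N + N).
{ rewrite rsum_scal A. unfold c. field. lra. }
rewrite -rsum_minus.
have T : forall k, (k < N + N)%nat -> 0 <= c * / sin ((PI * x - INR N * PI + INR k * PI) / (2 * INR N)) ^ 2 - / (x + (INR k - INR N)) ^ 2 <= c.
{ move=> k Hk. set v := x + (INR k - INR N). set u := (PI * x - INR N * PI + INR k * PI) / (2 * INR N).
  have Eu : u = PI * v / (2 * INR N) by unfold u, v; field; lra.
  have Nv : v <> 0.
  { unfold v. destruct (Nat.lt_ge_cases k N) as [L|L]; apply le_INR in L; rewrite ?S_INR in L; lra. }
  have Hv : - INR N <= v <= INR N. { have Hk2 := le_INR (Datatypes.S k) (N + N) Hk. rewrite S_INR plus_INR in Hk2. have := pos_INR k. unfold v. lra. }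
  have Hu : - (PI / 2) <= u <= PI / 2.
  { rewrite Eu. have E : PI * v / (2 * INR N) = PI / 2 * (v * / INR N) by field; lra. rewrite E. have I : 0 < / INR N by apply Rinv_0_lt_compat.
    have J : INR N * / INR N = 1 by field; lra. have : -1 <= v * / INR N <= 1 by nra. nra. }
  have Nu : u <> 0. { rewrite Eu. apply Rmult_integral_contrapositive_currified; [nra|]. apply Rinv_neq_0_compat. lra. }
  have [b1 b2] := inv_sin2_bounds u Nu Hu. have E : / v ^ 2 = c * / u ^ 2 by rewrite Eu; unfold c; field; repeat split; lra. rewrite E. nra. }
split.
- apply rsum_ge0 => k Hk. apply T => //.
- eapply Rle_trans; [apply (rsum_le _ (fun _ => c)) => k Hk; apply T => //|]. rewrite rsum_const plus_INR -EN. unfold c.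
  have -> : (INR N + INR N) * (PI ^ 2 / (2 * INR N) ^ 2) = PI ^ 2 / INR N / 2 by field; lra.
  have : 0 < PI ^ 2 / INR N by apply Rdiv_lt_0_compat => //; apply pow_lt. lra.
Qed.

Lemma is_derive_rsum (f f' : nat -> R -> R) n x : (forall k, is_derive (f k) x (f' k x)) ->
  is_derive (fun x => rsum (fun k => f k x) n) x (rsum (fun k => f' k x) n).
Proof.
move=> H. elim: n => [|n IH]; [apply: is_derive_const|]. exact (is_derive_plus _ _ x _ _ IH (H n)).
Qed.

(** The expansion of the derivative is integrated from 1 / 2, where the cotangent and every paired
    term vanish. *)
Lemma cot_partial_fractions x j : 0 < x < 1 -> Rabs (cotR x - rsum (fun n => cot_term n x) (2 ^ j)) <= PI ^ 2 / 2 ^ j.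
Proof.
move=> Hx. set g := fun x => cotR x - rsum (fun n => cot_term n x) (2 ^ j).
set g' := fun x => - (PI ^ 2 / sin (PI * x) ^ 2 - rsum (fun n => / (x + INR n) ^ 2 + / (x - INR n - 1) ^ 2) (2 ^ j)).
have D : forall u, 0 < u < 1 -> is_derive g u (g' u).
{ move=> u Hu. have S := sin_PI_pos u Hu.
  have D1 : is_derive cotR u (- (PI ^ 2 / sin (PI * u) ^ 2)).
  { unfold cotR. auto_derive; [lra|]. have Q := sin2_cos2 (PI * u). unfold Rsqr in Q. field_simplify; [|lra|lra]. f_equal.
    replace (- PI ^ 2 * sin (PI * u) ^ 2 - PI ^ 2 * cos (PI * u) ^ 2) with (- PI ^ 2 * (sin (PI * u) * sin (PI * u) + cos (PI * u) * cos (PI * u))) by ring. rewrite Q. ring. }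
  have D2 := is_derive_rsum (fun n x => cot_term n x) (fun n x => - (/ (x + INR n) ^ 2 + / (x - INR n - 1) ^ 2)) (2 ^ j) u.
  have D3 := is_derive_minus _ _ u _ _ D1 (D2 _). eapply eq_ind; [apply D3|]. 
  - move=> k. have Pk := pos_INR k. unfold cot_term. auto_derive; [split; [lra|split => //; lra]|]. field. lra.
  - match goal with |- minus ?a ?b = ?c => change (a - b = c) end. unfold g'. rewrite (rsum_ext (fun n => - (/ (u + INR n) ^ 2 + / (u - INR n - 1) ^ 2)) (fun n => (-1) * (/ (u + INR n) ^ 2 + / (u - INR n - 1) ^ 2))); [rewrite rsum_scal; ring|move=> n _; ring]. }
have G0 : g (1 / 2) = 0.
{ unfold g, cotR. replace (PI * (1 / 2)) with (PI / 2) by field. rewrite cos_PI2 (rsum_ext _ (fun _ => 0)); [rewrite rsum_const; unfold Rdiv; ring|].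
  move=> n _. unfold cot_term. have := pos_INR n. move=> Pn. field. lra. }
have Pj : 0 < 2 ^ j by apply pow_lt; lra.
destruct (MVT_gen g (1 / 2) x g') as [c [Hc E]].
- move=> u Hu. apply D. move: Hu. unfold Rmin, Rmax. destruct (Rle_dec (1 / 2) x); lra.
- move=> u Hu. apply continuity_pt_filterlim. apply: ex_derive_continuous. eexists. apply D. move: Hu. unfold Rmin, Rmax. destruct (Rle_dec (1 / 2) x); lra.
- rewrite G0 Rminus_0_r in E. change (Rabs (g x) <= PI ^ 2 / 2 ^ j). rewrite E Rabs_mult.
  have Hc1 : 0 < c < 1 by move: Hc; unfold Rmin, Rmax; destruct (Rle_dec (1 / 2) x); lra.
  have B := inv_sin2_series c j Hc1. have A1 : Rabs (g' c) <= PI ^ 2 / 2 ^ j by unfold g'; rewrite Rabs_Ropp Rabs_right; lra.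
  have A2 : Rabs (x - 1 / 2) <= 1 by apply Rabs_le; lra. have := Rabs_pos (g' c). have := Rabs_pos (x - 1 / 2). nra.
Qed.

(** * The complex cotangent *)

Definition Csin (z : C) : C := ((Cexp (Ci * z) - Cexp (- (Ci * z))) / (2 * Ci))%C.
Definition Ccos (z : C) : C := ((Cexp (Ci * z) + Cexp (- (Ci * z))) / 2)%C.

Lemma Ci_neq_0 : Ci <> 0%C.
Proof. move=> E. injection E. lra. Qed.

Lemma Ci_sqr : (Ci * Ci)%C = (- (1))%C.
Proof. unfold Ci, Cmult, Copp. simpl. f_equal; ring. Qed.

Lemma Csin_RtoC x : Csin (RtoC x) = RtoC (sin x).
Proof.
have H1 : Cexp (Ci * RtoC x)%C = (cos x, sin x).
{ unfold Cexp. simpl. replace (0 * x - 1 * 0) with 0 by ring. replace (0 * 0 + 1 * x) with x by ring. rewrite exp_0 !Rmult_1_l //. }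
have H2 : Cexp (- (Ci * RtoC x))%C = (cos x, - sin x).
{ unfold Cexp. simpl. replace (- (0 * x - 1 * 0)) with 0 by ring. replace (- (0 * 0 + 1 * x)) with (- x) by ring. rewrite exp_0 !Rmult_1_l cos_neg sin_neg //. }
have HN := Ci_neq_0. unfold Csin. rewrite H1 H2. replace ((cos x, sin x) - (cos x, (- sin x)%R))%C with (2 * Ci * RtoC (sin x))%C; [field; done|].
unfold Ci, Cmult, Cminus, Cplus, Copp, RtoC. simpl. f_equal; ring.
Qed.

Lemma Ccos_RtoC x : Ccos (RtoC x) = RtoC (cos x).
Proof.
have H1 : Cexp (Ci * RtoC x)%C = (cos x, sin x).
{ unfold Cexp. simpl. replace (0 * x - 1 * 0) with 0 by ring. replace (0 * 0 + 1 * x) with x by ring. rewrite exp_0 !Rmult_1_l //. }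
have H2 : Cexp (- (Ci * RtoC x))%C = (cos x, - sin x).
{ unfold Cexp. simpl. replace (- (0 * x - 1 * 0)) with 0 by ring. replace (- (0 * 0 + 1 * x)) with (- x) by ring. rewrite exp_0 !Rmult_1_l cos_neg sin_neg //. }
unfold Ccos. rewrite H1 H2. replace ((cos x, sin x) + (cos x, (- sin x)%R))%C with (2 * RtoC (cos x))%C; [field|].
unfold Cmult, Cplus, RtoC. simpl. f_equal; ring.
Qed.

Lemma cdiff_Cexp_comp f z : cdiff f z -> cdiff (fun s => Cexp (f s)) z.
Proof. move=> H. apply (cdiff_comp Cexp) => //. eexists. apply cderiv_Cexp. Qed.

Lemma cdiff_Csin f z : cdiff f z -> cdiff (fun s => Csin (f s)) z.
Proof.
move=> H. have D : cdiff (fun s => Ci * f s)%C z by apply cdiff_mult => //; apply cdiff_const.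
apply cdiff_mult; [apply cdiff_minus; apply cdiff_Cexp_comp => //; by apply cdiff_opp|apply cdiff_const].
Qed.

Lemma cdiff_Ccos f z : cdiff f z -> cdiff (fun s => Ccos (f s)) z.
Proof.
move=> H. have D : cdiff (fun s => Ci * f s)%C z by apply cdiff_mult => //; apply cdiff_const.
apply cdiff_mult; [apply cdiff_plus; apply cdiff_Cexp_comp => //; by apply cdiff_opp|apply cdiff_const].
Qed.

(** A zero forces |exp(i z)| = |exp(- i z)|, hence Im z = 0, and the zeros of the real sine
    remain. *)
Lemma Csin_eq_0 (z : C) : Csin z = 0%C -> exists k : Z, z = RtoC (IZR k * PI).
Proof.
move=> H. have HN := Ci_neq_0.
have E : Cexp (Ci * z)%C = Cexp (- (Ci * z))%C.
{ have E0 : (Cexp (Ci * z) - Cexp (- (Ci * z)))%C = (Csin z * (2 * Ci))%C by unfold Csin; field. rewrite H in E0.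
  replace (Cexp (Ci * z)) with (Cexp (Ci * z) - Cexp (- (Ci * z)) + Cexp (- (Ci * z)))%C by ring. rewrite E0. ring. }
have M : Cmod (Cexp (Ci * z)) = Cmod (Cexp (- (Ci * z))%C) by rewrite E. rewrite !Cmod_Cexp in M. apply exp_inv in M.
destruct z as [x y]. simpl in M. have -> : y = 0 by lra. change (x, 0) with (RtoC x).
have Ey : y = 0 by lra. rewrite Ey in H. change (x, 0) with (RtoC x) in H. rewrite Csin_RtoC in H. have S : sin x = 0 by injection H.
destruct (sin_eq_0_0 x S) as [k Hk]. exists k. by rewrite Hk.
Qed.

Definition cotC_term (n : nat) (z : C) : C := (/ (z + RtoC (INR n)) + / (z - RtoC (INR n) - 1))%C.
(** z times [cotC_term] over a common denominator, the form in which the decay n^(-2) is visible. *)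
Definition cot_coef (n : nat) (z : C) : C := (z * (2 * z - 1) / ((z + RtoC (INR n)) * (z - RtoC (INR n) - 1)))%C.

(* z times the sum of the partial fractions of pi cot(pi z); the pole of the term n = 0 at z = 0 is cancelled. *)
Definition cotS (z : C) : C := ((2 * z - 1) / (z - 1) + cot_coef 1 z + Clim (csum (fun n => cot_coef (S (S n)) z)))%C.

Lemma Cneq0_Re (w : C) : Re w <> 0 -> w <> 0%C.
Proof. move=> H E. apply H. by rewrite E. Qed.

Lemma cot_denoms (z : C) n : Rabs (Re z) < 1 -> (z + RtoC (INR (S n)))%C <> 0%C /\ (z - RtoC (INR n) - 1)%C <> 0%C.
Proof.
move=> Hz. apply Rabs_def2 in Hz. have P := INR_S_ge1 n. have P0 := pos_INR n. split; apply Cneq0_Re; rewrite ?Re_minus ?Re_plus !Re_RtoC; lra.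
Qed.

Lemma cot_coef_bound (z : C) n : Rabs (Re z) < 1 -> Cmod (cot_coef (S (S n)) z) <= Cmod z * (2 * Cmod z + 1) * Rpower (INR (S n)) (- 1 - 1).
Proof.
move=> Hz. apply Rabs_def2 in Hz. have P := INR_S_pos n. have E := S_INR (S n).
have -> : Rpower (INR (S n)) (- 1 - 1) = / INR (S n) * / INR (S n) by replace (- 1 - 1) with (- (1) + - (1)) by ring; rewrite Rpower_plus Rpower_Ropp Rpower_1.
have L1 : INR (S n) <= Cmod (z + RtoC (INR (S (S n))))%C.
{ eapply Rle_trans; [|apply Rabs_fst_le]. change (INR (S n) <= Rabs (Re (z + RtoC (INR (S (S n))))%C)). rewrite Re_plus Re_RtoC E. eapply Rle_trans; [|apply Rle_abs]. lra. }
have L2 : INR (S n) <= Cmod (z - RtoC (INR (S (S n))) - 1)%C.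
{ eapply Rle_trans; [|apply Rabs_fst_le]. change (INR (S n) <= Rabs (Re (z - RtoC (INR (S (S n))) - 1)%C)). rewrite !Re_minus !Re_RtoC E. rewrite -Rabs_Ropp. eapply Rle_trans; [|apply Rle_abs]. lra. }
have M0 := Cmod_ge_0 z. unfold cot_coef. rewrite Cmod_div ?Cmod_mult; last first.
{ apply Cmult_neq_0 => E0; rewrite E0 Cmod_0 in L1 L2; lra. }
unfold Rdiv. rewrite Rinv_mult. apply Rmult_le_compat.
- apply Rmult_le_pos => //. apply Cmod_ge_0.
- apply Rmult_le_pos; apply Rlt_le, Rinv_0_lt_compat; lra.
- apply Rmult_le_compat_l => //. eapply Rle_trans; [apply Cmod_triangle_sub|]. rewrite Cmod_mult Cmod_1 Cmod_R Rabs_right; lra.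
- apply Rmult_le_compat; try (apply Rlt_le, Rinv_0_lt_compat; lra); by apply Rinv_le_contravar.
Qed.

Lemma cotS_lim (z : C) : Rabs (Re z) < 1 -> z <> 0%C -> clim (fun N => z * csum (fun n => cotC_term n z) N)%C (cotS z).
Proof.
move=> Hz Hz0. set A := Cmod z * (2 * Cmod z + 1). have M0 := Cmod_ge_0 z. have PA : 0 <= A by unfold A; nra.
have [T [_ [HT _]]] := rsum_bounded_lim (fun k => A * Rpower (INR (S k)) (- 1 - 1)) (A * (1 + / 1)) (fun k => Rmult_le_pos _ _ PA (Rlt_le _ _ (Rpower_pos _ _))) (fun n => qfac_sum A n PA).
have [L _] := csum_majorant _ _ T (fun n => cot_coef_bound z n Hz) HT.
apply (clim_shift _ _ 2). have L2 := clim_plus _ _ _ _ (clim_const ((2 * z - 1) / (z - 1) + cot_coef 1 z)%C) L.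
eapply clim_ext; [|apply L2]. move=> n. cbv beta. replace (n + 2)%nat with (2 + n)%nat by lia. rewrite csum_add Cmult_plus_distr_l -(csum_scal z (fun k => cotC_term (2 + k) z)). f_equal.
- have [_ N0] := cot_denoms z 0 Hz. have [N1 _] := cot_denoms z 0 Hz. have [_ N2] := cot_denoms z 1 Hz. simpl csum. unfold cotC_term, cot_coef. change (INR 0) with 0 in *. change (INR 1) with 1 in *.
  have N0' : (z - 1)%C <> 0%C by replace (z - 1)%C with (z - 0 - 1)%C by ring. field. repeat split => //.
- apply csum_ext => k _. have [N1 _] := cot_denoms z (S k) Hz. have [_ N2] := cot_denoms z (S (S k)) Hz. unfold cotC_term, cot_coef. simpl Nat.add. field. split => //.
Qed.

Lemma cdiff_cotS (z : C) : Rabs (Re z) < 1 -> cdiff cotS z.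
Proof.
move=> Hz. set r := Rmin 1 (1 - Rabs (Re z)). have Hr : 0 < r by apply Rmin_glb_lt; lra. have r1 := Rmin_l 1 (1 - Rabs (Re z)). have r2 := Rmin_r 1 (1 - Rabs (Re z)). fold r in r1, r2.
have HB : forall w, Cmod (w - z)%C < r -> Rabs (Re w) < 1 /\ Cmod w <= Cmod z + 1.
{ move=> w Hw. split.
  - have := Re_ball _ _ _ Hw => B. move: B r2. unfold Rabs. destruct (Rcase_abs (Re z)), (Rcase_abs (Re w)); lra.
  - have := Cmod_triangle_rev w z. lra. }
have DL : forall c w, cdiff (fun w => w + c)%C w by move=> c w; apply cdiff_plus; [apply cdiff_id|apply cdiff_const].
have DM : forall w, cdiff (fun w => 2 * w - 1)%C w by move=> w; apply cdiff_minus; [apply cdiff_mult; [apply cdiff_const|apply cdiff_id]|apply cdiff_const].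
have DC : forall n w, Rabs (Re w) < 1 -> cdiff (cot_coef (S n)) w.
{ move=> n w Hw. have [N1 _] := cot_denoms w n Hw. have [_ N2] := cot_denoms w (S n) Hw. apply cdiff_div; [apply cdiff_mult; [apply cdiff_id|apply DM]| |by apply Cmult_neq_0].
  apply cdiff_mult; [apply DL|]. apply cdiff_minus; [apply cdiff_minus; [apply cdiff_id|apply cdiff_const]|apply cdiff_const]. }
have [_ N0] := cot_denoms z 0 Hz. change (INR 0) with 0 in N0.
apply cdiff_plus; [apply cdiff_plus; [|by apply DC]|].
- apply cdiff_div; [apply DM|apply cdiff_minus; [apply cdiff_id|apply cdiff_const]|]. by replace (z - 1)%C with (z - 0 - 1)%C by ring.
- set R := Cmod z + 1. have M0 := Cmod_ge_0 z. have PA : 0 <= R * (2 * R + 1) by unfold R; nra.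
  apply (cdiff_series (fun n z => cot_coef (S (S n)) z) (fun k => R * (2 * R + 1) * Rpower (INR (S k)) (- 1 - 1)) (R * (2 * R + 1) * (1 + / 1)) z r) => //.
  + move=> k w Hw. apply DC, HB, Hw.
  + move=> k w Hw. have [h1 h2] := HB w Hw. eapply Rle_trans; [by apply cot_coef_bound|]. apply Rmult_le_compat_r; [apply Rlt_le, Rpower_pos|]. have := Cmod_ge_0 w. fold R in h2. nra.
  + move=> n. by apply qfac_sum.
Qed.

(** The real expansion is known along N = 2^j, and this subsequence identifies the limit. *)
Lemma cotS_real x : 0 < x < 1 -> cotS (RtoC x) = RtoC (x * cotR x).
Proof.
move=> Hx. have L := cotS_lim (RtoC x) ltac:(rewrite Re_RtoC Rabs_right; lra) ltac:(apply RtoC_neq_0; lra).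
apply (clim_unique (fun j => RtoC x * csum (fun n => cotC_term n (RtoC x)) (2 ^ j))%C).
- move=> eps He. destruct (L eps He) as [N HN]. exists N => j Hj. apply HN. have := Nat.pow_gt_lin_r 2 j ltac:(lia). lia.
- have Lr : is_lim_seq (fun j => x * rsum (fun n => cot_term n x) (2 ^ j)) (x * cotR x).
  { apply (is_lim_seq_scal_l _ x (Finite (cotR x))). apply is_lim_seq_eps => eps He. have P := PI_RGT_0.
    have [N HN] := INR_unbounded (PI ^ 2 / eps). exists N => j Hj. rewrite Rabs_minus_sym. eapply Rle_lt_trans; [by apply cot_partial_fractions|].
    have Pj : 0 < 2 ^ j by apply pow_lt; lra. apply Rmult_lt_reg_r with (2 ^ j) => //. unfold Rdiv. rewrite Rmult_assoc Rinv_l; [|lra]. rewrite Rmult_1_r.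
    have h : INR N <= 2 ^ j. { have := Nat.pow_gt_lin_r 2 j ltac:(lia). move=> h. have := le_INR N (2 ^ j) ltac:(lia). by rewrite pow_INR. }
    have E : PI ^ 2 = PI ^ 2 / eps * eps by field; lra. nra. }
  eapply clim_ext; [|apply (clim_RtoC _ _ Lr)]. move=> j. cbv beta. rewrite RtoC_mult -csum_RtoC. f_equal. apply csum_ext => n _. have Pn := pos_INR n.
  unfold cot_term, cotC_term. rewrite RtoC_plus !RtoC_inv ?RtoC_minus ?RtoC_plus //; lra.
Qed.

(** Multiplying by the sine avoids a quotient at z = 0. The identity holds on (0, 1), and the strip
    |Re z| < 1 contains the imaginary axis, where the expansion becomes that of coth. *)
Lemma cot_partial_fractions_C (z : C) : Rabs (Re z) < 1 -> (Csin (RtoC PI * z) * cotS z)%C = (RtoC PI * z * Ccos (RtoC PI * z))%C.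
Proof.
move=> Hz. set f := fun z : C => (Csin (RtoC PI * z) * cotS z - RtoC PI * z * Ccos (RtoC PI * z))%C.
have Df : forall z : C, Rabs (Re z) < 1 -> cdiff f z.
{ move=> w Hw. have D : cdiff (fun z => RtoC PI * z)%C w by apply cdiff_mult; [apply cdiff_const|apply cdiff_id].
  apply cdiff_minus; apply cdiff_mult => //; [by apply cdiff_Csin|by apply cdiff_cotS|by apply cdiff_Ccos]. }
have F0 : forall x, 0 < x < 1 -> f (RtoC x) = 0%C.
{ move=> x Hx. unfold f. rewrite cotS_real // -!RtoC_mult Csin_RtoC Ccos_RtoC -!RtoC_mult -RtoC_minus. f_equal. have := sin_PI_pos x Hx. unfold cotR => S. field. lra. }
have E : f z = 0%C.
{ apply (identity_theorem (fun w => Rabs (Re w) < 1) f (RtoC (1 / 2))) => //.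
  - move=> a b t Ha Hb Ht. apply Rabs_def2 in Ha. apply Rabs_def2 in Hb. have -> : Re (a + RtoC t * (b - a))%C = (1 - t) * Re a + t * Re b by destruct a, b; simpl; ring.
    destruct Ha as [a1 a2], Hb as [b1 b2], Ht as [t1 t2]. move: (Re a) (Re b) a1 a2 b1 b2 => u v a1 a2 b1 b2. destruct (Rle_dec u v); apply Rabs_def1; nra.
  - move=> a Ha. exists (1 - Rabs (Re a)). split; [lra|] => w Hw. have := Re_ball _ _ _ Hw => B. move: B Ha. unfold Rabs. destruct (Rcase_abs (Re a)), (Rcase_abs (Re w)); lra.
  - rewrite Re_RtoC Rabs_right; lra.
  (* [identity_theorem] starts from a disc of zeros; the real zeros accumulating at 1 / 2 provide
     one. *)
  - exists (1 / 2 / 3). split; [lra|] => w Hw. apply (isolated_zeros f (RtoC (1 / 2)) (1 / 2)) => //; [lra| |].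
    + move=> v Hv. apply Df. have := Re_ball _ _ _ Hv. rewrite Re_RtoC => B. rewrite Rabs_right; lra.
    + move=> d Hd. set t := Rmin (d / 2) (1 / 4). have t0 : 0 < t by apply Rmin_glb_lt; lra. have t1 := Rmin_l (d / 2) (1 / 4). have t2 := Rmin_r (d / 2) (1 / 4). fold t in t1, t2.
      exists (RtoC (1 / 2 + t)). split; [move=> E; injection E; lra|]. split; [|apply F0; lra]. rewrite -RtoC_minus Cmod_R. replace (1 / 2 + t - 1 / 2) with t by ring. rewrite Rabs_right; lra. }
unfold f in E. transitivity (Csin (RtoC PI * z) * cotS z - RtoC PI * z * Ccos (RtoC PI * z) + RtoC PI * z * Ccos (RtoC PI * z))%C; [ring|]. rewrite E. ring.
Qed.

(** The cotangent expansion at z = i y. Its value is real, so only the real parts of the partial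
    sums are followed. *)
Lemma coth_series y : 0 < y ->
  is_lim_seq (fun N => rsum (fun n => y ^ 2 / (y ^ 2 + INR n ^ 2) + y ^ 2 / (y ^ 2 + INR (S n) ^ 2)) N)
    (PI * y * (exp (PI * y) + exp (- (PI * y))) / (exp (PI * y) - exp (- (PI * y)))).
Proof.
move=> Hy. have P := PI_RGT_0. set z := (Ci * RtoC y)%C. have Rz : Re z = 0 by unfold z; simpl; ring.
have Nz : z <> 0%C by apply Cmult_neq_0; [apply Ci_neq_0|apply RtoC_neq_0; lra].
have L := clim_fst _ _ (cotS_lim z ltac:(rewrite Rz Rabs_R0; lra) Nz).
have E := cot_partial_fractions_C z ltac:(rewrite Rz Rabs_R0; lra).
have Ez : (Ci * (RtoC PI * z))%C = RtoC (- (PI * y)). { unfold z. replace (Ci * (RtoC PI * (Ci * RtoC y)))%C with (Ci * Ci * (RtoC PI * RtoC y))%C by ring. rewrite Ci_sqr RtoC_opp RtoC_mult. ring. }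
set a := exp (PI * y). set b := exp (- (PI * y)).
have Hab : b < a by apply exp_increasing; nra.
have ES : Csin (RtoC PI * z) = (RtoC (b - a) / (2 * Ci))%C by unfold Csin; rewrite Ez -RtoC_opp !Cexp_RtoC Ropp_involutive RtoC_minus.
have EC : Ccos (RtoC PI * z) = (RtoC (b + a) / 2)%C by unfold Ccos; rewrite Ez -RtoC_opp !Cexp_RtoC Ropp_involutive RtoC_plus.
rewrite ES EC in E. have HN := Ci_neq_0. have NB : RtoC (b - a) <> 0%C by apply RtoC_neq_0; lra.
have EV : cotS z = RtoC (PI * y * (a + b) / (a - b)).
{ have -> : cotS z = (RtoC (b - a) / (2 * Ci) * cotS z * (2 * Ci) / RtoC (b - a))%C by field. rewrite E. unfold z.
  replace (RtoC PI * (Ci * RtoC y) * (RtoC (b + a) / 2) * (2 * Ci) / RtoC (b - a))%C with ((Ci * Ci) * RtoC PI * RtoC y * RtoC (b + a) / RtoC (b - a))%C by (field; done).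
  rewrite Ci_sqr RtoC_div; [|lra]. rewrite !RtoC_mult. replace (a - b) with (- (b - a)) by ring. rewrite RtoC_opp (Rplus_comm a b). field. done. }
rewrite EV in L. simpl (fst (RtoC _)) in L.
apply: is_lim_seq_ext L => N. elim: N => [|N IH]; [simpl; ring|].
change (csum (fun n => cotC_term n z) (S N)) with (csum (fun n => cotC_term n z) N + cotC_term N z)%C. rewrite Cmult_plus_distr_l.
change (fst (z * csum (fun n => cotC_term n z) N)%C + fst (z * cotC_term N z)%C = rsum (fun n => y ^ 2 / (y ^ 2 + INR n ^ 2) + y ^ 2 / (y ^ 2 + INR (S n) ^ 2)) N + (y ^ 2 / (y ^ 2 + INR N ^ 2) + y ^ 2 / (y ^ 2 + INR (S N) ^ 2))).
rewrite IH. f_equal. unfold cotC_term, z. rewrite (S_INR N). have PN := pos_INR N. move: (INR N) PN => u Hu.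
simpl. field. repeat split; nra.
Qed.

(** * The series of the cosecant *)

Lemma csc_cot x : 0 < x < 1 -> cotR (x / 2) - cotR x = PI / sin (PI * x).
Proof.
move=> Hx. have S := sin_PI_pos x Hx. have S2 := sin_PI_pos (x / 2) ltac:(lra). unfold cotR.
have Q := sin2_cos2 (PI * (x / 2)). unfold Rsqr in Q. have E : PI * x = 2 * (PI * (x / 2)) by field. rewrite E in S |- *. rewrite sin_2a cos_2a. rewrite sin_2a in S.
move: (sin _) (cos _) S S2 Q => u v S S2 Q. have V : v <> 0 by nra.
replace (PI / (2 * u * v)) with (PI * (u * u + v * v) / (2 * u * v)) by (rewrite Q; field; lra). field. lra.
Qed.

(** The partial fractions of PI / sin(PI x), with the poles - n and n + 1 paired. *)
Definition csc_term (x : R) (n : nat) : R := (-1) ^ n * (/ (INR n + x) + / (INR n + 1 - x)).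

Lemma csc_partial x N : 0 < x < 1 ->
  rsum (fun n => cot_term n (x / 2)) N - rsum (fun n => cot_term n x) (N + N) = rsum (csc_term x) (N + N).
Proof.
move=> Hx. elim: N => [|N IH]; [simpl; ring|]. replace (S N + S N)%nat with (S (S (N + N))) by lia.
change (rsum (fun n => cot_term n (x / 2)) N + cot_term N (x / 2) - (rsum (fun n => cot_term n x) (N + N) + cot_term (N + N) x + cot_term (S (N + N)) x) =
  rsum (csc_term x) (N + N) + csc_term x (N + N) + csc_term x (S (N + N))).
rewrite -IH. unfold csc_term, cot_term. have -> : (-1) ^ (N + N) = 1. { replace (N + N)%nat with (2 * N)%nat by lia. rewrite pow_1_even //. }
have -> : (-1) ^ S (N + N) = -1. { replace (N + N)%nat with (2 * N)%nat by lia. apply pow_1_odd. }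
rewrite S_INR plus_INR. have P := pos_INR N. move: (INR N) P => u P. field. lra.
Qed.

Lemma csc_series x : 0 < x < 1 -> is_lim_seq (fun j => rsum (csc_term x) (2 ^ S j)) (PI / sin (PI * x)).
Proof.
move=> Hx. have P := PI_RGT_0. apply is_lim_seq_eps => eps He.
destruct (INR_unbounded (2 * PI ^ 2 / eps)) as [N HN]. exists N => j Hj.
have E : (2 ^ S j)%nat = (2 ^ j + 2 ^ j)%nat by simpl; lia. rewrite {1}E -csc_partial // -E -csc_cot //.
have B1 := cot_partial_fractions (x / 2) j ltac:(lra). have B2 := cot_partial_fractions x (S j) Hx.
have Pj : 0 < 2 ^ j by apply pow_lt; lra. have E2 : PI ^ 2 / 2 ^ S j = PI ^ 2 / 2 ^ j / 2 by simpl; field; lra.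
have Q0 : 0 < PI ^ 2 / 2 ^ j by apply Rdiv_lt_0_compat => //; apply pow_lt.
have Q : 2 * (PI ^ 2 / 2 ^ j) < eps.
{ apply Rmult_lt_reg_r with (2 ^ j) => //. replace (2 * (PI ^ 2 / 2 ^ j) * 2 ^ j) with (2 * PI ^ 2) by (field; lra).
  have h : INR N <= 2 ^ j. { have h0 := Nat.pow_gt_lin_r 2 j ltac:(lia). have := le_INR N (2 ^ j) ltac:(lia). by rewrite pow_INR. }
  have E3 : 2 * PI ^ 2 = 2 * PI ^ 2 / eps * eps by field; lra. nra. }
match goal with |- Rabs ?g < _ => match type of B1 with Rabs ?u <= _ => match type of B2 with Rabs ?v <= _ => replace g with (v - u) by ring end end end.
eapply Rle_lt_trans; [apply Rabs_triang|]. rewrite Rabs_Ropp. lra.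
Qed.

(** * Improper integrals and Muentz's formula *)

Definition cont0 (f : R -> R) : Prop := forall x, 0 < x -> continuous f x.

(** The improper integral over (0, infinity), with independent limits at the two ends. *)
Definition II (f : R -> R) (l : R) : Prop := forall eps, 0 < eps -> exists A B, 0 < A <= B /\
  forall a b, 0 < a <= A -> B <= b -> Rabs (RInt f a b - l) < eps.

Lemma ex0 f a b : cont0 f -> 0 < a -> 0 < b -> ex_RInt f a b.
Proof.
move=> H Ha Hb. apply: ex_RInt_continuous => x Hx. apply H. move: Hx. unfold Rmin, Rmax. destruct (Rle_dec a b); lra.
Qed.

Lemma cont0_plus f g : cont0 f -> cont0 g -> cont0 (fun x => f x + g x).
Proof. move=> Hf Hg x Hx. apply: continuous_plus; auto. Qed.
Lemma cont0_minus f g : cont0 f -> cont0 g -> cont0 (fun x => f x - g x).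
Proof. move=> Hf Hg x Hx. apply: continuous_minus; auto. Qed.
Lemma cont0_mult f g : cont0 f -> cont0 g -> cont0 (fun x => f x * g x).
Proof. move=> Hf Hg x Hx. apply: continuous_mult; auto. Qed.
Lemma cont0_scal c f : cont0 f -> cont0 (fun x => c * f x).
Proof. move=> Hf x Hx. apply: continuous_mult; [apply continuous_const|auto]. Qed.
Lemma cont0_derive f : (forall x, 0 < x -> ex_derive f x) -> cont0 f.
Proof. move=> H x Hx. apply: ex_derive_continuous. by apply H. Qed.
Lemma cont0_Rpower e : cont0 (fun x => Rpower x e).
Proof. move=> x Hx. by apply continuous_Rpower. Qed.

Lemma II_plus f g l m : cont0 f -> cont0 g -> II f l -> II g m -> II (fun x => f x + g x) (l + m).
Proof.
move=> cf cg Hf Hg eps He. destruct (Hf (eps / 2) ltac:(lra)) as [A1 [B1 [P1 K1]]]. destruct (Hg (eps / 2) ltac:(lra)) as [A2 [B2 [P2 K2]]].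
have m1 := Rmin_l A1 A2. have m2 := Rmin_r A1 A2. have m3 := Rmax_l B1 B2. have m4 := Rmax_r B1 B2.
exists (Rmin A1 A2), (Rmax B1 B2). split; [split; [apply Rmin_glb_lt; lra|lra]|]. move=> a b Ha Hb.
have k1 := K1 a b ltac:(lra) ltac:(lra). have k2 := K2 a b ltac:(lra) ltac:(lra).
rewrite RInt_plus_R; try (apply ex0 => //; lra).
replace (RInt f a b + RInt g a b - (l + m)) with ((RInt f a b - l) + (RInt g a b - m)) by ring. eapply Rle_lt_trans; [apply Rabs_triang|]. lra.
Qed.

Lemma II_scal c f l : cont0 f -> II f l -> II (fun x => c * f x) (c * l).
Proof.
move=> cf Hf eps He. have C := Rabs_pos c. destruct (Hf (eps / (Rabs c + 1))) as [A1 [B1 [P1 K1]]]; [apply Rdiv_lt_0_compat; lra|].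
exists A1, B1. split => // a b Ha Hb. have k := K1 a b Ha Hb. rewrite RInt_scal_R; [|apply ex0 => //; lra].
replace (c * RInt f a b - c * l) with (c * (RInt f a b - l)) by ring. rewrite Rabs_mult.
apply Rle_lt_trans with (Rabs c * (eps / (Rabs c + 1))); [apply Rmult_le_compat_l; lra|].
apply Rmult_lt_reg_r with (Rabs c + 1); [lra|]. replace (Rabs c * (eps / (Rabs c + 1)) * (Rabs c + 1)) with (Rabs c * eps) by (field; lra). nra.
Qed.

Lemma II_ext f g l : (forall x, 0 < x -> f x = g x) -> II f l -> II g l.
Proof.
move=> E H eps He. destruct (H eps He) as [A [B [P K]]]. exists A, B. split => // a b Ha Hb. rewrite -(RInt_ext f g); [by apply K|].
move=> x Hx. apply E. move: Hx. unfold Rmin, Rmax. destruct (Rle_dec a b); lra.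
Qed.

Lemma II_minus f g l m : cont0 f -> cont0 g -> II f l -> II g m -> II (fun x => f x - g x) (l - m).
Proof.
move=> cf cg Hf Hg. have H := II_plus _ _ _ _ cf (cont0_scal (-1) g cg) Hf (II_scal (-1) g m cg Hg).
replace (l - m) with (l + -1 * m) by ring. apply: II_ext H => x _. ring.
Qed.

Lemma II_le f g l m : cont0 f -> cont0 g -> (forall x, 0 < x -> f x <= g x) -> II f l -> II g m -> l <= m.
Proof.
move=> cf cg H Hf Hg. apply le_epsilon => eps He. destruct (Hf (eps / 2) ltac:(lra)) as [A1 [B1 [P1 K1]]]. destruct (Hg (eps / 2) ltac:(lra)) as [A2 [B2 [P2 K2]]].
have m1 := Rmin_l A1 A2. have m2 := Rmin_r A1 A2. have m3 := Rmax_l B1 B2. have m4 := Rmax_r B1 B2. have m0 : 0 < Rmin A1 A2 by apply Rmin_glb_lt; lra.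
have k1 := K1 (Rmin A1 A2) (Rmax B1 B2) ltac:(lra) ltac:(lra). have k2 := K2 (Rmin A1 A2) (Rmax B1 B2) ltac:(lra) ltac:(lra).
have : RInt f (Rmin A1 A2) (Rmax B1 B2) <= RInt g (Rmin A1 A2) (Rmax B1 B2).
{ apply RInt_le; [lra|apply ex0 => //; lra|apply ex0 => //; lra|]. move=> x Hx. apply H. lra. }
apply Rabs_def2 in k1. apply Rabs_def2 in k2. lra.
Qed.

Lemma II_unique f l m : cont0 f -> II f l -> II f m -> l = m.
Proof. move=> cf H1 H2. apply Rle_antisym; apply (II_le f f) => //; move=> x _; lra. Qed.

Lemma RInt_derive0 F f a b : (forall x, 0 < x -> is_derive F x (f x)) -> cont0 f -> 0 < a -> 0 < b -> RInt f a b = F b - F a.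
Proof.
move=> HF cf Ha Hb. apply is_RInt_unique. apply: is_RInt_derive.
- move=> x Hx. apply HF. move: Hx. unfold Rmin, Rmax. destruct (Rle_dec a b); lra.
- move=> x Hx. apply cf. move: Hx. unfold Rmin, Rmax. destruct (Rle_dec a b); lra.
Qed.

Lemma II_0 : II (fun _ => 0) 0.
Proof.
move=> eps He. exists 1, 1. split; [lra|] => a b _ _. rewrite RInt_const Rminus_0_r /scal /= /mult /= Rmult_0_r Rabs_R0 //.
Qed.

Lemma II_FTC F f l0 l1 : (forall x, 0 < x -> is_derive F x (f x)) -> cont0 f ->
  (forall eps, 0 < eps -> exists d, 0 < d /\ forall x, 0 < x <= d -> Rabs (F x - l0) < eps) ->
  (forall eps, 0 < eps -> exists B, forall x, B <= x -> Rabs (F x - l1) < eps) -> II f (l1 - l0).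
Proof.
move=> HF cf H0 H1 eps He. destruct (H0 (eps / 2) ltac:(lra)) as [d [Hd Kd]]. destruct (H1 (eps / 2) ltac:(lra)) as [B KB].
exists d, (Rmax d B). have m1 := Rmax_l d B. have m2 := Rmax_r d B. split => // a b Ha Hb.
rewrite (RInt_derive0 F f) //; try lra. have k1 := Kd a Ha. have k2 := KB b ltac:(lra).
replace (F b - F a - (l1 - l0)) with ((F b - l1) - (F a - l0)) by ring. eapply Rle_lt_trans; [apply Rabs_triang|]. rewrite Rabs_Ropp. lra.
Qed.

Lemma RInt_nonneg f a b : cont0 f -> (forall x, 0 < x -> 0 <= f x) -> 0 < a <= b -> 0 <= RInt f a b.
Proof. move=> cf H Hab. apply RInt_ge_0; [lra|apply ex0 => //; lra|]. move=> x Hx. apply H. lra. Qed.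

Lemma RInt_mono_int f a b a' b' : cont0 f -> (forall x, 0 < x -> 0 <= f x) -> 0 < a' <= a -> a <= b <= b' -> RInt f a b <= RInt f a' b'.
Proof.
move=> cf H Ha Hb. have E1 := RInt_Chasles f a' a b' (ex0 f a' a cf ltac:(lra) ltac:(lra)) (ex0 f a b' cf ltac:(lra) ltac:(lra)).
have E2 := RInt_Chasles f a b b' (ex0 f a b cf ltac:(lra) ltac:(lra)) (ex0 f b b' cf ltac:(lra) ltac:(lra)).
change (RInt f a' a + RInt f a b' = RInt f a' b') in E1. change (RInt f a b + RInt f b b' = RInt f a b') in E2.
have := RInt_nonneg f a' a cf H ltac:(lra). have := RInt_nonneg f b b' cf H ltac:(lra). lra.
Qed.

Lemma II_partial_le f l a b : cont0 f -> (forall x, 0 < x -> 0 <= f x) -> II f l -> 0 < a <= b -> RInt f a b <= l.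
Proof.
move=> cf H Hl Hab. apply le_epsilon => eps He. destruct (Hl eps He) as [A [B [P K]]].
have m1 := Rmin_l A a. have m2 := Rmin_r A a. have m3 := Rmax_l B b. have m4 := Rmax_r B b. have m0 : 0 < Rmin A a by apply Rmin_glb_lt; lra.
have k := K (Rmin A a) (Rmax B b) ltac:(lra) ltac:(lra). have := RInt_mono_int f a b (Rmin A a) (Rmax B b) cf H ltac:(lra) ltac:(lra).
apply Rabs_def2 in k. lra.
Qed.

(** The integrals over compact intervals increase with the interval, so their supremum is the
    limit. *)
Lemma II_exists f M : cont0 f -> (forall x, 0 < x -> 0 <= f x) -> (forall a b, 0 < a <= b -> RInt f a b <= M) -> exists l, 0 <= l /\ II f l.
Proof.
move=> cf H HM. set E := fun y => exists a b, 0 < a <= b /\ y = RInt f a b.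
destruct (completeness E) as [l [U1 U2]].
- exists M => y [a [b [Hab ->]]]. by apply HM.
- exists (RInt f 1 1). exists 1, 1. split => //. lra.
- exists l. split.
  + apply Rle_trans with (RInt f 1 1); [apply RInt_nonneg => //; lra|]. apply U1. exists 1, 1. split => //. lra.
  + move=> eps He. destruct (Classical_Prop.classic (exists a b, 0 < a <= b /\ l - eps < RInt f a b)) as [[A [B [P K]]]|N].
    * exists A, B. split => // a b Ha Hb. have k := RInt_mono_int f A B a b cf H ltac:(lra) ltac:(lra).
      have u : RInt f a b <= l by apply U1; exists a, b; split => //; lra. apply Rabs_def1; lra.
    * exfalso. have : l <= l - eps; [|lra]. apply U2 => y [a [b [Hab ->]]]. apply Rnot_lt_le => L. apply N. by exists a, b.
Qed.

Lemma II_scale f l c : cont0 f -> 0 < c -> II f l -> II (fun x => f (c * x)) (l / c).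
Proof.
move=> cf Hc H eps He. destruct (H (c * eps) ltac:(nra)) as [A [B [P K]]]. have Pc : 0 < / c by apply Rinv_0_lt_compat.
exists (A / c), (B / c). split; [split; [apply Rdiv_lt_0_compat; lra|apply Rmult_le_compat_r; lra]|]. move=> a b Ha Hb.
have E1 : c * (A / c) = A by field; lra. have E2 : c * (B / c) = B by field; lra.
have k := K (c * a) (c * b) ltac:(nra) ltac:(nra).
have P1 : 0 < B / c by apply Rdiv_lt_0_compat; lra. have Ca : 0 < c * a by nra. have Cb : 0 < c * b by nra.
have E := is_RInt_comp_lin f c 0 a b (RInt f (c * a) (c * b)). rewrite !Rplus_0_r in E.
have E3 := is_RInt_unique _ _ _ _ (E (RInt_correct _ _ _ (ex0 f _ _ cf Ca Cb))).
have E4 : RInt (fun y => c * f (c * y)) a b = RInt f (c * a) (c * b).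
{ rewrite -E3. apply RInt_ext => x _. by rewrite Rplus_0_r. }
rewrite RInt_scal_R in E4.
2:{ apply ex0; try lra. move=> x Hx. apply: (continuous_comp (fun x => c * x) f); [|apply cf; nra]. apply: continuous_mult; [apply continuous_const|apply continuous_id]. }
have -> : RInt (fun x => f (c * x)) a b - l / c = / c * (RInt f (c * a) (c * b) - l) by rewrite -E4; field; lra.
rewrite Rabs_mult Rabs_right; [|lra]. replace eps with (/ c * (c * eps)) by (field; lra). by apply Rmult_lt_compat_l.
Qed.

Lemma cont0_inv_comp f c : cont0 f -> 0 < c -> cont0 (fun y => f (c / y) * (c / y ^ 2)).
Proof.
move=> cf Hc. apply cont0_mult.
- move=> y Hy. apply: (continuous_comp (fun y => c / y) f); [|apply cf; by apply Rdiv_lt_0_compat]. apply: ex_derive_continuous. auto_derive. lra.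
- apply cont0_derive => y Hy. auto_derive. nra.
Qed.

Lemma RInt_inv_subst f c a b : cont0 f -> 0 < c -> 0 < a <= b -> RInt (fun y => f (c / y) * (c / y ^ 2)) a b = RInt f (c / b) (c / a).
Proof.
move=> cf Hc Hab. have E := is_RInt_comp f (fun y => c / y) (fun y => - (c / y ^ 2)) a b.
have PA : 0 < c / a by apply Rdiv_lt_0_compat; lra. have PB : 0 < c / b by apply Rdiv_lt_0_compat; lra.
have {} E := is_RInt_unique _ _ _ _ (E _ _).
rewrite -(opp_RInt_swap _ (c / a)); [|apply ex0 => //]. change (RInt (fun y => f (c / y) * (c / y ^ 2)) a b = - RInt f (c / a) (c / b)). rewrite -E.
have -> : RInt (fun y => scal (- (c / y ^ 2)) (f (c / y))) a b = RInt (fun y => (-1) * (f (c / y) * (c / y ^ 2))) a b.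
{ apply RInt_ext => y _. rewrite /scal /= /mult /=. ring. }
rewrite RInt_scal_R; [lra|]. apply ex0; try lra. by apply cont0_inv_comp.
Unshelve.
- move=> x Hx. apply cf. rewrite Rmin_left ?Rmax_right in Hx; try lra. apply Rdiv_lt_0_compat; lra.
- move=> x Hx. rewrite Rmin_left ?Rmax_right in Hx; try lra. split.
  + auto_derive; [lra|]. field. lra.
  + apply: ex_derive_continuous. auto_derive. nra.
Qed.

(** The decreasing substitution x = c / y, which exchanges the two ends. *)
Lemma II_inv f l c : cont0 f -> 0 < c -> II f l -> II (fun y => f (c / y) * (c / y ^ 2)) l.
Proof.
move=> cf Hc H eps He. destruct (H eps He) as [A [B [P K]]].
exists (c / B), (c / A). have PA : 0 < / A by apply Rinv_0_lt_compat; lra. have PB : 0 < / B by apply Rinv_0_lt_compat; lra.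
have I : / B <= / A by apply Rinv_le_contravar; lra.
split; [split; [apply Rdiv_lt_0_compat; lra|unfold Rdiv; nra]|]. move=> a b Ha Hb.
have Q1 : c / B <= c / A by unfold Rdiv; nra. rewrite RInt_inv_subst //; [|lra].
apply K.
- have Hb0 : 0 < b by lra. split; [by apply Rdiv_lt_0_compat|]. apply Rmult_le_reg_r with b => //. replace (c / b * b) with c by (field; lra).
  apply Rmult_le_reg_r with (/ A) => //. rewrite Rmult_comm (Rmult_comm A) Rmult_assoc Rinv_r; [|lra]. unfold Rdiv in Hb. lra.
- apply Rmult_le_reg_r with a; [lra|]. replace (c / a * a) with c by (field; lra). apply Rmult_le_reg_r with (/ B) => //.
  rewrite (Rmult_comm B) Rmult_assoc Rinv_r; [|lra]. destruct Ha as [_ Ha]. unfold Rdiv in Ha. lra.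
Qed.

(* x^(s-1) (1+x)^(-s-1) is the derivative of (x/(1+x))^s / s. *)
Lemma mellin_exists phi s : cont0 phi -> 0 < s < 1 -> (forall x, 0 < x -> 0 <= phi x <= 2 / (1 + x) ^ 2) ->
  exists m, 0 <= m /\ II (fun x => Rpower x (s - 1) * phi x) m.
Proof.
move=> cp Hs Hp. set F := fun x => Rpower (x / (1 + x)) s. set f := fun x => s * Rpower (x / (1 + x)) (s - 1) * / (1 + x) ^ 2.
have DF : forall x, 0 < x -> is_derive F x (f x).
{ move=> x Hx. have Px : 0 < x / (1 + x) by apply Rdiv_lt_0_compat; lra.
  have D1 : is_derive (fun u => Rpower u s) (x / (1 + x)) (s * Rpower (x / (1 + x)) (s - 1)) by apply is_derive_Reals, derivable_pt_lim_power.
  have D2 : is_derive (fun x => x / (1 + x)) x (/ (1 + x) ^ 2) by auto_derive; [lra|field; lra].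
  eapply eq_ind; [apply: (is_derive_comp (fun u => Rpower u s) (fun x => x / (1 + x)) x _ _ D1 D2)|]. change (/ (1 + x) ^ 2 * (s * Rpower (x / (1 + x)) (s - 1)) = f x). unfold f. ring. }
have cf : cont0 f.
{ apply cont0_mult; [apply cont0_scal|apply cont0_derive => x Hx; auto_derive; nra].
  move=> x Hx. have Px : 0 < x / (1 + x) by apply Rdiv_lt_0_compat; lra.
  apply: (continuous_comp (fun x => x / (1 + x)) (fun u => Rpower u (s - 1))); [apply: ex_derive_continuous; auto_derive; lra|by apply continuous_Rpower]. }
have cg : cont0 (fun x => Rpower x (s - 1) * phi x) by apply cont0_mult => //; apply cont0_Rpower.
apply (II_exists _ (2 / s)) => //.
- move=> x Hx. apply Rmult_le_pos; [apply Rlt_le, Rpower_pos|apply Hp => //].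
- move=> a b Hab. have R := RInt_derive0 F f a b DF cf ltac:(lra) ltac:(lra).
  have B1 : 0 < F a by apply Rpower_pos. have B2 : F b <= 1.
  { unfold F. eapply Rle_trans; [|right; apply (Rpower_base_1 s)]. apply Rpower_mono; [|lra]. split; [apply Rdiv_lt_0_compat; lra|]. apply Rmult_le_reg_r with (1 + b); [lra|]. unfold Rdiv. rewrite Rmult_assoc Rinv_l; lra. }
  apply Rle_trans with (RInt (fun x => 2 / s * f x) a b).
  + apply RInt_le; [lra|apply ex0 => //; lra|apply ex0; [by apply cont0_scal|lra|lra]|]. move=> x Hx. have Hx0 : 0 < x by lra. have [p1 p2] := Hp x Hx0.
    have -> : 2 / s * f x = Rpower (x / (1 + x)) (s - 1) * (2 / (1 + x) ^ 2) by unfold f; field; lra.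
    apply Rmult_le_compat => //; [apply Rlt_le, Rpower_pos|]. apply Rpower_anti; [|lra]. split; [apply Rdiv_lt_0_compat; lra|].
    apply Rmult_le_reg_r with (1 + x); [lra|]. have -> : x / (1 + x) * (1 + x) = x by field; lra. clear - Hx0. nra.
  + rewrite RInt_scal_R; [|apply ex0 => //; lra]. rewrite R. have : 0 < 2 / s by apply Rdiv_lt_0_compat; lra. nra.
Qed.

Lemma Rpower_1_mult x e : 0 < x -> Rpower x (e + 1) = Rpower x e * x.
Proof. move=> Hx. by rewrite Rpower_plus Rpower_1. Qed.

Lemma is_derive_Rpower e x : 0 < x -> is_derive (fun u => Rpower u e) x (e * Rpower x (e - 1)).
Proof. move=> Hx. apply is_derive_Reals. by apply derivable_pt_lim_power. Qed.

Lemma Rpower_lim0 e K : 0 < e -> forall eps, 0 < eps -> exists d, 0 < d /\ forall x, 0 < x <= d -> Rabs (K * Rpower x e) < eps.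
Proof.
move=> He eps Hep. have K0 := Rabs_pos K. set v := eps / (Rabs K + 1). have V : 0 < v by apply Rdiv_lt_0_compat; lra.
destruct (Rpower_small e v He V) as [X [HX1 HX]].
exists (/ X). split; [apply Rinv_0_lt_compat; lra|]. move=> x Hx. have Px := Rpower_pos x e.
have h : Rpower x e < v.
{ have := HX (/ x) _. rewrite Rpower_inv_base; [|lra]. rewrite Ropp_involutive. apply. rewrite -(Rinv_inv X). apply Rinv_le_contravar; lra. }
rewrite Rabs_mult (Rabs_right (Rpower x e)); [|lra]. have E : v * (Rabs K + 1) = eps by unfold v; field; lra. nra.
Qed.

Lemma Rpower_lim_infty e K : 0 < e -> forall eps, 0 < eps -> exists B, 1 <= B /\ forall x, B <= x -> Rabs (K * Rpower x (- e)) < eps.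
Proof.
move=> He eps Hep. have K0 := Rabs_pos K. set v := eps / (Rabs K + 1). have V : 0 < v by apply Rdiv_lt_0_compat; lra.
destruct (Rpower_small e v He V) as [X [HX1 HX]]. exists X. split => // x Hx. have h := HX x Hx. have Px := Rpower_pos x (- e).
rewrite Rabs_mult (Rabs_right (Rpower x (- e))); [|lra]. have E : v * (Rabs K + 1) = eps by unfold v; field; lra. nra.
Qed.

(** * Muentz's formula *)

Section Muentz.
Variables (phi Phi H : R -> R) (s B m zr : R).
Hypothesis Hs : 0 < s < 1.
Hypothesis DPhi : forall x, is_derive Phi x (phi x).
Hypothesis cphi : forall x, continuous phi x.
Hypothesis phi_pos : forall x, 0 <= x -> 0 <= phi x.
Hypothesis phi_dec : forall x y, 0 <= x <= y -> phi y <= phi x.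
Hypothesis Phi0 : Phi 0 = 0.
Hypothesis PhiB : forall x, 0 <= x -> Rabs (Phi x) <= B.
Hypothesis Hm : II (fun x => Rpower x (s - 1) * phi x) m.
Hypothesis cH : cont0 H.

(** The regularized sum cut at N, where [Phi (N x) / x] is the integral of phi(x t) over 0 <= t <=
    N. It decreases in N with a remainder at most phi(N x), and this domination justifies the
    exchange of limit and integral. *)
Let D (N : nat) (x : R) : R := rsum (fun n => phi (INR (S n) * x)) N - Phi (INR N * x) / x.

Hypothesis HlimH : forall x, 0 < x -> is_lim_seq (fun N => D N x) (H x).
Hypothesis Hzr : is_lim_seq (fun N => rsum (fun n => Rpower (INR (S n)) (- s)) N - Rpower (INR N) (1 - s) / (1 - s)) zr.

Lemma Phi_increment x y : 0 <= x <= y -> phi y * (y - x) <= Phi y - Phi x <= phi x * (y - x).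
Proof.
move=> Hxy. destruct (MVT_gen Phi x y phi) as [c [Hc E]].
- move=> u _. apply DPhi.
- move=> u _. apply continuity_pt_filterlim. apply: ex_derive_continuous. eexists. apply DPhi.
- rewrite Rmin_left ?Rmax_right in Hc; try lra. rewrite E. have := phi_dec x c ltac:(lra). have := phi_dec c y ltac:(lra). nra.
Qed.

Lemma muentz_step N x : 0 < x -> phi (INR (S N) * x) - phi (INR N * x) <= D (S N) x - D N x <= 0.
Proof.
move=> Hx. have PN := pos_INR N. unfold D. change (rsum (fun n => phi (INR (S n) * x)) (S N)) with (rsum (fun n => phi (INR (S n) * x)) N + phi (INR (S N) * x)).
have I := Phi_increment (INR N * x) (INR (S N) * x) ltac:(rewrite S_INR; split; nra).
have Ex : INR (S N) * x - INR N * x = x by rewrite S_INR; ring. rewrite Ex in I.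
set a := Phi (INR (S N) * x) in I *. set b := Phi (INR N * x) in I *. set p := phi (INR (S N) * x) in I *. set q := phi (INR N * x) in I *.
have E : a / x - b / x = (a - b) * / x by field; lra. have Px : 0 < / x by apply Rinv_0_lt_compat.
have I1 : p <= (a - b) * / x. { apply Rmult_le_reg_r with x => //. rewrite Rmult_assoc Rinv_l; lra. }
have I2 : (a - b) * / x <= q. { apply Rmult_le_reg_r with x => //. rewrite Rmult_assoc Rinv_l; lra. }
lra.
Qed.

(** The lower bounds for the increments telescope, and positivity of [phi] leaves at most phi(N
    x). *)
Lemma muentz_remainder N x : 0 < x -> 0 <= D N x - H x <= phi (INR N * x).
Proof.
move=> Hx. have T : forall k, - phi (INR N * x) <= D (N + k) x - D N x <= 0.
{ have T0 : forall k, phi (INR (N + k) * x) - phi (INR N * x) <= D (N + k) x - D N x <= 0.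
  { elim=> [|k IH]; [rewrite Nat.add_0_r; lra|]. rewrite Nat.add_succ_r. have := muentz_step (N + k) x Hx. lra. }
  move=> k. have := T0 k. have := phi_pos (INR (N + k) * x) ltac:(apply Rmult_le_pos; [apply pos_INR|lra]). lra. }
split; apply Rnot_lt_le => L.
- move/is_lim_seq_eps: (HlimH x Hx) => /(_ (H x - D N x) ltac:(lra)) [M HM]. have := Rabs_def2 _ _ (HM (N + M)%nat ltac:(lia)). have := T M. lra.
- move/is_lim_seq_eps: (HlimH x Hx) => /(_ (D N x - H x - phi (INR N * x)) ltac:(lra)) [M HM]. have := Rabs_def2 _ _ (HM (N + M)%nat ltac:(lia)). have := T M. lra.
Qed.

Lemma cont0_phi_scale c : cont0 (fun x => phi (c * x)).
Proof. move=> x Hx. apply: (continuous_comp (fun x => c * x) phi) => //. apply: continuous_mult; [apply continuous_const|apply continuous_id]. Qed.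

Lemma cont0_Phi_scale c : cont0 (fun x => Phi (c * x)).
Proof.
move=> x Hx. apply: (continuous_comp (fun x => c * x) Phi); [apply: continuous_mult; [apply continuous_const|apply continuous_id]|].
apply: ex_derive_continuous. eexists. apply DPhi.
Qed.

Lemma mellin_phi_scale c : 0 < c -> II (fun x => Rpower x (s - 1) * phi (c * x)) (Rpower c (- s) * m).
Proof.
move=> Hc. have cf : cont0 (fun x => Rpower x (s - 1) * phi x) by apply cont0_mult; [apply cont0_Rpower|move=> x _; apply cphi].
have S1 := II_scale _ m c cf Hc Hm.
have cg : cont0 (fun x => Rpower (c * x) (s - 1) * phi (c * x)).
{ move=> x Hx. apply: (continuous_comp (fun x => c * x) (fun x => Rpower x (s - 1) * phi x)); [|apply cf; nra]. apply: continuous_mult; [apply continuous_const|apply continuous_id]. }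
have S2 := II_scal (Rpower c (1 - s)) _ _ cg S1.
replace (Rpower c (- s) * m) with (Rpower c (1 - s) * (m / c)).
- apply: II_ext S2 => x Hx. rewrite -Rpower_mult_distr //. rewrite -!Rmult_assoc -Rpower_plus. replace (1 - s + (s - 1)) with 0 by ring. rewrite Rpower_O //. ring.
- replace (1 - s) with (- s + 1) by ring. rewrite Rpower_1_mult //. field. lra.
Qed.

(** Integration by parts. The boundary term x^(s-1) Phi(c x) vanishes at 0 because Phi(c x) = O(x),
    and at infinity because [Phi] is bounded and s < 1. *)
Lemma mellin_Phi_scale c : 0 < c -> II (fun x => Rpower x (s - 1) * (Phi (c * x) / x)) (Rpower c (1 - s) / (1 - s) * m).
Proof.
move=> Hc. set G := fun x => Rpower x (s - 1) * Phi (c * x).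
set G' := fun x => (s - 1) * Rpower x (s - 1 - 1) * Phi (c * x) + Rpower x (s - 1) * (c * phi (c * x)).
have DG : forall x, 0 < x -> is_derive G x (G' x).
{ move=> x Hx. have D1 := is_derive_Rpower (s - 1) x Hx.
  have D2 : is_derive (fun x => Phi (c * x)) x (c * phi (c * x)).
  { have D3 : is_derive (fun x => c * x) x c by auto_derive => //; ring. exact (is_derive_comp Phi (fun x => c * x) x _ _ (DPhi (c * x)) D3). }
  exact (is_derive_mult _ _ x _ _ D1 D2 Rmult_comm). }
have c1 : cont0 (fun x => Rpower x (s - 1) * phi (c * x)) by apply cont0_mult; [apply cont0_Rpower|apply cont0_phi_scale].
have cG : cont0 G'.
{ apply cont0_plus; apply cont0_mult; [apply cont0_scal, cont0_Rpower|apply cont0_Phi_scale|apply cont0_Rpower|apply cont0_scal, cont0_phi_scale]. }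
have Q0 := phi_pos 0 ltac:(lra).
have IG : II G' (0 - 0).
{ apply (II_FTC G) => // eps He.
  - destruct (Rpower_lim0 s (phi 0 * c) ltac:(lra) eps He) as [d [Hd Kd]]. exists d. split => // x Hx. rewrite Rminus_0_r. eapply Rle_lt_trans; [|by apply (Kd x Hx)].
    have I := Phi_increment 0 (c * x) ltac:(split; nra). rewrite Phi0 !Rminus_0_r in I. have P1 := phi_pos (c * x) ltac:(nra). have Px := Rpower_pos x (s - 1).
    unfold G. rewrite !Rabs_mult (Rabs_right (Rpower x (s - 1))) ?(Rabs_right (Rpower x s)); try (apply Rle_ge, Rlt_le, Rpower_pos).
    have Q1 : 0 <= phi (c * x) * (c * x) by apply Rmult_le_pos => //; nra.
    rewrite (Rabs_right (Phi _)) ?(Rabs_right (phi 0)) ?(Rabs_right c); try lra. have Es : Rpower x s = Rpower x (s - 1) * x by rewrite -Rpower_1_mult; [f_equal; ring|lra]. rewrite Es.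
    replace (phi 0 * c * (Rpower x (s - 1) * x)) with (Rpower x (s - 1) * (phi 0 * (c * x))) by ring. apply Rmult_le_compat_l; lra.
  - destruct (Rpower_lim_infty (1 - s) B ltac:(lra) eps He) as [X [HX KX]]. exists X => x Hx. rewrite Rminus_0_r. eapply Rle_lt_trans; [|by apply (KX x Hx)].
    unfold G. have Px := Rpower_pos x (s - 1). rewrite !Rabs_mult (Rabs_right (Rpower x (s - 1))); [|lra]. replace (- (1 - s)) with (s - 1) by ring. rewrite (Rabs_right (Rpower x (s - 1))); [|lra].
    rewrite Rmult_comm. apply Rmult_le_compat_r; [lra|]. eapply Rle_trans; [apply PhiB; nra|]. apply Rle_abs. }
have S1 := II_minus _ _ _ _ (cont0_scal c _ c1) cG (II_scal c _ _ c1 (mellin_phi_scale c Hc)) IG.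
have S2 := II_scal (/ (1 - s)) _ _ (cont0_minus _ _ (cont0_scal c _ c1) cG) S1.
replace (Rpower c (1 - s) / (1 - s) * m) with (/ (1 - s) * (c * (Rpower c (- s) * m) - (0 - 0))).
- apply: II_ext S2 => x Hx. unfold G'. have E : Rpower x (s - 1) = Rpower x (s - 1 - 1) * x by rewrite -Rpower_1_mult //; f_equal; ring. rewrite E. field. lra.
- have Ec : Rpower c (1 - s) = Rpower c (- s) * c by rewrite -Rpower_1_mult //; f_equal; ring. rewrite Ec. field. lra.
Qed.

Lemma cont0_D N : cont0 (D N).
Proof.
apply cont0_minus.
- elim: N => [|N IH]; [move=> x _; apply continuous_const|]. exact (cont0_plus _ _ IH (cont0_phi_scale _)).
- apply cont0_mult; [apply cont0_Phi_scale|apply cont0_derive => x Hx; auto_derive; lra].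
Qed.

Lemma mellin_D N : (1 <= N)%nat -> II (fun x => Rpower x (s - 1) * D N x) ((rsum (fun n => Rpower (INR (S n)) (- s)) N - Rpower (INR N) (1 - s) / (1 - s)) * m).
Proof.
move=> HN. have PN : 0 < INR N by apply lt_0_INR; lia. rewrite Rmult_minus_distr_r.
have cs : forall M, cont0 (fun x => Rpower x (s - 1) * rsum (fun n => phi (INR (S n) * x)) M).
{ move=> M. apply cont0_mult; [apply cont0_Rpower|]. elim: M => [|M IH]; [move=> x _; apply continuous_const|]. exact (cont0_plus _ _ IH (cont0_phi_scale _)). }
have S1 : forall M, II (fun x => Rpower x (s - 1) * rsum (fun n => phi (INR (S n) * x)) M) (rsum (fun n => Rpower (INR (S n)) (- s)) M * m).
{ elim=> [|M IH].
  - rewrite Rmult_0_l. apply: II_ext II_0 => x _. simpl. ring.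
  - have c1 : cont0 (fun x => Rpower x (s - 1) * phi (INR (S M) * x)) by apply cont0_mult; [apply cont0_Rpower|apply cont0_phi_scale].
    have S2 := II_plus _ _ _ _ (cs M) c1 IH (mellin_phi_scale (INR (S M)) (INR_S_pos M)). rewrite -Rmult_plus_distr_r in S2. apply: II_ext S2 => x Hx. by rewrite -Rmult_plus_distr_l. }
have c2 : cont0 (fun x => Rpower x (s - 1) * (Phi (INR N * x) / x)).
{ apply cont0_mult; [apply cont0_Rpower|]. apply cont0_mult; [apply cont0_Phi_scale|apply cont0_derive => x Hx; auto_derive; lra]. }
have S2 := II_minus _ _ _ _ (cs N) c2 (S1 N) (mellin_Phi_scale (INR N) PN). apply: II_ext S2 => x Hx. unfold D. ring.
Qed.

(* H(x) stands for the regularized difference sum phi(n x) - (1/x) int phi, m for the Mellin transform of phi at s and zr for zeta(s). *)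
Lemma muentz : II (fun x => Rpower x (s - 1) * H x) (zr * m).
Proof.
move=> eps He.
have cp := cont0_mult _ _ (cont0_Rpower (s - 1)).
have m0 : 0 <= m.
{ apply (II_le (fun _ => 0) (fun x => Rpower x (s - 1) * phi x)) => //; [move=> x _; apply continuous_const|apply cp; move=> x _; apply cphi| |].
  - move=> x Hx. apply Rmult_le_pos; [apply Rlt_le, Rpower_pos|apply phi_pos; lra].
  - apply II_0. }
set v := eps / (4 * (m + 1)). have V : 0 < v by apply Rdiv_lt_0_compat; lra. have Ev : v * m <= eps / 4.
{ have E : v * (m + 1) = eps / 4 by unfold v; field; lra. lra. }
move/is_lim_seq_eps: Hzr => /(_ v V) [N1 H1]. move/is_lim_seq_eps: (Rpower_seq_lim0 s ltac:(lra)) => /(_ v V) [N2 H2].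
set N := S (max N1 N2). have h1 := H1 N ltac:(unfold N; lia). have h2 := H2 (max N1 N2) ltac:(lia). fold N in h2. rewrite Rminus_0_r Rabs_right in h2; [|apply Rle_ge, Rlt_le, Rpower_pos].
set cN := rsum (fun n => Rpower (INR (S n)) (- s)) N - Rpower (INR N) (1 - s) / (1 - s) in h1.
destruct (mellin_D N ltac:(unfold N; lia) (eps / 4) ltac:(lra)) as [A0 [B0 [P0 K0]]]. fold cN in K0. exists A0, B0. split => // a b Ha Hb.
have k := K0 a b Ha Hb. have PN : 0 < INR N by apply INR_S_pos.
have c1 := cp _ (cont0_D N). have c2 := cp _ cH. have c3 := cp _ (cont0_phi_scale (INR N)).
have ED : RInt (fun x => Rpower x (s - 1) * D N x) a b - RInt (fun x => Rpower x (s - 1) * H x) a b = RInt (fun x => Rpower x (s - 1) * D N x - Rpower x (s - 1) * H x) a b by rewrite RInt_minus_R //; apply ex0 => //; lra.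
have c4 := cont0_minus _ _ c1 c2.
have B1 : 0 <= RInt (fun x => Rpower x (s - 1) * D N x - Rpower x (s - 1) * H x) a b.
{ apply RInt_nonneg => //; [|lra]. move=> x Hx. have := muentz_remainder N x Hx. have := Rpower_pos x (s - 1). nra. }
(* Truncation at N costs at most the Mellin transform of phi(N x), that is N^(- s) m. *)
have B2 : RInt (fun x => Rpower x (s - 1) * D N x - Rpower x (s - 1) * H x) a b <= Rpower (INR N) (- s) * m.
{ apply Rle_trans with (RInt (fun x => Rpower x (s - 1) * phi (INR N * x)) a b).
  - apply RInt_le; [lra|apply ex0 => //; lra|apply ex0 => //; lra|]. move=> x Hx. have := muentz_remainder N x ltac:(lra). have := Rpower_pos x (s - 1). nra.
  - apply II_partial_le => //; [|by apply mellin_phi_scale|lra]. move=> x Hx. apply Rmult_le_pos; [apply Rlt_le, Rpower_pos|]. apply phi_pos. nra. }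
have B3 : Rpower (INR N) (- s) * m <= v * m by apply Rmult_le_compat_r => //; lra.
have B4 : Rabs (cN * m - zr * m) <= v * m by rewrite -Rmult_minus_distr_r Rabs_mult (Rabs_right m); [apply Rmult_le_compat_r; lra|lra].
apply Rabs_def2 in k. have B5 := Rle_abs (cN * m - zr * m). have B6 := Rle_abs (- (cN * m - zr * m)). rewrite Rabs_Ropp in B6. apply Rabs_def1; lra.
Qed.
End Muentz.

(** * The Gamma integral *)

Lemma cont0_exp_neg : cont0 (fun x => exp (- x)).
Proof. apply cont0_derive => x _. by auto_derive. Qed.

Lemma cont0_gamma t : cont0 (fun x => Rpower x t * exp (- x)).
Proof. apply cont0_mult; [apply cont0_Rpower|apply cont0_exp_neg]. Qed.

(** The inequality exp(x / (t + 1)) >= x / (t + 1), raised to the power t + 1. *)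
Lemma gamma_tail t x : 0 < t -> 0 < x -> Rpower x t * exp (- x) <= Rpower (t + 1) (t + 1) * Rpower x (- (1)).
Proof.
move=> Ht Hx. have P : 0 < x / (t + 1) by apply Rdiv_lt_0_compat; lra.
have E : Rpower (x / (t + 1)) (t + 1) <= exp x.
{ have -> : exp x = Rpower (exp (x / (t + 1))) (t + 1) by unfold Rpower; rewrite ln_exp; f_equal; field; lra.
  apply Rpower_mono; [|lra]. split => //. have := exp_ineq1_le (x / (t + 1)). lra. }
rewrite Rpower_div // in E; [|lra]. rewrite exp_Ropp. have Pe := exp_pos x. have P1 := Rpower_pos x t. have P2 := Rpower_pos (t + 1) (t + 1).
have E2 : Rpower (t + 1) (t + 1) * Rpower (t + 1) (- (t + 1)) = 1 by rewrite -Rpower_plus; replace (t + 1 + - (t + 1)) with 0 by ring; apply Rpower_O; lra.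
rewrite Rpower_1_mult // in E. have E3 : Rpower x (- (1)) = / x by rewrite Rpower_Ropp Rpower_1. rewrite E3.
apply Rmult_le_reg_r with (exp x) => //. rewrite Rmult_assoc Rinv_l; [|lra]. rewrite Rmult_1_r.
apply Rmult_le_reg_r with x => //. replace (Rpower (t + 1) (t + 1) * / x * exp x * x) with (Rpower (t + 1) (t + 1) * exp x) by (field; lra).
apply Rle_trans with (Rpower (t + 1) (t + 1) * (Rpower x t * x * Rpower (t + 1) (- (t + 1)))); [|apply Rmult_le_compat_l; lra].
right. transitivity (Rpower x t * x * (Rpower (t + 1) (t + 1) * Rpower (t + 1) (- (t + 1)))); [rewrite E2|]; ring.
Qed.

Lemma gamma_step t g : 0 < t -> II (fun x => Rpower x (t - 1) * exp (- x)) g -> II (fun x => Rpower x t * exp (- x)) (t * g).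
Proof.
move=> Ht Hg. set G := fun x => Rpower x t * exp (- x). set G' := fun x => t * Rpower x (t - 1) * exp (- x) + Rpower x t * - exp (- x).
have DG : forall x, 0 < x -> is_derive G x (G' x).
{ move=> x Hx. have D2 : is_derive (fun x => exp (- x)) x (- exp (- x)) by auto_derive => //; ring. exact (is_derive_mult _ _ x _ _ (is_derive_Rpower t x Hx) D2 Rmult_comm). }
have cG : cont0 G'.
{ apply cont0_plus; apply cont0_mult; [apply cont0_scal, cont0_Rpower|apply cont0_exp_neg|apply cont0_Rpower|]. apply cont0_derive => x _. by auto_derive. }
have IG : II G' (0 - 0).
{ apply (II_FTC G) => // eps He.
  - destruct (Rpower_lim0 t 1 Ht eps He) as [d [Hd Kd]]. exists d. split => // x Hx. have k := Kd x Hx. have P1 := Rpower_pos x t. rewrite Rmult_1_l Rabs_right in k; [|lra].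
    have P2 := exp_pos (- x). have P3 : exp (- x) <= 1 by rewrite -exp_0; apply exp_le; lra. unfold G. rewrite Rminus_0_r Rabs_right; nra.
  - destruct (Rpower_lim_infty 1 (Rpower (t + 1) (t + 1)) Rlt_0_1 eps He) as [B [HB KB]]. exists B => x Hx. have k := KB x Hx. have T := gamma_tail t x Ht ltac:(lra).
    have P1 := Rpower_pos x t. have P2 := exp_pos (- x). rewrite Rminus_0_r. unfold G. rewrite Rabs_right; [|nra]. eapply Rle_lt_trans; [apply T|]. eapply Rle_lt_trans; [apply Rle_abs|apply k]. }
have S1 := II_minus _ _ _ _ (cont0_scal t _ (cont0_gamma (t - 1))) cG (II_scal t _ _ (cont0_gamma (t - 1)) Hg) IG.
replace (t * g) with (t * g - (0 - 0)) by ring. apply: II_ext S1 => x _. unfold G', G. ring.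
Qed.

Lemma gamma_1 : II (fun x => Rpower x (1 - 1) * exp (- x)) 1.
Proof.
have S : II (fun x => exp (- x)) (0 - - 1).
{ apply (II_FTC (fun x => - exp (- x))).
  - move=> x _. auto_derive => //. ring.
  - apply cont0_exp_neg.
  - move=> eps He. exists (Rmin (eps / 2) 1). have m1 := Rmin_l (eps / 2) 1. split; [apply Rmin_glb_lt; lra|] => x Hx. have := exp_ineq1_le (- x).
    have P3 : exp (- x) <= 1 by rewrite -exp_0; apply exp_le; lra. move=> h. rewrite Rabs_right; lra.
  - move=> eps He. exists (/ eps) => x Hx. have Pe : 0 < / eps by apply Rinv_0_lt_compat. rewrite Rminus_0_r Rabs_Ropp Rabs_right; [|apply Rle_ge, Rlt_le, exp_pos].
    rewrite exp_Ropp -(Rinv_inv eps). have := exp_ineq1_le x => h. apply Rinv_lt_contravar; [apply Rmult_lt_0_compat; [lra|apply exp_pos]|lra]. }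
replace (0 - - 1) with 1 in S by ring. apply: II_ext S => x Hx. rewrite Rminus_diag Rpower_O //. ring.
Qed.

Lemma gamma_fact N : II (fun x => Rpower x (INR N) * exp (- x)) (INR (fact N)).
Proof.
elim: N => [|N IH]; [apply: II_ext gamma_1 => x _; by rewrite Rminus_diag|].
rewrite fact_simpl mult_INR. apply gamma_step; [apply INR_S_pos|]. apply: II_ext IH => x _. do 2 f_equal. rewrite S_INR. ring.
Qed.

(** The rising product (s + 1) ... (s + N) divided by N!. *)
Fixpoint gauss (s : R) (N : nat) : R := match N with O => 1 | S n => gauss s n * (1 + s / INR (S n)) end.

Lemma gamma_rising s g N : 0 < s -> II (fun x => Rpower x (s - 1) * exp (- x)) g ->
  II (fun x => Rpower x (s + INR N) * exp (- x)) (s * g * (INR (fact N) * gauss s N)).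
Proof.
move=> Hs Hg. elim: N => [|N IH].
- have S1 := gamma_step s g Hs Hg. simpl. rewrite !Rmult_1_r. apply: II_ext S1 => x _. by rewrite Rplus_0_r.
- have PN := INR_S_pos N. replace (s * g * (INR (fact (S N)) * gauss s (S N))) with ((s + INR (S N)) * (s * g * (INR (fact N) * gauss s N))).
  + apply gamma_step; [lra|]. apply: II_ext IH => x _. do 2 f_equal. rewrite S_INR. ring.
  + rewrite fact_simpl mult_INR. change (gauss s (S N)) with (gauss s N * (1 + s / INR (S N))). field. lra.
Qed.

(* Tangent line bounds for x^s at x = N + 1. *)
Lemma gamma_sandwich s g N : 0 < s < 1 -> II (fun x => Rpower x (s - 1) * exp (- x)) g ->
  1 - (1 - s) / INR (S N) <= s * g * (gauss s N * Rpower (INR (S N)) (- s)) <= 1.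
Proof.
move=> Hs Hg. set n := INR (S N). have Pn : 0 < n by apply INR_S_pos. have R := gamma_rising s g N ltac:(lra) Hg.
have PF : 0 < INR (fact N) by apply INR_fact_lt_0.
have F0 := gamma_fact N. have F1 := gamma_fact (S N). have F2 := gamma_fact (S (S N)).
have EF1 : INR (fact (S N)) = n * INR (fact N) by rewrite fact_simpl mult_INR.
have EF2 : INR (fact (S (S N))) = (n + 1) * (n * INR (fact N)) by rewrite fact_simpl mult_INR EF1 (S_INR (S N)).
have PR := Rpower_pos n s. have ER : Rpower n s * Rpower n (- s) = 1 by rewrite -Rpower_plus Rplus_opp_r Rpower_O.
have Es : forall x, 0 < x -> Rpower x s = Rpower n s * Rpower (x / n) s.
{ move=> x Hx. rewrite Rpower_mult_distr //; [f_equal; field; lra|by apply Rdiv_lt_0_compat]. }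
have PRn := Rpower_pos n (- s).
split.
- set L := INR (fact N) * Rpower n s.
  have S1 := II_minus _ _ _ _ (cont0_scal (2 - s) _ (cont0_gamma (INR (S N)))) (cont0_scal ((1 - s) / n) _ (cont0_gamma (INR (S (S N)))))
    (II_scal (2 - s) _ _ (cont0_gamma _) F1) (II_scal ((1 - s) / n) _ _ (cont0_gamma _) F2).
  have cS := cont0_minus _ _ (cont0_scal (2 - s) _ (cont0_gamma (INR (S N)))) (cont0_scal ((1 - s) / n) _ (cont0_gamma (INR (S (S N))))).
  have S2 := II_scal (Rpower n (s - 1)) _ _ cS S1.
  have H := II_le _ _ _ _ (cont0_scal _ _ cS) (cont0_gamma (s + INR N)) _ S2 R.
  have E1 : Rpower n s = Rpower n (s - 1) * n by rewrite -Rpower_1_mult //; f_equal; ring.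
  have H2 : Rpower n (s - 1) * ((2 - s) * INR (fact (S N)) - (1 - s) / n * INR (fact (S (S N)))) <= s * g * (INR (fact N) * gauss s N).
  { apply H => x Hx. have Px := exp_pos (- x). replace (s + INR N) with ((s - 1) + INR (S N)) by (rewrite S_INR; ring). rewrite Rpower_plus.
    have Ex : Rpower x (INR (S (S N))) = Rpower x (INR (S N)) * x by rewrite (S_INR (S N)) Rpower_1_mult. rewrite Ex.
    have PX := Rpower_pos x (INR (S N)). have Py : 0 < x / n by apply Rdiv_lt_0_compat.
    (* For the lower bound one power of x is split off: the remaining u^(s-1) is convex and lies
       above its tangent at 1. *)
    have T : 1 + (s - 1) * (x / n - 1) <= Rpower (x / n) (s - 1).
    { unfold Rpower. eapply Rle_trans; [|apply exp_ineq1_le]. have := exp_ineq1_le (ln (x / n)). rewrite exp_ln // => h. nra. }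
    have E2 : Rpower x (s - 1) = Rpower n (s - 1) * Rpower (x / n) (s - 1) by rewrite Rpower_mult_distr //; f_equal; field; lra.
    rewrite E2. have PN1 := Rpower_pos n (s - 1).
    replace (Rpower n (s - 1) * ((2 - s) * (Rpower x (INR (S N)) * exp (- x)) - (1 - s) / n * (Rpower x (INR (S N)) * x * exp (- x)))) with
      (Rpower n (s - 1) * Rpower x (INR (S N)) * exp (- x) * (1 + (s - 1) * (x / n - 1))) by (field; lra).
    replace (Rpower n (s - 1) * Rpower (x / n) (s - 1) * Rpower x (INR (S N)) * exp (- x)) with (Rpower n (s - 1) * Rpower x (INR (S N)) * exp (- x) * Rpower (x / n) (s - 1)) by ring.
    apply Rmult_le_compat_l => //. apply Rmult_le_pos; [apply Rmult_le_pos|]; lra. }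
  rewrite EF1 EF2 in H2.
  have H3 : INR (fact N) * (Rpower n s * (1 - (1 - s) / n)) <= INR (fact N) * (s * g * gauss s N).
  { rewrite E1. eapply Rle_trans; [|eapply Rle_trans; [apply H2|right; ring]]. right. field. lra. }
  apply Rmult_le_reg_l in H3 => //. apply (Rmult_le_compat_r (Rpower n (- s))) in H3; [|lra].
  replace (1 - (1 - s) / n) with (Rpower n s * Rpower n (- s) * (1 - (1 - s) / n)) by (rewrite ER; ring). lra.
- have S1 := II_plus _ _ _ _ (cont0_scal (1 - s) _ (cont0_gamma (INR N))) (cont0_scal (s / n) _ (cont0_gamma (INR (S N))))
    (II_scal (1 - s) _ _ (cont0_gamma _) F0) (II_scal (s / n) _ _ (cont0_gamma _) F1).
  have cS := cont0_plus _ _ (cont0_scal (1 - s) _ (cont0_gamma (INR N))) (cont0_scal (s / n) _ (cont0_gamma (INR (S N)))).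
  have S2 := II_scal (Rpower n s) _ _ cS S1.
  have H := II_le _ _ _ _ (cont0_gamma (s + INR N)) (cont0_scal _ _ cS) _ R S2.
  have H2 : s * g * (INR (fact N) * gauss s N) <= Rpower n s * ((1 - s) * INR (fact N) + s / n * INR (fact (S N))).
  { apply H => x Hx. have Px := exp_pos (- x). rewrite Rpower_plus (Es x Hx).
    have Ex : Rpower x (INR (S N)) = Rpower x (INR N) * x by rewrite (S_INR N) Rpower_1_mult. rewrite Ex.
    have PX := Rpower_pos x (INR N). have Py : 0 < x / n by apply Rdiv_lt_0_compat.
    have T : Rpower (x / n) s <= 1 + s * (x / n - 1).
    { set l := ln (x / n). have El : x / n = exp l by unfold l; rewrite exp_ln. rewrite El. unfold Rpower. rewrite ln_exp. have P1 := exp_pos (s * l).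
      have A1 := exp_ineq1_le (l - s * l). have A2 := exp_ineq1_le (- (s * l)).
      have E1 : exp l = exp (s * l) * exp (l - s * l) by rewrite -exp_plus; f_equal; ring. have E2 : exp (s * l) * exp (- (s * l)) = 1 by rewrite -exp_plus Rplus_opp_r exp_0.
      have A3 : 1 <= (1 - s) * exp (- (s * l)) + s * exp (l - s * l) by nra.
      apply (Rmult_le_compat_l (exp (s * l))) in A3; [|lra]. nra. }
    replace (Rpower n s * ((1 - s) * (Rpower x (INR N) * exp (- x)) + s / n * (Rpower x (INR N) * x * exp (- x)))) with
      (Rpower n s * Rpower x (INR N) * exp (- x) * (1 + s * (x / n - 1))) by (field; lra).
    replace (Rpower n s * Rpower (x / n) s * Rpower x (INR N) * exp (- x)) with (Rpower n s * Rpower x (INR N) * exp (- x) * Rpower (x / n) s) by ring.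
    apply Rmult_le_compat_l => //. apply Rmult_le_pos; [apply Rmult_le_pos|]; lra. }
  rewrite EF1 in H2.
  have H3 : INR (fact N) * (s * g * gauss s N) <= INR (fact N) * Rpower n s.
  { eapply Rle_trans; [|eapply Rle_trans; [apply H2|]]; right; [ring|field; lra]. }
  apply Rmult_le_reg_l in H3 => //. apply (Rmult_le_compat_r (Rpower n (- s))) in H3; lra.
Qed.

Lemma cprod_gauss s N : cprod (fun k => qfac k (RtoC s)) N = RtoC (gauss s N * Rpower (INR (S N)) (- s)).
Proof.
elim: N => [|N IH].
- simpl. by rewrite Rpower_base_1 Rmult_1_r.
- change (cprod (fun k => qfac k (RtoC s)) (S N)) with (cprod (fun k => qfac k (RtoC s)) N * qfac N (RtoC s))%C. rewrite IH. unfold qfac.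
  rewrite -RtoC_opp Rcpower_RtoC -!RtoC_mult -RtoC_plus -!RtoC_mult. f_equal. have P := INR_S_pos N. have P2 := INR_S_pos (S N).
  change (gauss s (S N)) with (gauss s N * (1 + s / INR (S N))). rewrite Rpower_div //. rewrite Ropp_involutive.
  have E : Rpower (INR (S N)) (- s) * Rpower (INR (S N)) s = 1 by rewrite -Rpower_plus Rplus_opp_l Rpower_O.
  transitivity (gauss s N * (1 + s / INR (S N)) * Rpower (INR (S (S N))) (- s) * (Rpower (INR (S N)) (- s) * Rpower (INR (S N)) s)); [unfold Rdiv; ring|rewrite E; ring].
Qed.

(** The two sides of [gamma_sandwich] tend to 1, so s times the integral is the reciprocal of the
    Gauss product. *)
Lemma gamma_qG s g : 0 < s < 1 -> II (fun x => Rpower x (s - 1) * exp (- x)) g -> (RtoC (s * g) * qG (RtoC s))%C = 1%C.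
Proof.
move=> Hs Hg. have [L _] := qG_spec (RtoC s).
apply (clim_unique (fun N => RtoC (s * g) * cprod (fun k => qfac k (RtoC s)) N)%C); [by apply clim_scal|].
eapply (clim_ext (fun N => RtoC (s * g * (gauss s N * Rpower (INR (S N)) (- s))))); [move=> N; by rewrite cprod_gauss -RtoC_mult|].
apply clim_RtoC. apply is_lim_seq_eps => eps He. move/is_lim_seq_eps: (is_lim_seq_inv_n (1 - s)) => /(_ eps He) [N HN]. exists N => n Hn.
have k := HN n Hn. rewrite Rminus_0_r in k. have S := gamma_sandwich s g n Hs Hg. unfold Rdiv in S. apply Rabs_def2 in k. apply Rabs_def1; lra.
Qed.

(** * The Mellin transform of 1 / (1 + x^2) *)

Definition cauchy_kernel (x : R) : R := / (1 + x ^ 2).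

Lemma cauchy_kernel_pos x : 0 < cauchy_kernel x.
Proof. apply Rinv_0_lt_compat. nra. Qed.

Lemma continuous_cauchy_kernel x : continuous cauchy_kernel x.
Proof. apply: ex_derive_continuous. unfold cauchy_kernel. auto_derive. nra. Qed.

Lemma cont0_cauchy e : cont0 (fun x => Rpower x e * cauchy_kernel x).
Proof. apply cont0_mult; [apply cont0_Rpower|move=> x _; apply continuous_cauchy_kernel]. Qed.

Definition altsum (e : R) (N : nat) : R := rsum (fun k => (-1) ^ k / (2 * INR k + e)) N.

Lemma cauchy_half_geom e N x : 0 < x ->
  Rpower x (e - 1) * cauchy_kernel x - rsum (fun k => (-1) ^ k * Rpower x (2 * INR k + e - 1)) N = (-1) ^ N * (Rpower x (2 * INR N + e - 1) * cauchy_kernel x).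
Proof.
move=> Hx. elim: N => [|N IH]; [simpl; rewrite Rmult_0_r Rplus_0_l; ring|].
change (rsum (fun k => (-1) ^ k * Rpower x (2 * INR k + e - 1)) (S N)) with (rsum (fun k => (-1) ^ k * Rpower x (2 * INR k + e - 1)) N + (-1) ^ N * Rpower x (2 * INR N + e - 1)).
have E : Rpower x (2 * INR (S N) + e - 1) = Rpower x (2 * INR N + e - 1) * (x * x).
{ rewrite S_INR. replace (2 * (INR N + 1) + e - 1) with (2 * INR N + e - 1 + 1 + 1) by ring. rewrite !Rpower_1_mult //. ring. }
rewrite E -tech_pow_Rmult. have K : cauchy_kernel x * (1 + x ^ 2) = 1 by unfold cauchy_kernel; apply Rinv_l; nra.
match goal with |- ?a - (?b + ?c) = _ => replace (a - (b + c)) with ((a - b) - c) by ring end. rewrite IH.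
transitivity ((-1) ^ N * Rpower x (2 * INR N + e - 1) * (cauchy_kernel x - cauchy_kernel x * (1 + x ^ 2))); [rewrite K|]; ring.
Qed.

(** The finite geometric series is integrated over [a, 1]. The first error comes from the remainder
    of the series, the second is its primitive at [a]. *)
Lemma cauchy_half e N a : 0 < e -> 0 < a <= 1 ->
  Rabs (RInt (fun x => Rpower x (e - 1) * cauchy_kernel x) a 1 - altsum e N) <= / (2 * INR N + e) + INR N / e * Rpower a e.
Proof.
move=> He Ha. have PN := pos_INR N.
set P := fun x => rsum (fun k => (-1) ^ k / (2 * INR k + e) * Rpower x (2 * INR k + e)) N.
set p := fun x => rsum (fun k => (-1) ^ k * Rpower x (2 * INR k + e - 1)) N.
have ne : forall k, 2 * INR k + e <> 0 by move=> k; have := pos_INR k; lra.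
have DP : forall x, 0 < x -> is_derive P x (p x).
{ move=> x Hx. unfold P, p. clear - Hx ne. elim: N => [|N IH]; [apply: is_derive_const|].
  apply: (is_derive_plus _ _ x _ _ IH). have D := is_derive_scal _ x ((-1) ^ N / (2 * INR N + e)) _ (is_derive_Rpower (2 * INR N + e) x Hx).
  eapply eq_ind; [apply D|]. change ((-1) ^ N / (2 * INR N + e) * ((2 * INR N + e) * Rpower x (2 * INR N + e - 1)) = (-1) ^ N * Rpower x (2 * INR N + e - 1)). field. apply ne. }
have cp : cont0 p.
{ unfold p. clear. elim: N => [|N IH]; [move=> x _; apply continuous_const|]. exact (cont0_plus _ _ IH (cont0_scal _ _ (cont0_Rpower _))). }
have I := RInt_derive0 P p a 1 DP cp ltac:(lra) Rlt_0_1.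
have P1 : P 1 = altsum e N by unfold P, altsum; apply rsum_ext => k _; rewrite Rpower_base_1; ring.
have cf := cont0_cauchy (e - 1).
have sgn : forall k, Rabs ((-1) ^ k) = 1 by move=> k; rewrite -RPow_abs Rabs_Ropp Rabs_R1 pow1.
have Pa : Rabs (P a) <= INR N / e * Rpower a e.
{ unfold P. eapply Rle_trans; [apply Rabs_rsum_le|]. replace (INR N / e * Rpower a e) with (INR N * (/ e * Rpower a e)) by (field; lra). rewrite -rsum_const. apply rsum_le => k _.
  have Pk := pos_INR k. unfold Rdiv. rewrite !Rabs_mult sgn Rmult_1_l Rabs_inv (Rabs_right (2 * _ + _)); [|lra]. rewrite Rabs_right; [|apply Rle_ge, Rlt_le, Rpower_pos].
  apply Rmult_le_compat; [apply Rlt_le, Rinv_0_lt_compat; lra|apply Rlt_le, Rpower_pos|apply Rinv_le_contravar; lra|].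
  rewrite Rpower_plus -{2}(Rmult_1_l (Rpower a e)). apply Rmult_le_compat_r; [apply Rlt_le, Rpower_pos|]. eapply Rle_trans; [|right; apply (Rpower_base_1 (2 * INR k))]. apply Rpower_mono; lra. }
set q := fun x => Rpower x (2 * INR N + e - 1).
have Q : RInt q a 1 = / (2 * INR N + e) * (1 - Rpower a (2 * INR N + e)).
{ have D : forall x, 0 < x -> is_derive (fun x => / (2 * INR N + e) * Rpower x (2 * INR N + e)) x (q x).
  { move=> x Hx. have D := is_derive_scal _ x (/ (2 * INR N + e)) _ (is_derive_Rpower (2 * INR N + e) x Hx). eapply eq_ind; [apply D|].
    change (/ (2 * INR N + e) * ((2 * INR N + e) * Rpower x (2 * INR N + e - 1)) = q x). unfold q. field. apply ne. }
  have E := RInt_derive0 _ q a 1 D (cont0_Rpower _) ltac:(lra) Rlt_0_1. rewrite Rpower_base_1 in E. rewrite E. lra. }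
have B : Rabs (RInt (fun x => Rpower x (e - 1) * cauchy_kernel x - p x) a 1) <= RInt q a 1.
{ apply: (norm_RInt_le (fun x => Rpower x (e - 1) * cauchy_kernel x - p x) q a 1); [lra| | |].
  - move=> x Hx. change (Rabs (Rpower x (e - 1) * cauchy_kernel x - p x) <= q x). unfold p. rewrite cauchy_half_geom; [|lra]. rewrite Rabs_mult sgn Rmult_1_l.
    have K0 := cauchy_kernel_pos x. have K1 : cauchy_kernel x <= 1 by unfold cauchy_kernel; rewrite -{2}Rinv_1; apply Rinv_le_contravar; nra. have PR := Rpower_pos x (2 * INR N + e - 1).
    rewrite Rabs_right; [unfold q|]; nra.
  - apply: RInt_correct. apply ex0; [by apply cont0_minus|lra|lra].
  - apply: RInt_correct. apply ex0; [apply cont0_Rpower|lra|lra]. }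
rewrite Q RInt_minus_R in B; try (apply ex0 => //; lra). rewrite I P1 in B.
set J := RInt _ a 1 in B *. replace (J - altsum e N) with ((J - (altsum e N - P a)) - P a) by ring.
eapply Rle_trans; [apply Rabs_triang|]. rewrite Rabs_Ropp. have PR := Rpower_pos a (2 * INR N + e).
have Pi : 0 < / (2 * INR N + e) by apply Rinv_0_lt_compat; lra. nra.
Qed.

(** The part beyond 1 is folded back by x -> 1 / x. The alternating series with offsets 1 - s and 1
    + s then combine to half the cosecant series at (1 - s) / 2. *)
Lemma cauchy_mellin s K : 0 < s < 1 -> II (fun x => Rpower x (- s) * cauchy_kernel x) K -> K = PI / (2 * sin (PI * ((1 - s) / 2))).
Proof.
move=> Hs HK.
have B : forall N, Rabs (K - (altsum (1 - s) N + altsum (1 + s) N)) <= / (2 * INR N + (1 - s)) + / (2 * INR N + (1 + s)).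
{ move=> N. apply le_epsilon => eps He. destruct (HK (eps / 3) ltac:(lra)) as [A [C [P0 K0]]]. have PN := pos_INR N.
  destruct (Rpower_lim0 (1 - s) (INR N / (1 - s)) ltac:(lra) (eps / 3) ltac:(lra)) as [d1 [Hd1 Kd1]].
  destruct (Rpower_lim0 (1 + s) (INR N / (1 + s)) ltac:(lra) (eps / 3) ltac:(lra)) as [d2 [Hd2 Kd2]].
  set a := Rmin 1 (Rmin A d1). set u := Rmin 1 (Rmin (/ C) d2). have PC : 0 < / C by apply Rinv_0_lt_compat; lra.
  have a0 : 0 < a by repeat apply Rmin_glb_lt; lra. have u0 : 0 < u by repeat apply Rmin_glb_lt; lra.
  have a1 := Rmin_l 1 (Rmin A d1). have a2 := Rmin_r 1 (Rmin A d1). have a3 := Rmin_l A d1. have a4 := Rmin_r A d1. fold a in a1, a2.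
  have u1 := Rmin_l 1 (Rmin (/ C) d2). have u2 := Rmin_r 1 (Rmin (/ C) d2). have u3 := Rmin_l (/ C) d2. have u4 := Rmin_r (/ C) d2. fold u in u1, u2.
  have Hb : C <= / u by rewrite -(Rinv_inv C); apply Rinv_le_contravar; lra. have Pu : 1 <= / u by rewrite -Rinv_1; apply Rinv_le_contravar; lra.
  have k := K0 a (/ u) ltac:(lra) Hb. have cf := cont0_cauchy (- s).
  have Ch := RInt_Chasles _ a 1 (/ u) (ex0 _ a 1 cf a0 Rlt_0_1) (ex0 _ 1 (/ u) cf Rlt_0_1 ltac:(lra)). rewrite -Ch in k.
  have H1 := cauchy_half (1 - s) N a ltac:(lra) ltac:(lra). replace (1 - s - 1) with (- s) in H1 by ring.
  have H2 := cauchy_half (1 + s) N u ltac:(lra) ltac:(lra). replace (1 + s - 1) with s in H2 by ring.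
  have E : RInt (fun x => Rpower x (- s) * cauchy_kernel x) 1 (/ u) = RInt (fun x => Rpower x s * cauchy_kernel x) u 1.
  { have Sb := RInt_inv_subst (fun x => Rpower x s * cauchy_kernel x) 1 1 (/ u) (cont0_cauchy s) Rlt_0_1 ltac:(lra).
    replace (1 / / u) with u in Sb by (field; lra). rewrite Rdiv_1_r in Sb. rewrite -Sb. apply RInt_ext => y Hy. rewrite Rmin_left in Hy; [|lra].
    unfold Rdiv at 1. rewrite Rmult_1_l Rpower_inv_base; [|lra]. unfold cauchy_kernel. match goal with |- ?a = ?b => change (@eq R a b) end. field. split; nra. }
  rewrite E in k. have k1 := Kd1 a ltac:(lra). have k2 := Kd2 u ltac:(lra).
  change (Rabs (RInt (fun x => Rpower x (- s) * cauchy_kernel x) a 1 + RInt (fun x => Rpower x s * cauchy_kernel x) u 1 - K) < eps / 3) in k.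
  have e1 := Rle_abs (INR N / (1 - s) * Rpower a (1 - s)). have e2 := Rle_abs (INR N / (1 + s) * Rpower u (1 + s)).
  set I1 := RInt _ a 1 in k H1. set I2 := RInt _ u 1 in k H2. rewrite Rabs_minus_sym in k.
  replace (K - (altsum (1 - s) N + altsum (1 + s) N)) with ((K - (I1 + I2)) + ((I1 - altsum (1 - s) N) + (I2 - altsum (1 + s) N))) by ring.
  eapply Rle_trans; [apply Rabs_triang|]. have := Rabs_triang (I1 - altsum (1 - s) N) (I2 - altsum (1 + s) N). lra. }
set x := (1 - s) / 2. have Hx : 0 < x < 1 by unfold x; lra.
have Ealt : forall N, altsum (1 - s) N + altsum (1 + s) N = / 2 * rsum (csc_term x) N.
{ move=> N. unfold altsum. rewrite -rsum_plus -rsum_scal. apply rsum_ext => k _. unfold csc_term, x. have := pos_INR k => Pk. field. lra. }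
have S := sin_PI_pos x Hx. have L := csc_series x Hx.
apply: Rminus_diag_uniq. apply cond_eq => eps He. rewrite Rminus_0_r.
move/is_lim_seq_eps: L => /(_ eps He) [N1 HN1]. destruct (INR_unbounded (4 / eps)) as [N2 HN2].
set j := max N1 N2. have h := HN1 j ltac:(unfold j; lia). set N := (2 ^ Datatypes.S j)%nat in h.
have hN : INR N2 <= INR N. { apply le_INR. unfold N. have h0 := Nat.pow_gt_lin_r 2 (Datatypes.S j) ltac:(lia). unfold j in h0 |- *. lia. }
have b := B N. rewrite Ealt in b.
have P4 : 0 < 4 / eps by apply Rdiv_lt_0_compat; lra. have E4 : / (4 / eps) = eps / 4 by field; lra.
have i1 : / (2 * INR N + (1 - s)) <= eps / 4 by rewrite -E4; apply Rinv_le_contravar; lra.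
have i2 : / (2 * INR N + (1 + s)) <= eps / 4 by rewrite -E4; apply Rinv_le_contravar; lra.
replace (K - PI / (2 * sin (PI * x))) with ((K - / 2 * rsum (csc_term x) N) + / 2 * (rsum (csc_term x) N - PI / sin (PI * x))) by (field; lra).
eapply Rle_lt_trans; [apply Rabs_triang|]. rewrite Rabs_mult (Rabs_right (/ 2)); lra.
Qed.

(** * The functional equation *)

(** [Hexp] and [Hcauchy] are the sums over n >= 1 of exp(- n x) and of 1 / (1 + n^2 y^2), each minus
    its integral over n; the relation between them is the partial fraction expansion of coth. *)
Definition Hexp (x : R) : R := / (exp x - 1) - / x.
Definition Hcauchy (y : R) : R := PI / y * Hexp (2 * PI / y).

Lemma exp_gt_1 x : 0 < x -> 1 < exp x.
Proof. move=> Hx. rewrite -exp_0. by apply exp_increasing. Qed.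

Lemma cont0_Hexp : cont0 Hexp.
Proof. apply cont0_derive => x Hx. have P1 := exp_gt_1 x Hx. unfold Hexp. auto_derive. split; [lra|split => //; lra]. Qed.

Lemma cont0_Hcauchy : cont0 Hcauchy.
Proof.
have P := PI_RGT_0. apply cont0_mult; [apply cont0_derive => x Hx; auto_derive; lra|].
move=> y Hy. apply: (continuous_comp (fun y => 2 * PI / y) Hexp); [apply: ex_derive_continuous; auto_derive; lra|]. apply cont0_Hexp. apply Rdiv_lt_0_compat; lra.
Qed.

Lemma Hexp_lim x : 0 < x -> is_lim_seq (fun N => rsum (fun n => exp (- (INR (S n) * x))) N - (1 - exp (- (INR N * x))) / x) (Hexp x).
Proof.
move=> Hx. have P1 := exp_gt_1 x Hx. set q := exp (- x). have Pq : 0 < q by apply exp_pos. have Eq : exp x = / q by unfold q; rewrite exp_Ropp Rinv_inv.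
have Hq : q < 1 by unfold q; rewrite -exp_0; apply exp_increasing; lra.
have Epow : forall N, exp (- (INR N * x)) = q ^ N.
{ elim=> [|N IH]; [rewrite Rmult_0_l Ropp_0 exp_0 //|]. rewrite -tech_pow_Rmult -IH S_INR. unfold q. rewrite -exp_plus. f_equal. ring. }
have L : is_lim_seq (fun N => Hexp x * (1 - q ^ N)) (Hexp x * (1 - 0)).
{ apply (is_lim_seq_scal_l _ (Hexp x) (Finite (1 - 0))). apply is_lim_seq_minus'; [apply is_lim_seq_const|apply pow_lim0; lra]. }
replace (Hexp x * (1 - 0)) with (Hexp x) in L by ring. apply: is_lim_seq_ext L => N. rewrite Epow.
rewrite (rsum_ext (fun n => exp (- (INR (S n) * x))) (fun n => q * q ^ n)); [|move=> n _; by rewrite Epow].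
rewrite rsum_scal rsum_geom; [|lra]. unfold Hexp. rewrite Eq. field. repeat split; lra.
Qed.

(** Rescaled by y, the coth series counts every kernel value twice except the one at n = 0 and the
    last one, and [atan (N y) / y] tends to PI / (2 y). *)
Lemma Hcauchy_lim y : 0 < y -> is_lim_seq (fun N => rsum (fun n => cauchy_kernel (INR (S n) * y)) N - atan (INR N * y) / y) (Hcauchy y).
Proof.
move=> Hy. have P := PI_RGT_0. have Pi : 0 < / y by apply Rinv_0_lt_compat.
have L := coth_series (/ y) Pi. set c := _ / _ in L.
have E : forall N, rsum (fun n => (/ y) ^ 2 / ((/ y) ^ 2 + INR n ^ 2) + (/ y) ^ 2 / ((/ y) ^ 2 + INR (S n) ^ 2)) N =
  2 * rsum (fun n => cauchy_kernel (INR (S n) * y)) N + 1 - cauchy_kernel (INR N * y).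
{ have T : forall u, (/ y) ^ 2 / ((/ y) ^ 2 + u ^ 2) = cauchy_kernel (u * y) by move=> u; unfold cauchy_kernel; field; repeat split; nra.
  elim=> [|N IH]; [simpl; rewrite Rmult_0_l /cauchy_kernel; field|].
  change (rsum (fun n => (/ y) ^ 2 / ((/ y) ^ 2 + INR n ^ 2) + (/ y) ^ 2 / ((/ y) ^ 2 + INR (S n) ^ 2)) N + ((/ y) ^ 2 / ((/ y) ^ 2 + INR N ^ 2) + (/ y) ^ 2 / ((/ y) ^ 2 + INR (S N) ^ 2)) =
    2 * (rsum (fun n => cauchy_kernel (INR (S n) * y)) N + cauchy_kernel (INR (S N) * y)) + 1 - cauchy_kernel (INR (S N) * y)).
  rewrite IH !T. ring. }
have L0 : is_lim_seq (fun N => / (INR (S N) * y)) 0.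
{ apply: is_lim_seq_ext (is_lim_seq_inv_n (/ y)) => N. rewrite Rinv_mult. ring. }
have LA : is_lim_seq (fun N => atan (INR (S N) * y)) (PI / 2 - 0).
{ have LA0 : is_lim_seq (fun N => atan (/ (INR (S N) * y))) (atan 0) by apply is_lim_seq_continuous => //; apply derivable_continuous_pt, derivable_pt_atan.
  rewrite atan_0 in LA0. apply: (is_lim_seq_ext _ _ _ _ (is_lim_seq_minus' _ _ _ _ (is_lim_seq_const (PI / 2)) LA0)) => N.
  rewrite atan_inv; [ring|]. apply Rmult_lt_0_compat => //. apply INR_S_pos. }
have LK : is_lim_seq (fun N => cauchy_kernel (INR (S N) * y)) 0.
{ apply (is_lim_seq_le_le (fun _ => 0) _ (fun N => / (INR (S N) * y))) => //; [|apply is_lim_seq_const].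
  move=> N. have Q := INR_S_pos N. have Q2 : 0 < INR (S N) * y by apply Rmult_lt_0_compat. split; [apply Rlt_le, cauchy_kernel_pos|]. apply Rinv_le_contravar => //. nra. }
apply is_lim_seq_incr_1. have L1 := proj1 (is_lim_seq_incr_1 _ _) L.
have L2 := is_lim_seq_plus' _ _ _ _ (is_lim_seq_minus' _ _ _ _ (is_lim_seq_scal_l _ (/ 2) (Finite c) L1) (is_lim_seq_const (/ 2))) (is_lim_seq_scal_l _ (/ 2) (Finite 0) LK).
have L3 := is_lim_seq_minus' _ _ _ _ L2 (is_lim_seq_scal_l _ (/ y) (Finite (PI / 2 - 0)) LA).
have EV : / 2 * c - / 2 + / 2 * 0 - / y * (PI / 2 - 0) = Hcauchy y.
{ unfold c, Hcauchy, Hexp. have Pz : 0 < PI * / y by apply Rmult_lt_0_compat. set z := PI * / y in Pz *. have -> : 2 * PI / y = z + z by unfold z; field; lra.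
  rewrite exp_plus exp_Ropp. have Pe := exp_gt_1 z Pz. have -> : PI / y = z by done. have -> : / y * (PI / 2 - 0) = z / 2 by unfold z; field; lra.
  move: (exp z) Pe => a Pe. field. repeat split; nra. }
match type of L3 with is_lim_seq _ ?l => have EL : l = Finite (Hcauchy y) by rewrite -EV end.
rewrite EL in L3. apply: is_lim_seq_ext L3 => N. rewrite E. field. lra.
Qed.

(** The series of [Zf] pairs the sum up to N with the boundary term at N + 1; moving one summand
    over costs (N + 1)^(- s), which tends to 0. *)
Lemma zeta_real_lim s : 0 < s < 1 ->
  exists zr : R, is_lim_seq (fun N => rsum (fun n => Rpower (INR (S n)) (- s)) N - Rpower (INR N) (1 - s) / (1 - s)) zr /\ Zf (RtoC s) = RtoC ((s - 1) * zr).
Proof.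
move=> Hs. set u := fun N => rsum (fun n => Rpower (INR (S n)) (- s)) N - Rpower (INR (S N)) (1 - s) / (1 - s).
have L : clim (fun N => RtoC ((s - 1) * u N)) (Zf (RtoC s)).
{ have [Z _] := zterm_clim (RtoC s) ltac:(rewrite Re_RtoC; lra). have Z2 := clim_plus _ _ _ _ (clim_const 1%C) Z.
  eapply clim_ext; [|apply Z2]. move=> N. cbv beta. rewrite csum_zterm.
  rewrite (csum_ext (fun k => Rcpower (INR (S k)) (- RtoC s)) (fun k => RtoC (Rpower (INR (S k)) (- s)))); [|move=> k _; by rewrite -RtoC_opp Rcpower_RtoC].
  rewrite csum_RtoC. have -> : (1 - RtoC s)%C = RtoC (1 - s) by rewrite RtoC_minus. rewrite Rcpower_RtoC. unfold u.
  have E : (s - 1) * (rsum (fun n => Rpower (INR (S n)) (- s)) N - Rpower (INR (S N)) (1 - s) / (1 - s)) = (s - 1) * rsum (fun n => Rpower (INR (S n)) (- s)) N + Rpower (INR (S N)) (1 - s) by field; lra.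
  rewrite E RtoC_plus RtoC_mult RtoC_minus. ring. }
have L1 := clim_fst _ _ L. have L2 := clim_snd _ _ L. simpl in L1, L2. set zr := fst (Zf (RtoC s)) / (s - 1). exists zr. split.
- apply is_lim_seq_incr_1.
  have L5 := is_lim_seq_plus' _ _ _ _ (is_lim_seq_scal_l _ (/ (s - 1)) (Finite (fst (Zf (RtoC s)))) L1) (Rpower_seq_lim0 s ltac:(lra)).
  match type of L5 with is_lim_seq _ ?l => have EL : l = Finite zr by f_equal; unfold zr, Rdiv; simpl; ring end. rewrite EL in L5.
  apply: is_lim_seq_ext L5 => N. unfold u. change (rsum (fun n => Rpower (INR (S n)) (- s)) (S N)) with (rsum (fun n => Rpower (INR (S n)) (- s)) N + Rpower (INR (S N)) (- s)). field. lra.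
- have Z2 : snd (Zf (RtoC s)) = 0. { have := is_lim_seq_unique _ _ L2. rewrite Lim_seq_const => H. injection H. done. }
  rewrite -(C_surj (Zf (RtoC s))) Z2. unfold zr. change (RtoC (fst (Zf (RtoC s))) = RtoC ((s - 1) * (fst (Zf (RtoC s)) / (s - 1)))). f_equal. field. lra.
Qed.

(** The form is free of poles: both zetas appear through [Zf], Gamma through [qG], and the sine,
    which is cos(PI s / 2), is multiplied across. *)
Lemma functional_equation_real s : 0 < s < 1 ->
  (2 * Zf (RtoC s) * Csin (RtoC (PI / 2) * (1 - RtoC s)) = (1 - RtoC s) * Rcpower (2 * PI) (RtoC s) * Zf (1 - RtoC s) * qG (RtoC s))%C.
Proof.
move=> Hs. have P := PI_RGT_0. have [z1 [Lz1 Ez1]] := zeta_real_lim s Hs. have [z2 [Lz2 Ez2]] := zeta_real_lim (1 - s) ltac:(lra).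
have [g [_ Hg]] : exists g, 0 <= g /\ II (fun x => Rpower x (s - 1) * exp (- x)) g.
{ apply mellin_exists => //; [apply cont0_exp_neg|]. move=> x Hx. split; [apply Rlt_le, exp_pos|]. rewrite exp_Ropp.
  have E1 := exp_ineq1_le (x / 3). have E2 : exp x = exp (x / 3) * (exp (x / 3) * exp (x / 3)) by rewrite -!exp_plus; f_equal; field.
  have -> : 2 / (1 + x) ^ 2 = / ((1 + x) ^ 2 / 2) by field; lra. apply Rinv_le_contravar; [nra|]. rewrite E2.
  apply Rle_trans with ((1 + x / 3) * ((1 + x / 3) * (1 + x / 3))); [|repeat (apply Rmult_le_compat; try nra)].
  (* (1 + x / 3)^3 - (1 + x)^2 / 2 has a double zero at x = 3, which is why exp is bounded below by
     this particular cube. *)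
  have Q : 0 <= (x - 3) * (x - 3) * (2 * x + 3) by apply Rmult_le_pos; [apply (Rle_0_sqr (x - 3))|lra].
  have E3 : (1 + x / 3) * ((1 + x / 3) * (1 + x / 3)) - (1 + x) ^ 2 / 2 = (x - 3) * (x - 3) * (2 * x + 3) / 54 by field. lra. }
have [K [_ HK]] : exists K, 0 <= K /\ II (fun x => Rpower x (1 - s - 1) * cauchy_kernel x) K.
{ apply mellin_exists => //; [move=> x _; apply continuous_cauchy_kernel|lra|]. move=> x Hx. split; [apply Rlt_le, cauchy_kernel_pos|]. unfold cauchy_kernel.
  have -> : 2 / (1 + x) ^ 2 = / ((1 + x) ^ 2 / 2) by field; lra. apply Rinv_le_contravar; [nra|]. have := Rle_0_sqr (1 - x). unfold Rsqr. lra. }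
have M1 := muentz (fun x => exp (- x)) (fun x => 1 - exp (- x)) Hexp s 1 g z1 Hs.
have {}M1 : II (fun x => Rpower x (s - 1) * Hexp x) (z1 * g).
{ apply M1 => //.
  - move=> x. auto_derive => //. ring.
  - move=> x. apply: ex_derive_continuous. by auto_derive.
  - move=> x _. apply Rlt_le, exp_pos.
  - move=> x y Hxy. apply exp_le. lra.
  - rewrite Ropp_0 exp_0. ring.
  - move=> x Hx. have := exp_pos (- x). have : exp (- x) <= 1 by rewrite -exp_0; apply exp_le; lra. move=> h1 h2. rewrite Rabs_right; lra.
  - apply cont0_Hexp.
  - move=> x Hx. by apply Hexp_lim. }
have M2 := muentz cauchy_kernel atan Hcauchy (1 - s) (PI / 2) K z2 ltac:(lra).
have {}M2 : II (fun x => Rpower x (1 - s - 1) * Hcauchy x) (z2 * K).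
{ apply M2 => //.
  - move=> x. unfold cauchy_kernel. apply is_derive_Reals. exact (derivable_pt_lim_atan x).
  - apply continuous_cauchy_kernel.
  - move=> x _. apply Rlt_le, cauchy_kernel_pos.
  - move=> x y Hxy. apply Rinv_le_contravar; nra.
  - apply atan_0.
  - move=> x _. have := atan_bound x => B. apply Rabs_le. lra.
  - apply cont0_Hcauchy.
  - move=> x Hx. by apply Hcauchy_lim. }
have c1 : cont0 (fun x => Rpower x (s - 1) * Hexp x) by apply cont0_mult; [apply cont0_Rpower|apply cont0_Hexp].
have c2 : cont0 (fun x => Rpower x (1 - s - 1) * Hcauchy x) by apply cont0_mult; [apply cont0_Rpower|apply cont0_Hcauchy].
have M3 := II_inv _ _ (2 * PI) c1 ltac:(lra) M1.
have M4 := II_scal (Rpower (2 * PI) s / PI) _ _ c2 M2.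
(* Both numbers are the integral of the same function of y, by the definition of [Hcauchy] through
   [Hexp]. *)
have EQ : z1 * g = Rpower (2 * PI) s / PI * (z2 * K).
{ apply (II_unique (fun x => Rpower (2 * PI) s / PI * (Rpower x (1 - s - 1) * Hcauchy x))) => //; [by apply cont0_scal|].
  apply: II_ext M3 => y Hy. cbv beta. unfold Hcauchy. rewrite Rpower_div //; [|lra]. replace (- (s - 1)) with (1 - s - 1 + 1) by ring. rewrite Rpower_1_mult //.
  have -> : Rpower (2 * PI) s = Rpower (2 * PI) (s - 1) * (2 * PI) by rewrite -Rpower_1_mult; [f_equal; ring|lra]. field. lra. }
have HK2 : K = PI / (2 * sin (PI * ((1 - s) / 2))).
{ apply cauchy_mellin => //. apply: II_ext HK => x _. f_equal. f_equal. ring. }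
have S := sin_PI_pos ((1 - s) / 2) ltac:(lra).
have EC : (1 - RtoC s)%C = RtoC (1 - s) by rewrite RtoC_minus.
have G := gamma_qG s g Hs Hg.
rewrite EC Ez1 Ez2 Rcpower_RtoC -(RtoC_mult (PI / 2) (1 - s)) Csin_RtoC. replace (PI / 2 * (1 - s)) with (PI * ((1 - s) / 2)) by field.
set sn := sin (PI * ((1 - s) / 2)) in S HK2 *. set W := Rpower (2 * PI) s in EQ *.
have EQ2 : z1 * 2 * sn * g = W * z2. { replace (z1 * 2 * sn * g) with (2 * sn * (z1 * g)) by ring. rewrite EQ HK2. field. lra. }
have A : (RtoC (z1 * 2 * sn) = RtoC (W * z2 * s) * qG (RtoC s))%C.
{ transitivity (RtoC (z1 * 2 * sn) * (RtoC (s * g) * qG (RtoC s)))%C; [rewrite G; ring|].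
  replace (W * z2 * s) with (z1 * 2 * sn * (s * g)) by (rewrite -EQ2; ring). rewrite !RtoC_mult. ring. }
transitivity (RtoC (s - 1) * RtoC (z1 * 2 * sn))%C; [rewrite !RtoC_mult; ring|]. rewrite A !RtoC_mult !RtoC_minus. ring.
Qed.

Lemma functional_equation (s : C) : 0 < Re s < 1 ->
  (2 * Zf s * Csin (RtoC (PI / 2) * (1 - s)) = (1 - s) * Rcpower (2 * PI) s * Zf (1 - s) * qG s)%C.
Proof.
move=> Hs. set f := fun s : C => (2 * Zf s * Csin (RtoC (PI / 2) * (1 - s)) - (1 - s) * Rcpower (2 * PI) s * Zf (1 - s) * qG s)%C.
have Df : forall z : C, 0 < Re z < 1 -> cdiff f z.
{ move=> z Hz. have D1 : cdiff (fun s => 1 - s)%C z by apply cdiff_minus; [apply cdiff_const|apply cdiff_id].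
  apply cdiff_minus.
  - apply cdiff_mult; [apply cdiff_mult; [apply cdiff_const|apply cdiff_Zf; lra]|]. apply cdiff_Csin. apply cdiff_mult => //. apply cdiff_const.
  - apply cdiff_mult; [|apply qG_spec]. apply cdiff_mult; [apply cdiff_mult => //; apply cdiff_Rcpower, cdiff_id|]. apply (cdiff_comp Zf) => //. apply cdiff_Zf. rewrite Re_minus Re_RtoC. lra. }
have F0 : forall x, 0 < x < 1 -> f (RtoC x) = 0%C by move=> x Hx; unfold f; rewrite functional_equation_real //; ring.
have E : f s = 0%C.
{ apply (identity_theorem (fun w => 0 < Re w < 1) f (RtoC (1 / 2))) => //.
  - move=> a b t Ha Hb Ht. have -> : Re (a + RtoC t * (b - a))%C = (1 - t) * Re a + t * Re b by destruct a, b; simpl; ring.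
    destruct Ha as [a1 a2], Hb as [b1 b2], Ht as [t1 t2]. move: (Re a) (Re b) a1 a2 b1 b2 => u v a1 a2 b1 b2. destruct (Rle_dec u v); nra.
  - move=> a Ha. exists (Rmin (Re a) (1 - Re a)). have m1 := Rmin_l (Re a) (1 - Re a). have m2 := Rmin_r (Re a) (1 - Re a).
    split; [apply Rmin_glb_lt; lra|] => w Hw. have := Re_ball _ _ _ Hw. lra.
  - rewrite Re_RtoC. lra.
  - exists (1 / 2 / 3). split; [lra|] => w Hw. apply (isolated_zeros f (RtoC (1 / 2)) (1 / 2)) => //; [lra| |].
    + move=> v Hv. apply Df. have := Re_ball _ _ _ Hv. rewrite Re_RtoC. lra.
    + move=> d Hd. set t := Rmin (d / 2) (1 / 4). have t0 : 0 < t by apply Rmin_glb_lt; lra. have t1 := Rmin_l (d / 2) (1 / 4). have t2 := Rmin_r (d / 2) (1 / 4). fold t in t1, t2.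
      exists (RtoC (1 / 2 + t)). split; [move=> E; injection E; lra|]. split; [|apply F0; lra]. rewrite -RtoC_minus Cmod_R. replace (1 / 2 + t - 1 / 2) with t by ring. rewrite Rabs_right; lra. }
unfold f in E. match type of E with (?a - ?b)%C = _ => transitivity (a - b + b)%C; [ring|rewrite E; ring] end.
Qed.

(** * Continuation of zeta to the plane and its zeros *)

(** Solving the functional equation for zeta requires division by s. The entire quotient [S]
    performs it at s = 0 as well, and [S 0] being nonzero excludes a zero of zeta there. *)
Lemma sin_quotient : exists S : C -> C, (forall z, cdiff S z) /\ (forall z : C, Csin (RtoC (PI / 2) * z) = (S z * z)%C) /\ S 0%C <> 0%C.
Proof.
have P := PI_RGT_0. set f := fun z : C => Csin (RtoC (PI / 2) * z)%C.
have Df : forall z, cdiff f z by move=> z; apply cdiff_Csin; apply cdiff_mult; [apply cdiff_const|apply cdiff_id].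
have f0 : f 0%C = 0%C. { unfold f. replace (RtoC (PI / 2) * 0)%C with (RtoC 0) by ring. by rewrite Csin_RtoC sin_0. }
destruct (removable_quotient f 0%C) as [S [D0 HS]]; [exists 1; split; [lra|done]|done|]. exists S.
have Ez : forall z : C, (z - 0)%C = z by move=> z; ring.
split; [|split].
- move=> z. destruct (Ceq_dec z 0%C) as [->|N] => //. apply (cdiff_ext_loc (fun z => f z / z)%C).
  + exists (Cmod z). split; [by apply Cmod_gt_0|] => w Hw. have [_ h] := HS w. rewrite h ?Ez // => E. rewrite E in Hw. move: Hw. have -> : (0 - z)%C = (- z)%C by ring. rewrite Cmod_opp. lra.
  + apply cdiff_div => //. apply cdiff_id.
- move=> z. have [h _] := HS z. rewrite Ez in h. exact h.
- move=> E. destruct (ccont_cdiff S 0%C D0 (PI / 8) ltac:(lra)) as [d [Hd K]]. set x := Rmin (d / 2) (1 / 2). have x0 : 0 < x by apply Rmin_glb_lt; lra.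
  have x1 := Rmin_l (d / 2) (1 / 2). have x2 := Rmin_r (d / 2) (1 / 2). fold x in x1, x2.
  have k := K (RtoC x) ltac:(rewrite Ez Cmod_R Rabs_right; lra). rewrite E Ez in k.
  have NX : RtoC x <> 0%C by apply RtoC_neq_0; lra. have [_ h] := HS (RtoC x). rewrite h // Ez in k. unfold f in k. rewrite -RtoC_mult Csin_RtoC in k.
  rewrite -RtoC_div in k; [|lra]. rewrite Cmod_R in k.
  have xc := x_cos_le_sin (PI / 2 * x) ltac:(split; nra). have c : 1 / 2 <= cos (PI / 2 * x).
  { rewrite -cos_PI3. apply cos_decr_1; nra. }
  have B : PI / 4 <= sin (PI / 2 * x) / x. { apply Rmult_le_reg_r with x => //. unfold Rdiv at 2. rewrite Rmult_assoc Rinv_l; [|lra]. rewrite Rmult_1_r.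
    have := Rmult_le_compat_l (PI / 2 * x) _ _ ltac:(nra) c. lra. }
  rewrite Rabs_right in k; lra.
Qed.

Theorem mertens_RH : mertens_bound -> Riemann_hypothesis.
Proof.
move=> HM. have P := PI_RGT_0. destruct sin_quotient as [S [DS [HS S0]]].
have NZ : forall s : C, 1 / 2 < Re s -> Zf s <> 0%C.
{ move=> s Hs E. destruct (Ceq_dec s 1%C) as [E1|N]; [move: E; rewrite E1 Zf_1 => E; injection E; lra|]. have F := Ff_Zf s HM Hs. rewrite E in F.
  apply N. transitivity (s - 1 + 1)%C; [ring|]. rewrite -F. ring. }
(* The functional equation at 1 - s, solved for [Zf s]; the factor s has been cancelled against the
   sine, and the denominator has no zero for Re s < 1. *)
set Zl := fun s : C => (2 * Zf (1 - s) * S s / (Rcpower (2 * PI) (1 - s) * qG (1 - s)))%C.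
set Ze := fun s : C => match Rlt_dec 0 (Re s) with left _ => Zf s | right _ => Zl s end.
have Re1 : forall s : C, Re (1 - s)%C = 1 - Re s by move=> s; rewrite Re_minus Re_RtoC.
have NP2 : forall s : C, Rcpower (2 * PI) s <> 0%C by move=> s; apply Cexp_neq_0.
have NQ : forall s : C, Re s < 1 -> qG (1 - s) <> 0%C by move=> s Hs; apply qG_neq_0; rewrite Re1; lra.
have ND : forall s : C, Re s < 1 -> (Rcpower (2 * PI) (1 - s) * qG (1 - s))%C <> 0%C by move=> s Hs; apply Cmult_neq_0; auto.
have EL : forall s : C, Re s < 1 -> Ze s = Zl s.
{ move=> s Hs. unfold Ze. destruct (Rlt_dec 0 (Re s)) => //. have F := functional_equation (1 - s)%C ltac:(rewrite Re1; lra).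
  have ES : (1 - (1 - s))%C = s by ring. rewrite ES HS in F. have N0 : s <> 0%C by apply Cneq0_Re; lra. have N1 := NP2 (1 - s)%C. have N2 := NQ s Hs. unfold Zl.
  transitivity (s * Rcpower (2 * PI) (1 - s) * Zf s * qG (1 - s) / (s * (Rcpower (2 * PI) (1 - s) * qG (1 - s))))%C; [|rewrite -F]; field; repeat split => //. }
have DR : forall s : C, Re s < 1 -> cdiff Zl s.
{ move=> s Hs. have D1 : cdiff (fun s => 1 - s)%C s by apply cdiff_minus; [apply cdiff_const|apply cdiff_id].
  apply cdiff_div; [| |by apply ND].
  - apply cdiff_mult => //. apply cdiff_mult; [apply cdiff_const|]. apply (cdiff_comp Zf) => //. apply cdiff_Zf. rewrite Re1. lra.
  - apply cdiff_mult; [by apply cdiff_Rcpower|]. apply (cdiff_comp qG) => //. apply qG_spec. }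
have DZ : forall s, cdiff Ze s.
{ move=> s. destruct (Rlt_dec (Re s) (1 / 2)) as [L|L].
  - apply (cdiff_ext_loc Zl); [|apply DR; lra]. exists (1 / 2). split; [lra|] => w Hw. have := Re_ball _ _ _ Hw. symmetry. apply EL. lra.
  - apply (cdiff_ext_loc Zf); [|apply cdiff_Zf; lra]. exists (1 / 2). split; [lra|] => w Hw. have B := Re_ball _ _ _ Hw. unfold Ze. destruct (Rlt_dec 0 (Re w)) => //. lra. }
exists (fun s => Ze s / (s - 1))%C. split; [split|].
- move=> s Hs. apply is_series_clim. have EZ : Ze s = Zf s by unfold Ze; destruct (Rlt_dec 0 (Re s)) => //; lra. rewrite EZ. by apply dirichlet_zeta.
- move=> s Hs. apply holomorphic_at_iff. exists (Cmod (s - 1)%C). split; [by apply Cmod_gt_0, Csub_neq_0|] => w Hw. apply cdiff_div => //; [apply cdiff_minus; [apply cdiff_id|apply cdiff_const]|].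
  move=> E. have : Cmod (s - 1)%C <= Cmod (w - s)%C; [|lra]. right. replace (w - s)%C with ((w - 1) - (s - 1))%C by ring. rewrite E. replace (0 - (s - 1))%C with (- (s - 1))%C by ring. by rewrite Cmod_opp.
- move=> s Hs E Ht. have Ns := Csub_neq_0 _ _ Hs. have EZ : Ze s = 0%C by transitivity (Ze s / (s - 1) * (s - 1))%C; [field|rewrite E; ring].
  destruct (Rtotal_order (Re s) (1 / 2)) as [L|[L|L]] => //; exfalso.
  (* Left of the line every factor of [Zl] except [S] is nonzero, so sin(PI s / 2) = 0 and s is an
     even integer; it is below 1 / 2 and not 0, hence a trivial zero. *)
  + rewrite EL in EZ; [|lra]. have N1 := NP2 (1 - s)%C. have N2 := NQ s ltac:(lra). have NZ1 := NZ (1 - s)%C ltac:(rewrite Re1; lra).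
    have ES : S s = 0%C.
    { transitivity (Zl s * (Rcpower (2 * PI) (1 - s) * qG (1 - s)) / (2 * Zf (1 - s)))%C; [unfold Zl; field; repeat split => //|rewrite EZ; unfold Cdiv; ring]. }
    have Nz : s <> 0%C. { move=> E0. apply S0. rewrite E0 in ES. exact ES. }
    have EC : Csin (RtoC (PI / 2) * s) = 0%C by rewrite HS ES; ring. destruct (Csin_eq_0 _ EC) as [k Hk].
    have NP : RtoC (PI / 2) <> 0%C by apply RtoC_neq_0; lra.
    have Ek : s = RtoC (2 * IZR k).
    { transitivity (RtoC (PI / 2) * s / RtoC (PI / 2))%C; [field; done|]. rewrite Hk -RtoC_div; [|lra]. f_equal. field. lra. }
    rewrite Ek Re_RtoC in L. have k1 : (k < 1)%Z by apply lt_IZR; lra. have k0 : k <> 0%Z by move=> E0; apply Nz; rewrite Ek E0; f_equal; ring.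
    (* With s = 2 k and k < 0, the index m = - k - 1 gives s = - 2 (m + 1). *)
    apply (Ht (Z.to_nat (- k - 1))). rewrite Ek. f_equal. rewrite S_INR INR_IZR_INZ Z2Nat.id; [|lia]. rewrite minus_IZR opp_IZR. ring.
  + apply (NZ s L). unfold Ze in EZ. destruct (Rlt_dec 0 (Re s)) => //. lra.
Qed.

Theorem theorem4p1 : Riemann_hypothesis <-> FGV Ingham (1 / 2).
Proof.
split; [apply RH_FGV|]. move=> H. by apply mertens_RH, FGV_mertens.
Qed.
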